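(* Let $(N,\mathcal{D},J)$ be a compact manifold of dimension $2n+1$ with a CR structure of Sasaki type and let $\mathfrak{t}^+\subset\mathfrak{t}$ be its (reduced) Sasaki cone. Within $\mathfrak{t}^+$ there is at most one ray of Reeb vector fields $\xi$ with vanishing transverse scalar curvature ($s^T_\xi\equiv 0$). Moreover, if there is one $\xi_o\in\mathfrak{t}^+$ whose Sasaki structure has non-negative transverse scalar curvature ($s^T_{\xi_o}\ge 0$ on $N$), then the total transverse scalar curvature satisfies $\mathbf{S}_\xi\ge 0$ for all $\xi\in\mathfrak{t}^+$.
   Context: $N$ is a (connected) compact manifold of dimension $2n+1$, $n\ge 1$. A CR structure $(\mathcal{D},J)$ of Sasaki type on $N$ is a co-oriented contact distribution $\mathcal{D}$ with an integrable complex structure $J$ on $\mathcal{D}$ such that there is a contact form $\eta$ (with $\ker\eta=\mathcal{D}$, compatible with the co-orientation) with $d\eta(\cdot,J\cdot)$ positive definite on $\mathcal{D}$ and whose Reeb vector field lies in $\mathfrak{cr}(\mathcal{D},J)$, the Lie algebra of the group $CR(\mathcal{D},J)$ of (co-orientation preserving) CR diffeomorphisms. Fix a maximal torus $T\subset CR(\mathcal{D},J)$ with Lie algebra $\mathfrak{t}$; $a\in\mathfrak{t}$ induces the vector field $X_a$ on $N$. The (reduced) Sasaki cone is the open convex cone $\mathfrak{t}^+=\{b\in\mathfrak{t} : \eta(X_b)>0 \text{ everywhere on } N\}$; we write $\xi=X_b$ and identify $b$ with $\xi$. For $\xi\in\mathfrak{t}^+$ put $\eta_\xi=\eta/\eta(\xi)$,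 the contact form of $\mathcal{D}$ with Reeb field $\xi$; let $\Phi_\xi$ be the endomorphism of $TN$ with $\Phi_\xi(\xi)=0$, $\Phi_\xi|_{\mathcal{D}}=J$, and $g_\xi=\frac12 d\eta_\xi(\cdot,\Phi_\xi\cdot)+\eta_\xi\otimes\eta_\xi$ the Sasaki metric. Transverse scalar curvature: locally $N\supset U\to V$ is the quotient by the flow of $\xi$, and $(g_\xi|_{\mathcal{D}},\frac12 d\eta_\xi,J)$ descends to a Kähler structure on $V$; the pull-backs to $N$ of the scalar curvatures of these Kähler metrics patch to a global function $s^T_\xi$ on $N$. The total transverse scalar curvature is $\mathbf{S}_\xi=\int_N s^T_\xi\,\frac{\eta_\xi\wedge(d\eta_\xi)^n}{n!}$. *)

(* Defs.v *)
From HB Require Import structures.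
From mathcomp Require Import all_boot all_order all_algebra all_fingroup.
From mathcomp Require Import all_classical all_reals all_analysis.

Set Implicit Arguments.
Unset Strict Implicit.
Unset Printing Implicit Defensive.

Import Order.TTheory GRing.Theory Num.Theory.
Import numFieldNormedType.Exports.

Local Open Scope classical_set_scope.
Local Open Scope ring_scope.

(* Conventions.  Tangent vectors are row vectors, covectors are column vectors,
   linear maps of tangent spaces act by right multiplication, and a bilinear
   form B is evaluated as v *m B *m w^T.  *)

Section Euclidean.
Context {R : realType}.

(* For a finite-dimensional V and an open U this is the usual class C^k: the
   directional derivatives along all fixed vectors are linear combinations of
   the partial derivatives. *)
Fixpoint Ck_on (V W : normedModType R) (k : nat) (U : set V) (f : V -> W) : Prop :=
  (forall x, U x -> {for x, continuous f}) /\
  (if k is k'.+1 then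
     forall v : V, (forall x, U x -> derivable f x v) /\
                   Ck_on k' U (fun x => 'D_v f x)
   else True).

Definition smooth_on (V W : normedModType R) (U : set V) (f : V -> W) : Prop :=
  forall k, Ck_on k U f.

Definition partial (m : nat) (i : 'I_m) (f : 'rV[R]_m -> R) (x : 'rV[R]_m) : R :=
  'D_(delta_mx 0 i) f x.

(* d a (X, Y) = X (a Y) - Y (a X) - a [X, Y], without a factor 1/2 *)
Definition extder_loc (m : nat) (a : 'rV[R]_m -> 'cV[R]_m) (x : 'rV[R]_m) : 'M[R]_m :=
  \matrix_(i, j) (partial i (fun y => a y j 0) x - partial j (fun y => a y i 0) x).

(* The value of a /\ B^n on the standard basis, for a covector a and an
   alternating form B.  The wedge product is the one with
   (dx_1 /\ ... /\ dx_m) (e_1, ..., e_m) = 1, whence the factor 2 ^- n. *)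
Definition wedge_top (n : nat) (a : 'cV[R]_(n.*2.+1)) (B : 'M[R]_(n.*2.+1)) : R :=
  2 ^- n * \sum_(s : 'S_(n.*2.+1)) (-1) ^+ s *
    (a (s ord0) 0 *
     \prod_(i < n) B (s (inord i.*2.+1)) (s (inord i.*2.+2))).

(* Integration of a nonnegative Borel function against Lebesgue measure on R^m,
   as an iterated integral (Tonelli). *)
Fixpoint iter_integral (m : nat) : ('rV[R]_m -> \bar R) -> \bar R :=
  match m with
  | 0 => fun f => f 0
  | m'.+1 => fun f =>
      (\int[@lebesgue_measure R]_t
        iter_integral (fun y : 'rV[R]_m' => f (row_mx (t%:M : 'rV[R]_1) y)))%E
  end.

Section Curvature.
Variables (d : nat) (h : 'rV[R]_d -> 'M[R]_d).

Definition riemannian_metric_on (V : set 'rV[R]_d) : Prop :=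
  [/\ smooth_on V h,
      forall x, V x -> (h x)^T = h x
    & forall x, V x -> forall v : 'rV[R]_d, v != 0 -> 0 < (v *m h x *m v^T) 0 0].

Definition christoffel (k i j : 'I_d) (x : 'rV[R]_d) : R :=
  2^-1 * \sum_l (invmx (h x)) k l *
    (partial i (fun y => h y j l) x + partial j (fun y => h y i l) x
     - partial l (fun y => h y i j) x).

Definition ricci (j k : 'I_d) (x : 'rV[R]_d) : R :=
  \sum_i (partial i (christoffel i j k) x - partial j (christoffel i i k) x
    + \sum_p (christoffel i i p x * christoffel p j k x
              - christoffel i j p x * christoffel p i k x)).

Definition scalar_curvature (x : 'rV[R]_d) : R :=
  \sum_j \sum_k (invmx (h x)) j k * ricci j k x.

End Curvature.
End Euclidean.

Record chart (R : realType) (N : topologicalType) (m : nat) := Chart {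
  cdom : set N;
  cmap : N -> 'rV[R]_m;
  cinv : 'rV[R]_m -> N }.

Definition cimg (R : realType) (N : topologicalType) (m : nat) (c : chart R N m) :
  set 'rV[R]_m := cmap c @` cdom c.

Definition is_chart (R : realType) (N : topologicalType) (m : nat) (c : chart R N m) :=
  [/\ open (cdom c), open (cimg c),
      forall p, cdom c p -> cinv c (cmap c p) = p,
      forall p, cdom c p -> {for p, continuous (cmap c)}
    & forall x, cimg c x -> {for x, continuous (cinv c)}].

(* An atlas, together with a preferred chart around each point: the tangent
   space at p is 'rV_m, through the components in the chart chart_at p. *)
Record smooth_structure (R : realType) (N : topologicalType) (m : nat) := SmoothStructure {
  atlas : set (chart R N m);
  chart_at : N -> chart R N m;
  atlas_chart : forall c, atlas c -> is_chart c;
  atlas_smooth : forall c c', atlas c -> atlas c' ->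
    smooth_on (cmap c @` (cdom c `&` cdom c')) (cmap c' \o cinv c);
  atlas_chart_at : forall p, atlas (chart_at p) /\ cdom (chart_at p) p }.

Section Tensors.
Context {R : realType} {N : topologicalType} {m : nat}.
Variable M : smooth_structure R N m.

Definition coord_at (p : N) : 'rV[R]_m := cmap (chart_at M p) p.

Definition jac (c c' : chart R N m) (p : N) : 'M[R]_m :=
  'J (cmap c' \o cinv c) (cmap c p).

Definition vfield_loc (c : chart R N m) (X : N -> 'rV[R]_m) (x : 'rV[R]_m) : 'rV[R]_m :=
  let p := cinv c x in X p *m jac (chart_at M p) c p.

Definition form_loc (c : chart R N m) (a : N -> 'cV[R]_m) (x : 'rV[R]_m) : 'cV[R]_m :=
  let p := cinv c x in jac c (chart_at M p) p *m a p.

Definition smooth_vfield (X : N -> 'rV[R]_m) : Prop :=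
  forall c, atlas M c -> smooth_on (cimg c) (vfield_loc c X).

Definition smooth_form (a : N -> 'cV[R]_m) : Prop :=
  forall c, atlas M c -> smooth_on (cimg c) (form_loc c a).

Definition pairing (a : 'cV[R]_m) (v : 'rV[R]_m) : R := (v *m a) 0 0.

Definition bilin (B : 'M[R]_m) (v w : 'rV[R]_m) : R := (v *m B *m w^T) 0 0.

Definition extder (a : N -> 'cV[R]_m) (p : N) : 'M[R]_m :=
  extder_loc (form_loc (chart_at M p) a) (coord_at p).

Definition bracket (X Y : N -> 'rV[R]_m) (p : N) : 'rV[R]_m :=
  'D_(X p) (vfield_loc (chart_at M p) Y) (coord_at p)
  - 'D_(Y p) (vfield_loc (chart_at M p) X) (coord_at p).

Definition smooth_map (f : N -> N) : Prop :=
  continuous f /\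
  forall c c', atlas M c -> atlas M c' ->
    smooth_on (cmap c @` (cdom c `&` f @^-1` cdom c')) (cmap c' \o f \o cinv c).

Definition tangent_map (f : N -> N) (p : N) : 'M[R]_m :=
  'J (cmap (chart_at M (f p)) \o f \o cinv (chart_at M p)) (coord_at p).

Definition smooth_fun_on (d : nat) (U : set N) (f : N -> 'rV[R]_d) : Prop :=
  forall c, atlas M c -> smooth_on (cmap c @` (cdom c `&` U)) (f \o cinv c).

Definition tangent_fun (d : nat) (f : N -> 'rV[R]_d) (p : N) : 'M[R]_(m, d) :=
  'J (f \o cinv (chart_at M p)) (coord_at p).

Definition smooth_action (k : nat) (rho : 'rV[R]_k -> N -> N) : Prop :=
  [/\ forall p, rho 0 p = p,
      forall a b p, rho (a + b) p = rho a (rho b p),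
      continuous (fun z : 'rV[R]_k * N => rho z.1 z.2)
    & forall c c', atlas M c -> atlas M c' ->
        smooth_on
          [set z : 'rV[R]_k * 'rV[R]_m | cimg c z.2 /\ cdom c' (rho z.1 (cinv c z.2))]
          (fun z : 'rV[R]_k * 'rV[R]_m => cmap c' (rho z.1 (cinv c z.2)))].

(* the vector field X_a : p |-> d/dt rho (t a) p at t = 0 *)
Definition generator (k : nat) (rho : 'rV[R]_k -> N -> N) (a : 'rV[R]_k) (p : N) :
  'rV[R]_m := (fun t : R => cmap (chart_at M p) (rho (t *: a) p))^`()%classic 0.

End Tensors.

(* cr_D p is the contact hyperplane at p, cr_pos p the open half-space of vectors
   on its positive side (the co-orientation).  Of the matrix cr_J p only the
   restriction to cr_D p is meaningful. *)
Record cr_data (R : realType) (N : topologicalType) (m : nat) := CRData {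
  cr_D : N -> set 'rV[R]_m;
  cr_pos : N -> set 'rV[R]_m;
  cr_J : N -> 'M[R]_m }.

(* The base point of N is only there because Borel sigma-algebras are built over
   pointed types; it says that N is not empty. *)
Section Sasaki.
Context {R : realType} {N : ptopologicalType} {n : nat}.
Let m := n.*2.+1.
Variables (M : smooth_structure R N m) (S : cr_data R N m).

Definition contact_form (eta : N -> 'cV[R]_m) : Prop :=
  [/\ smooth_form M eta,
      forall p, wedge_top (eta p) (extder M eta p) != 0,
      forall p v, cr_D S p v <-> pairing (eta p) v = 0
    & forall p v, cr_pos S p v <-> 0 < pairing (eta p) v].

Definition D_section (X : N -> 'rV[R]_m) : Prop :=
  smooth_vfield M X /\ forall p, cr_D S p (X p).

Definition applyJ (X : N -> 'rV[R]_m) (p : N) : 'rV[R]_m := X p *m cr_J S p.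

(* The bundle of the vectors X + i J X is involutive:
   [X + i J X, Y + i J Y] = Z + i J Z. *)
Definition integrable_J : Prop :=
  forall X Y, D_section X -> D_section Y -> forall p,
    let Z := bracket M X Y p - bracket M (applyJ X) (applyJ Y) p in
    cr_D S p Z /\
    Z *m cr_J S p = bracket M (applyJ X) Y p + bracket M X (applyJ Y) p.

Definition cr_structure : Prop :=
  [/\ exists eta, contact_form eta,
      forall p v, cr_D S p v ->
        cr_D S p (v *m cr_J S p) /\ v *m cr_J S p *m cr_J S p = - v,
      forall X, D_section X -> smooth_vfield M (applyJ X)
    & integrable_J].

Definition cr_diffeo (f : N -> N) : Prop :=
  [/\ smooth_map M f,
      exists g, [/\ smooth_map M g, cancel f g & cancel g f],
      forall p v, cr_D S p v ->
        cr_D S (f p) (v *m tangent_map M f p) /\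
        v *m cr_J S p *m tangent_map M f p = v *m tangent_map M f p *m cr_J S (f p)
    & forall p v, cr_pos S p v -> cr_pos S (f p) (v *m tangent_map M f p)].

Definition cr_action (k : nat) (rho : 'rV[R]_k -> N -> N) : Prop :=
  smooth_action M rho /\ forall a, cr_diffeo (rho a).

(* the Lie algebra of the group of CR diffeomorphisms: generators of its
   one-parameter subgroups *)
Definition cr_algebra (X : N -> 'rV[R]_m) : Prop :=
  exists2 phi : 'rV[R]_1 -> N -> N,
    cr_action phi & forall p, X p = generator M phi (const_mx 1) p.

Definition reeb_field (eta : N -> 'cV[R]_m) (xi : N -> 'rV[R]_m) : Prop :=
  forall p, pairing (eta p) (xi p) = 1 /\
            forall v, bilin (extder M eta p) (xi p) v = 0.

Definition sasaki_type : Prop :=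
  cr_structure /\
  exists eta, exists xi,
    [/\ contact_form eta,
        forall p v, cr_D S p v -> v != 0 ->
          0 < bilin (extder M eta p) v (v *m cr_J S p),
        smooth_vfield M xi, reeb_field eta xi
      & cr_algebra xi].

(* A torus of CR diffeomorphisms, as the image of R^k / Z^k; its Lie algebra is
   R^k, and a in R^k induces the vector field generator rho a. *)
Definition cr_torus (k : nat) (rho : 'rV[R]_k -> N -> N) : Prop :=
  cr_action rho /\
  forall a, (forall p, rho a p = p) <-> (forall i, a 0 i \is a Num.int).

Definition maximal_cr_torus (k : nat) (rho : 'rV[R]_k -> N -> N) : Prop :=
  cr_torus rho /\
  forall k' (rho' : 'rV[R]_k' -> N -> N), cr_torus rho' ->
    range rho `<=` range rho' -> range rho' `<=` range rho.

Section Cone.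
Variables (eta : N -> 'cV[R]_m) (k : nat) (rho : 'rV[R]_k -> N -> N).

Definition sasaki_cone : set 'rV[R]_k :=
  [set b | forall p, 0 < pairing (eta p) (generator M rho b p)].

Section Ray.
Variable b : 'rV[R]_k.
Let xi := generator M rho b.

Definition eta_of (p : N) : 'cV[R]_m := (pairing (eta p) (xi p))^-1 *: eta p.

(* J precomposed with the projection v |-> v - eta_of p (v) xi p onto cr_D p *)
Definition Phi_of (p : N) : 'M[R]_m := (1%:M - eta_of p *m xi p) *m cr_J S p.

Definition sasaki_metric (p : N) : 'M[R]_m :=
  2^-1 *: (extder M eta_of p *m (Phi_of p)^T) + eta_of p *m (eta_of p)^T.

(* pi : U -> pi(U) is a quotient of U by the local flow of xi, and h is the
   metric on pi(U) to which the restriction of the Sasaki metric to D descends,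
   i.e. the Riemannian metric of the transverse Kaehler structure. *)
Definition local_quotient (U : set N) (pi : N -> 'rV[R]_(n.*2))
    (h : 'rV[R]_(n.*2) -> 'M[R]_(n.*2)) : Prop :=
  [/\ open U,
      smooth_fun_on M U pi /\ (forall p, U p -> row_full (tangent_fun M pi p)),
      forall p q, U p -> U q ->
        (pi p = pi q <->
         exists2 t : R, q = rho (t *: b) p
           & forall r : R, 0 <= r <= 1 -> U (rho ((r * t) *: b) p)),
      riemannian_metric_on h (pi @` U)
    & forall p v w, U p -> cr_D S p v -> cr_D S p w ->
        bilin (sasaki_metric p) v w =
        bilin (h (pi p)) (v *m tangent_fun M pi p) (w *m tangent_fun M pi p)].

(* The value does not depend on the local quotient chosen around p, because
   scalar curvature is invariant under isometries. *)
Definition transverse_scal (p : N) : R :=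
  xget 0 [set s : R | exists U pi h,
    [/\ local_quotient U pi h, U p & s = scalar_curvature h (pi p)]].

(* The density in the chart c of the volume form eta_of /\ (d eta_of)^n / n!;
   the absolute value amounts to orienting N by this form. *)
Definition volume_density (c : chart R N m) (x : 'rV[R]_m) : R :=
  `| wedge_top (form_loc M c eta_of x) (extder_loc (form_loc M c eta_of) x) |
    / (n`!)%:R.

(* the Borel measure on N given by the volume form eta_of /\ (d eta_of)^n / n! *)
Definition volume_measure
    (mu : {measure set (g_sigma_algebraType (@open N)) -> \bar R}) : Prop :=
  forall c, atlas M c ->
  forall A : set (g_sigma_algebraType (@open N)), measurable A -> A `<=` cdom c ->
    mu A = iter_integral (fun x : 'rV[R]_m =>
             (\1_(cmap c @` (A : set N)) x * volume_density c x)%:E).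

Definition total_transverse_scal
    (mu : {measure set (g_sigma_algebraType (@open N)) -> \bar R}) : R :=
  Rintegral mu setT transverse_scal.

End Ray.
End Cone.
End Sasaki.

(* Main.v *)
(* For b and c in the cone put f = eta_b (X_c).  Then eta_c = f^-1 eta_b, and the transverse scalar
   curvatures satisfy s_c = f (s_b + (2n + 2) E - Q), where E is the divergence of the transverse
   gradient of log f, up to a constant, and Q >= 0 is a multiple of its squared norm.  If s_c >= 0,
   then s_b >= - (2n + 2) E, and E has integral zero for the volume form of eta_b.
   If s_b = s_c = 0, then at a maximum q of f we have df = 0 and Q = 0, so E, f^-1 times the trace of the
   transverse Hessian, vanishes, and with it the 2-jet of f - f(q).  Hence the field of c - f(q) b,
   whose contact Hamiltonian is f - f(q), has vanishing 1-jet at q; averaging over the torus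
   elements that fix q to first order shows that its flow is trivial near q.  So the closed
   set where f = f(q) is open, and c = f(q) b because N is connected and the torus acts effectively. *)

From HB Require Import structures.
From mathcomp Require Import all_boot all_order all_algebra all_fingroup.
From mathcomp Require Import all_classical all_reals all_analysis.
From mathcomp Require Import measurable_realfun ring lra.
Require Import Defs.

Set Implicit Arguments.
Unset Strict Implicit.
Unset Printing Implicit Defensive.

Import Order.TTheory GRing.Theory Num.Theory.
Import numFieldNormedType.Exports.

Local Open Scope classical_set_scope.
Local Open Scope ring_scope.

(** * Smooth maps between normed spaces *)

(** The two transverse metrics live on different local quotients, which share no chart. They are
    compared upstairs, on an open set of N: the horizontal lifts e_i of coordinate fields act as
    derivations on a ring of smooth functions, with [e_i, e_j] = - Om_ij X, and the coordinates of
    the new quotient are functions killed by the new Reeb field. Inverse metrics are used because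
    they transform by the Jacobian itself. Where the inverse metric is a multiple of the identity
    with vanishing differential, the scalar curvature is a contraction of its second derivatives, so
    the change formula becomes an identity in that ring, up to third derivatives of the new
    coordinates. On the torus side, the closure of the one-parameter group of c - f(q) b is compact
    and its elements have identity differential at q. Near q they are uniformly Lipschitz-close to
    the identity, and iterates that stay in a ball force them to be the identity. For the integral,
    the transverse scalar curvature is a pointwise choice, so it is only bounded below by a
    continuous function; divergences are integrated chart by chart through a partition of unity. *)

Section CkClosure.
Context {R : realType}.
Implicit Types V W Z : normedModType R.

Lemma derivable_linear_comp V W Z (L : {linear W -> Z}) (f : V -> W) x v :
  continuous L -> derivable f x v -> is_derive x v (L \o f) (L ('D_v f x)).
Proof.
move=> cL df.
have H : (fun h : R => h^-1 *: (((L \o f) \o shift x) (h *: v) - (L \o f) x)) @ 0^'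
   --> L ('D_v f x).
  have -> : (fun h : R => h^-1 *: (((L \o f) \o shift x) (h *: v) - (L \o f) x))
     = L \o (fun h : R => h^-1 *: ((f \o shift x) (h *: v) - f x)).
    apply/funext => h /=; apply/esym; apply: (etrans (linearZ_LR _ _ _)).
    by congr (_ *: _); exact: linearB.
  by apply: continuous_cvg; [exact: cL | exact: df].
by apply: DeriveDef; [apply/cvg_ex; eexists; exact: H | exact: cvg_lim H].
Qed.

(** Every derivative thereby becomes one of a real variable, where the mean value theorem and the
    chain rule apply. *)
Lemma is_derive_line V W (f : V -> W) x v df :
  is_derive x v f df <-> is_derive (0 : R) 1 (fun t => f (x + t *: v)) df.
Proof.
have E : (fun h : R => h^-1 *: ((f \o shift x) (h *: v) - f x)) =
  (fun h : R => h^-1 *: (((fun t => f (x + t *: v)) \o shift 0) (h *: 1) - f (x + 0 *: v))).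
  apply/funext => h /=; rewrite scale0r !addr0.
  have -> : h%:A = h :> R by rewrite /GRing.scale/= mulr1.
  by rewrite (addrC x).
split=> -[A B]; apply: DeriveDef; move: A B; rewrite /derivable /derive ?E //.
Qed.

Lemma Ck_on_cont V W k (U : set V) (f : V -> W) x :
  Ck_on k U f -> U x -> {for x, continuous f}.
Proof. by case: k => [|k] [H _] /H. Qed.

Lemma Ck_onW V W k (U : set V) (f : V -> W) : Ck_on k.+1 U f -> Ck_on k U f.
Proof.
elim: k f => [|k IH] f [H1 H2]; split=> // v.
by case: (H2 v) => H3 H4; split=> //; apply: IH.
Qed.

Lemma Ck_on_sub V W k (U A : set V) (f : V -> W) :
  A `<=` U -> Ck_on k U f -> Ck_on k A f.
Proof.
move=> AU; elim: k f => [|k IH] f [H1 H2]; split=> //; try by move=> x /AU/H1.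
by move=> v; case: (H2 v) => H3 H4; split; [move=> x /AU/H3|exact: IH].
Qed.

(** [Ck_on] quantifies over the points of [U] only and ['D_v f] is a total function, so the class is
    a condition at each point separately. Smoothness can therefore be proved locally and glued. *)
Lemma Ck_on_pt V W k (U : set V) (f : V -> W) :
  (forall x, U x -> Ck_on k [set x] f) -> Ck_on k U f.
Proof.
elim: k f => [|k IH] f H; split=> //; try by move=> x /H [+ _]; apply.
move=> v; split; first by move=> x /H [_ /(_ v)[+ _]]; apply.
by apply: IH => x /H [_ /(_ v)[_]].
Qed.

Lemma near_continuous_at (V W : topologicalType) (f g : V -> W) x :
  (\forall y \near x, f y = g y) -> {for x, continuous f} -> {for x, continuous g}.
Proof.
move=> fg cf; rewrite /prop_for /continuous_at -(nbhs_singleton fg).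
by apply: cvg_trans cf; exact: near_eq_cvg.
Qed.

Lemma Ck_on_near V W k (U : set V) (f g : V -> W) :
  (forall x, U x -> \forall y \near x, f y = g y) -> Ck_on k U f -> Ck_on k U g.
Proof.
elim: k f g => [|k IH] f g fg [H1 H2]; split=> //; try (
  by move=> x Ux; apply: near_continuous_at (H1 x Ux); exact: fg).
move=> v; case: (H2 v) => H3 H4; split.
  by move=> x Ux; apply: near_eq_derivable (H3 x Ux); exact: fg.
apply: (IH (fun x => 'D_v f x)) => // x Ux.
have /nbhs_interior := fg x Ux; apply: filterS => y /= yfg.
exact: near_eq_derive.
Qed.

Lemma open_near (T : topologicalType) (U : set T) (P : T -> Prop) x : open U -> U x ->
  (forall y, U y -> P y) -> \forall y \near x, P y.
Proof.
by move=> oU Ux H; have : nbhs x U by [exact: open_nbhs_nbhs]; apply: filterS.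
Qed.

Lemma Ck_on_eq V W k (U : set V) (f g : V -> W) : open U ->
  (forall x, U x -> f x = g x) -> Ck_on k U f -> Ck_on k U g.
Proof. by move=> oU fg; apply: Ck_on_near => x Ux; exact: (open_near oU Ux). Qed.

Lemma Ck_on_cst V W k (U : set V) (w : W) : Ck_on k U (fun _ => w).
Proof.
elim: k w => [|k IH] w; split => //; try by move=> x _; exact: cvg_cst.
move=> v; split; first by move=> x _; exact: derivable_cst.
suff -> : (fun x => 'D_v (fun=> w) x) = (fun=> 0) by exact: IH.
by apply/funext => x; exact: derive_cst.
Qed.

(** The successor step of the closure proofs below: openness lets the formula [df] replace ['D_v f]
    near each point, and the induction hypothesis is then applied to [df]. *)
Lemma Ck_onSI V W k (U : set V) (f : V -> W) (df : V -> V -> W) : open U ->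
  (forall x, U x -> {for x, continuous f}) ->
  (forall v x, U x -> is_derive x v f (df v x)) ->
  (forall v, Ck_on k U (df v)) -> Ck_on k.+1 U f.
Proof.
move=> oU cf Hd Hk; split=> // v; split; first by move=> x /(Hd v) [].
by apply: Ck_on_eq (Hk v) => // x /(Hd v) [_ ->].
Qed.

Lemma Ck_on_derivable V W k (U : set V) (f : V -> W) x v :
  Ck_on k.+1 U f -> U x -> derivable f x v.
Proof. by move=> [_ /(_ v)[+ _]]; apply. Qed.

Lemma Ck_on_derive V W k (U : set V) (f : V -> W) v :
  Ck_on k.+1 U f -> Ck_on k U (fun x => 'D_v f x).
Proof. by move=> [_ /(_ v)[]]. Qed.

Lemma Ck_on_is_derive V W k (U : set V) (f : V -> W) x v :
  Ck_on k.+1 U f -> U x -> is_derive x v f ('D_v f x).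
Proof. by move=> F Ux; apply: derivableP; exact: Ck_on_derivable F Ux. Qed.

Lemma Ck_on_add V W k (U : set V) (f g : V -> W) : open U ->
  Ck_on k U f -> Ck_on k U g -> Ck_on k U (fun x => f x + g x).
Proof.
move=> oU; elim: k f g => [|k IH] f g F G; last apply: (@Ck_onSI _ _ _ _ _
  (fun v x => 'D_v f x + 'D_v g x)) => //; last first.
- by move=> v; apply: IH; exact: Ck_on_derive.
- by move=> v x Ux; apply: is_deriveD; apply: Ck_on_is_derive Ux; [exact: F|exact: G].
- by move=> x Ux; apply: cvgD; [exact: Ck_on_cont F Ux|exact: Ck_on_cont G Ux].
by split=> // x Ux; apply: cvgD; [exact: Ck_on_cont F Ux|exact: Ck_on_cont G Ux].
Qed.

Lemma Ck_on_lin V W Z k (U : set V) (L : {linear W -> Z}) (f : V -> W) : open U ->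
  continuous L -> Ck_on k U f -> Ck_on k U (fun x => L (f x)).
Proof.
move=> oU cL; elim: k f => [|k IH] f F; last apply: (@Ck_onSI _ _ _ _ _
  (fun v x => L ('D_v f x))) => //; last first.
- by move=> v; apply: IH; exact: Ck_on_derive.
- move=> v x Ux; apply: derivable_linear_comp => //; exact: Ck_on_derivable F Ux.
- by move=> x Ux; apply: continuous_comp; [exact: Ck_on_cont F Ux|exact: cL].
by split=> // x Ux; apply: continuous_comp; [exact: Ck_on_cont F Ux|exact: cL].
Qed.

Lemma Ck_on_opp V W k (U : set V) (f : V -> W) : open U ->
  Ck_on k U f -> Ck_on k U (fun x => - f x).
Proof.
move=> oU F; apply: (@Ck_on_lin _ _ _ k U (-%R : {linear W -> W})) F => //.
by move=> x; exact: opp_continuous.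
Qed.

Lemma Ck_on_sub_fun V W k (U : set V) (f g : V -> W) : open U ->
  Ck_on k U f -> Ck_on k U g -> Ck_on k U (fun x => f x - g x).
Proof. by move=> oU F G; apply: Ck_on_add => //; exact: Ck_on_opp. Qed.

Lemma Ck_on_sum V W k (U : set V) (I : Type) (r : seq I) (P : pred I) (f : I -> V -> W) :
  open U -> (forall i, P i -> Ck_on k U (f i)) ->
  Ck_on k U (fun x => \sum_(i <- r | P i) f i x).
Proof.
move=> oU H; elim: r => [|i r IH].
  by under eq_fun do rewrite big_nil; exact: Ck_on_cst.
under eq_fun do rewrite big_cons; case Pi: (P i) => //.
by apply: Ck_on_add => //; exact: H.
Qed.

Lemma Ck_on_mul V k (U : set V) (f g : V -> R) : open U ->
  Ck_on k U f -> Ck_on k U g -> Ck_on k U (fun x => f x * g x).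
Proof.
move=> oU; elim: k f g => [|k IH] f g F G; last apply: (@Ck_onSI _ _ _ _ _
  (fun v x => f x *: 'D_v g x + g x *: 'D_v f x)) => //; last first.
- move=> v; apply: Ck_on_add => //; apply: IH; do ?[exact: Ck_on_derive];
  exact: Ck_onW.
- by move=> v x Ux; apply: is_deriveM; apply: Ck_on_is_derive Ux; [exact: F|exact: G].
- by move=> x Ux; apply: cvgM; [exact: Ck_on_cont F Ux|exact: Ck_on_cont G Ux].
by split=> // x Ux; apply: cvgM; [exact: Ck_on_cont F Ux|exact: Ck_on_cont G Ux].
Qed.

Lemma Ck_on_prod V k (U : set V) (I : Type) (r : seq I) (P : pred I) (f : I -> V -> R) :
  open U -> (forall i, P i -> Ck_on k U (f i)) ->
  Ck_on k U (fun x => \prod_(i <- r | P i) f i x).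
Proof.
move=> oU H; elim: r => [|i r IH].
  by under eq_fun do rewrite big_nil; exact: Ck_on_cst.
under eq_fun do rewrite big_cons; case Pi: (P i) => //.
by apply: Ck_on_mul => //; exact: H.
Qed.

Lemma Ck_on_inv V k (U : set V) (f : V -> R) : open U ->
  (forall x, U x -> f x != 0) -> Ck_on k U f -> Ck_on k U (fun x => (f x)^-1).
Proof.
move=> oU f0; elim: k => [|k IH] F; last apply: (@Ck_onSI _ _ _ _ _
  (fun v x => - ((f x)^-1 * (f x)^-1 * 'D_v f x))) => //; last first.
- move=> v; apply: Ck_on_opp => //; have G := IH (Ck_onW F).
  by apply: Ck_on_mul => //; [exact: Ck_on_mul|exact: Ck_on_derive].
- move=> v x Ux; have dF := Ck_on_derivable (v:=v) F Ux.
  apply: DeriveDef; first by apply: derivableV => //; exact: f0.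
  rewrite deriveV //; last exact: f0.
  by rewrite /GRing.scale/= mulNr expr2 invfM.
- by move=> x Ux; apply: cvgV; [exact: f0|exact: Ck_on_cont F Ux].
by split=> // x Ux; apply: cvgV; [exact: f0|exact: Ck_on_cont F Ux].
Qed.

Lemma coord_continuousE m n i j : continuous (fun M : 'M[R]_(m, n) => M i j).
Proof. by move=> x; exact: coord_continuous. Qed.

Lemma mx_continuous_at (T : topologicalType) m n (F : T -> 'M[R]_(m, n)) (x : T) :
  (forall i j, {for x, continuous (fun y => F y i j)}) -> {for x, continuous F}.
Proof.
move=> H; apply/cvgrPdist_le => /= e e0.
near=> y; rewrite /Num.Def.normr/= mx_normrE (bigmax_le _ (ltW e0))//= => i _.
rewrite !mxE; move: i; near: y; apply: filter_forall => /= i.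
exact: ((cvgrPdist_le _ _).1 (H i.1 i.2)).
Unshelve. all: by end_near. Qed.

Lemma is_derive_mx V m n (F : V -> 'M[R]_(m, n)) x v dF :
  is_derive x v F dF <-> forall i j, is_derive x v (fun y => F y i j) (dF i j).
Proof.
split=> [[D <-] i j|H].
  have D' := (derivable_mxP F x v).1 D i j.
  apply: DeriveDef => //; rewrite derive_mx //.
  by rewrite mxE.
have D : derivable F x v by apply/derivable_mxP => i j; case: (H i j).
apply: DeriveDef => //; rewrite derive_mx //; apply/matrixP => i j; rewrite mxE.
by case: (H i j).
Qed.

Lemma Ck_on_mx V m n k (U : set V) (F : V -> 'M[R]_(m, n)) : open U ->
  Ck_on k U F <-> forall i j, Ck_on k U (fun x => F x i j).
Proof.
move=> oU; elim: k F => [|k IH] F.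
  split=> [[H _] i j|H]; split=> // x Ux.
    by apply: (@continuous_comp _ _ _ F (fun M : 'M[R]_(m, n) => M i j));
      [exact: H|exact: coord_continuous].
  by apply: mx_continuous_at => i j; case: (H i j) => + _; apply.
split=> [H i j|H].
  apply: (@Ck_onSI _ _ _ _ _ (fun v x => 'D_v F x i j)) => //.
  - move=> x Ux; apply: (@continuous_comp _ _ _ F (fun M : 'M[R]_(m, n) => M i j));
      [exact: Ck_on_cont H Ux|exact: coord_continuous].
  - move=> v x Ux; have := Ck_on_is_derive v H Ux.
    by move/is_derive_mx; apply.
  - by move=> v; apply: (IH _).1; exact: Ck_on_derive.
apply: (@Ck_onSI _ _ _ _ _ (fun v x => \matrix_(i, j) 'D_v (fun y => F y i j) x)) => //.
- by move=> x Ux; apply: mx_continuous_at => i j; exact: Ck_on_cont (H i j) Ux.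
- move=> v x Ux; apply/is_derive_mx => i j; rewrite mxE.
  exact: Ck_on_is_derive (H i j) Ux.
- move=> v; apply/IH => i j; under eq_fun do rewrite mxE.
  exact: Ck_on_derive.
Qed.

(* Precomposition with an affine map needs no chain rule, hence no finite-dimensionality. *)
Lemma Ck_on_affine V W Z k (U : set W) (f : W -> Z) (L : {linear V -> W}) (w : W) :
  continuous L -> Ck_on k U f -> Ck_on k [set x | U (L x + w)] (fun x => f (L x + w)).
Proof.
move=> cL; elim: k f => [|k IH] f F.
  split=> // x Ux; apply: (@continuous_comp _ _ _ (fun x => L x + w)).
    by apply: cvgD; [exact: cL|exact: cvg_cst].
  exact: Ck_on_cont F Ux.
have E v : (fun x => 'D_v (fun x => f (L x + w)) x) = (fun x => 'D_(L v) f (L x + w)).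
  apply/funext => x; rewrite /derive; set a := (X in lim (X @ _)).
  set b := (X in _ = lim (X @ _)); suff -> : a = b by [].
  by apply/funext => h; rewrite /a /b /= (linearD L) (linearZ_LR L) addrA.
split.
  move=> x Ux; apply: (@continuous_comp _ _ _ (fun x => L x + w)).
    by apply: cvgD; [exact: cL|exact: cvg_cst].
  exact: Ck_on_cont F Ux.
move=> v; split; last by rewrite E; apply: (IH (fun y => 'D_(L v) f y)); exact: Ck_on_derive.
move=> x Ux; have := Ck_on_derivable (v:=L v) F Ux; rewrite /derivable /=.
set a := (X in cvg (X @ _)); set b := (X in _ -> cvg (X @ _)); suff -> : a = b by [].
by apply/funext => h; rewrite /a /b /= (linearD L) (linearZ_LR L) addrA.
Qed.

End CkClosure.

(** * Differentiability and symmetry of second derivatives *)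

Section Differentiability.
Context {R : realType}.
Implicit Types V W Z : normedModType R.

Lemma near_dist_le (T : topologicalType) (g : T -> R) x (e : R) :
  {for x, continuous g} -> 0 < e -> \forall y \near x, `|g y - g x| <= e.
Proof.
by move=> + e0 => /cvgrPdist_le /(_ e e0); apply: filterS => y; rewrite distrC.
Qed.

Lemma near0_norm_lt V (d : R) : 0 < d -> \forall t \near (0 : V), `|t| < d.
Proof.
move=> d0; apply/nbhs_ballP; exists d => // t; rewrite -ball_normE /ball_ /= sub0r normrN.
by [].
Qed.

Lemma near0_ex2 (P Q : R -> Prop) : (\forall t \near (0 : R), P t) ->
  (\forall t \near (0 : R), Q t) -> exists t : R, [/\ t != 0, P t & Q t].
Proof.
move=> HP HQ; have : \forall t \near (0 : R)^', [/\ t != 0, P t & Q t].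
  near=> t; split; [near: t; exact: nbhs_dnbhs_neq|near: t; exact: nbhs_dnbhs|].
  by near: t; exact: nbhs_dnbhs.
by move=> /filter_ex.
Unshelve. all: by end_near. Qed.

Lemma is_derive_scale V W (f : V -> W) x v d (a : R) :
  is_derive x v f d -> is_derive x (a *: v) f (a *: d).
Proof.
move=> /is_derive_line [D E]; apply/is_derive_line.
set phi := (fun t : R => f (x + t *: v)) in D E.
have dphi : differentiable phi (a * 0) by rewrite mulr0; apply/derivable1_diffP.
have -> : (fun t : R => f (x + t *: (a *: v))) = phi \o ( *%R a).
  by apply/funext => t; rewrite /phi /= scalerA mulrC.
have dc : differentiable (phi \o ( *%R a)) (0 : R) by exact: differentiable_comp.
apply: DeriveDef; first exact/derivable1_diffP.
rewrite deriveE // diff_comp //=.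
have -> : 'd ( *%R a) (0 : R) (1 : R) = a *: (1 : R).
  by have := @diff_val _ _ _ _ _ _ ( *:%R a) (is_diff_scaler a (0 : R)) => /(congr1 (@^~ 1)).
rewrite linearZ_LR /=; congr (_ *: _).
by rewrite -deriveE // mulr0.
Qed.

Lemma is_derive_shift_line V W (f : V -> W) x v t d :
  is_derive (x + t *: v) v f d -> is_derive (t : R) 1 (fun s => f (x + s *: v)) d.
Proof.
move=> /is_derive_line H; apply/is_derive_line; move: H.
rewrite [X in is_derive _ _ X](_ : _ = fun s : R => f (x + (t + s *: 1) *: v)) //.
by apply/funext => s /=; rewrite scalerDl addrA /GRing.scale /= mulr1.
Qed.

(** Subtracting the expected increment [c] turns the mean value theorem into an error bound;
    first-order expansions, Schwarz's theorem and the Lipschitz estimates below are all obtained in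
    this form. *)
Lemma line_mvt V (f : V -> R) x v (c e : R) :
  (forall t, 0 <= t <= 1 -> derivable f (x + t *: v) v /\
      `|'D_v f (x + t *: v) - c| <= e) -> `|f (x + v) - f x - c| <= e.
Proof.
move=> H; pose phi := fun t : R => f (x + t *: v).
have D t : 0 <= t <= 1 -> is_derive (t : R) 1 phi ('D_v f (x + t *: v)).
  by move=> /H [H1 _]; apply: is_derive_shift_line; exact: derivableP.
have [||t] := @MVT_segment R phi (fun t => 'D_v f (x + t *: v)) 0 1 ler01.
- by move=> t; rewrite in_itv /= => /andP[/ltW t0 /ltW t1]; apply: D; rewrite t0.
- apply: derivable_within_continuous => t; rewrite in_itv /= => /D [].
  by [].
rewrite in_itv /= => t01; rewrite /phi scale1r scale0r addr0 subr0 mulr1 => ->.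
by have [] := H t t01.
Qed.

Section Partial.
Variable m : nat.

(** The corners of the staircase from 0 to [h] that moves along one coordinate axis after the
    other. *)
Definition trunc_row (j : nat) (h : 'rV[R]_m) : 'rV[R]_m :=
  \row_i (if (i < j)%N then h 0 i else 0).

Lemma trunc_row_step (h : 'rV[R]_m) (j : 'I_m) :
  trunc_row j.+1 h = trunc_row j h + h 0 j *: delta_mx 0 j.
Proof.
apply/rowP => i; rewrite !mxE /= ltnS leq_eqVlt.
have [->|ne] := eqVneq i j; first by rewrite eqxx /= ltnn add0r mulr1.
by rewrite -val_eqE in ne; rewrite (negbTE ne) /= mulr0 addr0.
Qed.

Lemma coord_le_norm (h : 'rV[R]_m) i : `|h 0 i| <= `|h|.
Proof.
rewrite [leRHS]/Num.Def.normr/= mx_normrE.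
by apply: (le_bigmax _ _ (ord0, i)).
Qed.

Lemma row_norm_le (h : 'rV[R]_m) (e : R) : 0 <= e -> (forall i, `|h 0 i| <= e) -> `|h| <= e.
Proof.
move=> e0 H; rewrite [leLHS]/Num.Def.normr/= mx_normrE bigmax_le // => -[i j] _ /=.
by rewrite ord1.
Qed.

Lemma row_norm_lt (h : 'rV[R]_m) (e : R) : 0 < e -> (forall i, `|h 0 i| < e) -> `|h| < e.
Proof.
move=> e0 H; rewrite [ltLHS]/Num.Def.normr/= mx_normrE.
by apply/bigmax_ltP; split => // -[i j] _ /=; rewrite ord1.
Qed.

Lemma row_sum_delta (v : 'rV[R]_m) : v = \sum_i v 0 i *: delta_mx 0 i.
Proof. exact: row_sum_delta. Qed.

(** Continuous partial derivatives give total differentiability: the increment is telescoped along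
    the staircase [trunc_row], and on each step the mean value inequality compares with the partial
    derivative at [x]. *)
Lemma Ck_on_differentiable k (U : set 'rV[R]_m) (f : 'rV[R]_m -> R) x : open U ->
  Ck_on k.+1 U f -> U x -> differentiable f x.
Proof.
move=> oU F Ux.
pose L (h : 'rV[R]_m) : R := \sum_i h 0 i * partial i f x.
have lL : linear L.
  move=> a u w; rewrite /L scaler_sumr -big_split; apply: eq_bigr => i _ /=.
  by rewrite !mxE mulrDl -mulrA.
pose LM := GRing.isLinear.Build _ _ _ _ L lL.
pose LL : {linear 'rV[R]_m -> R} := HB.pack L LM.
have cL : continuous LL.
  have [cL _] : Ck_on 0 setT L.
    apply: Ck_on_sum; [exact: openT|move=> i _; apply: Ck_on_mul; [exact: openT| |exact: Ck_on_cst]].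
    by split=> // y _; exact: coord_continuous.
  by move=> h; exact: cL.
have H : f \o shift x = cst (f x) + LL +o_ (0 : 'rV[R]_m) id.
  (* Each of the [m] steps of the staircase may err by [e'] times the norm of [h]; [m.+1] keeps the
     divisor nonzero. *)
  apply/eqaddoP => e e0; pose e' := e / m.+1%:R.
  have e'0 : 0 < e' by rewrite divr_gt0.
  have : \forall y \near x, U y /\ forall i, `|partial i f y - partial i f x| <= e'.
    apply: filterI; first exact: open_nbhs_nbhs.
    near=> y => i; move: i; near: y; apply: filter_forall => i.
    apply: (@near_dist_le _ (partial i f)) => //.
    exact: Ck_on_cont (Ck_on_derive (delta_mx 0 i) F) Ux.
  move=> /nbhs_ballP [d /= d0 Hd].
  have H0 := @near0_norm_lt 'rV[R]_m _ d0.
  near=> h; rewrite !fctE /= /LL /= /L.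
  have hd : `|h| < d by near: h; exact: H0.
  have yball (y : 'rV[R]_m) : `|y| <= `|h| -> ball x d (x + y).
    move=> yh; rewrite -ball_normE /ball_ /= opprD addrA subrr add0r normrN.
    exact: le_lt_trans hd.
  have step (j : 'I_m) : `|f (x + trunc_row j.+1 h) - f (x + trunc_row j h)
      - h 0 j * partial j f x| <= `|h| * e'.
    rewrite trunc_row_step addrA; apply: line_mvt => t /andP[t0 t1].
    set y := x + _ + _.
    have [Uy Hy] : U y /\ forall i, `|partial i f y - partial i f x| <= e'.
      apply: Hd; rewrite /y -addrA; apply: yball; apply: row_norm_le => // i.
      rewrite !mxE /=; case: ltnP => ij.
        by rewrite (_ : i == j = false) ?mulr0 ?addr0 ?coord_le_norm // -val_eqE ltn_eqF.
      rewrite add0r; case: (i == j); last by rewrite !mulr0 normr0.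
      rewrite mulr1 normrM ger0_norm // -[leRHS]mul1r.
      by apply: ler_pM => //; exact: coord_le_norm.
    have [D E] := is_derive_scale (h 0 j) (Ck_on_is_derive (delta_mx 0 j) F Uy).
    split => //; rewrite E /GRing.scale /= -mulrBr normrM.
    by apply: ler_pM => //; [exact: coord_le_norm|exact: Hy].
  have -> : f (h + x) - (f x + \sum_i h 0 i * partial i f x) =
    \sum_(j < m) (f (x + trunc_row j.+1 h) - f (x + trunc_row j h) - h 0 j * partial j f x).
    rewrite sumrB -(big_mkord predT (fun j => f (x + trunc_row j.+1 h) - f (x + trunc_row j h))).
    rewrite telescope_sumr // opprD addrA; congr (_ - _ - _).
      by rewrite addrC; congr (f (_ + _)); apply/rowP => i; rewrite mxE ltn_ord.
    by congr f; rewrite -[LHS]addr0; congr (_ + _); apply/rowP => i; rewrite !mxE ltn0.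
  apply: (le_trans (ler_norm_sum _ _ _)).
  apply: (@le_trans _ _ (\sum_(j < m) `|h| * e')); first by apply: ler_sum => j _; exact: step.
  rewrite sumr_const card_ord -mulr_natr -mulrA mulrC ler_wpM2r //.
  rewrite /e' -mulrA ler_piMr ?(ltW e0) // mulrC ler_pdivrMr // mul1r ler_nat //.
have dE : 'd f x = LL :> (_ -> _) by apply: diff_unique.
by apply/diff_locallyP; rewrite dE; split.
Unshelve. all: by end_near. Qed.

Lemma Ck_on_differentiable_mx p q k (U : set 'rV[R]_m) (f : 'rV[R]_m -> 'M[R]_(p, q)) x :
  open U -> Ck_on k.+1 U f -> U x -> differentiable f x.
Proof.
move=> oU F Ux.
have -> : f = \sum_(i < p) (\sum_(j < q) (fun y => f y i j *: delta_mx i j)).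
  apply/funext => y; rewrite fct_sumE [LHS]matrix_sum_delta.
  by apply: eq_bigr => i _; rewrite fct_sumE.
apply: differentiable_sum => i; apply: differentiable_sum => j.
apply: differentiableZl; apply: Ck_on_differentiable Ux => //.
by move/(Ck_on_mx _ _ oU): F; apply.
Qed.

Lemma derive_partial (f : 'rV[R]_m -> R) x v : differentiable f x ->
  'D_v f x = \sum_i v 0 i * partial i f x.
Proof.
move=> df; rewrite deriveE // {1}[v]row_sum_delta linear_sum.
by apply: eq_bigr => i _; rewrite linearZ_LR /= -deriveE.
Qed.

End Partial.

Lemma is_derive_comp V W (m : nat) (g : 'rV[R]_m -> W) (f : V -> 'rV[R]_m) x v :
  derivable f x v -> differentiable g (f x) ->
  is_derive x v (g \o f) ('D_('D_v f x) g (f x)).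
Proof.
move=> /derivableP /is_derive_line [D E] dg.
set phi := (fun t : R => f (x + t *: v)) in D E.
have p0 : phi 0 = f x by rewrite /phi scale0r addr0.
have dphi : differentiable phi 0 by apply/derivable1_diffP.
have dg' : differentiable g (phi 0) by rewrite p0.
apply/is_derive_line.
have dc : differentiable (g \o phi) 0 by exact: differentiable_comp.
apply: DeriveDef; first exact/derivable1_diffP.
apply: (etrans (deriveE _ dc)); rewrite (diff_comp dphi dg') /=.
by rewrite -(deriveE _ dphi) E p0 -(deriveE _ dg).
Qed.

(** The middle space is R^m, so that the chain rule is a finite sum of products of lower-order
    functions. The source is an arbitrary normed space because actions are smooth maps on a
    product. *)
Lemma Ck_on_comp V (m : nat) k (U : set V) (A : set 'rV[R]_m) (g : 'rV[R]_m -> R)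
  (f : V -> 'rV[R]_m) : open U -> open A -> (forall x, U x -> A (f x)) ->
  Ck_on k U f -> Ck_on k A g -> Ck_on k U (g \o f).
Proof.
move=> oU oA fA; elim: k f g fA => [|k IH] f g fA F G.
  by split=> // x Ux; apply: continuous_comp; [exact: Ck_on_cont F Ux|apply: Ck_on_cont G _; exact: fA].
apply: (@Ck_onSI _ _ _ _ _ _ (fun v x => \sum_i 'D_v f x 0 i * partial i g (f x))) => //.
- by move=> x Ux; apply: continuous_comp; [exact: Ck_on_cont F Ux|apply: Ck_on_cont G _; exact: fA].
- move=> v x Ux; have dg := Ck_on_differentiable oA G (fA x Ux).
  have := is_derive_comp (Ck_on_is_derive v F Ux).(@ex_derive _ _ _ _ _ _ _) dg.
  by rewrite (derive_partial _ dg).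
- move=> v; apply: Ck_on_sum => // i _; apply: Ck_on_mul => //.
    by have /(Ck_on_mx _ _ oU) := Ck_on_derive v F; apply.
  by apply: IH => //; [exact: Ck_onW|exact: Ck_on_derive].
Qed.

Lemma Ck_on_comp_mx V (m : nat) p q k (U : set V) (A : set 'rV[R]_m)
  (g : 'rV[R]_m -> 'M[R]_(p, q)) (f : V -> 'rV[R]_m) :
  open U -> open A -> (forall x, U x -> A (f x)) ->
  Ck_on k U f -> Ck_on k A g -> Ck_on k U (g \o f).
Proof.
move=> oU oA fA F /(Ck_on_mx _ _ oA) G; apply/(Ck_on_mx _ _ oU) => i j.
exact: (Ck_on_comp oU oA fA F (G i j)).
Qed.

(** Two nested mean value inequalities: along [t *: v] for the increment of [f] by [t *: w], then
    along [t *: w] for ['D_v f]. It serves Schwarz's theorem and, with [w] opposite to [v], the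
    second-order condition at a maximum. *)
Lemma second_difference V k (U : set V) (f : V -> R) x v w (e : R) : open U ->
  Ck_on k.+2 U f -> U x -> 0 < e ->
  \forall t \near (0 : R), `|f (x + t *: v + t *: w) - f (x + t *: v) - (f (x + t *: w) - f x)
     - t ^+ 2 * 'D_w ('D_v f) x| <= t ^+ 2 * e.
Proof.
move=> oU F Ux e0; set c := 'D_w _ x.
have : \forall y \near x, U y /\ `|'D_w ('D_v f) y - c| <= e.
  apply: filterI; first exact: open_nbhs_nbhs.
  by apply: near_dist_le => //; exact: Ck_on_cont (Ck_on_derive w (Ck_on_derive v F)) Ux.
move=> /nbhs_ballP [d /= d0 Hd].
have h0 : 0 < d / (`|v| + `|w| + 1) by rewrite divr_gt0 // ltr_wpDl // addr_ge0.
have H0 := @near0_norm_lt R _ h0.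
near=> t.
have td : `|t| * (`|v| + `|w|) < d.
  have : `|t| < d / (`|v| + `|w| + 1) by near: t; exact: H0.
  rewrite ltr_pdivlMr ?ltr_wpDl ?addr_ge0 //; apply: le_lt_trans.
  by apply: ler_wpM2l => //; rewrite lerDl.
have inb a b : 0 <= a <= 1 -> 0 <= b <= 1 ->
    U (x + a *: (t *: v) + b *: (t *: w)) /\
    `|'D_w ('D_v f) (x + a *: (t *: v) + b *: (t *: w)) - c| <= e.
  move=> /andP[a0 a1] /andP[b0 b1]; apply: Hd; rewrite -ball_normE /ball_ /=.
  rewrite -addrA opprD addrA subrr add0r normrN; apply: le_lt_trans td.
  apply: (le_trans (ler_normD _ _)); rewrite mulrDr !normrZ (ger0_norm a0) (ger0_norm b0).
  by apply: lerD; rewrite ler_piMl // mulr_ge0.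
have Uin a b : 0 <= a <= 1 -> 0 <= b <= 1 -> U (x + a *: (t *: v) + b *: (t *: w)).
  by move=> /inb H /H [].
have o0 : 0 <= (0 : R) <= 1 by rewrite lexx ler01.
have o1 : 0 <= (1 : R) <= 1 by rewrite ler01 lexx.
pose g y := f (y + t *: w) - f y.
apply: (@line_mvt _ g x (t *: v) (t ^+ 2 * c) (t ^+ 2 * e)) => a a01.
have [D1 E1] : is_derive (x + a *: (t *: v)) (t *: v) (fun y => f (y + t *: w))
    (t *: 'D_v f (x + a *: (t *: v) + t *: w)).
  apply: is_derive_scale; apply/is_derive_line.
  have /(Ck_on_is_derive v F)/is_derive_line := Uin a 1 a01 o1.
  rewrite scale1r; congr is_derive; apply/funext => s.
  by rewrite addrAC.
have [D2 E2] : is_derive (x + a *: (t *: v)) (t *: v) f (t *: 'D_v f (x + a *: (t *: v))).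
  apply: is_derive_scale; apply: (Ck_on_is_derive _ F).
  by have := Uin a 0 a01 o0; rewrite scale0r addr0.
split; first exact: (derivableB D1 D2).
rewrite [X in `|X - _|](_ : _ = t *: ('D_v f (x + a *: (t *: v) + t *: w) - 'D_v f (x + a *: (t *: v)))); last first.
  by rewrite (deriveB D1 D2) E1 E2 scalerBr.
rewrite /GRing.scale /= expr2 -!mulrA -mulrBr normrM.
have -> : t * (t * e) = `|t| * (`|t| * e) by rewrite !mulrA -normrM ger0_norm // -expr2 sqr_ge0.
apply: ler_wpM2l => //.
apply: (@line_mvt _ ('D_v f) _ (t *: w) (t * c) (`|t| * e)) => b b01; have [Uy Hy] := inb a b a01 b01.
have [D3 E3] := is_derive_scale t (Ck_on_is_derive w (Ck_on_derive v F) Uy).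
split => //; rewrite E3 /GRing.scale /= -mulrBr normrM.
exact: ler_wpM2l.
Unshelve. all: by end_near. Qed.

Lemma schwarz_arith (T p p' q r s X Y e : R) : 0 < T -> p = p' ->
  `|p - q - (r - s) - T * X| <= T * (e / 2) ->
  `|p' - r - (q - s) - T * Y| <= T * (e / 2) -> `|X - Y| <= e.
Proof.
move=> T0 <- A B; rewrite -(ler_pM2l T0) -[X in X * `|_|](ger0_norm (ltW T0)) -normrM.
move: A B; rewrite !ler_norml => /andP[A1 A2] /andP[B1 B2]; apply/andP; split; lra.
Qed.

(** The second difference is symmetric in [v] and [w], and both mixed derivatives are its leading
    coefficient in [t ^+ 2]. *)
Lemma derive_schwarz V k (U : set V) (f : V -> R) x v w : open U ->
  Ck_on k.+2 U f -> U x -> 'D_w ('D_v f) x = 'D_v ('D_w f) x.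
Proof.
move=> oU F Ux; apply/eqP; rewrite -subr_eq0 -normr_le0; apply/ler_addgt0Pl => e e0.
rewrite addr0.
have e2 : 0 < e / 2 by rewrite divr_gt0.
have A := second_difference v w oU F Ux e2.
have B := second_difference w v oU F Ux e2.
have [t [tn A' B']] := near0_ex2 A B.
have t0 : 0 < t ^+ 2 by rewrite exprn_even_gt0.
have E : x + t *: v + t *: w = x + t *: w + t *: v by exact: addrAC.
exact: (schwarz_arith t0 (congr1 f E) A' B').
Qed.

End Differentiability.

(** * Smooth maps and Jacobians *)

Section Smooth.
Context {R : realType}.
Implicit Types V W Z : normedModType R.

Lemma smooth_sub V W (U A : set V) (f : V -> W) :
  A `<=` U -> smooth_on U f -> smooth_on A f.
Proof. by move=> AU H k; exact: Ck_on_sub (H k). Qed.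

Lemma smooth_pt V W (U : set V) (f : V -> W) :
  (forall x, U x -> exists2 A : set V, A x & smooth_on A f) -> smooth_on U f.
Proof.
move=> H k; apply: Ck_on_pt => x /H [A Ax fA]; apply: Ck_on_sub (fA k).
by move=> y ->.
Qed.

Lemma smooth_eq V W (U : set V) (f g : V -> W) : open U ->
  (forall x, U x -> f x = g x) -> smooth_on U f -> smooth_on U g.
Proof. by move=> oU fg H k; exact: Ck_on_eq (H k). Qed.

Lemma smooth_cst V W (U : set V) (w : W) : smooth_on U (fun _ => w).
Proof. by move=> k; exact: Ck_on_cst. Qed.

Lemma smooth_derive V W (U : set V) (f : V -> W) v :
  smooth_on U f -> smooth_on U (fun x => 'D_v f x).
Proof. by move=> H k; exact: Ck_on_derive (H k.+1). Qed.

Lemma smooth_cont V W (U : set V) (f : V -> W) x :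
  smooth_on U f -> U x -> {for x, continuous f}.
Proof. by move=> H; exact: Ck_on_cont (H 0%N). Qed.

Lemma smooth_is_derive V W (U : set V) (f : V -> W) x v :
  smooth_on U f -> U x -> is_derive x v f ('D_v f x).
Proof. by move=> H; exact: Ck_on_is_derive (H 1%N). Qed.

Lemma smooth_derivable V W (U : set V) (f : V -> W) x v :
  smooth_on U f -> U x -> derivable f x v.
Proof. by move=> H Ux; case: (smooth_is_derive v H Ux). Qed.

Section OpenDomain.
Variables (V : normedModType R) (U : set V).
Hypothesis oU : open U.

Lemma smooth_add W (f g : V -> W) :
  smooth_on U f -> smooth_on U g -> smooth_on U (fun x => f x + g x).
Proof. by move=> F G k; exact: Ck_on_add. Qed.

Lemma smooth_opp W (f : V -> W) : smooth_on U f -> smooth_on U (fun x => - f x).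
Proof. by move=> F k; exact: Ck_on_opp. Qed.

Lemma smooth_subf W (f g : V -> W) :
  smooth_on U f -> smooth_on U g -> smooth_on U (fun x => f x - g x).
Proof. by move=> F G k; exact: Ck_on_sub_fun. Qed.

Lemma smooth_sum W (I : Type) (r : seq I) (P : pred I) (f : I -> V -> W) :
  (forall i, P i -> smooth_on U (f i)) ->
  smooth_on U (fun x => \sum_(i <- r | P i) f i x).
Proof. by move=> F k; apply: Ck_on_sum => // i /F. Qed.

Lemma smooth_prod (I : Type) (r : seq I) (P : pred I) (f : I -> V -> R) :
  (forall i, P i -> smooth_on U (f i)) ->
  smooth_on U (fun x => \prod_(i <- r | P i) f i x).
Proof. by move=> F k; apply: Ck_on_prod => // i /F. Qed.

Lemma smooth_mul (f g : V -> R) :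
  smooth_on U f -> smooth_on U g -> smooth_on U (fun x => f x * g x).
Proof. by move=> F G k; exact: Ck_on_mul. Qed.

Lemma smooth_inv (f : V -> R) : (forall x, U x -> f x != 0) ->
  smooth_on U f -> smooth_on U (fun x => (f x)^-1).
Proof. by move=> f0 F k; exact: Ck_on_inv. Qed.

Lemma smooth_mx m n (F : V -> 'M[R]_(m, n)) :
  smooth_on U F <-> forall i j, smooth_on U (fun x => F x i j).
Proof.
split=> [H i j k|H k]; first by move: i j; apply/Ck_on_mx.
by apply/Ck_on_mx => // i j; exact: H.
Qed.

Lemma smooth_comp m p q (A : set 'rV[R]_m) (g : 'rV[R]_m -> 'M[R]_(p, q)) (f : V -> 'rV[R]_m) :
  open A -> (forall x, U x -> A (f x)) -> smooth_on U f -> smooth_on A g ->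
  smooth_on U (g \o f).
Proof. by move=> oA fA F G k; exact: (Ck_on_comp_mx oU oA fA (F k) (G k)). Qed.

Lemma smooth_comp_fun m (A : set 'rV[R]_m) (g : 'rV[R]_m -> R) (f : V -> 'rV[R]_m) :
  open A -> (forall x, U x -> A (f x)) -> smooth_on U f -> smooth_on A g ->
  smooth_on U (g \o f).
Proof. by move=> oA fA F G k; exact: (Ck_on_comp oU oA fA (F k) (G k)). Qed.

Lemma smooth_scale m n (a : V -> R) (F : V -> 'M[R]_(m, n)) :
  smooth_on U a -> smooth_on U F -> smooth_on U (fun x => a x *: F x).
Proof.
move=> sa /smooth_mx sF; apply/smooth_mx => i j.
by under eq_fun do rewrite mxE; exact: smooth_mul.
Qed.

Lemma smooth_mulmx m n p (F : V -> 'M[R]_(m, n)) (G : V -> 'M[R]_(n, p)) :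
  smooth_on U F -> smooth_on U G -> smooth_on U (fun x => F x *m G x).
Proof.
move=> /smooth_mx sF /smooth_mx sG; apply/smooth_mx => i j.
under eq_fun do rewrite mxE; apply: smooth_sum => k _; exact: smooth_mul.
Qed.

Lemma smooth_trmx m n (F : V -> 'M[R]_(m, n)) :
  smooth_on U F -> smooth_on U (fun x => (F x)^T).
Proof.
move=> /smooth_mx sF; apply/smooth_mx => i j.
by under eq_fun do rewrite mxE; exact: sF.
Qed.

Lemma smooth_det n (F : V -> 'M[R]_n) : smooth_on U F -> smooth_on U (fun x => \det (F x)).
Proof.
move=> /smooth_mx sF; rewrite /determinant; apply: smooth_sum => s _.
apply: smooth_mul; first exact: smooth_cst.
by apply: smooth_prod => i _; exact: sF.
Qed.

Lemma smooth_invmx n (F : V -> 'M[R]_n) : (forall x, U x -> F x \in unitmx) ->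
  smooth_on U F -> smooth_on U (fun x => invmx (F x)).
Proof.
move=> u sF; apply: (@smooth_eq _ _ _ (fun x => (\det (F x))^-1 *: \adj (F x))) => //.
  by move=> x Ux; rewrite /invmx u.
apply: smooth_scale.
  apply: smooth_inv; last exact: smooth_det.
  by move=> x /u; rewrite unitmxE unitfE.
apply/smooth_mx => i j; under eq_fun do rewrite mxE /cofactor.
apply: smooth_mul; first exact: smooth_cst.
apply: smooth_det; apply/smooth_mx => a b; under eq_fun do rewrite !mxE.
by move/smooth_mx: sF; apply.
Qed.

Lemma smooth_row_mx p q r (F : V -> 'M[R]_(p, q)) (G : V -> 'M[R]_(p, r)) :
  smooth_on U F -> smooth_on U G -> smooth_on U (fun x => row_mx (F x) (G x)).
Proof.
move=> /smooth_mx sF /smooth_mx sG; apply/smooth_mx => i j.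
case: (fintype.split_ordP j) => j' ->.
  by rewrite (_ : (fun x => _) = (fun x => F x i j')) //; apply/funext => x; rewrite row_mxEl.
by rewrite (_ : (fun x => _) = (fun x => G x i j')) //; apply/funext => x; rewrite row_mxEr.
Qed.

End OpenDomain.

Lemma smooth_coord m n (U : set 'M[R]_(m, n)) i j : smooth_on U (fun x : 'M[R]_(m, n) => x i j).
Proof.
pose L (x : 'M[R]_(m, n)) := x i j.
have lL : linear L by move=> a x y; rewrite /L !mxE.
pose LM := GRing.isLinear.Build _ _ _ _ L lL.
pose LL : {linear 'M[R]_(m, n) -> R} := HB.pack L LM.
apply: (@smooth_sub _ _ setT) => // k; elim: k => [|k IH].
  by split=> // x _; exact: coord_continuous.
apply: (@Ck_onSI R 'M[R]_(m, n) R k setT _ (fun v _ => v i j)).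
- exact: openT.
- by move=> x _; exact: coord_continuous.
- move=> v x _; have D : derivable (id : 'M[R]_(m, n) -> _) x v by exact: derivable_id.
  have := @derivable_linear_comp _ _ _ _ LL id x v _ D.
  by rewrite derive_id; apply => y; exact: coord_continuous.
- by move=> v; exact: Ck_on_cst.
Qed.

Lemma smooth_id m n (U : set 'M[R]_(m, n)) : smooth_on U id.
Proof.
apply: (@smooth_sub _ _ setT) => //; apply/smooth_mx; first exact: openT.
by move=> i j; exact: smooth_coord.
Qed.

Section Jacobian.
Variable m : nat.
Implicit Types (U : set 'rV[R]_m) (x v : 'rV[R]_m).

Lemma smooth_differentiable p q U (f : 'rV[R]_m -> 'M[R]_(p, q)) x :
  open U -> smooth_on U f -> U x -> differentiable f x.
Proof. by move=> oU H Ux; exact: (Ck_on_differentiable_mx oU (H 1%N) Ux). Qed.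

Lemma smooth_diff_fun U (f : 'rV[R]_m -> R) x :
  open U -> smooth_on U f -> U x -> differentiable f x.
Proof. by move=> oU H Ux; exact: (Ck_on_differentiable oU (H 1%N) Ux). Qed.

Lemma mul_jacobian p (f : 'rV[R]_m -> 'rV[R]_p) x v :
  differentiable f x -> v *m 'J f x = 'D_v f x.
Proof. by move=> df; rewrite (deriveEjacobian _ df). Qed.

Lemma jacobianE p (f : 'rV[R]_m -> 'rV[R]_p) x i j : differentiable f x ->
  'J f x i j = partial i (fun y => f y 0 j) x.
Proof.
move=> df; rewrite /partial; have := mul_jacobian (delta_mx 0 i) df.
rewrite -rowE => /rowP /(_ j); rewrite mxE => ->.
rewrite derive_mx ?mxE //; exact: diff_derivable.
Qed.

Lemma smooth_jacobian p U (f : 'rV[R]_m -> 'rV[R]_p) :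
  open U -> smooth_on U f -> smooth_on U (fun x => 'J f x).
Proof.
move=> oU sf; apply/(smooth_mx oU) => i j.
apply: (@smooth_eq _ _ _ (partial i (fun y => f y 0 j))) => //.
  by move=> x Ux; rewrite jacobianE //; exact: smooth_differentiable Ux.
by apply: smooth_derive; move/(smooth_mx oU): sf; apply.
Qed.

Lemma smooth_derive_along U (f : 'rV[R]_m -> R) (X : 'rV[R]_m -> 'rV[R]_m) :
  open U -> smooth_on U f -> smooth_on U X -> smooth_on U (fun x => 'D_(X x) f x).
Proof.
move=> oU sf sX; apply: (@smooth_eq _ _ _ (fun x => \sum_i X x 0 i * partial i f x)) => //.
  by move=> x Ux; rewrite derive_partial //; exact: smooth_diff_fun Ux.
apply: smooth_sum => // i _; apply: smooth_mul => //; last exact: smooth_derive.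
by move/(smooth_mx oU): sX; apply.
Qed.

Lemma row_jacobian p (f : 'rV[R]_m -> 'rV[R]_p) x i :
  differentiable f x -> row i ('J f x) = 'D_(delta_mx 0 i) f x.
Proof. by move=> df; rewrite rowE; exact: mul_jacobian. Qed.

Lemma jacobian_near p (f g : 'rV[R]_m -> 'rV[R]_p) x :
  (\forall y \near x, f y = g y) -> differentiable f x -> differentiable g x ->
  'J f x = 'J g x.
Proof.
move=> fg df dg; apply/row_matrixP => i.
apply: (etrans (row_jacobian i df)); apply: (etrans _ (esym (row_jacobian i dg))).
exact: near_eq_derive.
Qed.

Lemma jacobian_id x : 'J (id : 'rV[R]_m -> 'rV[R]_m) x = 1%:M.
Proof.
apply/row_matrixP => i; rewrite !rowE mulmx1.
have d : differentiable (id : 'rV[R]_m -> 'rV[R]_m) x.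
  by apply: (smooth_differentiable openT _ I); exact: smooth_id.
by rewrite (mul_jacobian _ d) derive_id.
Qed.

Lemma smooth_affine p U (C : 'M[R]_(m, p)) (w : 'rV[R]_p) :
  smooth_on U (fun z : 'rV[R]_m => z *m C + w).
Proof.
apply: (@smooth_sub _ _ setT) => //; apply: smooth_add; first exact: openT.
  by apply: smooth_mulmx; [exact: openT|exact: smooth_id|exact: smooth_cst].
exact: smooth_cst.
Qed.

Lemma is_derive_affine p (C : 'M[R]_(m, p)) (w : 'rV[R]_p) x v :
  is_derive x v (fun z : 'rV[R]_m => z *m C + w) (v *m C).
Proof.
have c : continuous (mulmxr C : {linear 'rV[R]_m -> 'rV[R]_p}).
  move=> y; have := smooth_cont (@smooth_affine p setT C 0) I (x := y).
  by rewrite (_ : (fun z => z *m C + 0) = mulmxr C) //; apply/funext => z; rewrite addr0.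
have D := @derivable_linear_comp _ _ _ _ (mulmxr C : {linear 'rV[R]_m -> 'rV[R]_p}) id x v c
  (@derivable_id _ _ x v).
rewrite derive_id /= in D.
have := is_deriveD D (is_derive_cst w x v); rewrite addr0.
by apply.
Qed.

Lemma jacobian_affine p (C : 'M[R]_(m, p)) (w : 'rV[R]_p) x :
  'J (fun z : 'rV[R]_m => z *m C + w) x = C.
Proof.
have d : differentiable (fun z : 'rV[R]_m => z *m C + w) x.
  by apply: (smooth_differentiable openT _ I); exact: smooth_affine.
apply/row_matrixP => i; rewrite !rowE (mul_jacobian _ d).
by have [_ ->] := is_derive_affine C w x 'e_i.
Qed.

End Jacobian.

Lemma jacobian_comp m p q (f : 'rV[R]_m -> 'rV[R]_p) (g : 'rV[R]_p -> 'rV[R]_q) x :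
  differentiable f x -> differentiable g (f x) ->
  'J (g \o f) x = 'J f x *m 'J g (f x).
Proof.
move=> df dg; have dgf : differentiable (g \o f) x by exact: differentiable_comp.
apply/row_matrixP => i; apply: (etrans (row_jacobian i dgf)).
rewrite row_mul (row_jacobian i df) (mul_jacobian _ dg).
by have [_] := is_derive_comp (diff_derivable (v := 'e_i) df) dg.
Qed.
End Smooth.

(** * The inverse function theorem *)

Section InverseFunction.
Context {R : realType}.

Lemma near_forall (T : topologicalType) (I : finType) (x : T) (P : I -> T -> Prop) :
  (forall i, \forall y \near x, P i y) -> \forall y \near x, forall i, P i y.
Proof. by move=> H; near=> y => i; move: i; near: y; exact: filter_forall. Unshelve. all: by end_near. Qed.

Lemma norm_le_dist (V : normedModType R) (a b : V) : `|a| <= `|b - a| + `|b|.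
Proof.
have {1}-> : a = b - (b - a) by rewrite opprB addrC subrK.
by apply: (le_trans (ler_normB _ _)); rewrite addrC.
Qed.

Lemma norm_continuous_at (T : topologicalType) (V : normedModType R) (F : T -> V) x :
  {for x, continuous F} -> {for x, continuous (fun y => `|F y|)}.
Proof. by rewrite /prop_for /continuous_at => H; exact: cvg_norm. Qed.

Lemma dist_continuous_at (T : topologicalType) (V : normedModType R) (F : T -> V) x :
  (forall e, 0 < e -> \forall y \near x, `|F y - F x| < e) -> {for x, continuous F}.
Proof.
rewrite /prop_for /continuous_at => H; apply/cvgrPdist_lt => e /H.
by apply: filterS => y; rewrite distrC.
Qed.

Lemma near_neq0 (T : topologicalType) (g : T -> R) x :
  {for x, continuous g} -> g x != 0 -> \forall y \near x, g y != 0.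
Proof.
move=> + gx; rewrite /prop_for /continuous_at => /cvgrPdist_lt /(_ `|g x|).
rewrite normr_gt0 => /(_ gx); apply: filterS => y.
by apply: contraTneq => ->; rewrite subr0 ltxx.
Qed.

Lemma norm_mulmx_le p q (B : 'M[R]_(p, q)) :
  exists2 C : R, 0 < C & forall v : 'rV[R]_p, `|v *m B| <= C * `|v|.
Proof.
exists (1 + \sum_i \sum_j `|B i j|).
  by rewrite ltr_pwDl // sumr_ge0 // => i _; rewrite sumr_ge0.
move=> v; apply: row_norm_le.
  by rewrite mulr_ge0 // addr_ge0 // sumr_ge0 // => i _; rewrite sumr_ge0.
move=> j; rewrite mxE; apply: (le_trans (ler_norm_sum _ _ _)).
apply: (@le_trans _ _ (\sum_i `|B i j| * `|v|)).
  by apply: ler_sum => i _; rewrite normrM mulrC; apply: ler_wpM2l => //; exact: coord_le_norm.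
rewrite -mulr_suml; apply: ler_wpM2r => //; apply: ler_wpDl => //.
by apply: ler_sum => i _; rewrite (bigD1 j) //= lerDl sumr_ge0.
Qed.

(** Near [x0] all Jacobians are close to the one at [x0]; integrating along segments, which stay in
    the ball by convexity, makes the linear approximation uniform in both points. *)
Lemma strict_differentiable m p (U : set 'rV[R]_m) (f : 'rV[R]_m -> 'rV[R]_p) x0 (e : R) :
  open U -> smooth_on U f -> U x0 -> 0 < e ->
  exists2 r : R, 0 < r & ball x0 r `<=` U /\
    forall x y, ball x0 r x -> ball x0 r y ->
      `|f x - f y - (x - y) *m 'J f x0| <= e * `|x - y|.
Proof.
move=> oU sf Ux0 e0; pose e' := e / m.+1%:R.
have e'0 : 0 < e' by rewrite divr_gt0.
have sJ := smooth_jacobian oU sf.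
have : \forall y \near x0, U y /\ forall i j, `|'J f y i j - 'J f x0 i j| <= e'.
  apply: filterI; first exact: open_nbhs_nbhs.
  suff : \forall y \near x0, forall ij : 'I_m * 'I_p, `|'J f y ij.1 ij.2 - 'J f x0 ij.1 ij.2| <= e'.
    by apply: filterS => y H i j; exact: (H (i, j)).
  apply: near_forall => -[i j] /=.
  apply: (@near_dist_le _ _ (fun y => 'J f y i j)) => //.
  by apply: (smooth_cont _ Ux0); move/(smooth_mx oU): sJ; apply.
move=> /nbhs_ballP [r /= r0 Hr]; exists r => //; split; first by move=> x /Hr [].
move=> x y xr yr; apply: row_norm_le => [|j]; first by rewrite mulr_ge0 // ltW.
have dfc z : U z -> differentiable f z by move=> Uz; exact: smooth_differentiable Uz.
have seg t : 0 <= t <= 1 -> ball x0 r (y + t *: (x - y)).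
  move=> /andP[t0 t1]; move: xr yr; rewrite -ball_normE /ball_ /= => xr yr.
  have -> : x0 - (y + t *: (x - y)) = t *: (x0 - x) + (1 - t) *: (x0 - y).
    by rewrite !scalerBr !scalerBl !scale1r; apply/rowP => k; rewrite !mxE; ring.
  have t1' : 0 <= 1 - t by rewrite subr_ge0.
  apply: (le_lt_trans (ler_normD _ _)); rewrite !normrZ !ger0_norm //.
  apply: (@le_lt_trans _ _ (t * Num.max `|x0 - x| `|x0 - y| + (1 - t) * Num.max `|x0 - x| `|x0 - y|)).
    by apply: lerD; apply: ler_wpM2l => //; rewrite le_max lexx ?orbT.
  by rewrite -mulrDl addrC subrK mul1r gt_max xr yr.
have -> : (f x - f y - (x - y) *m 'J f x0) 0 j =
  (fun z => f z 0 j) (y + (x - y)) - (fun z => f z 0 j) y - ((x - y) *m 'J f x0) 0 j.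
  have -> : y + (x - y) = x by rewrite addrC subrK.
  by rewrite !mxE.
apply: (@line_mvt R _ (fun z => f z 0 j) y (x - y)) => t t01; have [Uz Hz] := Hr _ (seg t t01).
set z := y + _ in Uz Hz *.
have : is_derive z (x - y) f ((x - y) *m 'J f z).
  by rewrite mul_jacobian; [exact: smooth_is_derive Uz|exact: dfc].
move=> /is_derive_mx /(_ 0 j) [D E]; split; first exact: D.
rewrite E [X in `|X - _|]mxE [X in `|_ - X|]mxE -sumrB.
apply: (le_trans (ler_norm_sum _ _ _)).
apply: (@le_trans _ _ (\sum_(i < m) `|x - y| * e')).
  apply: ler_sum => i _; rewrite -mulrBr normrM; apply: ler_pM => //.
  exact: (coord_le_norm (x - y)).
rewrite sumr_const card_ord -mulr_natr -mulrA mulrC ler_wpM2r //.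
by rewrite /e' -mulrA ler_piMr ?(ltW e0) // mulrC ler_pdivrMr // mul1r ler_nat.
Qed.

Lemma closed_ball_compact m (x : 'rV[R]_m) (s : R) : compact [set y : 'rV[R]_m | `|y - x| <= s].
Proof.
apply: bounded_closed_compact.
  exists (`|x| + s); split; first by rewrite num_real.
  move=> M hM y /= yx; apply: ltW; apply: le_lt_trans hM.
  by rewrite -[y](subrK x) addrC; apply: (le_trans (ler_normD _ _)); rewrite lerD2l.
have -> : [set y : 'rV[R]_m | `|y - x| <= s] = closed_ball_ Num.Def.normr x s.
  by apply/seteqP; split=> y /=; rewrite /closed_ball_ /= distrC.
exact: closed_closed_ball_.
Qed.

Lemma inverse_remainder m (h : R) (J : 'M[R]_m) (v k : 'rV[R]_m) : h != 0 -> J \in unitmx ->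
  v *m invmx J - h^-1 *: k = h^-1 *: ((h *: v - k *m J) *m invmx J).
Proof.
move=> h0 uJ; rewrite [(_ - _) *m _]mulmxBl (mulmxK uJ) -[(h *: v) *m _]scalemxAl scalerBr.
by rewrite [in RHS]scalerA mulVf // scale1r.
Qed.

Lemma inverse_quotient_bound m (h e K C : R) (J : 'M[R]_m) (v k : 'rV[R]_m) :
  h != 0 -> J \in unitmx -> (forall w : 'rV[R]_m, `|w *m invmx J| <= C * `|w|) ->
  0 < C -> 0 < K -> 0 < e ->
  `|h *: v - k *m J| <= e / (C * (K * (`|v| + 1))) * `|k| -> `|k| <= K * (`|h| * `|v|) ->
  `|v *m invmx J - h^-1 *: k| <= e.
Proof.
move=> h0 uJ HC C0 K0 e0 Hh Lh; rewrite (inverse_remainder v k h0 uJ).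
rewrite normrZ normfV ler_pdivrMl ?normr_gt0 //.
apply: (le_trans (HC _)).
have D0 : 0 < C * (K * (`|v| + 1)) by rewrite !mulr_gt0 // ltr_wpDl.
have Lh' : `|k| <= K * (`|h| * (`|v| + 1)).
  by apply: (le_trans Lh); rewrite ler_pM2l // ler_wpM2l // lerDl.
have E0 : 0 <= e / (C * (K * (`|v| + 1))) by rewrite divr_ge0 ?ltW.
have := le_trans Hh (ler_wpM2l E0 Lh') => /(ler_wpM2l (ltW C0)) /le_trans; apply.
move: D0; set w := `|v| + 1; move=> D0.
have -> : C * (e / (C * (K * w)) * (K * (`|h| * w))) = e / (C * (K * w)) * (C * (K * w)) * `|h|.
  by ring.
by rewrite divfK ?gt_eqF // mulrC.
Qed.

Section Local.
Variables (m : nat) (U : set 'rV[R]_m) (f : 'rV[R]_m -> 'rV[R]_m) (x0 : 'rV[R]_m).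
Hypotheses (oU : open U) (sf : smooth_on U f) (Ux0 : U x0) (uJ : 'J f x0 \in unitmx).

(** With the error of [strict_differentiable] chosen as [2^-1 / C], where [C] bounds the inverse
    Jacobian, [f] followed by that inverse is within 1/2 of the identity in the Lipschitz sense.
    Hence [f] is injective near [x0] with Lipschitz inverse. *)
Lemma local_expansion : exists r K : R, [/\ 0 < r, 0 < K, ball x0 r `<=` U,
   forall x, ball x0 r x -> 'J f x \in unitmx &
   forall x y, ball x0 r x -> ball x0 r y ->
    `|x - y| <= K * `|f x - f y| /\
    `|(f x - f y) *m invmx ('J f x0) - (x - y)| <= 2^-1 * `|x - y|].
Proof.
have [C C0 HC] := norm_mulmx_le (invmx ('J f x0)).
have e0 : 0 < 2^-1 / C by rewrite divr_gt0.
have [r1 r10 [sub1 H1]] := strict_differentiable oU sf Ux0 e0.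
have : \forall y \near x0, 'J f y \in unitmx.
  have sJ := smooth_det oU (smooth_jacobian oU sf).
  have c : \det ('J f x0) != 0 by rewrite -unitfE -unitmxE.
  have := near_neq0 (smooth_cont sJ Ux0) c.
  by apply: filterS => y; rewrite unitmxE unitfE.
move=> /nbhs_ballP [r2 /= r20 H2].
pose r := Num.min r1 r2.
have b1 : ball x0 r `<=` ball x0 r1 by apply: le_ball; rewrite ge_min lexx.
have b2 : ball x0 r `<=` ball x0 r2 by apply: le_ball; rewrite ge_min lexx orbT.
exists r, (2 * C); split; [by rewrite lt_min r10|by rewrite mulr_gt0|by move=> x /b1/sub1|
  by move=> x /b2/H2|].
move=> x y /b1 xr /b1 yr; have := H1 x y xr yr => H.
have A : `|(f x - f y) *m invmx ('J f x0) - (x - y)| <= 2^-1 * `|x - y|.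
  have -> : (f x - f y) *m invmx ('J f x0) - (x - y) =
    (f x - f y - (x - y) *m 'J f x0) *m invmx ('J f x0).
    by rewrite [RHS]mulmxBl (mulmxK uJ).
  apply: (le_trans (HC _)); apply: (le_trans (ler_wpM2l (ltW C0) H)).
  by rewrite mulrA [C * _]mulrC divfK // gt_eqF.
split => //.
have B := HC (f x - f y).
have : `|x - y| <= 2^-1 * `|x - y| + C * `|f x - f y|.
  by apply: le_trans (lerD A B); exact: norm_le_dist.
by move: A B; set a := `|x - y|; set b := `|f x - f y|; move=> _ _; lra.
Qed.

(** That the image is open comes from compactness: the distance to the target [y], measured after
    the inverse Jacobian, has a minimum on a closed ball, and this minimum must be 0. *)
Theorem inverse_function (A : set 'rV[R]_m) : nbhs x0 A ->
  exists (V : set 'rV[R]_m) (g : 'rV[R]_m -> 'rV[R]_m),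
   [/\ open V /\ V x0, V `<=` U `&` A, open (f @` V) & 
     [/\ forall x, V x -> g (f x) = x, smooth_on (f @` V) g
       & forall x, V x -> 'J f x \in unitmx]].
Proof.
move=> nA; have [r' [K [r'0 K0 sub1 uJx H1]]] := local_expansion.
have [r2 /= r20 H2] := (nbhs_ballP _ _).1 nA.
pose r := Num.min r' r2.
have r0 : 0 < r by rewrite lt_min r'0.
have b1 : ball x0 r `<=` ball x0 r' by apply: le_ball; rewrite ge_min lexx.
have b2 : ball x0 r `<=` ball x0 r2 by apply: le_ball; rewrite ge_min lexx orbT.
pose V := ball x0 r.
have oV : open V by exact: ball_open.
pose g y := xget x0 [set x | V x /\ f x = y].
have gf x : V x -> g (f x) = x.
  move=> Vx; rewrite /g; case: xgetP => [z _ [Vz fz]|/(_ x) []//].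
  have [] := H1 z x (b1 _ Vz) (b1 _ Vx); rewrite fz subrr normr0 mulr0 normr_le0 subr_eq0.
  by move=> /eqP.
have [C C0 HC] := norm_mulmx_le (invmx ('J f x0)).
have oW : open (f @` V).
  rewrite openE => _ [x1 Vx1 <-].
  have [s /= s0 Hs] := (nbhs_ballP _ _).1 (open_nbhs_nbhs (conj oV Vx1)).
  pose s' := s / 2.
  have s'0 : 0 < s' by rewrite divr_gt0.
  pose B := [set x : 'rV[R]_m | `|x - x1| <= s'].
  have BV : B `<=` V.
    move=> x xB; apply: Hs; rewrite -ball_normE /ball_ /= distrC.
    by apply: le_lt_trans xB _; rewrite /s' ltr_pdivrMr // ltr_pMr // ltr1n.
  (* The minimiser is at most [4 * (C * d1)] from [x1] and the correction [k] has norm at most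
     [C * d1], so the corrected point stays in [B]. *)
  pose d1 := s' / (5 * C).
  have d10 : 0 < d1 by rewrite divr_gt0 // mulr_gt0.
  have d1E : 5 * (C * d1) = s' by rewrite /d1 mulrA mulrC divfK // gt_eqF // mulr_gt0.
  apply/nbhs_ballP; exists d1 => //= y; rewrite -ball_normE /ball_ /= => yd.
  have := @EVT_min_rV R m (fun x => `|(f x - y) *m invmx ('J f x0)|) B.
  case.
  - by exists x1; rewrite /B /= subrr normr0 ltW.
  - exact: closed_ball_compact.
  - apply: continuous_in_subspaceT => x; rewrite inE => /BV Vx.
    have Ux : U x by apply: sub1; exact: b1.
    have sh : smooth_on U (fun x => (f x - y) *m invmx ('J f x0)).
      apply: smooth_mulmx => //; last exact: smooth_cst.
      by apply: smooth_subf => //; exact: smooth_cst.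
    apply: (@norm_continuous_at _ 'rV[R]_m (fun x => (f x - y) *m invmx ('J f x0))).
    exact: (smooth_cont sh Ux).
  move=> xs /set_mem Bxs mn.
  have Vxs := BV _ Bxs.
  have Bx1 : B x1 by rewrite /B /= subrr normr0 ltW.
  pose k := (f xs - y) *m invmx ('J f x0).
  have kle : `|k| <= C * d1.
    apply: (le_trans (mn x1 _)); first by rewrite inE.
    by apply: (le_trans (HC _)); rewrite ler_wpM2l // ltW.
  exists xs => //; apply/eqP; apply: contraT => nfy.
  have k0 : 0 < `|k|.
    rewrite normr_gt0; apply: contraNneq nfy => /(congr1 (mulmx^~ ('J f x0))).
    by rewrite /k mulmxKV // mul0mx => /eqP; rewrite subr_eq0.
  (* A Newton step with the Jacobian frozen at [x0]. It would at least halve the minimal value,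
     which is impossible unless that value is 0. *)
  pose xn := xs - k.
  have [A1 A2] := H1 xs x1 (b1 _ Vxs) (b1 _ Vx1).
  have dx : `|xs - x1| <= 2 * (`|k| + C * d1).
    have : `|xs - x1| <= 2^-1 * `|xs - x1| + `|(f xs - f x1) *m invmx ('J f x0)|.
      by apply: le_trans (lerD A2 (lexx _)); exact: norm_le_dist.
    have : `|(f xs - f x1) *m invmx ('J f x0)| <= `|k| + C * d1.
      have -> : f xs - f x1 = (f xs - y) + (y - f x1) by rewrite addrA subrK.
      rewrite mulmxDl; apply: (le_trans (ler_normD _ _)); rewrite lerD2l.
      by apply: (le_trans (HC _)); rewrite ler_wpM2l ?(ltW C0) // distrC ltW.
    by lra.
  have Bxn : B xn.
    rewrite /B /= /xn addrAC; apply: (le_trans (ler_normB _ _)).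
    by move: dx kle d1E; lra.
  have := mn xn; rewrite inE => /(_ Bxn).
  have [_ A3] := H1 xn xs (b1 _ (BV _ Bxn)) (b1 _ Vxs).
  have E : (f xn - y) *m invmx ('J f x0) = (f xn - f xs) *m invmx ('J f x0) - (xn - xs).
    have -> : f xn - y = (f xn - f xs) + (f xs - y) by rewrite addrA subrK.
    by rewrite mulmxDl -/k /xn addrAC subrr sub0r opprK.
  rewrite E -/k => /le_trans /(_ A3); rewrite /xn addrAC subrr sub0r normrN.
  by move: k0; set a := `|k|; lra.
have fg y : (f @` V) y -> V (g y) /\ f (g y) = y.
  by move=> [x Vx <-]; rewrite gf.
have Lg y z : (f @` V) y -> (f @` V) z -> `|g y - g z| <= K * `|y - z|.
  move=> /fg [Vy Ey] /fg [Vz Ez].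
  by have [+ _] := H1 _ _ (b1 _ Vy) (b1 _ Vz); rewrite Ey Ez.
have cg y : (f @` V) y -> {for y, continuous g}.
  move=> Wy; apply: (@dist_continuous_at _ 'rV[R]_m) => e e0.
  have : \forall z \near y, (f @` V) z /\ `|z - y| < e / K.
    apply: filterI; first exact: open_nbhs_nbhs.
    apply/nbhs_ballP; exists (e / K); first by rewrite /= divr_gt0.
    by move=> z; rewrite -ball_normE /ball_ /= distrC.
  apply: filterS => z [Wz zy]; apply: (le_lt_trans (Lg z y Wz Wy)).
  by rewrite mulrC -ltr_pdivlMr.
have dg v y : (f @` V) y -> is_derive y v g (v *m invmx ('J f (g y))).
  move=> Wy; have [Vgy fgy] := fg y Wy.
  have uJy := uJx _ (b1 _ Vgy).
  set J := 'J f (g y) in uJy *.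
  have [CJ CJ0 HCJ] := norm_mulmx_le (invmx J).
  suff H : (fun h : R => h^-1 *: ((g \o shift y) (h *: v) - g y)) @ 0^' --> v *m invmx J.
    by apply: DeriveDef; [apply/cvg_ex; eexists; exact: H | exact: cvg_lim H].
  apply/cvgrPdist_le => /= e e0.
  pose e1 := e / (CJ * (K * (`|v| + 1))).
  have e10 : 0 < e1 by rewrite divr_gt0 // !mulr_gt0.
  have [rr rr0 [_ Hrr]] := strict_differentiable oU sf (sub1 _ (b1 _ Vgy)) e10.
  have cl : (fun h : R => h *: v + y) @ (0 : R) --> y.
    have : {for (0 : R), continuous (fun h : R => h *: v + y)}.
      by apply: cvgD; [exact: scalel_continuous|exact: cvg_cst].
    by rewrite /prop_for /continuous_at scale0r add0r.
  have N1 : \forall h \near (0 : R), (f @` V) (h *: v + y).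
    by apply: cl; exact: open_nbhs_nbhs.
  have N2 : \forall h \near (0 : R), ball (g y) rr (g (h *: v + y)).
    have P : nbhs y (fun z => ball (g y) rr (g z)).
      by have := cg y Wy; rewrite /prop_for /continuous_at; apply; exact: nbhsx_ballx.
    exact: (cl _ P).
  near=> h.
  have h0 : h != 0 by near: h; exact: nbhs_dnbhs_neq.
  have Wh : (f @` V) (h *: v + y) by near: h; apply: nbhs_dnbhs; exact: N1.
  have Bh : ball (g y) rr (g (h *: v + y)) by near: h; apply: nbhs_dnbhs; exact: N2.
  have [Vh fh] := fg _ Wh.
  have := Hrr _ _ Bh (ballxx _ rr0); rewrite fh fgy addrK => Hh.
  have Lh := Lg _ _ Wh Wy; rewrite addrK normrZ in Lh.
  set k := g (h *: v + y) - g y in Hh Lh *.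
  exact: (inverse_quotient_bound h0 uJy HCJ CJ0 K0 e0 Hh Lh).
have sg : smooth_on (f @` V) g.
  (* The derivative of [g] is a smooth function composed with [g], so that order [k] for [g] gives
     order [k] for the derivative. *)
  elim=> [|k IH]; first by split=> // y Wy; exact: cg.
  apply: (@Ck_onSI _ _ _ _ _ _ (fun v y => v *m invmx ('J f (g y)))) => //.
  move=> v.
  have uV x : V x -> 'J f x \in unitmx by move=> Vx; apply: uJx; exact: b1.
  have sfV : smooth_on V f by apply: smooth_sub sf; move=> x Vx; apply: sub1; exact: b1.
  have s1 : smooth_on V (fun x => v *m invmx ('J f x)).
    have s2 := smooth_invmx oV uV (smooth_jacobian oV sfV).
    have s3 : smooth_on V (fun _ : 'rV[R]_m => v) by exact: smooth_cst.
    exact: (smooth_mulmx oV s3 s2).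
  apply: (Ck_on_comp_mx oW oV _ IH (s1 k)).
  by move=> y /fg [].
have V0 : V x0 by exact: ballxx.
have VUA : V `<=` U `&` A by move=> x Vx; split; [apply: sub1; exact: b1|apply: H2; exact: b2].
have uV x : V x -> 'J f x \in unitmx by move=> Vx; apply: uJx; exact: b1.
exists V, g; split; [exact: (conj oV V0)|exact: VUA|exact: oW|].
by split; [exact: gf|exact: sg|exact: uV].
Unshelve. all: by end_near. Qed.

End Local.

(** On the affine subspace through [x0] parametrised by [C], a complement of the kernel of the
    differential, [f] has identity differential and the inverse function theorem applies. *)
Lemma submersion_section m d (U : set 'rV[R]_m) (f : 'rV[R]_m -> 'rV[R]_d) x0 :
  open U -> smooth_on U f -> U x0 -> row_full ('J f x0) ->
  exists (W : set 'rV[R]_d) (s : 'rV[R]_d -> 'rV[R]_m),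
    [/\ open W, W (f x0), s (f x0) = x0, smooth_on W s &
      forall y, W y -> U (s y) /\ f (s y) = y].
Proof.
move=> oU sf Ux0 /row_fullP [C CJ].
pose a (z : 'rV[R]_d) := z *m C + x0.
have sa (A : set 'rV[R]_d) : smooth_on A a by exact: smooth_affine.
pose Z := a @^-1` U.
have oZ : open Z.
  by apply: open_comp => // z _; apply: (smooth_cont (sa setT)).
have Z0 : Z 0 by rewrite /Z /= /a mul0mx add0r.
have a0 : a 0 = x0 by rewrite /a mul0mx add0r.
have sfa : smooth_on Z (f \o a) by exact: (smooth_comp oZ oU).
have da : differentiable a 0 by exact: (smooth_differentiable openT (sa setT)).
have df : differentiable f (a 0) by rewrite a0; exact: (smooth_differentiable oU sf).
have Ja : 'J a 0 = C by exact: jacobian_affine.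
have uJ : 'J (f \o a) 0 \in unitmx.
  by rewrite (jacobian_comp da df) Ja a0 CJ unitmx1.
have [V [g [[oV V0] VU oW [gf sg _]]]] := inverse_function oZ sfa Z0 uJ filterT.
exists ((f \o a) @` V), (a \o g); split.
- exact: oW.
- by exists 0; [exact: V0|rewrite /= a0].
- by rewrite /= -{1}a0 -[f (a 0)]/((f \o a) 0) gf.
- by apply: (smooth_comp oW openT _ sg (sa setT)).
move=> _ [z Vz <-]; rewrite /= -[f (a z)]/((f \o a) z) gf //.
by have [Zz _] := VU z Vz.
Qed.

End InverseFunction.

(** The curvature computations are polynomial identities in iterated derivatives. In a commutative
    ring with derivations they can be closed by [ring], and smoothness is built into the
    elements. *)
Definition derivation (A : pzRingType) (e : A -> A) :=
  (forall x y, e (x + y) = e x + e y) /\ (forall x y, e (x * y) = e x * y + x * e y).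

Section DerivationTheory.
Context {A : comPzRingType}.
Variable e : A -> A.
Hypothesis De : derivation e.

Lemma derivD x y : e (x + y) = e x + e y. Proof. exact: De.1. Qed.
Lemma derivM x y : e (x * y) = e x * y + x * e y. Proof. exact: De.2. Qed.
Lemma deriv0 : e 0 = 0.
Proof. by apply: (addrI (e 0)); rewrite -derivD !addr0. Qed.
Lemma derivN x : e (- x) = - e x.
Proof. by apply: (addrI (e x)); rewrite -derivD !subrr deriv0. Qed.
Lemma derivB x y : e (x - y) = e x - e y. Proof. by rewrite derivD derivN. Qed.
Lemma deriv1 : e 1 = 0.
Proof. by apply: (addrI (e 1)); rewrite addr0 -{3}(mulr1 1) derivM mulr1 mul1r. Qed.
Lemma deriv_sum (I : Type) (r : seq I) (P : pred I) (F : I -> A) :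
  e (\sum_(i <- r | P i) F i) = \sum_(i <- r | P i) e (F i).
Proof. exact: (big_morph e derivD deriv0). Qed.
Lemma deriv_nat n : e n%:R = 0.
Proof. by elim: n => [|n IH]; rewrite ?deriv0 // -addn1 natrD derivD IH deriv1 addr0. Qed.

Lemma deriv_mulmx p q r (M : 'M[A]_(p, q)) (N : 'M[A]_(q, r)) :
  map_mx e (M *m N) = map_mx e M *m N + M *m map_mx e N.
Proof.
apply/matrixP => i j; rewrite !mxE deriv_sum -big_split.
by apply: eq_bigr => k _; rewrite !mxE derivM.
Qed.

Lemma deriv_mxD p q (M N : 'M[A]_(p, q)) : map_mx e (M + N) = map_mx e M + map_mx e N.
Proof. by apply/matrixP => i j; rewrite !mxE derivD. Qed.
Lemma deriv_mxN p q (M : 'M[A]_(p, q)) : map_mx e (- M) = - map_mx e M.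
Proof. by apply/matrixP => i j; rewrite !mxE derivN. Qed.
Lemma deriv_mx1 p : map_mx e (1%:M : 'M[A]_p) = 0.
Proof. by apply/matrixP => i j; rewrite !mxE; case: (i == j); rewrite ?deriv1 ?deriv0. Qed.

End DerivationTheory.

(** * Curvature under a change of Reeb field *)

(* In coordinates [phi] with [phi_ij = Gamma_ij] at the point the inverse metric [F] has
   vanishing differential and the curvature is read off its second derivatives. *)
Section NormalCoordinates.
Context {A : comPzRingType} {R : comPzRingType}.
Variables (ev : {rmorphism A -> R}) (d : nat) (e : 'I_d -> A -> A).
Hypothesis De : forall i, derivation (e i).
Variables (h G Q : 'M[A]_d) (Ga : 'I_d -> 'M[A]_d).
Hypotheses (hG : h *m G = 1%:M) (Gh : G *m h = 1%:M) (symG : G^T = G).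
Hypothesis compat : forall i, map_mx (e i) h = Ga i *m h + h *m (Ga i)^T.
Hypothesis torsionfree : forall i j k, Ga i j k = Ga j i k.
Hypothesis Q0 : map_mx ev Q = 1%:M.
Hypothesis Q1 : forall i, map_mx ev (map_mx (e i) Q) = map_mx ev (Ga i).
Hypothesis Q2 : forall i j, map_mx ev (map_mx (e i) (map_mx (e j) Q)) = 0.

Let F := Q^T *m G *m Q.
(** The curvature endomorphism of the connection [Ga], with row and column of [Ga i] the lower and
    the upper index. The products are in reverse order because matrices act on rows. *)
Let Rm i j := map_mx (e i) (Ga j) - map_mx (e j) (Ga i) + (Ga j *m Ga i - Ga i *m Ga j).

Lemma deriv_inverse_metric j : map_mx (e j) G = - (G *m Ga j) - (Ga j)^T *m G.
Proof.
have E : G *m map_mx (e j) (h *m G) = 0 by rewrite hG (deriv_mx1 (De j)) mulmx0.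
move: E; rewrite (deriv_mulmx (De j)) compat mulmxDr mulmxDl mulmxDr.
rewrite -!mulmxA hG mulmx1 (mulmxA G h ((Ga j)^T *m G)) Gh mul1mx (mulmxA G h) Gh mul1mx.
by move=> /eqP; rewrite addrC addr_eq0 opprD => /eqP.
Qed.

Let g := map_mx ev G.
Let ga i := map_mx ev (Ga i).
(** The link between curvature and inverse metric: [Rm i j] evaluates to the antisymmetrisation of
    [T] in [i] and [j], while the second derivatives of [F] are the symmetric matrices built from
    [g *m T i j]. *)
Let T i j := map_mx ev (map_mx (e i) (Ga j)) + ga j *m ga i.

Let DT k (M : 'M[A]_d) : map_mx (e k) M^T = (map_mx (e k) M)^T.
Proof. by rewrite map_trmx. Qed.
Let ET (M : 'M[A]_d) : map_mx ev M^T = (map_mx ev M)^T.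
Proof. by rewrite map_trmx. Qed.
Let EB (M N : 'M[A]_d) : map_mx ev (M - N) = map_mx ev M - map_mx ev N.
Proof. by rewrite map_mxB. Qed.

Lemma normal_first j : map_mx ev (map_mx (e j) F) = 0.
Proof.
rewrite /F !(deriv_mulmx (De j)) DT !map_mxD !map_mxM map_mxD !map_mxM !ET Q0 Q1.
rewrite deriv_inverse_metric EB map_mxN !map_mxM ET -/g -/(ga j) trmx1 !mulmx1 !mul1mx.
apply/matrixP => a b; set X := (ga j)^T *m g; set Y := g *m ga j.
by rewrite !mxE; ring.
Qed.

Lemma normal_second i j : map_mx ev (map_mx (e i) (map_mx (e j) F)) =
  - (g *m T i j) - (T i j)^T *m g.
Proof.
have rules := (deriv_mxD (De i), deriv_mxN (De i), deriv_mulmx (De i), DT i).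
rewrite /F !(deriv_mulmx (De j)) DT deriv_inverse_metric !rules deriv_inverse_metric.
rewrite !(map_mxD, map_mxN, map_mxM, ET) !Q2 !Q0 !Q1 -/g -!/(ga _).
rewrite !(trmx1, mulmx1, mul1mx, trmx0, mul0mx, mulmx0, addr0, add0r).
have -> : (T i j)^T = (map_mx ev (map_mx (e i) (Ga j)))^T + (ga i)^T *m (ga j)^T.
  by rewrite /T linearD /= trmx_mul.
rewrite /T !(mulmxDr, mulmxDl, mulmxN, mulNmx, opprD, opprK) -!mulmxA.
by apply/matrixP => a b; rewrite !mxE; ring.
Qed.

(** Two contractions of [T] make up the scalar curvature. One is visible in the divergence term of
    [F]; the other is a trace of [T], which the second term produces twice and the divergence term
    removes once. *)
Lemma normal_scalar_curvature (hR := map_mx ev h) :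
  \sum_i \sum_j (g *m map_mx ev (Rm i j)) j i =
  - (\sum_i \sum_j (map_mx ev (map_mx (e i) (map_mx (e j) F))) i j
     - \sum_i \sum_j g i j * \sum_k \sum_l hR k l * (map_mx ev (map_mx (e i) (map_mx (e j) F))) k l).
Proof.
have symT i j k l : T i j k l = T i k j l.
  rewrite /T !mxE; congr (_ + _); first by rewrite torsionfree.
  by apply: eq_bigr => p _; rewrite !mxE torsionfree.
have symg : g^T = g by rewrite /g map_trmx symG.
have hRg : hR *m g = 1%:M by rewrite -map_mxM hG map_mx1.
have trace i j : \sum_k \sum_l hR k l * (- (g *m T i j) - (T i j)^T *m g) k l = - (\tr (T i j) *+ 2).
  have -> : \sum_k \sum_l hR k l * (- (g *m T i j) - (T i j)^T *m g) k l =
     \tr (hR *m (- (g *m T i j) - (T i j)^T *m g)^T).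
    by rewrite /mxtrace; apply: eq_bigr => k _; rewrite !mxE; apply: eq_bigr => l _; rewrite !mxE.
  have -> : (- (g *m T i j) - (T i j)^T *m g)^T = - ((T i j)^T *m g) - g *m T i j.
    by rewrite linearB linearN /= !trmx_mul trmxK symg.
  have gh : g *m hR = 1%:M by rewrite -map_mxM Gh map_mx1.
  rewrite mulmxBr mulmxN (mulmxA hR g) hRg mul1mx linearB linearN /= mxtrace_mulC -mulmxA gh.
  by rewrite mulmx1 mxtrace_tr mulr2n opprD.
have RT i j : map_mx ev (Rm i j) = T i j - T j i.
  rewrite /Rm /T !(map_mxD, map_mxN, map_mxM) -!/(ga _).
  by apply/matrixP => a b; rewrite !mxE; ring.
have BE (M N : 'M[R]_d) i j : (M - N) i j = M i j - N i j by rewrite !mxE.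
have NE (M : 'M[R]_d) i j : (- M) i j = - M i j by rewrite !mxE.
under eq_bigr => i _ do under eq_bigr => j _ do rewrite RT mulmxBr BE.
under [in RHS]eq_bigr => i _ do under eq_bigr => j _ do
  rewrite normal_second BE NE.
under [X in _ - X]eq_bigr => i _ do under eq_bigr => j _ do rewrite normal_second trace.
(* Torsion-freeness makes [T i] symmetric in its next two indices, so the two contractions with [g]
   agree. *)
have key : \sum_i \sum_j (g *m T i j) i j = \sum_i \sum_j g i j * \tr (T i j).
  apply: eq_bigr => i _; under eq_bigr => j _ do rewrite mxE.
  rewrite exchange_big /=; apply: eq_bigr => k _; rewrite mulr_sumr.
  by apply: eq_bigr => j _; rewrite symT.
have tr2 : \sum_i \sum_j ((T i j)^T *m g) i j = \sum_i \sum_j (g *m T i j) j i.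
  apply: eq_bigr => i _; apply: eq_bigr => j _.
  by rewrite -[in LHS]symg -trmx_mul mxE.
have swap : \sum_i \sum_j (g *m T j i) j i = \sum_i \sum_j (g *m T i j) i j.
  by rewrite exchange_big.
have dbl : \sum_i \sum_j g i j * - (\tr (T i j) *+ 2) = - ((\sum_i \sum_j g i j * \tr (T i j)) *+ 2).
  rewrite -sumrMnl -sumrN; apply: eq_bigr => i _; rewrite -sumrMnl -sumrN.
  by apply: eq_bigr => j _; rewrite mulrN mulrnAr.
rewrite dbl -key.
under eq_bigr => i _ do rewrite sumrB.
rewrite sumrB swap.
under [X in - (X - _)]eq_bigr => i _ do rewrite sumrB sumrN.
rewrite sumrB sumrN tr2.
move: (\sum_i \sum_j (g *m T i j) j i) (\sum_i \sum_j (g *m T i j) i j) => X Y.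
by rewrite mulr2n; ring.
Qed.

End NormalCoordinates.

(** * Contractions in an orthonormal frame *)

Section TripleSums.
Context {R : comPzRingType} {d : nat}.
Implicit Types f g : 'I_d -> 'I_d -> 'I_d -> R.

Definition sum3 (f : 'I_d -> 'I_d -> 'I_d -> R) : R := \sum_b \sum_i \sum_a f b i a.

Lemma sum3_cyc f : sum3 (fun b i a => f i a b) = sum3 f.
Proof.
rewrite /sum3 exchange_big /=; apply: eq_bigr => i _.
by rewrite exchange_big.
Qed.

Lemma eq_sum3 f g : (forall b i a, f b i a = g b i a) -> sum3 f = sum3 g.
Proof. by move=> H; do 3 (apply: eq_bigr => ? _); exact: H. Qed.

Lemma sum3D f g : sum3 (fun b i a => f b i a + g b i a) = sum3 f + sum3 g.
Proof.
rewrite /sum3 -big_split; apply: eq_bigr => b _ /=; rewrite -big_split.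
by apply: eq_bigr => i _ /=; rewrite -big_split.
Qed.

Lemma sum3Z c f : sum3 (fun b i a => c * f b i a) = c * sum3 f.
Proof.
rewrite /sum3 mulr_sumr; apply: eq_bigr => b _; rewrite mulr_sumr.
by apply: eq_bigr => i _; rewrite mulr_sumr.
Qed.

Lemma sum_delta (F : 'I_d -> R) j : \sum_i F i * (i == j)%:R = F j.
Proof.
rewrite (bigD1 j) //= eqxx mulr1 big1 ?addr0 // => i /negbTE ->.
by rewrite mulr0.
Qed.

Lemma sum_deltaC (F : 'I_d -> R) j : \sum_i F i * (j == i)%:R = F j.
Proof. by rewrite -[RHS]sum_delta; apply: eq_bigr => i _; rewrite eq_sym. Qed.

End TripleSums.

Section Contractions.
Context {R : realFieldType} {d : nat}.
Variables (Om : 'I_d -> 'I_d -> R) (z u : 'I_d -> R).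
Hypothesis asym : forall i j, Om i j = - Om j i.
Hypothesis sq : forall i j, \sum_k Om i k * Om j k = 4 * (i == j)%:R.
Hypothesis zOm : forall j, \sum_i z i * Om i j = - u j.

Definition norm2 := \sum_i u i ^+ 2.
Local Notation n2 := norm2.

Lemma Omz i : \sum_j Om i j * z j = u i.
Proof.
rewrite -[RHS]opprK -zOm -sumrN; apply: eq_bigr => j _.
by rewrite asym mulNr mulrC.
Qed.

(** Half of [Om] is an isometry by [sq], and [Om] takes [z] to [u]. *)
Lemma norm2_z : 4 * \sum_i z i ^+ 2 = n2.
Proof.
have E i : u i ^+ 2 = \sum_j \sum_k Om i j * z j * (Om i k * z k).
  by rewrite -Omz expr2 mulr_suml; apply: eq_bigr => j _; rewrite mulr_sumr.
rewrite /n2; under [RHS]eq_bigr => i _ do rewrite E.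
rewrite exchange_big /=.
under [RHS]eq_bigr => j _ do rewrite exchange_big /=.
have E2 j k : \sum_i Om i j * z j * (Om i k * z k) = 4 * (z j * z k * (j == k)%:R).
  rewrite mulrCA -sq mulr_sumr; apply: eq_bigr => i _.
  by rewrite (asym i j) (asym i k); ring.
under [RHS]eq_bigr => j _ do under eq_bigr => k _ do rewrite E2.
rewrite mulr_sumr; apply: eq_bigr => j _; rewrite -mulr_sumr.
by rewrite sum_deltaC expr2.
Qed.

Let al (b i a : 'I_d) : R := u b * (i == a)%:R.
Let be (b i a : 'I_d) : R := u i * (a == b)%:R.
Let ga (b i a : 'I_d) : R := u a * (b == i)%:R.
Let q (b i a : 'I_d) : R := Om i a * z b.
Let r (b i a : 'I_d) : R := Om a b * z i.
Let p (b i a : 'I_d) : R := Om b i * z a.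

Local Notation S f g := (sum3 (fun b i a => f b i a * g b i a)).

(** The six tensors form two orbits, [al], [be], [ga] and [q], [r], [p], under cyclic permutation of
    the indices. Seven of their 21 pairings are computed; the others follow by rotation. *)
Let cyc (f f' g g' : 'I_d -> 'I_d -> 'I_d -> R) :
  (forall b i a, f i a b = f' b i a) -> (forall b i a, g i a b = g' b i a) ->
  S f' g' = S f g.
Proof.
move=> F G; rewrite -[RHS]sum3_cyc; apply: eq_sum3 => b i a.
by rewrite F G.
Qed.

Let alal : S al al = d%:R * n2.
Proof.
rewrite /sum3 /al /n2 mulr_sumr; apply: eq_bigr => b _.
have E (i a : 'I_d) : u b * (i == a)%:R * (u b * (i == a)%:R) = u b ^+ 2 * (i == a)%:R :> R.
  by case: (i == a); rewrite ?mulr1 ?mulr0 ?expr2.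
under eq_bigr => i _ do under eq_bigr => a _ do rewrite E.
under eq_bigr => i _ do rewrite sum_deltaC.
by rewrite sumr_const card_ord mulr_natl.
Qed.

Let albe : S al be = n2.
Proof.
rewrite /sum3 /n2; apply: eq_bigr => b _.
rewrite exchange_big /=.
have E (i a : 'I_d) : al b i a * be b i a = (u b * u i * (a == b)%:R) * (i == a)%:R.
  by rewrite /al /be; ring.
under eq_bigr => a _ do under eq_bigr => i _ do rewrite E.
under eq_bigr => a _ do rewrite sum_delta.
by rewrite sum_delta expr2.
Qed.

Let qq : S q q = d%:R * n2.
Proof.
rewrite /sum3 /q -norm2_z mulrA mulr_sumr; apply: eq_bigr => b _.
have E i : \sum_a Om i a * z b * (Om i a * z b) = z b ^+ 2 * 4.
  have <- : \sum_a Om i a * Om i a = 4 by rewrite sq eqxx mulr1.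
  rewrite mulr_sumr; by apply: eq_bigr => a _; ring.
by under eq_bigr => i _ do rewrite E; rewrite sumr_const card_ord -mulr_natr; ring.
Qed.

Let O0 i : Om i i = 0.
Proof. by have := asym i i; lra. Qed.

Let alq : S al q = 0.
Proof.
rewrite /sum3 big1 // => b _; rewrite big1 // => i _.
have E a : al b i a * q b i a = (u b * Om i a * z b) * (i == a)%:R by rewrite /al /q; ring.
by under eq_bigr => a _ do rewrite E; rewrite sum_deltaC O0 mulr0 mul0r.
Qed.

Let alr : S al r = - n2.
Proof.
rewrite /sum3 /n2 -sumrN; apply: eq_bigr => b _.
have E i a : al b i a * r b i a = (u b * (z i * Om a b)) * (i == a)%:R by rewrite /al /r; ring.
under eq_bigr => i _ do under eq_bigr => a _ do rewrite E.
under eq_bigr => i _ do rewrite sum_deltaC.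
by rewrite -mulr_sumr zOm expr2 mulrN.
Qed.

Let alp : S al p = n2.
Proof.
rewrite /sum3 /n2; apply: eq_bigr => b _.
have E i a : al b i a * p b i a = (u b * (Om b i * z a)) * (i == a)%:R by rewrite /al /p; ring.
under eq_bigr => i _ do under eq_bigr => a _ do rewrite E.
under eq_bigr => i _ do rewrite sum_deltaC.
by rewrite -mulr_sumr Omz expr2.
Qed.

Let pq : S p q = - n2.
Proof.
have E3 : S p q = \sum_i \sum_a (\sum_b (z b * Om b i)) * (Om i a * z a).
  rewrite /sum3 exchange_big /=; apply: eq_bigr => i _; rewrite exchange_big /=.
  apply: eq_bigr => a _; rewrite mulr_suml; apply: eq_bigr => b _.
  by rewrite /p /q; ring.
rewrite E3 /n2 -sumrN; apply: eq_bigr => i _.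
by rewrite -mulr_sumr zOm Omz mulNr expr2.
Qed.

Let bebe : S be be = d%:R * n2. Proof. by rewrite -alal; exact: cyc. Qed.
Let gaga : S ga ga = d%:R * n2. Proof. by rewrite -bebe; exact: cyc. Qed.
Let bega : S be ga = n2. Proof. by rewrite -albe; exact: cyc. Qed.
Let gaal : S ga al = n2. Proof. by rewrite -bega; exact: cyc. Qed.
Let rr : S r r = d%:R * n2. Proof. by rewrite -qq; exact: cyc. Qed.
Let pp : S p p = d%:R * n2. Proof. by rewrite -rr; exact: cyc. Qed.
Let qr : S q r = - n2. Proof. by rewrite -pq; exact: cyc. Qed.
Let rp : S r p = - n2. Proof. by rewrite -qr; exact: cyc. Qed.
Let ber : S be r = 0. Proof. by rewrite -alq; exact: cyc. Qed.
Let gap : S ga p = 0. Proof. by rewrite -ber; exact: cyc. Qed.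
Let bep : S be p = - n2. Proof. by rewrite -alr; exact: cyc. Qed.
Let gaq : S ga q = - n2. Proof. by rewrite -bep; exact: cyc. Qed.
Let beq : S be q = n2. Proof. by rewrite -alp; exact: cyc. Qed.
Let gar : S ga r = n2. Proof. by rewrite -beq; exact: cyc. Qed.

(** Twice the second frame derivatives of the new coordinates. It is the Koszul formula of a
    connection with torsion [Om i j * z a] for which the metric is parallel up to the conformal
    weight [u]. *)
Definition Koszul (b i a : 'I_d) : R := p b i a - q b i a + r b i a
  - al b i a - be b i a + ga b i a.

Let split2 := (alal, albe, bebe, gaga, bega, gaal, qq, rr, pp, qr, rp, pq, alq, ber, gap,
  alr, bep, gaq, alp, beq, gar).

(** Flip, square, twist and trace are the contractions of these second derivatives that enter the
    scalar curvature; each reduces to a multiple of the squared norm of [u], or to [u] itself for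
    the trace. *)
Lemma Koszul_flip : sum3 (fun b i a => Koszul b i a * Koszul a i b) = 4 * n2.
Proof.
have E b i a : Koszul b i a * Koszul a i b =
  be b i a * be b i a + (p b i a * p b i a + (q b i a * q b i a + ((-2) * (be b i a * p b i a)
  + (2 * (be b i a * q b i a) + ((-2) * (p b i a * q b i a)
  + ((-1) * (al b i a * al b i a) + ((-1) * (ga b i a * ga b i a) + ((-1) * (r b i a * r b i a)
  + (2 * (ga b i a * al b i a) + (2 * (al b i a * r b i a) + (-2) * (ga b i a * r b i a))))))))))).
  rewrite /Koszul /al /be /ga /p /q /r (asym i b) (asym b a) (asym a i).
  by rewrite (eq_sym b i) (eq_sym b a) (eq_sym i a); ring.
by rewrite (eq_sum3 E) !(sum3D, sum3Z) !split2; ring.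
Qed.

Lemma Koszul_square : sum3 (fun b i a => Koszul a i b * Koszul a i b) = (6 * d%:R + 8) * n2.
Proof.
have E b i a : Koszul a i b * Koszul a i b =
  be b i a * be b i a + (p b i a * p b i a + (q b i a * q b i a + ((-2) * (be b i a * p b i a)
  + (2 * (be b i a * q b i a) + ((-2) * (p b i a * q b i a)
  + ((al b i a * al b i a) + ((ga b i a * ga b i a) + ((r b i a * r b i a)
  + ((-2) * (ga b i a * al b i a) + ((-2) * (al b i a * r b i a) + (2 * (ga b i a * r b i a)
  + ((-2) * (al b i a * be b i a) + (2 * (be b i a * ga b i a) + (2 * (be b i a * r b i a)
  + (2 * (al b i a * p b i a) + ((-2) * (ga b i a * p b i a) + ((-2) * (r b i a * p b i a)
  + ((-2) * (al b i a * q b i a) + (2 * (ga b i a * q b i a)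
  + 2 * (q b i a * r b i a)))))))))))))))))))).
  rewrite /Koszul /al /be /ga /p /q /r (asym i b) (asym b a) (asym a i).
  by rewrite (eq_sym b i) (eq_sym b a) (eq_sym i a); ring.
by rewrite (eq_sum3 E) !(sum3D, sum3Z) !split2; ring.
Qed.

Lemma Koszul_twist : sum3 (fun b i a => Om a b * z i * Koszul b i a) = (d%:R + 2) * n2.
Proof.
have E b i a : Om a b * z i * Koszul b i a =
  r b i a * p b i a + ((-1) * (q b i a * r b i a) + (r b i a * r b i a
  + ((-1) * (al b i a * r b i a) + ((-1) * (be b i a * r b i a) + ga b i a * r b i a)))).
  by rewrite /Koszul -/(r b i a); ring.
by rewrite (eq_sum3 E) !(sum3D, sum3Z) !split2; ring.
Qed.

Lemma Koszul_trace i : \sum_a Koszul a i a = - (d%:R + 2) * u i.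
Proof.
have E a : Koszul a i a = (u a * (a == i)%:R) - (u a * (i == a)%:R) - u i
   - 2 * (Om i a * z a).
  by rewrite /Koszul /al /be /ga /p /q /r (asym a i) O0 eqxx /=; ring.
under eq_bigr => a _ do rewrite E.
rewrite !sumrB -mulr_sumr sum_delta sum_deltaC Omz sumr_const card_ord -mulr_natl.
ring.
Qed.

(** As for the Levi-Civita connection, the symmetric part in the last two indices and the
    antisymmetric part in the first two determine [K]: an alternating sum over the cyclic
    permutations isolates it. *)
Lemma Koszul_unique (K : 'I_d -> 'I_d -> 'I_d -> R) :
  (forall c a b, K c b a + K c a b = - (u c * (a == b)%:R)) ->
  (forall i j a, K i j a - K j i a = Om i j * z a) ->
  forall i j a, 2 * K i j a = Koszul i j a.
Proof.
move=> skew tor i j a.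
have := (tor i j a, tor j a i, tor a i j, skew j a i, skew a i j, skew i j a).
rewrite /Koszul /al /be /ga /p /q /r => -[[[[[]]]]].
by lra.
Qed.

End Contractions.

(* [u] is the logarithmic derivative of the conformal factor [f] and [f (X + z^i e_i)] is the new
   Reeb field.  The coordinate functions [phi] of the new quotient are annihilated by it, and [F]
   is the new inverse metric in these coordinates. *)
Section ConformalChange.
Context {R : realFieldType} {A : comPzRingType}.
Variables (ev : {rmorphism A -> R}) (d : nat) (e : 'I_d -> A -> A) (X : A -> A).
Hypothesis De : forall i, derivation (e i).
Variables (f g : A) (u z : 'I_d -> A) (Om G H : 'M[A]_d) (phi : 'I_d -> A).
Hypotheses (fg : f * g = 1) (uE : forall i, u i = g * e i f).
Hypothesis comm : forall i j x, e i (e j x) - e j (e i x) = - (Om i j * X x).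
Hypothesis commX : forall i x, X (e i x) = e i (X x).
Hypothesis Xphi : forall a, X (phi a) = - \sum_i z i * e i (phi a).
Hypothesis zOmA : forall j, \sum_i z i * Om i j = - u j.
Hypothesis asymA : forall i j, Om i j = - Om j i.
Hypothesis closed : forall a b c, e a (Om b c) + e b (Om c a) + e c (Om a b) = 0.
Hypotheses (GH : G *m H = 1%:M) (OmG : Om *m G *m Om^T = 4%:R *: H).
Hypothesis G0 : map_mx ev G = 1%:M.
Hypothesis G1 : forall k, map_mx ev (map_mx (e k) G) = 0.
Let Phi : 'M[A]_d := \matrix_(i, a) e i (phi a).
Let F := f *: (Phi^T *m G *m Phi).
Hypothesis Phi0 : map_mx ev Phi = 1%:M.
Hypothesis F1 : forall k, map_mx ev (map_mx (e k) F) = 0.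

Let f0 := ev f.
Let U i := ev (u i).
Let Z i := ev (z i).
Let om i j := ev (Om i j).
Let U2 c b := ev (e c (u b)).
Let K c : 'M[R]_d := map_mx ev (map_mx (e c) Phi).
Let T c b : 'M[R]_d := map_mx ev (map_mx (e c) (map_mx (e b) Phi)).
Let G2 c b : 'M[R]_d := map_mx ev (map_mx (e c) (map_mx (e b) G)).

Let f_neq0 : f0 != 0.
Proof.
have : f0 * ev g = 1 by rewrite -rmorphM fg rmorph1.
by move=> E; apply: contraTneq isT => f00; move: E; rewrite f00 mul0r => /esym/eqP; rewrite oner_eq0.
Qed.

Let ef i : e i f = f * u i.
Proof. by rewrite uE mulrA fg mul1r. Qed.

Let DT k (M : 'M[A]_d) : map_mx (e k) M^T = (map_mx (e k) M)^T.
Proof. by rewrite map_trmx. Qed.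
Let ET (M : 'M[A]_d) : map_mx ev M^T = (map_mx ev M)^T.
Proof. by rewrite map_trmx. Qed.
Let EZ c (M : 'M[A]_d) : map_mx ev (c *: M) = ev c *: map_mx ev M.
Proof. by rewrite map_mxZ. Qed.
Let DZ k c (M : 'M[A]_d) : map_mx (e k) (c *: M) = e k c *: M + c *: map_mx (e k) M.
Proof. by apply/matrixP => i j; rewrite !mxE (derivM (De k)). Qed.

(** The first derivatives of both [F] and [G] vanish at the point, so in the product rule for [F]
    the derivative of the conformal factor must be cancelled by the symmetric part of [K]. *)
Let skewK c : K c + (K c)^T = - (U c *: 1%:M).
Proof.
have := F1 c; rewrite /F DZ map_mxD !EZ !(deriv_mulmx (De c)) DT !(map_mxD, map_mxM, ET).
rewrite G1 Phi0 G0 trmx1 !(mulmx1, mul1mx, mulmx0, addr0) -/(K c) ef rmorphM -/(U c) -/f0.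
rewrite -scalerA -scalerDr => /eqP; rewrite scaler_eq0 (negbTE f_neq0) /= addrC addr_eq0.
by rewrite addrC => /eqP.
Qed.

Let skew c a b : K c b a + K c a b = - (U c * (a == b)%:R).
Proof.
by have := congr1 (fun M : 'M[R]_d => M b a) (skewK c); rewrite !mxE eq_sym.
Qed.

Let Y a := \sum_i z i * Phi i a.

Let XphiY a : X (phi a) = - Y a.
Proof. by rewrite Xphi /Y; congr (- _); apply: eq_bigr => i _; rewrite mxE. Qed.

Let Y0 a : ev (Y a) = Z a.
Proof.
rewrite /Y rmorph_sum -[RHS]sum_delta; apply: eq_bigr => i _; rewrite rmorphM.
by congr (_ * _); have := congr1 (fun M : 'M[R]_d => M i a) Phi0; rewrite !mxE.
Qed.

(** Commuting [e i] and [e j] costs a derivative along [X], and on the new coordinates [X] acts as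
    minus the horizontal shift, since the new Reeb field annihilates them. *)
Let torsion i j a : K i j a - K j i a = om i j * Z a.
Proof.
rewrite !mxE -rmorphB comm XphiY mulrN opprK rmorphM Y0.
by [].
Qed.

Let omasym i j : om i j = - om j i.
Proof. by rewrite /om asymA rmorphN. Qed.
Let omz j : \sum_i Z i * om i j = - U j.
Proof. by rewrite /U -rmorphN -zOmA rmorph_sum; apply: eq_bigr => i _; rewrite rmorphM. Qed.

Let H0 : map_mx ev H = 1%:M.
Proof. by have := congr1 (map_mx ev) GH; rewrite map_mxM G0 mul1mx map_mx1. Qed.
Let H1 k : map_mx ev (map_mx (e k) H) = 0.
Proof.
have := congr1 (fun M => map_mx ev (map_mx (e k) M)) GH.
rewrite (deriv_mulmx (De k)) map_mxD !map_mxM G0 G1 mul0mx add0r mul1mx => ->.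
by rewrite (deriv_mx1 (De k)) map_mx0.
Qed.

Let omM := map_mx ev Om.
Let N k : 'M[R]_d := map_mx ev (map_mx (e k) Om).

Let omsqM : omM *m omM^T = 4%:R *: 1%:M.
Proof.
have := congr1 (map_mx ev) OmG; rewrite !map_mxM ET G0 mulmx1 EZ H0 rmorph_nat.
by [].
Qed.

Let omsq i j : \sum_k om i k * om j k = 4 * (i == j)%:R.
Proof.
have := congr1 (fun M : 'M[R]_d => M i j) omsqM; rewrite !mxE => <-.
by apply: eq_bigr => k _; rewrite !mxE.
Qed.

Let NomM k : N k *m omM^T + omM *m (N k)^T = 0.
Proof.
have := congr1 (fun M => map_mx ev (map_mx (e k) M)) OmG.
rewrite !(deriv_mulmx (De k)) DT map_mxD !map_mxM map_mxD !map_mxM !ET G0 G1 mulmx0 addr0 !mulmx1.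
rewrite DZ (deriv_nat (De k)) scale0r add0r EZ H1 scaler0.
by [].
Qed.

Let Nom k i j : \sum_l N k i l * om j l + \sum_l om i l * N k j l = 0.
Proof.
have := congr1 (fun M : 'M[R]_d => M i j) (NomM k); rewrite !mxE => E; rewrite -[RHS]E.
by congr (_ + _); apply: eq_bigr => l _; rewrite !mxE.
Qed.

Let Nasym k i j : N k i j = - N k j i.
Proof. by rewrite !mxE asymA (derivN (De k)) rmorphN. Qed.

Let Nclosed a b c : N a b c + N b c a + N c a b = 0.
Proof. by rewrite !mxE -!rmorphD closed rmorph0. Qed.

(** A closed form compatible with the metric is coclosed, as for the symplectic form of an almost
    Kaehler metric. At the point the first derivatives of the metric vanish, so this is linear
    algebra in the derivatives [N]. *)
Let divOm a : \sum_b N b a b = 0.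
Proof.
pose D c := \sum_b N b b c.
have trN k : \sum_b \sum_c om b c * N k b c = 0.
  have : \sum_b (\sum_l N k b l * om b l + \sum_l om b l * N k b l) = 0.
    by apply: big1 => b _; exact: Nom.
  rewrite big_split /= => E.
  have E2 : \sum_b \sum_l N k b l * om b l = \sum_b \sum_l om b l * N k b l.
    by apply: eq_bigr => b _; apply: eq_bigr => l _; exact: mulrC.
  by move: E; rewrite E2; lra.
(* Closedness contracted with [om]: the trace term drops by [trN], and the two remaining terms agree
   by antisymmetry. *)
have key x : \sum_b \sum_c om b c * N b c x = 0.
  have E : \sum_b \sum_c om b c * (N x b c + N b c x + N c x b) = 0.
    by apply: big1 => b _; apply: big1 => c _; rewrite Nclosed mulr0.
  have E3 : \sum_b \sum_c om b c * N c x b = \sum_b \sum_c om b c * N b c x.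
    rewrite exchange_big /=; apply: eq_bigr => b _; apply: eq_bigr => c _.
    by rewrite omasym (Nasym b x c); ring.
  have : \sum_b \sum_c om b c * (N x b c + N b c x + N c x b) =
     \sum_b \sum_c om b c * N x b c + \sum_b \sum_c om b c * N b c x + \sum_b \sum_c om b c * N c x b.
    rewrite -!big_split; apply: eq_bigr => b _ /=; rewrite -!big_split; apply: eq_bigr => c _ /=.
    by ring.
  by rewrite E trN E3; lra.
(* Tracing the differentiated compatibility leaves [om] applied to the divergence [D], and [om] is
   invertible. *)
have omD x : \sum_c om x c * D c = 0.
  have : \sum_b (\sum_l N b x l * om b l + \sum_l om x l * N b b l) = 0.
    by apply: big1 => b _; exact: Nom.
  rewrite big_split /= => E.
  have E1 : \sum_b \sum_l N b x l * om b l = - (\sum_b \sum_c om b c * N b c x).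
    rewrite -sumrN; apply: eq_bigr => b _; rewrite -sumrN; apply: eq_bigr => c _.
    by rewrite (Nasym b x c); ring.
  have E2 : \sum_b \sum_l om x l * N b b l = \sum_c om x c * D c.
    by rewrite exchange_big /=; apply: eq_bigr => c _; rewrite /D mulr_sumr.
  by move: E; rewrite E1 E2 key; lra.
have D0 c : D c = 0.
  have E : \sum_x om x c * (\sum_l om x l * D l) = 4 * D c.
    rewrite -[D c]sum_deltaC mulr_sumr.
    under eq_bigr => x _ do rewrite mulr_sumr.
    rewrite exchange_big /=; apply: eq_bigr => l _.
    rewrite mulrCA -omsq mulr_sumr; apply: eq_bigr => x _.
    by rewrite (omasym c x) (omasym l x); ring.
  have : \sum_x om x c * (\sum_l om x l * D l) = 0 by apply: big1 => x _; rewrite omD mulr0.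
  by rewrite E; lra.
transitivity (- D a); last by rewrite D0 oppr0.
by rewrite /D -sumrN; apply: eq_bigr => b _; rewrite Nasym.
Qed.

Let E0 := \sum_i U2 i i.

(** The derivative of the relation between [z] and [u]; the term in which [Om] is differentiated is
    its divergence and vanishes by [divOm]. *)
Let twist_dz : \sum_a \sum_b om a b * ev (e b (z a)) = - E0.
Proof.
have E b : \sum_a ev (e b (z a)) * om a b + \sum_a Z a * N b a b = - U2 b b.
  rewrite /U2 -rmorphN -(derivN (De b)) -zOmA (deriv_sum (De b)) rmorph_sum -big_split /=.
  by apply: eq_bigr => a _; rewrite (derivM (De b)) rmorphD !rmorphM !mxE.
have : \sum_b (\sum_a ev (e b (z a)) * om a b + \sum_a Z a * N b a b) = \sum_b - U2 b b.
  by apply: eq_bigr => b _; exact: E.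
rewrite big_split /= [X in _ + X = _ -> _]exchange_big /=.
have -> : \sum_a \sum_b Z a * N b a b = 0.
  by apply: big1 => a _; rewrite -mulr_sumr divOm mulr0.
rewrite addr0 exchange_big /= sumrN -/E0 => <-.
by apply: eq_bigr => a _; apply: eq_bigr => b _; exact: mulrC.
Qed.

Let K2 i j a : K i j a = 2^-1 * Koszul om Z U i j a.
Proof. by have := Koszul_unique skew torsion i j a; lra. Qed.

Let twist_K : \sum_a \sum_b om a b * (\sum_i Z i * K b i a) = (d%:R + 2) / 2 * norm2 U.
Proof.
transitivity (2^-1 * sum3 (fun b i a => om a b * Z i * Koszul om Z U b i a)).
  rewrite exchange_big /= /sum3 mulr_sumr; apply: eq_bigr => b _.
  rewrite mulr_sumr.
  under eq_bigr => a _ do rewrite mulr_sumr.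
  rewrite exchange_big /=; apply: eq_bigr => i _; rewrite mulr_sumr.
  by apply: eq_bigr => a _; rewrite K2; ring.
by rewrite (Koszul_twist omasym omsq omz); ring.
Qed.

Let evY b a : ev (e b (Y a)) = ev (e b (z a)) + \sum_i Z i * K b i a.
Proof.
rewrite /Y (deriv_sum (De b)) rmorph_sum -[X in X + _](sum_delta (fun i => ev (e b (z i))) a) -big_split /=.
apply: eq_bigr => i _; rewrite (derivM (De b)) rmorphD !rmorphM; congr (_ * _ + _).
  by have := congr1 (fun M : 'M[R]_d => M i a) Phi0; rewrite !mxE.
by rewrite !mxE.
Qed.

Let w a b := om a b * ev (e b (Y a)).

Let sum_w : \sum_a \sum_b w a b = - E0 + (d%:R + 2) / 2 * norm2 U.
Proof.
rewrite -twist_dz -twist_K -big_split /=; apply: eq_bigr => a _.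
by rewrite -big_split /=; apply: eq_bigr => b _; rewrite /w evY mulrDr.
Qed.

Let TE c b i a : T c b i a = ev (e c (e b (e i (phi a)))).
Proof. by rewrite !mxE. Qed.

Let swap_inner a b : T b a b a - T b b a a = N b a b * Z a + w a b.
Proof.
rewrite !TE -rmorphB -(derivB (De b)) comm XphiY mulrN opprK (derivM (De b)) rmorphD !rmorphM Y0.
by rewrite !mxE.
Qed.

Let swap_outer a b : T a b b a - T b a b a = w a b.
Proof.
by rewrite !TE -rmorphB comm commX XphiY (derivN (De b)) mulrN opprK rmorphM.
Qed.

(** Third derivatives of the new coordinates are not determined by the given data, but the curvature
    contains only this combination, in which reordering leaves nothing except commutators, that is,
    three times the sum of [w]. *)
Let third : \sum_a \sum_b T a b b a + \sum_a \sum_b T a b a b - 2 * (\sum_a \sum_b T a a b b) =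
  - 3 * E0 + 3 * (d%:R + 2) / 2 * norm2 U.
Proof.
have A1 : \sum_a \sum_b T a b a b = \sum_a \sum_b T b a b a by rewrite exchange_big.
have A2 : \sum_a \sum_b T a a b b = \sum_a \sum_b T b b a a by rewrite exchange_big.
have B1 : \sum_a \sum_b T a b b a = \sum_a \sum_b T b a b a + \sum_a \sum_b w a b.
  rewrite -big_split; apply: eq_bigr => a _ /=; rewrite -big_split; apply: eq_bigr => b _ /=.
  by rewrite -(swap_outer a b) addrC subrK.
have B2 : \sum_a \sum_b T b a b a = \sum_a \sum_b T b b a a + \sum_a \sum_b w a b.
  have Z0 : \sum_a \sum_b N b a b * Z a = 0.
    by apply: big1 => a _; rewrite -mulr_suml divOm mul0r.
  have <- : \sum_a \sum_b (N b a b * Z a + w a b) = \sum_a \sum_b w a b.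
    transitivity (\sum_a \sum_b N b a b * Z a + \sum_a \sum_b w a b); last by rewrite Z0 add0r.
    by rewrite -big_split; apply: eq_bigr => a _ /=; rewrite -big_split.
  rewrite -big_split; apply: eq_bigr => a _ /=.
  rewrite -big_split; apply: eq_bigr => b _ /=.
  by rewrite -(swap_inner a b) addrC subrK.
rewrite A1 A2 B1 B2 sum_w.
by move: (\sum_a \sum_b T b b a a) => t; ring.
Qed.

Lemma derive2_inverse_metric c b : map_mx ev (map_mx (e c) (map_mx (e b) F)) =
  f0 *: ((U2 c b - U c * U b) *: 1%:M + T c b + (T c b)^T + G2 c b
     + (K c)^T *m K b + (K b)^T *m K c).
Proof.
have rules := (deriv_mxD (De c), deriv_mulmx (De c), DT c, DZ c).
rewrite /F !(DZ b) !(deriv_mulmx (De b)) !(DT b) !rules.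
rewrite !(map_mxD, map_mxM, ET, EZ) !G1 G0 Phi0 -!/(K _) -/(T c b) -/(G2 c b).
rewrite !(trmx1, mulmx1, mul1mx, mulmx0, mul0mx, addr0, add0r) -/f0.
have -> : ev (e c (e b f)) = f0 * (U2 c b + U c * U b).
  by rewrite ef (derivM (De c)) ef rmorphD !rmorphM; rewrite -/f0 -/(U c) -/(U b) -/(U2 c b); ring.
have -> : ev (e b f) = f0 * U b by rewrite ef rmorphM.
have -> : ev (e c f) = f0 * U c by rewrite ef rmorphM.
have sk k : (K k)^T + K k = - (U k *: 1%:M) by rewrite addrC skewK.
rewrite !sk.
by apply/matrixP => i j; rewrite !mxE; ring.
Qed.

(** The coefficient [d%:R + 2] of the second derivatives of log f is d - 1 from differentiating the
    conformal factor twice and 3 from reordering third derivatives. The coefficient of the squared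
    gradient collects the trace, flip and square of [K], the conformal factor, and the gradient part
    of [third]. *)
Theorem conformal_curvature_change :
  - (\sum_a \sum_b ev (e a (e b (F a b))) - \sum_a \sum_b ev (e a (e a (F b b)))) =
  f0 * (- (\sum_a \sum_b ev (e a (e b (G a b))) - \sum_a \sum_b ev (e a (e a (G b b))))
    + (d%:R + 2) * \sum_i ev (e i (u i)) - d%:R * (d%:R + 2) / 4 * \sum_i (ev (u i)) ^+ 2).
Proof.
have V i : \sum_a K a i a = - (d%:R + 2) / 2 * U i.
  under eq_bigr => a _ do rewrite K2.
  by rewrite -mulr_sumr (Koszul_trace omasym omz); ring.
have Wc c b i j : ev (e c (e b (F i j))) = f0 * ((U2 c b - U c * U b) * (i == j)%:R
    + T c b i j + T c b j i + G2 c b i j + \sum_k K c k i * K b k j + \sum_k K b k i * K c k j).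
  have := congr1 (fun M : 'M[R]_d => M i j) (derive2_inverse_metric c b).
  rewrite 3!mxE => ->; rewrite mxE; congr (f0 * _).
  have DE (M P : 'M[R]_d) : (M + P) i j = M i j + P i j by rewrite mxE.
  rewrite !DE; congr (_ + _ + _ + _ + _ + _); rewrite ?mxE //.
  - by apply: eq_bigr => k _; rewrite mxE.
  - by apply: eq_bigr => k _; rewrite mxE.
have S1 : \sum_a \sum_b ev (e a (e b (F a b))) = f0 * ((E0 - norm2 U) + \sum_a \sum_b T a b b a
   + \sum_a \sum_b T a b a b + \sum_a \sum_b G2 a b a b + (d%:R + 2) ^+ 2 / 4 * norm2 U + norm2 U).
  have K1 : \sum_a \sum_b \sum_k K a k a * K b k b = (d%:R + 2) ^+ 2 / 4 * norm2 U.
    have -> : \sum_a \sum_b \sum_k K a k a * K b k b = \sum_k (\sum_a K a k a) * (\sum_b K b k b).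
      under eq_bigr => a _ do rewrite exchange_big /=.
      rewrite exchange_big /=; apply: eq_bigr => k _; rewrite mulr_suml.
      by apply: eq_bigr => a _; rewrite mulr_sumr.
    under eq_bigr => k _ do rewrite V.
    by rewrite /norm2 mulr_sumr; apply: eq_bigr => k _; field.
  have K2' : \sum_a \sum_b \sum_k K b k a * K a k b = norm2 U.
    transitivity (4^-1 * sum3 (fun b i a => Koszul om Z U b i a * Koszul om Z U a i b)).
      rewrite exchange_big /= /sum3 mulr_sumr; apply: eq_bigr => b _.
      rewrite exchange_big /= mulr_sumr; apply: eq_bigr => i _; rewrite mulr_sumr.
      by apply: eq_bigr => a _; rewrite !K2; field.
    by rewrite (Koszul_flip omasym omsq omz); field.
  have D1 : \sum_a \sum_b (U2 a b - U a * U b) * (a == b)%:R = E0 - norm2 U.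
    rewrite /E0 /norm2 -sumrB; apply: eq_bigr => a _.
    by rewrite sum_deltaC expr2.
  rewrite -D1 -K1 -[X in _ = f0 * (_ + X)]K2' -!big_split mulr_sumr /=.
  apply: eq_bigr => a _; rewrite -!big_split mulr_sumr /=; apply: eq_bigr => b _.
  by rewrite Wc; ring.
have S2 : \sum_a \sum_b ev (e a (e a (F b b))) = f0 * (d%:R * (E0 - norm2 U)
   + 2 * (\sum_a \sum_b T a a b b) + \sum_a \sum_b G2 a a b b + (3 * d%:R + 4) * norm2 U).
  have K3 : \sum_a \sum_b \sum_k K a k b * K a k b = (3 * d%:R + 4) / 2 * norm2 U.
    transitivity (4^-1 * sum3 (fun b i a => Koszul om Z U a i b * Koszul om Z U a i b)).
      rewrite exchange_big /= /sum3 mulr_sumr; apply: eq_bigr => b _.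
      rewrite exchange_big /= mulr_sumr; apply: eq_bigr => i _; rewrite mulr_sumr.
      by apply: eq_bigr => a _; rewrite !K2; field.
    by rewrite (Koszul_square omasym omsq omz); field.
  have D2 : \sum_a \sum_(b < d) (U2 a a - U a * U a) = d%:R * (E0 - norm2 U).
    rewrite /E0 /norm2 -sumrB mulr_sumr; apply: eq_bigr => a _.
    by rewrite -expr2 sumr_const card_ord mulr_natl.
  have -> : (3 * d%:R + 4) * norm2 U = 2 * \sum_a \sum_b \sum_k K a k b * K a k b.
    by rewrite K3; field.
  rewrite -D2 ![2 * _]mulr_sumr -!big_split mulr_sumr /=.
  apply: eq_bigr => a _; rewrite ![2 * _]mulr_sumr -!big_split mulr_sumr /=; apply: eq_bigr => b _.
  by rewrite Wc eqxx /=; ring.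
rewrite S1 S2; have t3 := third.
have -> : \sum_a \sum_b ev (e a (e b (G a b))) = \sum_a \sum_b G2 a b a b.
  by apply: eq_bigr => a _; apply: eq_bigr => b _; rewrite !mxE.
have -> : \sum_a \sum_b ev (e a (e a (G b b))) = \sum_a \sum_b G2 a a b b.
  by apply: eq_bigr => a _; apply: eq_bigr => b _; rewrite !mxE.
rewrite -/E0 -/(norm2 U) -mulrBr -mulrN; congr (f0 * _).
move: t3; move: (\sum_a \sum_b T a b b a) (\sum_a \sum_b T a b a b) (\sum_a \sum_b T a a b b) => t1 t2 t3'.
by move: E0 (norm2 U) (\sum_a _) (\sum_a _) (d%:R) => E N1 g1 g2 D; lra.
Qed.

End ConformalChange.

(* Functions smooth on [O], extended by zero, form a ring on which vector fields act as derivations. *)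
Section SmoothRing.
Context {R : realType} {m : nat}.
Variable O : set 'rV[R]_m.

Record smoothf := SmoothF {
  sfun :> 'rV[R]_m -> R;
  sfunP : smooth_on O sfun;
  sfun0 : forall x, ~ O x -> sfun x = 0 }.

(** Extension by zero is what turns agreement on [O] into an equality of elements, as the ring
    axioms require. *)
Lemma smoothf_eq (f g : smoothf) : (forall x, O x -> f x = g x) -> f = g.
Proof.
case: f g => [f fP f0] [g gP g0] /= fg.
have E : f = g.
  by apply/funext => x; have [/fg//|nx] := pselect (O x); rewrite f0 ?g0.
by case: _ / E gP g0 => gP g0; rewrite (Prop_irrelevance fP gP) (Prop_irrelevance f0 g0).
Qed.

Definition cut (f : 'rV[R]_m -> R) : 'rV[R]_m -> R := fun x => if pselect (O x) then f x else 0.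

Lemma cutE f x : O x -> cut f x = f x.
Proof. by rewrite /cut; case: pselect. Qed.
Lemma cut0 f x : ~ O x -> cut f x = 0.
Proof. by rewrite /cut; case: pselect. Qed.

HB.instance Definition _ := gen_eqMixin smoothf.
HB.instance Definition _ := gen_choiceMixin smoothf.
End SmoothRing.

Section SmoothRingOpen.
Context {R : realType} {m : nat}.

(** The openness proof travels with the set, so that the ring structure on [smoothf (carrier W)] can
    be inferred from its type. *)
Record openset := OpenSet { carrier : set 'rV[R]_m; carrierP : open carrier }.
Variable W : openset.
Local Notation O := (carrier W).
Let oO : open O := @carrierP W.

Lemma cut_smooth (f : 'rV[R]_m -> R) : smooth_on O f -> smooth_on O (cut O f).
Proof. by move=> sf; apply: smooth_eq sf; [exact: carrierP|move=> x Ox; rewrite cutE]. Qed.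

Definition mksf f (sf : smooth_on O f) : smoothf O := SmoothF (cut_smooth sf) (@cut0 _ _ O f).

Lemma mksfE f (sf : smooth_on O f) x : O x -> mksf sf x = f x.
Proof. exact: cutE. Qed.

Definition sf_zero : smoothf O := mksf (@smooth_cst R 'rV[R]_m R O 0).
Definition sf_one : smoothf O := mksf (@smooth_cst R 'rV[R]_m R O 1).
Definition sf_add (f g : smoothf O) : smoothf O := mksf (smooth_add oO (sfunP f) (sfunP g)).
Definition sf_opp (f : smoothf O) : smoothf O := mksf (smooth_opp oO (sfunP f)).
Definition sf_mul (f g : smoothf O) : smoothf O := mksf (smooth_mul oO (sfunP f) (sfunP g)).

Fact sf_addA : associative sf_add.
Proof. by move=> f g h; apply: smoothf_eq => x Ox; rewrite !mksfE // addrA. Qed.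
Fact sf_addC : commutative sf_add.
Proof. by move=> f g; apply: smoothf_eq => x Ox; rewrite !mksfE // addrC. Qed.
Fact sf_add0 : left_id sf_zero sf_add.
Proof. by move=> f; apply: smoothf_eq => x Ox; rewrite !mksfE // add0r. Qed.
Fact sf_addN : left_inverse sf_zero sf_opp sf_add.
Proof. by move=> f; apply: smoothf_eq => x Ox; rewrite !mksfE // addNr. Qed.
HB.instance Definition _ := GRing.isZmodule.Build (smoothf O) sf_addA sf_addC sf_add0 sf_addN.

Fact sf_mulA : associative sf_mul.
Proof. by move=> f g h; apply: smoothf_eq => x Ox; rewrite !mksfE // mulrA. Qed.
Fact sf_mulC : commutative sf_mul.
Proof. by move=> f g; apply: smoothf_eq => x Ox; rewrite !mksfE // mulrC. Qed.
Fact sf_mul1 : left_id sf_one sf_mul.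
Proof. by move=> f; apply: smoothf_eq => x Ox; rewrite !mksfE // mul1r. Qed.
Fact sf_mulDl : left_distributive sf_mul sf_add.
Proof. by move=> f g h; apply: smoothf_eq => x Ox; rewrite !mksfE // mulrDl. Qed.
HB.instance Definition _ :=
  GRing.Zmodule_isComPzRing.Build (smoothf O) sf_mulA sf_mulC sf_mul1 sf_mulDl.

Lemma sf_addE (f g : smoothf O) x : O x -> (f + g) x = f x + g x.
Proof. exact: cutE. Qed.
Lemma sf_mulE (f g : smoothf O) x : O x -> (f * g) x = f x * g x.
Proof. exact: cutE. Qed.
Lemma sf_oppE (f : smoothf O) x : O x -> (- f) x = - f x.
Proof. exact: cutE. Qed.
Lemma sf_zeroE x : O x -> (0 : smoothf O) x = 0.
Proof. exact: cutE. Qed.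
Lemma sf_oneE x : O x -> (1 : smoothf O) x = 1.
Proof. exact: cutE. Qed.
Lemma sf_sumE (I : Type) (r : seq I) (P : pred I) (F : I -> smoothf O) x : O x ->
  (\sum_(i <- r | P i) F i) x = \sum_(i <- r | P i) F i x.
Proof.
by move=> Ox; elim/big_ind2: _ => //; [exact: sf_zeroE|move=> a b c d <- <-; exact: sf_addE].
Qed.
Lemma sf_natE n x : O x -> (n%:R : smoothf O) x = n%:R.
Proof.
move=> Ox; elim: n => [|n IH]; first by rewrite sf_zeroE.
by rewrite -addn1 !natrD sf_addE // IH sf_oneE.
Qed.

Section Eval.
Variables (x0 : 'rV[R]_m) (Ox0 : O x0).
Definition sf_ev (f : smoothf O) : R := f x0.
Fact sf_ev_additive : zmod_morphism sf_ev.
Proof. by move=> f g; rewrite /sf_ev sf_addE // sf_oppE. Qed.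
Fact sf_ev_mult : monoid_morphism sf_ev.
Proof. by split=> [|f g]; [exact: sf_oneE|exact: sf_mulE]. Qed.
HB.instance Definition _ := GRing.isZmodMorphism.Build (smoothf O) R sf_ev sf_ev_additive.
HB.instance Definition _ := GRing.isMonoidMorphism.Build (smoothf O) R sf_ev sf_ev_mult.
Definition sf_eval : {rmorphism smoothf O -> R} := sf_ev.
End Eval.

Section Derivation.
Variables (X : 'rV[R]_m -> 'rV[R]_m).

Definition sf_der (sX : smooth_on O X) (f : smoothf O) : smoothf O :=
  mksf (smooth_derive_along oO (sfunP f) sX).

Hypothesis sX : smooth_on O X.

Lemma sf_derE (f : smoothf O) x : O x -> sf_der sX f x = 'D_(X x) f x.
Proof. exact: cutE. Qed.

Lemma near_cut (f g : 'rV[R]_m -> R) x : O x -> (forall y, O y -> f y = g y) ->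
  \forall y \near x, f y = g y.
Proof. by move=> Ox fg; exact: (open_near (oO) Ox). Qed.

Lemma sf_derivation : derivation (sf_der sX).
Proof.
split=> f g; apply: smoothf_eq => x Ox.
  rewrite sf_addE // !sf_derE //.
  have -> : 'D_(X x) (f + g) x = 'D_(X x) (fun y => f y + g y) x.
    by apply: near_eq_derive; apply: near_cut => // y; exact: sf_addE.
  have [F1 F2] := smooth_is_derive (X x) (sfunP f) Ox.
  have [G1 G2] := smooth_is_derive (X x) (sfunP g) Ox.
  exact: deriveD.
rewrite sf_addE // !sf_mulE // !sf_derE //.
have -> : 'D_(X x) (f * g) x = 'D_(X x) (fun y => f y * g y) x.
  by apply: near_eq_derive; apply: near_cut => // y; exact: sf_mulE.
have F := smooth_is_derive (X x) (sfunP f) Ox.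
have G := smooth_is_derive (X x) (sfunP g) Ox.
have [_ ->] := is_deriveM F G.
by rewrite addrC mulrC.
Qed.

Lemma sf_der_mksf (f : 'rV[R]_m -> R) (sf : smooth_on O f) x : O x ->
  sf_der sX (mksf sf) x = 'D_(X x) f x.
Proof.
move=> Ox; rewrite sf_derE //; apply: near_eq_derive; apply: near_cut => // y.
exact: mksfE.
Qed.

End Derivation.

Definition lie_bracket (X Y : 'rV[R]_m -> 'rV[R]_m) (x : 'rV[R]_m) : 'rV[R]_m :=
  'D_(X x) Y x - 'D_(Y x) X x.

Lemma derive_along_along (X Y : 'rV[R]_m -> 'rV[R]_m) (f : 'rV[R]_m -> R) x :
  smooth_on O X -> smooth_on O Y -> smooth_on O f -> O x ->
  'D_(X x) (fun y => 'D_(Y y) f y) x =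
  \sum_i (('D_(X x) Y x) 0 i * partial i f x
     + \sum_j Y x 0 i * (X x 0 j * partial j (partial i f) x)).
Proof.
move=> sX sY sf Ox.
have sp i : smooth_on O (partial i f) by exact: smooth_derive.
have -> : 'D_(X x) (fun y => 'D_(Y y) f y) x =
   'D_(X x) (fun y => \sum_i Y y 0 i * partial i f y) x.
  apply: near_eq_derive; apply: near_cut => // y Oy.
  by rewrite derive_partial //; exact: (smooth_diff_fun oO sf).
have D i : is_derive x (X x) (fun y => Y y 0 i * partial i f y)
   (Y x 0 i * 'D_(X x) (partial i f) x + partial i f x * ('D_(X x) Y x) 0 i).
  have A := (is_derive_mx Y x (X x) _).1 (smooth_is_derive (X x) sY Ox) 0 i.
  exact: (is_deriveM A (smooth_is_derive (X x) (sp i) Ox)).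
have [_] := @is_derive_sum _ _ _ _ (fun i y => Y y 0 i * partial i f y) x (X x) _ D.
rewrite (_ : \sum_i _ = (fun y => \sum_i Y y 0 i * partial i f y)); last first.
  by apply/funext => y; rewrite fct_sumE.
move=> ->; apply: eq_bigr => i _.
rewrite addrC mulrC; congr (_ + _).
rewrite (derive_partial _ (smooth_diff_fun oO (sp i) Ox)) mulr_sumr.
by [].
Qed.

(** The second derivatives of [f] cancel by Schwarz's theorem; the derivatives of the coefficients
    remain. *)
Lemma commutator_lie_bracket (X Y : 'rV[R]_m -> 'rV[R]_m) (f : 'rV[R]_m -> R) x :
  smooth_on O X -> smooth_on O Y -> smooth_on O f -> O x ->
  'D_(X x) (fun y => 'D_(Y y) f y) x - 'D_(Y x) (fun y => 'D_(X y) f y) x =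
  'D_(lie_bracket X Y x) f x.
Proof.
move=> sX sY sf Ox.
rewrite !derive_along_along // (derive_partial _ (smooth_diff_fun oO sf Ox)).
rewrite !big_split /= /lie_bracket.
have -> : \sum_i \sum_j Y x 0 i * (X x 0 j * partial j (partial i f) x) =
   \sum_i \sum_j X x 0 i * (Y x 0 j * partial j (partial i f) x).
  rewrite exchange_big /=; apply: eq_bigr => i _; apply: eq_bigr => j _.
  have E : partial i (partial j f) x = partial j (partial i f) x.
    exact: (derive_schwarz _ _ oO (sf 2%N)).
  exact: (etrans (mulrCA _ _ _) (congr1 (fun t => X x 0 i * (Y x 0 j * t)) E)).
rewrite opprD addrACA subrr addr0 -sumrB; apply: eq_bigr => i _.
have mxB (M N : 'rV[R]_m) : (M - N) 0 i = M 0 i - N 0 i by rewrite !mxE.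
exact: (etrans (esym (mulrBl _ _ _)) (congr1 (fun t => t * partial i f x) (esym (mxB _ _)))).
Qed.

End SmoothRingOpen.

(** * Scalar curvature in normal coordinates *)

Section CoordinateRing.
Context {R : realType} {d : nat}.
Variable W : @openset R d.
Local Notation V := (carrier W).
Let oV : open V := @carrierP R d W.

Definition sf_const (c : R) : smoothf V := mksf (@smooth_cst R 'rV[R]_d R V c).
Definition sf_coord (j : 'I_d) : smoothf V := mksf (@smooth_coord R 1 d V 0 j).
Definition sf_partial (i : 'I_d) : smoothf V -> smoothf V :=
  sf_der (@smooth_cst R 'rV[R]_d 'rV[R]_d V (delta_mx 0 i)).

Lemma sf_partial_derivation i : derivation (sf_partial i).
Proof. exact: sf_derivation. Qed.

Lemma sf_partialE i (f : smoothf V) x : V x -> sf_partial i f x = partial i f x.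
Proof. exact: sf_derE. Qed.

Lemma sf_partial_mksf i f (sf : smooth_on V f) x : V x ->
  sf_partial i (mksf sf) x = partial i f x.
Proof. exact: sf_der_mksf. Qed.

Lemma sf_partial_const i c : sf_partial i (sf_const c) = 0.
Proof.
apply: smoothf_eq => x Vx; rewrite sf_partial_mksf // sf_zeroE //.
exact: derive_cst.
Qed.

Lemma sf_partial_coord i j : sf_partial i (sf_coord j) = (i == j)%:R.
Proof.
apply: smoothf_eq => x Vx; rewrite sf_partial_mksf // sf_natE // /partial.
have [D E] : is_derive x (delta_mx 0 i : 'rV[R]_d) (id : 'rV[R]_d -> _) (delta_mx 0 i).
  exact: is_derive_id.
have := (is_derive_mx _ _ _ _).1 (DeriveDef D E) 0 j => -[_ ->].
by rewrite mxE eqxx /= eq_sym.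
Qed.

End CoordinateRing.

Section QuadrupleSums.
Context {R : comPzRingType} {d : nat}.

Lemma contract_mixed (M L : 'M[R]_d) (T : 'I_d -> 'I_d -> 'I_d -> 'I_d -> R) : L *m M = 1%:M ->
  \sum_a \sum_b \sum_i \sum_j M a i * M b j * \sum_k \sum_l L k a * L l b * T i j k l =
  \sum_i \sum_j T i j i j.
Proof.
move=> LM; have E i k : \sum_a M a i * L k a = (k == i)%:R.
  have := congr1 (fun P : 'M[R]_d => P k i) LM; rewrite !mxE => <-.
  by apply: eq_bigr => a _; exact: mulrC.
under eq_bigr => a _ do rewrite exchange_big.
rewrite exchange_big; apply: eq_bigr => i _.
under eq_bigr => a _ do rewrite exchange_big.
rewrite exchange_big; apply: eq_bigr => j _.
transitivity (\sum_k \sum_l \sum_a \sum_b M a i * M b j * (L k a * L l b * T i j k l)).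
  under eq_bigr => a _ do under eq_bigr => b _ do rewrite mulr_sumr.
  under eq_bigr => a _ do rewrite exchange_big.
  rewrite exchange_big; apply: eq_bigr => k _.
  under eq_bigr => a _ do under eq_bigr => b _ do rewrite mulr_sumr.
  under eq_bigr => a _ do rewrite exchange_big.
  by rewrite exchange_big.
have E2 k l : \sum_a \sum_b M a i * M b j * (L k a * L l b * T i j k l) =
   T i j k l * (k == i)%:R * (l == j)%:R.
  rewrite -mulrA -!E mulr_suml mulr_sumr; apply: eq_bigr => a _.
  by rewrite mulr_sumr mulr_sumr; apply: eq_bigr => b _; ring.
under eq_bigr => k _ do under eq_bigr => l _ do rewrite E2.
under eq_bigr => k _ do rewrite sum_delta.
exact: sum_delta.
Qed.

Lemma contract_pairs (A B : 'I_d -> 'I_d -> 'I_d -> R) (T : 'I_d -> 'I_d -> 'I_d -> 'I_d -> R) :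
  \sum_a \sum_b \sum_i \sum_j A a i j * \sum_k \sum_l B b k l * T i j k l =
  \sum_i \sum_j (\sum_a A a i j) * \sum_k \sum_l (\sum_b B b k l) * T i j k l.
Proof.
transitivity (\sum_a \sum_i \sum_j A a i j * \sum_k \sum_l (\sum_b B b k l) * T i j k l).
  apply: eq_bigr => a _; rewrite exchange_big; apply: eq_bigr => i _.
  rewrite exchange_big; apply: eq_bigr => j _; rewrite -mulr_sumr; congr (_ * _).
  rewrite exchange_big; apply: eq_bigr => k _; rewrite exchange_big; apply: eq_bigr => l _.
  by rewrite -mulr_suml.
rewrite exchange_big; apply: eq_bigr => i _; rewrite exchange_big; apply: eq_bigr => j _.
by rewrite -mulr_suml.
Qed.

End QuadrupleSums.

Section NormalChart.
Context {R : realType} {d : nat}.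
Variables (W : @openset R d) (h : 'rV[R]_d -> 'M[R]_d) (y0 : 'rV[R]_d) (L : 'M[R]_d) (c : R).
Local Notation V := (carrier W).
Let oV : open V := @carrierP R d W.
Hypotheses (Vy0 : V y0) (sh : smooth_on V h) (symh : forall y, V y -> (h y)^T = h y).
Hypotheses (uh : forall y, V y -> h y \in unitmx) (uL : L \in unitmx).
Hypotheses (c0 : c != 0) (Lh : L^T *m invmx (h y0) *m L = c *: 1%:M).

Let sG : smooth_on V (fun y => invmx (h y)).
Proof. exact: smooth_invmx. Qed.
Let shij i j : smooth_on V (fun y => h y i j).
Proof. by move: i j; apply/(smooth_mx oV). Qed.
Let sGij i j : smooth_on V (fun y => invmx (h y) i j).
Proof. by move: i j; apply/(smooth_mx oV). Qed.
Let sph k i j : smooth_on V (partial k (fun y => h y i j)).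
Proof. exact: smooth_derive. Qed.

Lemma smooth_christoffel k i j : smooth_on V (christoffel h k i j).
Proof.
apply: (smooth_mul oV); first exact: smooth_cst.
apply: (smooth_sum oV) => l _; apply: (smooth_mul oV); last first.
  by apply: (smooth_subf oV); [apply: (smooth_add oV)|]; exact: sph.
exact: sGij.
Qed.

Let A := smoothf V.
Let ev : {rmorphism A -> R} := sf_eval Vy0.
Let e := @sf_partial R d W.
Let De i : derivation (e i). Proof. exact: sf_partial_derivation. Qed.
Let hA : 'M[A]_d := \matrix_(i, j) mksf (shij i j).
Let GA : 'M[A]_d := \matrix_(i, j) mksf (sGij i j).
Let Ga (i : 'I_d) : 'M[A]_d := \matrix_(j, k) mksf (smooth_christoffel k i j).
Let cst (t : R) : A := sf_const W t.
Let x (j : 'I_d) : A := sf_coord W j - cst (y0 0 j).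
Let C (i j k : 'I_d) : R := christoffel h k i j y0.

Let ex i j : e i (x j) = (i == j)%:R.
Proof. by rewrite /x (derivB (De i)) /e sf_partial_coord sf_partial_const subr0. Qed.
Let ecst i t : e i (cst t) = 0. Proof. exact: sf_partial_const. Qed.
Let evE (f : A) : ev f = f y0. Proof. by []. Qed.
Let evx j : ev (x j) = 0.
Proof. by rewrite rmorphB !evE !mksfE // subrr. Qed.
Let evcst t : ev (cst t) = t. Proof. exact: mksfE. Qed.

Let hGA : hA *m GA = 1%:M.
Proof.
apply/matrixP => i j; apply: smoothf_eq => y Vy; rewrite !mxE sf_sumE // sf_natE //.
have := mulmxV (uh Vy) => /matrixP /(_ i j); rewrite !mxE => <-.
by apply: eq_bigr => k _; rewrite !mxE sf_mulE // !mksfE.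
Qed.

Let GhA : GA *m hA = 1%:M.
Proof.
apply/matrixP => i j; apply: smoothf_eq => y Vy; rewrite !mxE sf_sumE // sf_natE //.
have := mulVmx (uh Vy) => /matrixP /(_ i j); rewrite !mxE => <-.
by apply: eq_bigr => k _; rewrite !mxE sf_mulE // !mksfE.
Qed.

Let symG : GA^T = GA.
Proof.
apply/matrixP => i j; apply: smoothf_eq => y Vy; rewrite !mxE !mksfE //.
by rewrite -[in RHS](symh Vy) -trmx_inv mxE.
Qed.

Let syminv y i j : V y -> invmx (h y) i j = invmx (h y) j i.
Proof. by move=> Vy; rewrite -[in LHS](symh Vy) -trmx_inv mxE. Qed.

Let sym_ij y i j : V y -> h y i j = h y j i.
Proof. by move=> Vy; rewrite -[in LHS](symh Vy) mxE. Qed.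

Let sym_partial k i j y : V y ->
  partial k (fun y => h y i j) y = partial k (fun y => h y j i) y.
Proof.
move=> Vy; apply: near_eq_derive; apply: (open_near oV Vy) => z Vz.
exact: sym_ij.
Qed.

Let lower y i j k : V y -> \sum_l christoffel h l i j y * h y l k =
  2^-1 * (partial i (fun y => h y j k) y + partial j (fun y => h y i k) y
     - partial k (fun y => h y i j) y).
Proof.
move=> Vy; set T := fun l => (partial i (fun y => h y j l) y + partial j (fun y => h y i l) y
     - partial l (fun y => h y i j) y).
have E l : christoffel h l i j y * h y l k = \sum_p 2^-1 * (T p * (invmx (h y) l p * h y l k)).
  by rewrite /christoffel mulr_sumr mulr_suml; apply: eq_bigr => p _; rewrite /T; ring.
under eq_bigr => l _ do rewrite E.
rewrite exchange_big /=.
under eq_bigr => p _ do rewrite -mulr_sumr -mulr_sumr.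
rewrite -mulr_sumr; congr (_ * _); rewrite -[RHS](sum_delta T k); apply: eq_bigr => p _.
congr (_ * _); have := mulVmx (uh Vy) => /matrixP /(_ p k); rewrite !mxE => <-.
by apply: eq_bigr => l _; rewrite (syminv l p Vy).
Qed.

Let compat i : map_mx (e i) hA = Ga i *m hA + hA *m (Ga i)^T.
Proof.
apply/matrixP => j k; apply: smoothf_eq => y Vy.
rewrite !mxE sf_partial_mksf // sf_addE // !sf_sumE //.
have E1 : \sum_l (Ga i j l * hA l k) y = \sum_l christoffel h l i j y * h y l k.
  by apply: eq_bigr => l _; rewrite !mxE sf_mulE // !mksfE.
have E2 : \sum_l (hA j l * (Ga i)^T l k) y = \sum_l christoffel h l i k y * h y l j.
  by apply: eq_bigr => l _; rewrite !mxE sf_mulE // !mksfE // mulrC (sym_ij l j Vy).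
rewrite E1 E2 !lower // (sym_partial i k j Vy).
move: (partial i _ y) (partial j _ y) (partial k _ y) => a b t.
by lra.
Qed.

Let torsionfree i j k : Ga i j k = Ga j i k.
Proof.
apply: smoothf_eq => y Vy; rewrite !mxE !mksfE //; congr (_ * _); apply: eq_bigr => l _.
congr (_ * _); rewrite (sym_partial l i j Vy).
by rewrite [X in X - _]addrC.
Qed.

Let Csym i j k : C i j k = C j i k.
Proof. by have := congr1 ev (torsionfree i j k); rewrite !mxE !evE !mksfE. Qed.

Let psi0 (a : 'I_d) : A := x a + cst 2^-1 * \sum_j \sum_k x j * x k * cst (C j k a).
Let Q : 'M[A]_d := \matrix_(k, a) e k (psi0 a).

Let QE k a : Q k a = (k == a)%:R + \sum_j x j * cst (C j k a).
Proof.
rewrite mxE /psi0 (derivD (De k)) ex; congr (_ + _).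
rewrite (derivM (De k)) ecst mul0r add0r (deriv_sum (De k)).
have E j : e k (\sum_l x j * x l * cst (C j l a)) =
   (k == j)%:R * (\sum_l x l * cst (C j l a)) + x j * cst (C j k a).
  rewrite (deriv_sum (De k)) mulr_sumr -[X in _ + X](sum_deltaC (fun l => x j * cst (C j l a)) k).
  rewrite -big_split /=; apply: eq_bigr => l _.
  by rewrite !(derivM (De k)) ecst !ex; ring.
under eq_bigr => j _ do rewrite E.
rewrite big_split /=.
have -> : \sum_j (k == j)%:R * (\sum_l x l * cst (C j l a)) = \sum_j x j * cst (C j k a).
  under eq_bigr => j _ do rewrite mulrC.
  by rewrite sum_deltaC; apply: eq_bigr => j _; rewrite Csym.
set S := \sum_j x j * cst (C j k a); have -> : S + S = 2%:R * S by ring.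
rewrite mulrA.
have -> : cst 2^-1 * 2%:R = 1.
  apply: smoothf_eq => y Vy; rewrite sf_mulE // sf_natE // sf_oneE // /cst mksfE //.
  by rewrite mulVf // pnatr_eq0.
by rewrite mul1r.
Qed.

Let dQ i k a : e i (Q k a) = cst (C i k a).
Proof.
rewrite QE (derivD (De i)) (deriv_nat (De i)) add0r (deriv_sum (De i)).
rewrite -[RHS](sum_deltaC (fun j => cst (C j k a)) i); apply: eq_bigr => j _.
by rewrite (derivM (De i)) ex ecst mulr0 addr0 mulrC.
Qed.

Let evQ : map_mx ev Q = 1%:M.
Proof.
apply/matrixP => k a; rewrite [LHS]mxE QE rmorphD rmorph_nat rmorph_sum big1 ?addr0 ?mxE //.
by move=> j _; rewrite rmorphM evx mul0r.
Qed.

Let evdQ i : map_mx ev (map_mx (e i) Q) = map_mx ev (Ga i).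
Proof.
apply/matrixP => k a; rewrite [LHS]mxE [X in ev X]mxE dQ evcst !mxE.
by rewrite evE mksfE.
Qed.

Let evddQ i j : map_mx ev (map_mx (e i) (map_mx (e j) Q)) = 0.
Proof.
apply/matrixP => k a.
by rewrite [LHS]mxE [X in ev X]mxE [X in e i X]mxE dQ ecst rmorph0 mxE.
Qed.

(** The second-order Taylor polynomial of geodesic normal coordinates at [y0], followed by the
    linear map [L] that makes the inverse metric [c] times the identity. The constant [c] will be 1
    for the old Reeb field and the value of [f] for the new one. *)
Definition normal_chart (y : 'rV[R]_d) : 'rV[R]_d :=
  (\row_a ((y - y0) 0 a + 2^-1 * \sum_j \sum_k (y - y0) 0 j * (y - y0) 0 k * C j k a)) *m L.

Lemma smooth_normal_chart (U : set 'rV[R]_d) : smooth_on U normal_chart.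
Proof.
apply: (@smooth_sub _ _ _ setT) => //.
have sc j : smooth_on setT (fun y : 'rV[R]_d => (y - y0) 0 j).
  under eq_fun do rewrite mxE [X in _ + X]mxE.
  by apply: (smooth_subf openT); [exact: smooth_coord|exact: smooth_cst].
apply: (smooth_mulmx openT); last exact: smooth_cst.
apply/(smooth_mx openT) => i a; under eq_fun do rewrite mxE.
apply: (smooth_add openT); first exact: sc.
apply: (smooth_mul openT); first exact: smooth_cst.
apply: (smooth_sum openT) => j _; apply: (smooth_sum openT) => k _.
apply: (smooth_mul openT); last exact: smooth_cst.
by apply: (smooth_mul openT); exact: sc.
Qed.

Let QR y : 'M[R]_d := \matrix_(k, a) Q k a y.

Lemma jacobian_normal_chart y : V y -> 'J normal_chart y = QR y *m L.
Proof.
move=> Vy.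
have dn : differentiable normal_chart y.
  by apply: (smooth_differentiable openT (smooth_normal_chart setT)).
apply/matrixP => k b; rewrite (jacobianE _ _ dn) mxE.
have E z : V z -> normal_chart z 0 b = (\sum_a psi0 a * cst (L a b)) z.
  move=> Vz; rewrite mxE sf_sumE //; apply: eq_bigr => a _.
  have xz j : x j z = (z - y0) 0 j by rewrite /x sf_addE // sf_oppE // !mksfE // !mxE.
  rewrite mxE sf_mulE // /cst [sf_const _ _ _]mksfE //; congr (_ * _).
  rewrite /psi0 sf_addE // xz sf_mulE // [cst _ _]mksfE // sf_sumE //; congr (_ + _ * _).
  apply: eq_bigr => j _; rewrite sf_sumE //; apply: eq_bigr => l _.
  by rewrite !sf_mulE // !xz [cst _ _]mksfE.
have -> : partial k (fun z => normal_chart z 0 b) y = e k (\sum_a psi0 a * cst (L a b)) y.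
  rewrite sf_partialE //; apply: near_eq_derive; apply: (open_near oV Vy) => z Vz.
  exact: E.
rewrite (deriv_sum (De k)) sf_sumE //; apply: eq_bigr => a _.
by rewrite (derivM (De k)) ecst mulr0 addr0 sf_mulE // !mxE [cst _ _]mksfE.
Qed.

Lemma jacobian_normal_chart0 : 'J normal_chart y0 = L.
Proof.
rewrite jacobian_normal_chart //; suff -> : QR y0 = 1%:M by rewrite mul1mx.
by rewrite -evQ; apply/matrixP => i j; rewrite !mxE.
Qed.

(** The inverse metric in the normal chart, as a function of the old coordinate. Being contravariant
    it needs the Jacobian of the chart only, and it can be pulled back further along quotient
    maps. *)
Definition normal_inverse_metric (y : 'rV[R]_d) : 'M[R]_d :=
  ('J normal_chart y)^T *m invmx (h y) *m 'J normal_chart y.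
Local Notation F := normal_inverse_metric.

Let FA := Q^T *m GA *m Q.
Let FAE y : V y -> F y = L^T *m (\matrix_(i, j) FA i j y) *m L.
Proof.
move=> Vy; rewrite /F jacobian_normal_chart // trmx_mul -!mulmxA; congr (_ *m _).
rewrite !mulmxA; congr (_ *m _); apply/matrixP => i j; rewrite !mxE sf_sumE //.
apply: eq_bigr => k _; rewrite sf_mulE // !mxE sf_sumE //; congr (_ * _).
by apply: eq_bigr => l _; rewrite sf_mulE // !mxE mksfE.
Qed.

Lemma smooth_normal_inverse_metric : smooth_on V F.
Proof.
have sJ : smooth_on V (fun y => 'J normal_chart y).
  by apply: (smooth_jacobian oV); exact: smooth_normal_chart.
by apply: (smooth_mulmx oV) => //; apply: (smooth_mulmx oV) => //; exact: smooth_trmx.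
Qed.

Let FL (a b : 'I_d) : A := \sum_i \sum_j cst (L i a * L j b) * FA i j.
Let FLE a b y : V y -> F y a b = FL a b y.
Proof.
move=> Vy; rewrite FAE // mxE sf_sumE //.
have E i j : (cst (L i a * L j b) * FA i j) y = L i a * L j b * FA i j y.
  by rewrite sf_mulE // [cst _ _]mksfE.
under [RHS]eq_bigr => i _ do rewrite sf_sumE //.
under [RHS]eq_bigr => i _ do under eq_bigr => j _ do rewrite E.
rewrite [RHS]exchange_big; apply: eq_bigr => j _; rewrite mxE mulr_suml; apply: eq_bigr => i _.
by rewrite [L^T a i]mxE [(\matrix_(_, _) _) i j]mxE; ring.
Qed.

Let eFL k a b : e k (FL a b) = \sum_i \sum_j cst (L i a * L j b) * e k (FA i j).
Proof.
rewrite (deriv_sum (De k)); apply: eq_bigr => i _; rewrite (deriv_sum (De k)); apply: eq_bigr => j _.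
by rewrite (derivM (De k)) ecst mul0r add0r.
Qed.

Let partialF k a b y : V y -> partial k (fun z => F z a b) y = e k (FL a b) y.
Proof.
move=> Vy; rewrite sf_partialE //; apply: near_eq_derive; apply: (open_near oV Vy) => z Vz.
exact: FLE.
Qed.

Lemma normal_inverse_metric0 : F y0 = c *: 1%:M.
Proof. by rewrite /F jacobian_normal_chart0. Qed.

Lemma normal_inverse_metric1 k a b : partial k (fun z => F z a b) y0 = 0.
Proof.
rewrite partialF // -[LHS]/(ev (e k (FL a b))) eFL rmorph_sum big1 // => i _.
rewrite rmorph_sum big1 // => j _; rewrite rmorphM.
have H := normal_first De hGA GhA compat evQ evdQ k; move/matrixP/(_ i j): H.
by rewrite [LHS]mxE [X in ev X = _]mxE [RHS]mxE => ->; rewrite mulr0.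
Qed.

Let Hs i j k l : R := ev (e i (e j (FA k l))).

Let partial2F i j a b :
  partial i (partial j (fun z => F z a b)) y0 = \sum_k \sum_l L k a * L l b * Hs i j k l.
Proof.
have -> : partial i (partial j (fun z => F z a b)) y0 = ev (e i (e j (FL a b))).
  rewrite evE sf_partialE //; apply: near_eq_derive; apply: (open_near oV Vy0) => z Vz.
  exact: partialF.
rewrite eFL (deriv_sum (De i)) rmorph_sum; apply: eq_bigr => k _.
rewrite (deriv_sum (De i)) rmorph_sum; apply: eq_bigr => l _.
by rewrite (derivM (De i)) ecst mul0r add0r rmorphM evcst.
Qed.

Let M := invmx L.
Lemma second_derivative_along (f : 'rV[R]_d -> R) (v w : 'rV[R]_d) : smooth_on V f ->
  'D_v ('D_w f) y0 = \sum_i \sum_j v 0 i * w 0 j * partial i (partial j f) y0.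
Proof.
move=> sf; rewrite (derive_partial _ (smooth_diff_fun oV (smooth_derive w sf) Vy0)).
apply: eq_bigr => i _.
have -> : partial i ('D_w f) y0 = partial i (fun z => \sum_j w 0 j * partial j f z) y0.
  apply: near_eq_derive; apply: (open_near oV Vy0) => z Vz.
  exact: (derive_partial _ (smooth_diff_fun oV sf Vz)).
have D j : is_derive y0 (delta_mx 0 i : 'rV[R]_d) (fun z => w 0 j *: partial j f z)
   (w 0 j *: partial i (partial j f) y0).
  by apply: is_deriveZ; apply: (smooth_is_derive _ (smooth_derive _ sf) Vy0).
have [_] := @is_derive_sum _ _ _ _ (fun j z => w 0 j *: partial j f z) y0 _ _ D.
rewrite (_ : \sum_j _ = (fun z => \sum_j w 0 j * partial j f z)); last first.
  by apply/funext => z; rewrite fct_sumE.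
rewrite /partial => ->; rewrite mulr_sumr; apply: eq_bigr => j _.
by rewrite mulrA.
Qed.

(** The rows of [M] are the coordinate vectors of the normal chart at [y0]. In the trace term the
    inverse metric contributes [c] and the metric its inverse, so the formula is the same for every
    normalisation. *)
Theorem scalar_curvature_normal : scalar_curvature h y0 =
  - (\sum_a \sum_b 'D_(row a M) ('D_(row b M) (fun z => F z a b)) y0
     - \sum_a \sum_b 'D_(row a M) ('D_(row a M) (fun z => F z b b)) y0).
Proof.
have sF a b : smooth_on V (fun z => F z a b).
  by move: a b; apply/(smooth_mx oV); exact: smooth_normal_inverse_metric.
have S0 := normal_scalar_curvature De hGA GhA symG compat torsionfree evQ evdQ evddQ.
set Rm := fun i j : 'I_d => map_mx (e i) (Ga j) - map_mx (e j) (Ga i) + (Ga j *m Ga i - Ga i *m Ga j).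
have RmE i j k l : ev (Rm i j k l) = partial i (christoffel h l j k) y0 -
   partial j (christoffel h l i k) y0 + \sum_p (christoffel h p j k y0 * christoffel h l i p y0
      - christoffel h p i k y0 * christoffel h l j p y0).
  rewrite !mxE !rmorphD !rmorphN !rmorph_sum sumrB; congr (_ + _ + (_ + _)).
  - by rewrite evE sf_partial_mksf.
  - by congr (- _); rewrite evE sf_partial_mksf.
  - by apply: eq_bigr => p _; rewrite !mxE rmorphM !evE !mksfE.
  - by congr (- _); apply: eq_bigr => p _; rewrite !mxE rmorphM !evE !mksfE.
have -> : scalar_curvature h y0 = \sum_i \sum_j (map_mx ev GA *m map_mx ev (Rm i j)) j i.
  rewrite [RHS]exchange_big /=; apply: eq_bigr => j _.
  under [RHS]eq_bigr => i _ do rewrite mxE.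
  rewrite exchange_big /=; apply: eq_bigr => k _.
  rewrite /ricci mulr_sumr; apply: eq_bigr => i _.
  rewrite [X in _ = X * _]mxE [X in _ = _ * X]mxE RmE [X in ev X]mxE evE mksfE //.
  congr (_ * (_ + _)); apply: eq_bigr => p _; congr (_ - _); exact: mulrC.
have symM (v w : 'rV[R]_d) a b : 'D_v ('D_w (fun z => F z a b)) y0 =
    \sum_i \sum_j v 0 i * w 0 j * \sum_k \sum_l L k a * L l b * Hs i j k l.
  rewrite second_derivative_along //; apply: eq_bigr => i _; apply: eq_bigr => j _.
  by rewrite partial2F.
have LM : L *m M = 1%:M by exact: mulmxV.
have HsE i j k l : map_mx ev (map_mx (e i) (map_mx (e j) FA)) k l = Hs i j k l.
  by rewrite [LHS]mxE [X in ev X = _]mxE [X in ev (e i X) = _]mxE.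
have gP i j : map_mx ev GA i j = c * \sum_a M a i * M a j.
  have E : invmx (h y0) = c *: (M^T *m M).
    have := congr1 (fun P => M^T *m P *m M) Lh; rewrite !mulmxA.
    have -> : M^T *m L^T = 1%:M by rewrite -trmx_mul LM trmx1.
    by rewrite mul1mx -[_ *m L *m M]mulmxA LM mulmx1 -scalemxAr mulmx1 -scalemxAl.
  rewrite [LHS]mxE [X in ev X]mxE evE mksfE // E mxE mxE; congr (_ * _).
  by apply: eq_bigr => a _; rewrite mxE.
have hP k l : map_mx ev hA k l = c^-1 * \sum_b L k b * L l b.
  have E : h y0 = c^-1 *: (L *m L^T).
    have LM' : M *m L = 1%:M by exact: mulVmx.
    have uG : invmx (h y0) \in unitmx by rewrite unitmx_inv uh.
    apply: (can_inj (mulmxK uG)); rewrite mulmxV ?uh //.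
    rewrite -scalemxAl -mulmxA -[L^T *m _]mulmx1 -LM (mulmxA _ L M) Lh -scalemxAl mul1mx.
    by rewrite -scalemxAr LM scalerA mulVf // scale1r.
  rewrite [LHS]mxE [X in ev X]mxE evE mksfE // E mxE mxE; congr (_ * _).
  by apply: eq_bigr => a _; rewrite mxE.
rewrite S0; congr (- (_ - _)).
  under eq_bigr => i _ do under eq_bigr => j _ do rewrite HsE.
  rewrite -(contract_mixed Hs LM); apply: eq_bigr => a _; apply: eq_bigr => b _.
  rewrite symM; apply: eq_bigr => i _; apply: eq_bigr => j _.
  by rewrite ![row _ M 0 _]mxE.
transitivity (\sum_a \sum_b \sum_i \sum_j (M a i * M a j) * \sum_k \sum_l (L k b * L l b) * Hs i j k l).
  rewrite (contract_pairs (fun a i j => M a i * M a j) (fun b k l => L k b * L l b)).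
  apply: eq_bigr => i _; apply: eq_bigr => j _; rewrite gP -mulrA mulrCA; congr (_ * _).
  rewrite mulr_sumr; apply: eq_bigr => k _; rewrite mulr_sumr; apply: eq_bigr => l _.
  by rewrite HsE hP !mulrA mulfV // mul1r.
apply: eq_bigr => a _; apply: eq_bigr => b _.
rewrite symM; apply: eq_bigr => i _; apply: eq_bigr => j _.
by rewrite ![row _ M 0 _]mxE.
Qed.

End NormalChart.

Lemma cyclic_cancel (A : comPzRingType) (t1 t2 t3 t4 t5 t6 : A) :
  (- (t1 - t2) + (t3 - t4)) + (- (t3 - t5) + (t6 - t2)) + (- (t6 - t4) + (t1 - t5)) = 0.
Proof. by ring. Qed.

(** * The frame of horizontal lifts *)

Section ContactFrame.
Context {R : realType} {d : nat}.
Variable W : @openset R d.+1.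
Local Notation O := (carrier W).
Let oO : open O := @carrierP R d.+1 W.
Local Notation vec := 'rV[R]_d.+1.
Variables (a : vec -> 'cV[R]_d.+1) (X : vec -> vec) (phi : vec -> 'rV[R]_d).
Hypotheses (sa : smooth_on O a) (sX : smooth_on O X) (sphi : smooth_on O phi).
Hypotheses (aX : forall x, O x -> X x *m a x = 1%:M).
Hypotheses (XOm : forall x, O x -> X x *m extder_loc a x = 0).
Hypotheses (fullphi : forall x, O x -> row_full ('J phi x)).
Hypotheses (Xphi : forall x, O x -> X x *m 'J phi x = 0).

Lemma extder_loc_asym x i j : extder_loc a x i j = - extder_loc a x j i.
Proof. by rewrite !mxE opprB. Qed.

Lemma smooth_extder : smooth_on O (extder_loc a).
Proof.
apply/(smooth_mx oO) => i j; under eq_fun do rewrite mxE.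
by apply: (smooth_subf oO); apply: smooth_derive; move/(smooth_mx oO): sa; apply.
Qed.

(** Cartan's formula for the differential of a 1-form. It yields the component of a bracket along
    the Reeb field. *)
Lemma form_lie_bracket (V V' : vec -> vec) x : smooth_on O V -> smooth_on O V' -> O x ->
  (lie_bracket V V' x *m a x) 0 0 =
  'D_(V x) (fun y => (V' y *m a y) 0 0) x - 'D_(V' x) (fun y => (V y *m a y) 0 0) x
  - (V x *m extder_loc a x *m (V' x)^T) 0 0.
Proof.
move=> sV sV' Ox.
have prod (Y : vec -> vec) (v : vec) : smooth_on O Y ->
  'D_v (fun y => (Y y *m a y) 0 0) x = ('D_v Y x *m a x) 0 0 +
   \sum_i \sum_j v 0 j * Y x 0 i * partial j (fun y => a y i 0) x.
  move=> sY; have sai i : smooth_on O (fun y => a y i 0) by move/(smooth_mx oO): sa; apply.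
  have D i : is_derive x v (fun y => Y y 0 i * a y i 0)
     (Y x 0 i * 'D_v (fun y => a y i 0) x + a x i 0 * ('D_v Y x) 0 i).
    have A := (is_derive_mx Y x v _).1 (smooth_is_derive v sY Ox) 0 i.
    exact: (is_deriveM A (smooth_is_derive v (sai i) Ox)).
  have [_] := @is_derive_sum _ _ _ _ (fun i y => Y y 0 i * a y i 0) x v _ D.
  rewrite (_ : \sum_i _ = (fun y => (Y y *m a y) 0 0)); last first.
    by apply/funext => y; rewrite fct_sumE mxE.
  move=> ->; rewrite [X in _ = X + _]mxE -big_split /=; apply: eq_bigr => i _.
  rewrite [LHS]addrC; congr (_ + _); first exact: mulrC.
  rewrite (derive_partial _ (smooth_diff_fun oO (sai i) Ox)) mulr_sumr.
  by apply: eq_bigr => j _; rewrite mulrA [_ * v 0 j]mulrC.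
rewrite (prod V' (V x)) // (prod V (V' x)) //.
have -> : (V x *m extder_loc a x *m (V' x)^T) 0 0 =
    \sum_i \sum_j V x 0 j * V' x 0 i * partial j (fun y => a y i 0) x
    - \sum_i \sum_j V' x 0 j * V x 0 i * partial j (fun y => a y i 0) x.
  rewrite [X in _ = _ - X]exchange_big /= -sumrB mxE; apply: eq_bigr => i _.
  rewrite mxE mulr_suml -sumrB; apply: eq_bigr => j _.
  by rewrite [extder_loc a x j i]mxE [(V' x)^T i 0]mxE; ring.
have -> : (lie_bracket V V' x *m a x) 0 0 = ('D_(V x) V' x *m a x) 0 0 - ('D_(V' x) V x *m a x) 0 0.
  by rewrite /lie_bracket mulmxBl mxE [X in _ + X]mxE.
move: (('D_(V x) V' x *m a x) 0 0) (('D_(V' x) V x *m a x) 0 0) (\sum_i _) (\sum_i _) => p q r s.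
by ring.
Qed.

Definition coframe x : 'M[R]_d.+1 := row_mx (a x) ('J phi x).

Let block1 (x : 'rV[R]_d.+1) (l : 'M[R]_(d, d.+1)) (b : 'cV[R]_d.+1) (P : 'M[R]_(d.+1, d)) :
  [/\ x *m b = 1%:M, x *m P = 0, l *m b = 0 & l *m P = 1%:M] <->
  (col_mx x l : 'M[R]_d.+1) *m (row_mx b P : 'M[R]_d.+1) = 1%:M.
Proof.
have E : (col_mx x l : 'M[R]_d.+1) *m (row_mx b P : 'M[R]_d.+1) =
    block_mx (x *m b) (x *m P) (l *m b) (l *m P) := @mul_col_row R 1 d d.+1 1 d x l b P.
have I : (1%:M : 'M[R]_d.+1) = @block_mx R 1 d 1 d 1%:M 0 0 1%:M := @scalar_mx_block R 1 d 1.
rewrite E I; split; first by move=> [-> -> -> ->].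
by move=> /(@eq_block_mx R 1 d 1 d) [-> -> -> ->].
Qed.

Lemma coframe_unit x : O x -> coframe x \in unitmx.
Proof.
move=> Ox; have /row_fullP [C CJ] := fullphi Ox.
have : (col_mx (X x) (C - (C *m a x) *m X x) : 'M[R]_d.+1) *m coframe x = 1%:M.
  apply/block1; split; first exact: aX.
  - exact: Xphi.
  - by rewrite mulmxBl -(mulmxA (C *m a x)) (aX Ox) mulmx1 subrr.
  - by rewrite mulmxBl -(mulmxA (C *m a x)) (Xphi Ox) mulmx0 subr0.
by move=> /mulmx1_unit [].
Qed.

(** The rows are the horizontal lifts of the coordinate fields of the quotient: [X] and [lift] form
    the frame dual to the coframe of [a] and the differential of [phi]. *)
Definition lift x : 'M[R]_(d, d.+1) := @dsubmx R 1 d d.+1 (invmx (coframe x)).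

Lemma smooth_coframe : smooth_on O coframe.
Proof. by apply: (smooth_row_mx oO) => //; exact: smooth_jacobian. Qed.

Lemma smooth_lift : smooth_on O lift.
Proof.
have su : smooth_on O (fun x => invmx (coframe x)).
  by apply: (smooth_invmx oO); [exact: coframe_unit|exact: smooth_coframe].
apply/(smooth_mx oO) => i j; under eq_fun do rewrite mxE.
by move/(smooth_mx oO): su; apply.
Qed.

Lemma inv_coframe x : O x -> invmx (coframe x) = col_mx (X x) (lift x).
Proof.
move=> Ox; have U := coframe_unit Ox.
have E : X x = @usubmx R 1 d d.+1 (invmx (coframe x)).
  have F : X x *m coframe x = row_mx 1%:M 0.
    by rewrite /coframe; apply: etrans (@mul_mx_row R 1 d.+1 1 d _ _ _) _; rewrite (aX Ox) (Xphi Ox).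
  rewrite -[LHS](mulmxK U) F -{1}[invmx (coframe x)](@vsubmxK R 1 d).
  apply: etrans (@mul_row_col R 1 1 d d.+1 _ _ _ _) _.
  by rewrite mul1mx mul0mx addr0.
by rewrite E /lift; apply/esym; exact: (@vsubmxK R 1 d).
Qed.

Let liftP x : O x -> [/\ X x *m a x = 1%:M, X x *m 'J phi x = 0,
  lift x *m a x = 0 & lift x *m 'J phi x = 1%:M].
Proof. by move=> Ox; apply/block1; rewrite -(inv_coframe Ox); exact: mulVmx (coframe_unit Ox). Qed.

Lemma lift_form x : O x -> lift x *m a x = 0.
Proof. by move=> /liftP []. Qed.

Lemma lift_jacobian x : O x -> lift x *m 'J phi x = 1%:M.
Proof. by move=> /liftP []. Qed.

Lemma frame_decomposition p x (v : 'M[R]_(p, d.+1)) : O x ->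
  v = (v *m a x) *m X x + (v *m 'J phi x) *m lift x.
Proof.
move=> Ox; rewrite -[LHS](mulmxK (coframe_unit Ox)) (inv_coframe Ox) /coframe.
have -> : v *m (row_mx (a x) ('J phi x) : 'M[R]_d.+1) = row_mx (v *m a x) (v *m 'J phi x) :=
  @mul_mx_row R p d.+1 1 d _ _ _.
exact: (@mul_row_col R p 1 d).
Qed.

Definition e_ (i : 'I_d) x : vec := row i (lift x).

Lemma smooth_e i : smooth_on O (e_ i).
Proof.
apply/(smooth_mx oO) => k j; under eq_fun do rewrite mxE.
by move/(smooth_mx oO): smooth_lift; apply.
Qed.

Let dphi x j : O x -> differentiable (fun y => phi y 0 j) x.
Proof.
move=> Ox; apply: (smooth_diff_fun oO _ Ox).
by move/(smooth_mx oO): sphi; apply.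
Qed.

Lemma derive_phi (v : vec) x j : O x -> 'D_v (fun y => phi y 0 j) x = (v *m 'J phi x) 0 j.
Proof.
move=> Ox; rewrite (mul_jacobian _ (smooth_differentiable oO sphi Ox)).
have := (is_derive_mx _ _ _ _).1 (smooth_is_derive v sphi Ox) 0 j.
by case.
Qed.

Lemma e_phi i j x : O x -> 'D_(e_ i x) (fun y => phi y 0 j) x = (i == j)%:R.
Proof.
by move=> Ox; rewrite derive_phi // /e_ -row_mul lift_jacobian // !mxE.
Qed.

Lemma e_form i x : O x -> (e_ i x *m a x) 0 0 = 0.
Proof. by move=> Ox; rewrite /e_ -row_mul lift_form // !mxE. Qed.

Lemma X_phi j x : O x -> 'D_(X x) (fun y => phi y 0 j) x = 0.
Proof. by move=> Ox; rewrite derive_phi // Xphi // mxE. Qed.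

Definition Om_ x : 'M[R]_d := lift x *m extder_loc a x *m (lift x)^T.

Lemma smooth_Om : smooth_on O Om_.
Proof.
apply: (smooth_mulmx oO); last by apply: (smooth_trmx oO); exact: smooth_lift.
by apply: (smooth_mulmx oO); [exact: smooth_lift|exact: smooth_extder].
Qed.

Lemma Om_asym x i j : Om_ x i j = - Om_ x j i.
Proof.
have E : (extder_loc a x)^T = - extder_loc a x.
  by apply/matrixP => k l; rewrite mxE [RHS]mxE extder_loc_asym.
have : (Om_ x)^T = - Om_ x by rewrite /Om_ !trmx_mul trmxK E mulNmx mulmxN -mulmxA.
by move/matrixP/(_ j i); rewrite mxE [RHS]mxE.
Qed.

Lemma Om_entry x i j : (e_ i x *m extder_loc a x *m (e_ j x)^T) 0 0 = Om_ x i j.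
Proof.
rewrite /Om_ /e_ -row_mul [LHS]mxE [RHS]mxE; apply: eq_bigr => k _.
by rewrite [row i _ 0 k]mxE [_^T k 0]mxE [_^T k j]mxE [row j _ 0 k]mxE.
Qed.

Let bracket_phi (V V' : vec -> vec) x : smooth_on O V -> smooth_on O V' -> O x ->
  (forall j, \forall y \near x, 'D_(V y) (fun y => phi y 0 j) y = 'D_(V x) (fun y => phi y 0 j) x) ->
  (forall j, \forall y \near x, 'D_(V' y) (fun y => phi y 0 j) y = 'D_(V' x) (fun y => phi y 0 j) x) ->
  lie_bracket V V' x *m 'J phi x = 0.
Proof.
move=> sV sV' Ox H H'; apply/rowP => j.
have sj : smooth_on O (fun y => phi y 0 j) by move/(smooth_mx oO): sphi; apply.
rewrite -derive_phi // -(commutator_lie_bracket sV sV' sj Ox) mxE.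
rewrite (near_eq_derive _ (H' j)) (near_eq_derive _ (H j)).
by rewrite !derive_cst subrr.
Qed.

(** The derivatives of [phi] along the lifts are constant, so the bracket has no horizontal part;
    its vertical part is given by Cartan's formula. *)
Lemma bracket_e i j x : O x -> lie_bracket (e_ i) (e_ j) x = - (Om_ x i j *: X x).
Proof.
move=> Ox; rewrite [LHS](frame_decomposition _ Ox).
rewrite (bracket_phi (smooth_e i) (smooth_e j) Ox) ?mul0mx ?addr0; last 2 first.
- by move=> k; apply: (open_near oO Ox) => y Oy; rewrite !e_phi.
- by move=> k; apply: (open_near oO Ox) => y Oy; rewrite !e_phi.
rewrite [_ *m a x]mx11_scalar mul_scalar_mx form_lie_bracket //; last 2 first.
- exact: smooth_e.
- exact: smooth_e.
have z k v : 'D_v (fun y => (e_ k y *m a y) 0 0) x = 0.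
  rewrite -[RHS](derive_cst (0 : R) x v); apply: near_eq_derive.
  by apply: (open_near oO Ox) => y Oy; rewrite e_form.
by rewrite !z subrr sub0r Om_entry scaleNr.
Qed.

Lemma bracket_X i x : O x -> lie_bracket X (e_ i) x = 0.
Proof.
move=> Ox; rewrite [LHS](frame_decomposition _ Ox).
rewrite (bracket_phi sX (smooth_e i) Ox) ?mul0mx ?addr0; last 2 first.
- by move=> k; apply: (open_near oO Ox) => y Oy; rewrite !X_phi.
- by move=> k; apply: (open_near oO Ox) => y Oy; rewrite !e_phi.
rewrite [_ *m a x]mx11_scalar mul_scalar_mx form_lie_bracket //; last exact: smooth_e.
have -> : 'D_(X x) (fun y => (e_ i y *m a y) 0 0) x = 0.
  rewrite -[RHS](derive_cst (0 : R) x (X x)); apply: near_eq_derive.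
  by apply: (open_near oO Ox) => y Oy; rewrite e_form.
have -> : 'D_(e_ i x) (fun y => (X y *m a y) 0 0) x = 0.
  rewrite -[RHS](derive_cst (1 : R) x (e_ i x)); apply: near_eq_derive.
  by apply: (open_near oO Ox) => y Oy; rewrite aX // mxE.
by rewrite XOm // mul0mx mxE !subr0 scale0r.
Qed.

Let A := smoothf O.
Definition eA (i : 'I_d) : A -> A := sf_der (smooth_e i).
Definition XA : A -> A := sf_der sX.
Let sOm i j : smooth_on O (fun x => Om_ x i j).
Proof. by move/(smooth_mx oO): smooth_Om; apply. Qed.
Definition OmA : 'M[A]_d := \matrix_(i, j) mksf (sOm i j).

Lemma eA_derivation i : derivation (eA i). Proof. exact: sf_derivation. Qed.
Let der_commutator (V V' : vec -> vec) (sV : smooth_on O V) (sV' : smooth_on O V') (f : A) x :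
  O x -> sf_der sV (sf_der sV' f) x - sf_der sV' (sf_der sV f) x = 'D_(lie_bracket V V' x) f x.
Proof.
move=> Ox; rewrite -(commutator_lie_bracket sV sV' (sfunP f) Ox).
have E (Y Z : vec -> vec) (sY : smooth_on O Y) (sZ : smooth_on O Z) :
    sf_der sY (sf_der sZ f) x = 'D_(Y x) (fun y => 'D_(Z y) f y) x.
  apply: etrans (sf_derE sY _ Ox) _; apply: near_eq_derive.
  by apply: (open_near oO Ox) => y Oy; exact: sf_derE.
apply: (@congr2 _ _ _ (fun p q : R => p - q)); [exact: (E V V')|exact: (E V' V)].
Qed.

Lemma frame_comm i j f : eA i (eA j f) - eA j (eA i f) = - (OmA i j * XA f).
Proof.
apply: smoothf_eq => x Ox.
apply: etrans (sf_addE _ _ Ox) _; apply: etrans (congr1 _ (sf_oppE _ Ox)) _.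
apply: etrans (der_commutator (smooth_e i) (smooth_e j) f Ox) _.
apply: etrans _ (esym (sf_oppE _ Ox)); apply: etrans _ (congr1 _ (esym (sf_mulE _ _ Ox))).
have -> : OmA i j x = Om_ x i j by rewrite mxE (mksfE _ Ox).
rewrite (bracket_e i j Ox) [XA f x](sf_derE sX f Ox).
have [_] := is_derive_scale (- Om_ x i j) (smooth_is_derive (X x) (sfunP f) Ox).
rewrite -scaleNr => ->; exact: mulNr.
Qed.

Lemma frame_commX i f : XA (eA i f) = eA i (XA f).
Proof.
apply: smoothf_eq => x Ox; apply/eqP; rewrite -subr_eq0; apply/eqP.
apply: etrans (der_commutator sX (smooth_e i) f Ox) _.
by rewrite (bracket_X i Ox); have [_] := is_derive_scale 0 (smooth_is_derive 0 (sfunP f) Ox); rewrite !scale0r.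
Qed.

Lemma OmA_asym i j : OmA i j = - OmA j i.
Proof. apply: smoothf_eq => x Ox; apply: etrans _ (esym (sf_oppE _ Ox)).
by rewrite [OmA i j]mxE [OmA j i]mxE (mksfE _ Ox) (mksfE (sOm j i) Ox); exact: Om_asym. Qed.

(** Tested on the coordinate functions, [X] has a nonzero component at every point because its
    pairing with [a] is 1. *)
Let XA_cancel (p : A) : (forall f, p * XA f = 0) -> p = 0.
Proof.
move=> H; apply: smoothf_eq => x Ox; rewrite sf_zeroE //.
have Hk k : p x * X x 0 k = 0.
  have := congr1 (fun q : A => q x) (H (mksf (@smooth_coord R 1 d.+1 O 0 k))).
  rewrite sf_mulE // sf_zeroE // sf_der_mksf //.
  have [D E] : is_derive x (X x) (id : vec -> vec) (X x) by exact: is_derive_id.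
  by have := (is_derive_mx _ _ _ _).1 (DeriveDef D E) 0 k => -[_ ->].
have /matrixP/(_ 0 0) := aX Ox; rewrite !mxE => E.
rewrite -[LHS]mulr1 -[1]E mulr_sumr big1 // => k _.
by rewrite mulrA Hk mul0r.
Qed.

(* The Jacobi identity for the commutators. *)
Lemma frame_closed i j k : eA i (OmA j k) + eA j (OmA k i) + eA k (OmA i j) = 0.
Proof.
apply: XA_cancel => f.
have step p q r : eA p (OmA q r) * XA f = eA p (OmA q r * XA f) - OmA q r * eA p (XA f).
  by rewrite (derivM (eA_derivation p)) addrK.
have cm p q r : eA p (OmA q r * XA f) - OmA q r * eA p (XA f) =
   - (eA p (eA q (eA r f)) - eA p (eA r (eA q f))) + (eA q (eA r (eA p f)) - eA r (eA q (eA p f))).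
  have C1 : OmA q r * XA f = - (eA q (eA r f) - eA r (eA q f)).
    by apply/eqP; rewrite -eqr_oppLR; apply/eqP; exact: esym (frame_comm q r f).
  have C2 : OmA q r * XA (eA p f) = - (eA q (eA r (eA p f)) - eA r (eA q (eA p f))).
    by apply/eqP; rewrite -eqr_oppLR; apply/eqP; exact: esym (frame_comm q r _).
  rewrite -[eA p (XA f)]frame_commX C2 C1 opprK.
  by rewrite (derivN (eA_derivation p)) (derivB (eA_derivation p)).
have E p q r : eA p (OmA q r) * XA f = _ := etrans (step p q r) (cm p q r).
rewrite [LHS]mulrDl [X in X + _]mulrDl (E i j k) (E j k i) (E k i j).
exact: cyclic_cancel.
Qed.

End ContactFrame.

(** Gram-Schmidt in block form: [P] clears the first row and column of [H] and leaves the Schur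
    complement [S], which is again symmetric and positive definite. *)
Lemma posdef_orthonormal {R : realType} d (H : 'M[R]_d) : H^T = H ->
  (forall v : 'rV[R]_d, v != 0 -> 0 < (v *m H *m v^T) 0 0) ->
  exists Q : 'M[R]_d, Q *m H *m Q^T = 1%:M.
Proof.
elim: d H => [|d IH] H sym pos; first by exists 0; apply/matrixP => -[].
pose H' : 'M[R]_(1 + d) := H; pose a := ulsubmx H'; pose b := ursubmx H'; pose D := drsubmx H'.
have pos' (v : 'rV[R]_(1 + d)) : v != 0 -> 0 < (v *m H' *m v^T) 0 0 := pos v.
have sym' : H'^T = H' := sym.
have dl : dlsubmx H' = b^T by rewrite /b trmx_ursub sym'.
have Hb : H' = block_mx a b b^T D by rewrite -dl submxK.
have symD : D^T = D by rewrite /D trmx_drsub sym'.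
have a0 : 0 < a 0 0.
  have nz : (row_mx 1%:M 0 : 'rV[R]_(1 + d)) != 0.
    apply/eqP => /(congr1 lsubmx); rewrite row_mxKl => /matrixP/(_ 0 0).
    by rewrite !mxE eqxx => /eqP; rewrite oner_eq0.
  have := pos' _ nz; rewrite Hb mul_row_block tr_row_mx mul_row_col.
  by rewrite trmx1 trmx0 !mulmx1 !mulmx0 !mul0mx !mul1mx !addr0.
set c := a 0 0 in a0 *; have ac : a = c%:M by rewrite [LHS]mx11_scalar.
have cn : c != 0 by rewrite gt_eqF.
pose S := D - c^-1 *: (b^T *m b).
pose P : 'M[R]_(1 + d) := block_mx 1%:M 0 (- c^-1 *: b^T) 1%:M.
have PHP : P *m H' *m P^T = block_mx a 0 0 S.
  rewrite /P Hb tr_block_mx !trmx1 trmx0 linearZ /= trmxK !mulmx_block.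
  rewrite !mul1mx !mulmx1 !mul0mx !mulmx0 !addr0.
  have E1 : a *m (- c^-1 *: b) + b = 0.
    by rewrite ac mul_scalar_mx scalerA mulrN divff // scaleN1r addNr.
  have E2 : - c^-1 *: b^T *m a + b^T = 0.
    by rewrite ac mul_mx_scalar scalerA mulrN divff // scaleN1r addNr.
  by rewrite E1 E2 mul0mx add0r /S -scalemxAl scaleNr addrC.
have symS : S^T = S by rewrite /S linearB linearZ /= symD trmx_mul trmxK.
have posS (w : 'rV[R]_d) : w != 0 -> 0 < (w *m S *m w^T) 0 0.
  move=> wn; have nz : (row_mx 0 w : 'rV[R]_(1 + d)) *m P != 0.
    apply: contra_neq wn; rewrite /P mul_row_block => /(congr1 rsubmx).
    by rewrite row_mxKr mulmx1 mulmx0 add0r linear0.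
  have := pos' _ nz; rewrite trmx_mul !mulmxA -[_ *m P *m H']mulmxA -[_ *m (P *m H') *m P^T]mulmxA PHP.
  rewrite mul_row_block tr_row_mx mul_row_col.
  by rewrite !mul0mx !mulmx0 !add0r mul0mx add0r.
have [Q1 QE] := IH S symS posS.
pose B : 'M[R]_(1 + d) := block_mx (Num.sqrt c)^-1%:M 0 0 Q1.
have BB : B *m block_mx a 0 0 S *m B^T = 1%:M.
  rewrite /B tr_block_mx !trmx0 !mulmx_block !(mul0mx, mulmx0, addr0, add0r) QE.
  rewrite ac tr_scalar_mx -!scalar_mxM.
  have sn : Num.sqrt c != 0 by rewrite gt_eqF // sqrtr_gt0.
  have -> : (Num.sqrt c)^-1 * c * (Num.sqrt c)^-1 = 1.
    by rewrite -{2}(sqr_sqrtr (ltW a0)) expr2 mulrA mulVf // mul1r divff.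
  by rewrite -scalar_mx_block.
exists (B *m P); have -> : H = H' by [].
rewrite trmx_mul !mulmxA -[_ *m P *m H']mulmxA -[_ *m (P *m H') *m P^T]mulmxA PHP.
exact: BB.
Qed.

Section Pullback.
Context {R : realType} {m d : nat}.
Variables (W : @openset R m) (V : @openset R d) (p : 'rV[R]_m -> 'rV[R]_d).
Local Notation O := (carrier W).
Let oO : open O := @carrierP R m W.
Let oV : open (carrier V) := @carrierP R d V.
Hypotheses (sp : smooth_on O p) (pV : forall x, O x -> carrier V (p x)).

Lemma smooth_pullback (K : 'rV[R]_d -> R) : smooth_on (carrier V) K -> smooth_on O (fun y => K (p y)).
Proof. by move=> sK; exact: (smooth_comp_fun oO oV pV sp sK). Qed.

Lemma derive_pullback (K : 'rV[R]_d -> R) v x : smooth_on (carrier V) K -> O x ->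
  'D_v (fun y => K (p y)) x = \sum_l (v *m 'J p x) 0 l * partial l K (p x).
Proof.
move=> sK Ox; have dK := smooth_diff_fun oV sK (pV Ox).
have [_ E] := is_derive_comp (smooth_derivable (v := v) sp Ox) dK.
apply: etrans E _; rewrite -(mul_jacobian v (smooth_differentiable oO sp Ox)).
exact: derive_partial.
Qed.

Lemma derive_pullback_critical (K : 'rV[R]_d -> R) v x : smooth_on (carrier V) K -> O x ->
  (forall k, partial k K (p x) = 0) -> 'D_v (fun y => K (p y)) x = 0.
Proof.
by move=> sK Ox H; rewrite (derive_pullback v sK Ox) big1 // => l _; rewrite H mulr0.
Qed.

(** The derivative of the field [e] and the second derivatives of [p] both enter multiplied by the
    differential of [K], which vanishes at [p x]. *)
Lemma second_derive_pullback (K : 'rV[R]_d -> R) (e : 'rV[R]_m -> 'rV[R]_m) v x :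
  smooth_on (carrier V) K -> smooth_on O e -> O x ->
  (forall k, partial k K (p x) = 0) ->
  'D_v (fun y => 'D_(e y) (fun z => K (p z)) y) x =
  'D_(v *m 'J p x) ('D_(e x *m 'J p x) K) (p x).
Proof.
move=> sK se Ox H.
have sc l : smooth_on O (fun y => (e y *m 'J p y) 0 l).
  have := smooth_mulmx oO se (smooth_jacobian oO sp).
  by move/(smooth_mx oO); apply.
have sq l : smooth_on (carrier V) (partial l K) by exact: smooth_derive.
have -> : 'D_v (fun y => 'D_(e y) (fun z => K (p z)) y) x =
    'D_v (fun y => \sum_l (e y *m 'J p y) 0 l * partial l K (p y)) x.
  apply: near_eq_derive; apply: (open_near oO Ox) => y Oy.
  exact: derive_pullback.
have D l : is_derive x v (fun y => (e y *m 'J p y) 0 l * partial l K (p y))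
   ((e x *m 'J p x) 0 l * \sum_k (v *m 'J p x) 0 k * partial k (partial l K) (p x)).
  have D1 := smooth_is_derive v (sc l) Ox.
  have D2 := smooth_is_derive v (smooth_pullback (sq l)) Ox.
  have [D3 E3] := is_deriveM D1 D2; apply: DeriveDef; first exact: D3.
  apply: etrans E3 _; rewrite H scale0r addr0 (derive_pullback v (sq l) Ox).
  by [].
have [_] := @is_derive_sum _ _ _ _ (fun l y => (e y *m 'J p y) 0 l * partial l K (p y)) x v _ D.
rewrite (_ : \sum_i _ = (fun y => \sum_l (e y *m 'J p y) 0 l * partial l K (p y))); last first.
  by apply/funext => y; rewrite fct_sumE.
move=> ->; rewrite (second_derivative_along (pV Ox) _ _ sK) exchange_big; apply: eq_bigr => l _.
rewrite mulr_sumr; apply: eq_bigr => k _.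
by rewrite mulrCA mulrA.
Qed.
End Pullback.

Section MatrixRing.
Context {R : realType} {m : nat}.
Variable W : @openset R m.
Local Notation O := (carrier W).
Let oO : open O := @carrierP R m W.

Definition mkmx p q (F : 'rV[R]_m -> 'M[R]_(p, q)) (sF : smooth_on O F) : 'M[smoothf O]_(p, q) :=
  \matrix_(i, j) mksf ((smooth_mx oO F).1 sF i j).

Lemma mkmx_eval p q F (sF : smooth_on O F) x (Ox : O x) :
  map_mx (sf_eval Ox) (@mkmx p q F sF) = F x.
Proof. by apply/matrixP => i j; rewrite mxE [X in sf_eval _ X]mxE; exact: mksfE. Qed.

Lemma mxA_eq p q (A B : 'M[smoothf O]_(p, q)) :
  (forall x (Ox : O x), map_mx (sf_eval Ox) A = map_mx (sf_eval Ox) B) -> A = B.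
Proof.
move=> H; apply/matrixP => i j; apply: smoothf_eq => x Ox.
by have /matrixP/(_ i j) := H x Ox; rewrite !mxE.
Qed.
End MatrixRing.

(** * Two Reeb fields on a common open set *)

Section ConformalPair.
Context {R : realType} {d : nat}.
Variables (W : @openset R d.+1) (V V' : @openset R d).
Local Notation O := (carrier W).
Let oO : open O := @carrierP R d.+1 W.
Let oV : open (carrier V) := @carrierP R d V.
Let oV' : open (carrier V') := @carrierP R d V'.
Local Notation vec := 'rV[R]_d.+1.
Variables (a : vec -> 'cV[R]_d.+1) (X X' : vec -> vec) (Jc : vec -> 'M[R]_d.+1).
Variables (p p' : vec -> 'rV[R]_d) (h h' : 'rV[R]_d -> 'M[R]_d) (x0 : vec) (L : 'M[R]_d).
Definition contact_ham x : R := (X' x *m a x) 0 0.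
Local Notation f := contact_ham.
Hypotheses (Ox0 : O x0) (sa : smooth_on O a) (sX : smooth_on O X) (sX' : smooth_on O X').
Hypotheses (sp : smooth_on O p) (sp' : smooth_on O p').
Hypotheses (aX : forall x, O x -> X x *m a x = 1%:M).
Hypotheses (XOm : forall x, O x -> X x *m extder_loc a x = 0).
Hypotheses (X'Om : forall x j, O x -> (X' x *m extder_loc a x) 0 j = - partial j f x).
Hypotheses (f_gt0 : forall x, O x -> 0 < f x).
Hypotheses (JD : forall x (v : vec), O x -> v *m a x = 0 ->
  v *m Jc x *m a x = 0 /\ v *m Jc x *m Jc x = - v).
Hypotheses (pV : forall x, O x -> carrier V (p x)) (pV' : forall x, O x -> carrier V' (p' x)).
Hypotheses (fullp : forall x, O x -> row_full ('J p x)).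
Hypotheses (fullp' : forall x, O x -> row_full ('J p' x)).
Hypotheses (Xp : forall x, O x -> X x *m 'J p x = 0).
Hypotheses (X'p' : forall x, O x -> X' x *m 'J p' x = 0).
Hypotheses (rh : riemannian_metric_on h (carrier V)) (rh' : riemannian_metric_on h' (carrier V')).
Hypotheses (hp : forall x (v w : vec), O x -> v *m a x = 0 -> w *m a x = 0 ->
  v *m ('J p x *m h (p x) *m ('J p x)^T) *m w^T =
  2^-1 *: (v *m extder_loc a x *m (w *m Jc x)^T)).
Hypotheses (hp' : forall x (v w : vec), O x -> v *m a x = 0 -> w *m a x = 0 ->
  v *m ('J p' x *m h' (p' x) *m ('J p' x)^T) *m w^T =
  (2^-1 * (f x)^-1) *: (v *m extder_loc a x *m (w *m Jc x)^T)).
Hypotheses (uL : L \in unitmx) (Lh : L^T *m invmx (h (p x0)) *m L = 1%:M).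
Local Notation psi := (normal_chart h (p x0) L).
Hypotheses (uJ : forall x, O x -> 'J psi (p x) \in unitmx).

Lemma posdef_unit k (B : 'M[R]_k) : B^T = B ->
  (forall v : 'rV[R]_k, v != 0 -> 0 < (v *m B *m v^T) 0 0) -> B \in unitmx.
Proof.
move=> sB pB; have [Q QE] := posdef_orthonormal sB pB.
have [uQ _] := mulmx1_unit (etrans (mulmxA _ _ _) QE).
by have [_] := mulmx1_unit (mulmx1C QE); rewrite unitmx_mul => /andP [].
Qed.

Let uh y : carrier V y -> h y \in unitmx.
Proof. by move=> Vy; case: rh => _ s1 s2; apply: posdef_unit; [exact: s1|exact: s2]. Qed.
Let uh' y : carrier V' y -> h' y \in unitmx.
Proof. by move=> Vy; case: rh' => _ s1 s2; apply: posdef_unit; [exact: s1|exact: s2]. Qed.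
Let sh : smooth_on (carrier V) h. Proof. by case: rh. Qed.
Let sh' : smooth_on (carrier V') h'. Proof. by case: rh'. Qed.
Let symh y : carrier V y -> (h y)^T = h y. Proof. by case: rh => _ s _; exact: s. Qed.
Let symh' y : carrier V' y -> (h' y)^T = h' y. Proof. by case: rh' => _ s _; exact: s. Qed.
Let fn x : O x -> f x != 0. Proof. by move=> Ox; rewrite gt_eqF // f_gt0. Qed.

Definition base_chart x := psi (p x).
Local Notation phi := base_chart.

Let spsi U : smooth_on U psi. Proof. exact: smooth_normal_chart. Qed.

Let sphi : smooth_on O phi.
Proof. by apply: (smooth_comp oO oV pV sp); exact: spsi. Qed.

Let Jphi x : O x -> 'J phi x = 'J p x *m 'J psi (p x).
Proof.
move=> Ox; apply: jacobian_comp; first exact: (smooth_differentiable oO sp Ox).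
exact: (smooth_differentiable oV (spsi _) (pV Ox)).
Qed.

Let fullphi x : O x -> row_full ('J phi x).
Proof.
move=> Ox; have /row_fullP [B BJ] := fullp Ox; apply/row_fullP.
exists (invmx ('J psi (p x)) *m B); rewrite (Jphi Ox) mulmxA -(mulmxA (invmx _)) BJ mulmx1.
exact: mulVmx (uJ Ox).
Qed.

Let Xphi x : O x -> X x *m 'J phi x = 0.
Proof. by move=> Ox; rewrite (Jphi Ox) mulmxA (Xp Ox) mul0mx. Qed.

Local Notation E := (lift a phi).
(** The transverse metric of [X] on the lifts. Its inverse, next, is written through the normal
    chart, so that it factors through [p] and inherits the value 1 and the vanishing differential at
    [x0]. *)
Definition frame_metric x : 'M[R]_d := E x *m ('J p x *m h (p x) *m ('J p x)^T) *m (E x)^T.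
Definition frame_inverse_metric x : 'M[R]_d := normal_inverse_metric h (p x0) L (p x).
Local Notation H := frame_metric.
Local Notation G := frame_inverse_metric.

Let EJp x : O x -> E x *m 'J p x *m 'J psi (p x) = 1%:M.
Proof. by move=> Ox; rewrite -mulmxA -(Jphi Ox); exact: (lift_jacobian aX fullphi Xphi). Qed.

Lemma frame_metricK x : O x -> G x *m H x = 1%:M.
Proof.
move=> Ox; have N : 'J psi (p x) *m (E x *m 'J p x) = 1%:M by exact: mulmx1C (EJp Ox).
rewrite /G /normal_inverse_metric /H.
have -> : E x *m ('J p x *m h (p x) *m ('J p x)^T) *m (E x)^T =
   (E x *m 'J p x) *m h (p x) *m (E x *m 'J p x)^T by rewrite trmx_mul !mulmxA.
move: ('J psi (p x)) (E x *m 'J p x) N => A B AB.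
rewrite !mulmxA -(mulmxA _ A B) AB mulmx1 -(mulmxA _ (invmx _)) (mulVmx (uh (pV Ox))) mulmx1.
by rewrite -trmx_mul (mulmx1C AB) trmx1.
Qed.

Let symH x : O x -> (H x)^T = H x.
Proof. by move=> Ox; rewrite /H !trmx_mul !trmxK (symh (pV Ox)) !mulmxA. Qed.

Let JDm q x (v : 'M[R]_(q, d.+1)) : O x -> v *m a x = 0 ->
  v *m Jc x *m a x = 0 /\ v *m Jc x *m Jc x = - v.
Proof.
move=> Ox va; have H i : row i v *m a x = 0 by rewrite -row_mul va row0.
split; apply/row_matrixP => i; have [H1 H2] := JD Ox (H i).
  by rewrite !row_mul H1 row0.
by rewrite !row_mul H2 linearN.
Qed.

Let bilinear_rows q (v w : 'M[R]_(q, d.+1)) (A B : 'M[R]_d.+1) :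
  (forall i j, row i v *m A *m (row j w)^T = row i v *m B *m (row j w)^T) ->
  v *m A *m w^T = v *m B *m w^T.
Proof.
move=> H; apply/matrixP => i j; have /matrixP/(_ 0 0) := H i j.
have key (C : 'M[R]_d.+1) : (row i v *m C *m (row j w)^T) 0 0 = (v *m C *m w^T) i j.
  rewrite -row_mul [LHS]mxE [RHS]mxE; apply: eq_bigr => k _.
  by rewrite [row i _ 0 k]mxE [_^T k 0]mxE [_^T k j]mxE [row j _ 0 k]mxE.
by rewrite !key.
Qed.

Local Notation Om := (Om_ a phi).
Definition frame_J x : 'M[R]_d := E x *m Jc x *m 'J phi x.
Local Notation Je := frame_J.

Let Ea x : O x -> E x *m a x = 0. Proof. exact: (lift_form aX fullphi Xphi). Qed.

Lemma lift_J x : O x -> E x *m Jc x = Je x *m E x.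
Proof.
move=> Ox; have [H1 _] := JDm Ox (Ea Ox).
by rewrite [LHS](frame_decomposition aX fullphi Xphi _ Ox) H1 mul0mx add0r.
Qed.

Let Je2 x : O x -> Je x *m Je x = - 1%:M.
Proof.
move=> Ox; have [_ H2] := JDm Ox (Ea Ox).
rewrite {2}/Je !mulmxA -(lift_J Ox) H2 mulNmx; congr (- _).
exact: (lift_jacobian aX fullphi Xphi).
Qed.

Let HJ x : O x -> H x = 2^-1 *: (Om x *m (Je x)^T).
Proof.
move=> Ox; have -> : H x = E x *m (2^-1 *: (extder_loc a x *m (Jc x)^T)) *m (E x)^T.
  apply: bilinear_rows => i j.
  have Ei k : row k (E x) *m a x = 0 by rewrite -row_mul (Ea Ox) row0.
  rewrite (hp Ox (Ei i) (Ei j)) trmx_mul -scalemxAr -scalemxAl; congr (_ *: _).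
  by rewrite !mulmxA.
rewrite -scalemxAr -scalemxAl; congr (_ *: _).
rewrite -mulmxA -(mulmxA (extder_loc _ _)) -trmx_mul (lift_J Ox) trmx_mul.
by rewrite /Om_ !mulmxA.
Qed.

Let OmH x : O x -> Om x = (- 2) *: (H x *m (Je x)^T).
Proof.
move=> Ox; rewrite (HJ Ox) -scalemxAl -mulmxA -trmx_mul (Je2 Ox) linearN /= trmx1 mulmxN mulmx1.
by rewrite scalerN scalerN scaleNr opprK scalerA divff ?scale1r // pnatr_eq0.
Qed.

Let OmT x : (Om x)^T = - Om x.
Proof. by apply/matrixP => i j; rewrite mxE [RHS]mxE Om_asym. Qed.

(** The metric is one half of the differential of [a] twisted by the complex structure, and that
    structure squares to - 1; the 4 is the square of this 2. *)
Lemma frame_compatible x : O x -> Om x *m G x *m (Om x)^T = 4%:R *: H x.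
Proof.
move=> Ox; rewrite OmT (OmH Ox) -scaleNr opprK -scalemxAl -scalemxAl -scalemxAr scalerA.
have -> : H x *m (Je x)^T *m G x *m (H x *m (Je x)^T) = - H x.
  rewrite mulmxA -(mulmxA _ (G x)) (frame_metricK Ox) mulmx1 -mulmxA -trmx_mul (Je2 Ox).
  by rewrite linearN /= trmx1 mulmxN mulmx1.
by rewrite scalerN -scaleNr; congr (_ *: _); ring.
Qed.

Let OmG x : O x -> Om x *m G x = 2 *: Je x.
Proof.
move=> Ox; have JH : H x *m (Je x)^T = - (Je x *m H x).
  have := OmT x; rewrite (OmH Ox) linearZ /= trmx_mul trmxK (symH Ox) -scalerN => E.
  have n2 : - 2 != 0 :> R by rewrite oppr_eq0 pnatr_eq0.
  by have := scalerI n2 E => ->; rewrite opprK.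
rewrite (OmH Ox) JH scalerN scaleNr opprK -scalemxAl -mulmxA (mulmx1C (frame_metricK Ox)).
by rewrite mulmx1.
Qed.

Definition log_gradient x : 'rV[R]_d := \row_i ((f x)^-1 * 'D_(e_ a phi i x) f x).
Local Notation u := log_gradient.
(** The horizontal components of the new Reeb field after division by [f]: it is [f] times the sum
    of [X] and this combination of lifts. *)
Definition reeb_shift x : 'rV[R]_d := (f x)^-1 *: (X' x *m 'J phi x).
Local Notation z := reeb_shift.

Let sf : smooth_on O f.
Proof. by have := smooth_mulmx oO sX' sa; move/(smooth_mx oO); apply. Qed.

Let X'E x : O x -> X' x = f x *: (X x + z x *m E x).
Proof.
move=> Ox; rewrite [LHS](frame_decomposition aX fullphi Xphi _ Ox) [X' x *m a x]mx11_scalar mul_scalar_mx.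
by rewrite scalerDr /z -scalemxAl scalerA (divff (fn Ox)) scale1r.
Qed.

(** The contact Hamiltonian equation [X'Om] restricted to the lifts; the component of [X'] along [X]
    drops by [XOm]. *)
Let zOm x : O x -> z x *m Om x = - u x.
Proof.
move=> Ox; apply/rowP => j; rewrite [RHS]mxE [X in - X]mxE.
have -> : z x *m Om x = (f x)^-1 *: (X' x *m extder_loc a x *m (E x)^T).
  rewrite {1}(X'E Ox) -!scalemxAl scalerA (mulVf (fn Ox)) scale1r.
  rewrite mulmxDl mulmxDl (XOm Ox) mul0mx add0r /Om_ /z -!scalemxAl; congr (_ *: _).
  by rewrite !mulmxA.
rewrite mxE -mulrN; congr (_ * _); rewrite mxE.
rewrite (derive_partial _ (smooth_diff_fun oO sf Ox)) -sumrN; apply: eq_bigr => k _.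
by rewrite (X'Om _ Ox) [_^T k j]mxE [e_ _ _ _ _ 0 k]mxE mulNr mulrC.
Qed.

(* The gradient of log f for the transverse metric of X. *)
Lemma transverse_gradient x : O x -> u x *m G x *m E x =
  (- 2 * (f x)^-1) *: (X' x *m (1%:M - a x *m X x) *m Jc x).
Proof.
move=> Ox; have -> : u x *m G x = - 2 *: (z x *m Je x).
  by rewrite -[u x]opprK -(zOm Ox) mulNmx -mulmxA (OmG Ox) -scalemxAr scaleNr.
rewrite -scalemxAl -mulmxA -(lift_J Ox) -scalerA mulmxA; congr (_ *: _).
rewrite scalemxAl; congr (_ *m _).
rewrite mulmxBr mulmx1 mulmxA [X' x *m a x]mx11_scalar mul_scalar_mx -/(f x) scalerBr.
rewrite scalerA (mulVf (fn Ox)) scale1r {1}(X'E Ox) scalerA (mulVf (fn Ox)) scale1r.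
by rewrite addrC addKr.
Qed.

Local Notation y0' := (p' x0).
Definition quotient_frame x : 'M[R]_d := E x *m 'J p' x.
Local Notation P := quotient_frame.

(** The new Reeb field is transverse to the kernel of [a] because [f] is positive. Subtracting
    multiples of it makes a one-sided inverse of the new differential horizontal, hence expressible
    through the old lifts. *)
Let uP x : O x -> P x \in unitmx.
Proof.
move=> Ox; have /row_fullP [C CJ] := fullp' Ox.
pose C' := C - (C *m a x) *m ((f x)^-1 *: X' x).
have C'a : C' *m a x = 0.
  rewrite mulmxBl -(mulmxA (C *m a x)) -scalemxAl [X' x *m a x]mx11_scalar -scalemx1 -/(f x) scalerA.
  by rewrite (mulVf (fn Ox)) scale1r mulmx1 subrr.
have C'J : C' *m 'J p' x = 1%:M.
  by rewrite mulmxBl -(mulmxA (C *m a x)) -scalemxAl (X'p' Ox) scaler0 mulmx0 subr0.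
have D : C' = C' *m 'J phi x *m E x.
  by rewrite [LHS](frame_decomposition aX fullphi Xphi _ Ox) C'a mul0mx add0r.
have : (C' *m 'J phi x) *m P x = 1%:M by rewrite /P mulmxA -D.
by case/mulmx1_unit.
Qed.

(** Here the two metrics meet: both are computed on the same hyperplane from the differential of
    [a], and [hp'] brings in the conformal factor. *)
Let hP x : O x -> P x *m h' (p' x) *m (P x)^T = (f x)^-1 *: H x.
Proof.
move=> Ox; rewrite (HJ Ox) /P.
have -> : E x *m 'J p' x *m h' (p' x) *m (E x *m 'J p' x)^T =
  E x *m ('J p' x *m h' (p' x) *m ('J p' x)^T) *m (E x)^T by rewrite trmx_mul !mulmxA.
have -> : E x *m ('J p' x *m h' (p' x) *m ('J p' x)^T) *m (E x)^T =
  E x *m ((2^-1 * (f x)^-1) *: (extder_loc a x *m (Jc x)^T)) *m (E x)^T.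
  apply: bilinear_rows => i j.
  have Ei k : row k (E x) *m a x = 0 by rewrite -row_mul (Ea Ox) row0.
  rewrite (hp' Ox (Ei i) (Ei j)) trmx_mul -scalemxAr -scalemxAl; congr (_ *: _).
  by rewrite !mulmxA.
rewrite -scalemxAr -scalemxAl scalerA [2^-1 * _]mulrC; congr (_ *: _).
rewrite -mulmxA -(mulmxA (extder_loc _ _)) -trmx_mul (lift_J Ox) trmx_mul.
by rewrite /Om_ !mulmxA.
Qed.

Let invh' x : O x -> invmx (h' (p' x)) = f x *: ((P x)^T *m G x *m P x).
Proof.
move=> Ox; move: (hP Ox) (uP Ox) (mulmx1C (frame_metricK Ox)) (fn Ox) (uh' (pV' Ox)).
move: (P x) (h' (p' x)) (H x) (G x) (f x) => Px hx Hx Gx fx E1 uPx HG f0 U.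
apply: (can_inj (mulKmx U)); rewrite (mulmxV U).
apply: (can_inj (mulKmx uPx)); rewrite mulmx1 -!scalemxAr !mulmxA E1 -!scalemxAl.
by rewrite HG mul1mx scalerA divff // scale1r.
Qed.

Local Notation L' := (invmx (P x0)).
Local Notation psi' := (normal_chart h' y0' L').
Let spsi' U : smooth_on U psi'. Proof. exact: smooth_normal_chart. Qed.
Let phi' x := psi' (p' x).
Let sphi' : smooth_on O phi'.
Proof. by apply: (smooth_comp oO oV' pV' sp'); exact: spsi'. Qed.
Let Jphi' x : O x -> 'J phi' x = 'J p' x *m 'J psi' (p' x).
Proof.
move=> Ox; apply: jacobian_comp; first exact: (smooth_differentiable oO sp' Ox).
exact: (smooth_differentiable oV' (spsi' _) (pV' Ox)).
Qed.

Lemma frame_inverse_metric0 : G x0 = 1%:M.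
Proof.
have Lh1 : L^T *m invmx (h (p x0)) *m L = 1 *: 1%:M by rewrite scale1r.
by rewrite /G (normal_inverse_metric0 (pV Ox0) sh symh uh Lh1) scale1r.
Qed.

Let Lh' : L'^T *m invmx (h' y0') *m L' = f x0 *: 1%:M.
Proof.
rewrite (invh' Ox0) frame_inverse_metric0 mulmx1 -scalemxAr -scalemxAl; congr (_ *: _).
by rewrite !mulmxA -trmx_mul (mulmxV (uP Ox0)) trmx1 mul1mx (mulmxV (uP Ox0)).
Qed.

Local Notation F' := (normal_inverse_metric h' y0' L').

Let F'E x : O x -> F' (p' x) = f x *: ((P x *m 'J psi' (p' x))^T *m G x *m (P x *m 'J psi' (p' x))).
Proof.
move=> Ox; rewrite /normal_inverse_metric (invh' Ox) -scalemxAr -scalemxAl; congr (_ *: _).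
by move: (G x) (P x) => Gx Px; rewrite trmx_mul !mulmxA.
Qed.

Let sGV : smooth_on (carrier V) (normal_inverse_metric h (p x0) L).
Proof. exact: smooth_normal_inverse_metric. Qed.
Let sFV : smooth_on (carrier V') F'.
Proof. exact: smooth_normal_inverse_metric. Qed.
Let sGij i j : smooth_on (carrier V) (fun y => normal_inverse_metric h (p x0) L y i j).
Proof. by move: i j; apply/(smooth_mx oV). Qed.
Let sFij i j : smooth_on (carrier V') (fun y => F' y i j).
Proof. by move: i j; apply/(smooth_mx oV'). Qed.
Lemma smooth_frame_inverse_metric : smooth_on O G.
Proof. exact: (smooth_comp oO oV pV sp sGV). Qed.

Lemma frame_inverse_metric1 v i j : 'D_v (fun x => G x i j) x0 = 0.
Proof.
have Z k := normal_inverse_metric1 L (pV Ox0) sh symh uh k i j.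
exact: (derive_pullback_critical sp pV v (sGij i j) Ox0 Z).
Qed.

Let F'1 v i j : 'D_v (fun x => F' (p' x) i j) x0 = 0.
Proof.
have Z k := normal_inverse_metric1 L' (pV' Ox0) sh' symh' uh' k i j.
exact: (derive_pullback_critical sp' pV' v (sFij i j) Ox0 Z).
Qed.

Local Notation A := (smoothf O).
Local Notation ev := (sf_eval Ox0).
Let e := eA sa sphi aX fullphi Xphi.
Let De i : derivation (e i). Proof. exact: eA_derivation. Qed.
Let XX := XA sX.
Let se i : smooth_on O (e_ a phi i). Proof. exact: (smooth_e sa sphi aX fullphi Xphi). Qed.
Let sfi : smooth_on O (fun x => (f x)^-1). Proof. exact: (smooth_inv oO fn sf). Qed.
Let sz : smooth_on O z.
Proof.
by apply: (smooth_scale oO sfi); apply: (smooth_mulmx oO sX'); exact: (smooth_jacobian oO sphi).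
Qed.
Let sH : smooth_on O H.
Proof.
have sE := smooth_lift sa sphi aX fullphi Xphi.
have sJ := smooth_jacobian oO sp.
apply: (smooth_mulmx oO); last exact: (smooth_trmx oO sE).
apply: (smooth_mulmx oO sE); apply: (smooth_mulmx oO); last exact: (smooth_trmx oO sJ).
by apply: (smooth_mulmx oO sJ); exact: (smooth_comp oO oV pV sp sh).
Qed.

Let fA : A := mksf sf.
Let gA : A := mksf sfi.
Let uA i := gA * e i fA.
Let zA : 'rV[A]_d := mkmx sz.
Let OmAA := OmA sa sphi aX fullphi Xphi.
Let GA := mkmx smooth_frame_inverse_metric.
Let HA := mkmx sH.
Let phiA : 'rV[A]_d := mkmx sphi'.
Let PhiA : 'M[A]_d := \matrix_(i, b) e i (phiA 0 b).

Let eE i (k : A) (K : vec -> R) x : O x -> (forall y, O y -> k y = K y) ->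
  e i k x = 'D_(e_ a phi i x) K x.
Proof.
move=> Ox kK; apply: etrans (sf_derE (se i) k Ox) _; apply: near_eq_derive.
exact: (open_near oO Ox).
Qed.

Let ee i j (k : A) (K : vec -> R) : (forall y, O y -> k y = K y) ->
  ev (e i (e j k)) = 'D_(e_ a phi i x0) (fun y => 'D_(e_ a phi j y) K y) x0.
Proof.
by move=> kK; apply: (eE i Ox0) => y Oy; exact: eE.
Qed.

Let OmE x (Ox : O x) : map_mx (sf_eval Ox) OmAA = Om x.
Proof. by apply/matrixP => i j; rewrite mxE [X in sf_eval _ X]mxE; exact: mksfE. Qed.

Let PhiE x (Ox : O x) : map_mx (sf_eval Ox) PhiA = P x *m 'J psi' (p' x).
Proof.
apply/matrixP => i b; rewrite mxE [X in sf_eval _ X]mxE.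
have -> : P x *m 'J psi' (p' x) = E x *m 'J phi' x by rewrite (Jphi' Ox) mulmxA.
have K y : O y -> phiA 0 b y = phi' y 0 b by move=> Oy; rewrite mxE; exact: mksfE.
apply: etrans (eE i Ox K) _.
have D := (is_derive_mx _ _ _ _).1 (smooth_is_derive (e_ a phi i x) sphi' Ox) 0 b.
apply: etrans (@derive_val _ _ _ _ _ _ _ D) _.
rewrite -(mul_jacobian _ (smooth_differentiable oO sphi' Ox)).
by rewrite /e_ -row_mul mxE.
Qed.

Let FAE x (Ox : O x) : map_mx (sf_eval Ox) (fA *: (PhiA^T *m GA *m PhiA)) = F' (p' x).
Proof.
rewrite map_mxZ !map_mxM -map_trmx (PhiE Ox) (mkmx_eval _ Ox) (F'E Ox); congr (_ *: _).
exact: mksfE.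
Qed.

Let entry p1 q1 (Y : 'M[A]_(p1, q1)) (K : vec -> 'M[R]_(p1, q1)) :
  (forall x (Ox : O x), map_mx (sf_eval Ox) Y = K x) -> forall i j x, O x -> Y i j x = K x i j.
Proof. by move=> H i j x Ox; rewrite -(H x Ox) mxE. Qed.

Let fgA : fA * gA = 1.
Proof.
apply: smoothf_eq => x Ox; rewrite sf_mulE // sf_oneE //.
by rewrite [fA x]mksfE // [gA x]mksfE // divff // fn.
Qed.

Let zE x (Ox : O x) : map_mx (sf_eval Ox) zA = z x. Proof. exact: mkmx_eval. Qed.

Let XphiA b : XX (phiA 0 b) = - \sum_i zA 0 i * e i (phiA 0 b).
Proof.
apply: smoothf_eq => x Ox; apply: etrans _ (esym (sf_oppE _ Ox)).
have -> : (\sum_i zA 0 i * e i (phiA 0 b)) x = (z x *m (E x *m 'J phi' x)) 0 b.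
  rewrite sf_sumE // [RHS]mxE; apply: eq_bigr => i _; rewrite sf_mulE //; congr (_ * _).
    by have /matrixP/(_ 0 i) := zE Ox; rewrite mxE.
  have /matrixP/(_ i b) := PhiE Ox; rewrite mxE [X in sf_eval _ X]mxE => PE; apply: etrans PE _.
  have Q : P x *m 'J psi' (p' x) = E x *m 'J phi' x.
    exact: etrans (esym (mulmxA _ _ _)) (congr1 _ (esym (Jphi' Ox))).
  by rewrite Q.
have K y : O y -> phiA 0 b y = phi' y 0 b by move=> Oy; rewrite mxE; exact: mksfE.
have -> : XX (phiA 0 b) x = (X x *m 'J phi' x) 0 b.
  apply: etrans (sf_derE sX _ Ox) _.
  have -> : 'D_(X x) (phiA 0 b) x = 'D_(X x) (fun y => phi' y 0 b) x.
    by apply: near_eq_derive; exact: (open_near oO Ox).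
  have D := (is_derive_mx _ _ _ _).1 (smooth_is_derive (X x) sphi' Ox) 0 b.
  apply: etrans (@derive_val _ _ _ _ _ _ _ D) _.
  by rewrite -(mul_jacobian _ (smooth_differentiable oO sphi' Ox)).
have Z : X' x *m 'J phi' x = 0 by rewrite (Jphi' Ox) mulmxA (X'p' Ox) mul0mx.
move: Z; rewrite (X'E Ox) -scalemxAl mulmxDl => /eqP.
rewrite scaler_eq0 (negbTE (fn Ox)) addr_eq0 => /eqP ->.
by rewrite mxE mulmxA.
Qed.

Let uE x i : O x -> uA i x = u x 0 i.
Proof.
move=> Ox; rewrite [RHS]mxE sf_mulE //; congr (_ * _); first exact: mksfE.
by apply: (eE i Ox) => y Oy; exact: mksfE.
Qed.

Let zOmA j : \sum_i zA 0 i * OmAA i j = - uA j.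
Proof.
apply: smoothf_eq => x Ox; apply: etrans _ (esym (sf_oppE _ Ox)); rewrite (uE j Ox).
have /matrixP/(_ 0 j) := zOm Ox; rewrite [RHS]mxE => <-; rewrite sf_sumE // [RHS]mxE.
apply: eq_bigr => i _; rewrite sf_mulE //; congr (_ * _).
  by have /matrixP/(_ 0 i) := zE Ox; rewrite mxE.
by have /matrixP/(_ i j) := OmE Ox; rewrite mxE.
Qed.

Let GHA : GA *m HA = 1%:M.
Proof.
apply: mxA_eq => x Ox; rewrite map_mxM map_mx1 (mkmx_eval _ Ox) (mkmx_eval _ Ox).
exact: frame_metricK.
Qed.

Let OmGA : OmAA *m GA *m OmAA^T = 4%:R *: HA.
Proof.
apply: mxA_eq => x Ox; rewrite map_mxZ !map_mxM -map_trmx (OmE Ox) (mkmx_eval _ Ox) (mkmx_eval _ Ox).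
by rewrite rmorph_nat; exact: frame_compatible.
Qed.

Let evD k p1 q1 (Y : 'M[A]_(p1, q1)) (K : vec -> 'M[R]_(p1, q1)) :
  (forall x (Ox : O x), map_mx (sf_eval Ox) Y = K x) ->
  (forall v i j, 'D_v (fun x => K x i j) x0 = 0) -> map_mx ev (map_mx (e k) Y) = 0.
Proof.
move=> YK K0; apply/matrixP => i j; rewrite mxE [X in ev X]mxE [RHS]mxE -(K0 (e_ a phi k x0) i j).
by apply: (eE k Ox0) => y Oy; exact: (entry YK).
Qed.

Theorem conformal_scalar_curvature : scalar_curvature h' (p' x0) =
  f x0 * (scalar_curvature h (p x0)
    + (d%:R + 2) * \sum_i 'D_(e_ a phi i x0) (fun x => u x 0 i) x0
    - d%:R * (d%:R + 2) / 4 * \sum_i (u x0 0 i) ^+ 2).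
Proof.
have GAE x (Ox : O x) : map_mx (sf_eval Ox) GA = G x by exact: mkmx_eval.
have G0 : map_mx ev GA = 1%:M by rewrite GAE; exact: frame_inverse_metric0.
have G1 k : map_mx ev (map_mx (e k) GA) = 0 by apply: (evD k GAE); exact: frame_inverse_metric1.
have F1 k : map_mx ev (map_mx (e k) (fA *: (PhiA^T *m GA *m PhiA))) = 0.
  by apply: (evD k FAE); exact: F'1.
(* The linear part [invmx (P x0)] of the new normal chart is chosen for this: on the old orthonormal
   frame the new coordinates have identity differential. *)
have P0 : map_mx ev PhiA = 1%:M.
  rewrite PhiE (jacobian_normal_chart0 L' (pV' Ox0) sh' symh' uh'); exact: (mulmxV (uP Ox0)).
have C := conformal_curvature_change De fgA (fun i => erefl (uA i))
  (frame_comm sa sX sphi aX fullphi Xphi) (frame_commX sa sX sphi aX XOm fullphi Xphi)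
  XphiA zOmA (OmA_asym sa sphi aX fullphi Xphi)
  (frame_closed sa sX sphi aX XOm fullphi Xphi) GHA OmGA G0 G1 P0 F1.
have f0 : ev fA = f x0 by exact: mksfE.
have u0 i : ev (uA i) = u x0 0 i by exact: uE.
have u1 i : ev (e i (uA i)) = 'D_(e_ a phi i x0) (fun x => u x 0 i) x0.
  by apply: (eE i Ox0) => y Oy; exact: uE.
have S' : scalar_curvature h' (p' x0) =
   - (\sum_a0 \sum_b ev (e a0 (e b ((fA *: (PhiA^T *m GA *m PhiA)) a0 b)))
      - \sum_a0 \sum_b ev (e a0 (e a0 ((fA *: (PhiA^T *m GA *m PhiA)) b b)))).
  have uL' : L' \in unitmx by rewrite unitmx_inv; exact: uP.
  rewrite (scalar_curvature_normal (pV' Ox0) sh' symh' uh' uL' (fn Ox0) Lh') invmxK.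
  (* The entries of the inverse metric are critical at the base point, so iterated frame derivatives
     upstairs are second derivatives on the quotient. *)
  have K i j i' j' : ev (e i (e j ((fA *: (PhiA^T *m GA *m PhiA)) i' j'))) =
     'D_(row i (P x0)) ('D_(row j (P x0)) (fun y => F' y i' j')) y0'.
    rewrite (ee i j (entry FAE i' j')) /P !row_mul.
    apply: (second_derive_pullback sp' pV' _ (sFij i' j') (se j) Ox0) => k.
    exact: (normal_inverse_metric1 L' (pV' Ox0) sh' symh' uh').
  congr (- (_ - _)); apply: eq_bigr => i _; apply: eq_bigr => j _; exact: esym (K _ _ _ _).
have S : scalar_curvature h (p x0) =
   - (\sum_a0 \sum_b ev (e a0 (e b (GA a0 b))) - \sum_a0 \sum_b ev (e a0 (e a0 (GA b b)))).
  have Lh1 : L^T *m invmx (h (p x0)) *m L = 1 *: 1%:M by rewrite scale1r.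
  have IL : invmx L = E x0 *m 'J p x0.
    have := EJp Ox0; rewrite (jacobian_normal_chart0 L (pV Ox0) sh symh uh) => F.
    by rewrite -[LHS]mul1mx -F mulmxK.
  rewrite (scalar_curvature_normal (pV Ox0) sh symh uh uL (oner_neq0 _) Lh1).
  have K i j i' j' : ev (e i (e j (GA i' j'))) =
     'D_(row i (invmx L)) ('D_(row j (invmx L)) (fun y => normal_inverse_metric h (p x0) L y i' j')) (p x0).
    rewrite (ee i j (entry GAE i' j')) IL !row_mul.
    apply: (second_derive_pullback sp pV _ (sGij i' j') (se j) Ox0) => k.
    exact: (normal_inverse_metric1 L (pV Ox0) sh symh uh).
  congr (- (_ - _)); apply: eq_bigr => i _; apply: eq_bigr => j _; exact: esym (K _ _ _ _).
rewrite S' S; apply: etrans C _; rewrite f0; congr (_ * (_ + _ * _ - _ * _)).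
- by apply: eq_bigr => i _; exact: u1.
- by apply: eq_bigr => i _; rewrite u0.
Qed.

End ConformalPair.

(** * Top-degree forms and determinants *)

Section WedgeSum.
Context {A : comPzRingType} {n : nat}.
Let m := n.*2.+1.

(** [wedge_top] without its numerical factor, over an arbitrary commutative ring: it is applied to
    rings of smooth functions and to polynomials in a deformation parameter. *)
Definition wedge_sum (a : 'cV[A]_m) (B : 'M[A]_m) : A :=
  \sum_(s : 'S_m) (-1) ^+ s *
    (a (s ord0) 0 * \prod_(i < n) B (s (inord i.*2.+1)) (s (inord i.*2.+2))).

(** The slots of the product of a covector with n two-forms: one for the covector and a consecutive
    pair for each two-form. *)
Lemma ord_odd_ind (Q : 'I_m -> Prop) : Q ord0 ->
  (forall i : 'I_n, Q (inord i.*2.+1) /\ Q (inord i.*2.+2)) -> forall j, Q j.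
Proof.
move=> Q0 QS j; have [j0|jp] := posnP j; first by have -> : j = ord0 by exact: val_inj.
have lt : (j.-1./2 < n)%N by rewrite ltn_half_double -ltnS prednK //; exact: ltn_ord.
have [Q1 Q2] := QS (Ordinal lt); have := odd_double_half j.-1; case: (odd _) => /= E.
  have Ej : val j = (j.-1./2).*2.+2 := etrans (esym (prednK jp)) (congr1 S (esym E)).
  by rewrite -(inord_val j) Ej.
have Ej : val j = (j.-1./2).*2.+1 := etrans (esym (prednK jp)) (congr1 S (esym E)).
by rewrite -(inord_val j) Ej.
Qed.

Lemma prod_odd (F : 'I_m -> A) :
  \prod_j F j = F ord0 * \prod_(i < n) (F (inord i.*2.+1) * F (inord i.*2.+2)).
Proof.
have nat_case (k : nat) (G : nat -> A) :
    \prod_(j < k.*2.+1) G j = G 0%N * \prod_(i < k) (G i.*2.+1 * G i.*2.+2).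
  elim: k => [|k IH]; first by rewrite big_ord_recl big_ord0 big_ord0.
  by rewrite doubleS big_ord_recr big_ord_recr /= IH big_ord_recr /= !mulrA.
have := nat_case n (fun k => F (inord k)).
have -> : \prod_(j < n.*2.+1) F (inord j) = \prod_j F j.
  by apply: eq_bigr => j _; rewrite inord_val.
by move=> ->; congr (F _ * _); apply: val_inj; rewrite /= inordK.
Qed.

Let I := 'I_m.
Let split (f : {ffun I -> I}) : I * {ffun 'I_n -> I * I} :=
  (f ord0, [ffun i : 'I_n => (f (inord i.*2.+1), f (inord i.*2.+2))]).

Let split_bij : bijective split.
Proof.
apply: inj_card_bij.
  move=> f g E; apply/ffunP; apply: ord_odd_ind; first by case: E.
  by move=> i; case: E => _ /ffunP/(_ i); rewrite !ffunE => -[-> ->].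
rewrite card_prod !card_ffun card_prod !card_ord mulnn -expnM mul2n.
by rewrite -expnS.
Qed.

Lemma tensor_mulmx (P : 'M[A]_m) (a : 'cV[A]_m) (B : 'M[A]_m) (g : I -> I) :
  (P *m a) (g ord0) 0 * \prod_(i < n) (P *m B *m P^T) (g (inord i.*2.+1)) (g (inord i.*2.+2)) =
  \sum_(f : {ffun I -> I}) (\prod_j P (g j) (f j)) *
     (a (f ord0) 0 * \prod_(i < n) B (f (inord i.*2.+1)) (f (inord i.*2.+2))).
Proof.
pose F (i : 'I_n) (pq : I * I) :=
  P (g (inord i.*2.+1)) pq.1 * P (g (inord i.*2.+2)) pq.2 * B pq.1 pq.2.
have E (i : 'I_n) : (P *m B *m P^T) (g (inord i.*2.+1)) (g (inord i.*2.+2)) = \sum_pq F i pq.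
  rewrite -(pair_bigA _ (fun p q => F i (p, q))) exchange_big mxE; apply: eq_bigr => q _.
  rewrite [X in X * _]mxE mulr_suml; apply: eq_bigr => p _.
  by rewrite [P^T q _]mxE /F /= mulrAC.
under eq_bigr => i _ do rewrite E.
rewrite bigA_distr_bigA mxE mulr_suml.
have -> : \sum_(p < m) P (g ord0) p * a p 0 * (\sum_(f : {ffun 'I_n -> I * I}) \prod_i F i (f i)) =
  \sum_(pf : I * {ffun 'I_n -> I * I}) P (g ord0) pf.1 * a pf.1 0 * \prod_i F i (pf.2 i).
  rewrite -(pair_bigA _ (fun p (f : {ffun 'I_n -> I * I}) => P (g ord0) p * a p 0 * \prod_i F i (f i))).
  by apply: eq_bigr => p _; rewrite mulr_sumr.
rewrite (reindex split) /=; last by apply: onW_bij; exact: split_bij.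
apply: eq_bigr => f _; rewrite prod_odd.
have -> : \prod_i F i ([ffun i0 : 'I_n => (f (inord i0.*2.+1), f (inord i0.*2.+2))] i) =
  (\prod_(i < n) (P (g (inord i.*2.+1)) (f (inord i.*2.+1)) * P (g (inord i.*2.+2)) (f (inord i.*2.+2))))
  * \prod_(i < n) B (f (inord i.*2.+1)) (f (inord i.*2.+2)).
  by rewrite -big_split; apply: eq_bigr => i _; rewrite ffunE.
by rewrite !mulrA; congr (_ * _); rewrite mulrAC.
Qed.

(** As in the multiplicativity of the determinant: expand over all index maps [f]; the sum over
    permutations is a determinant with rows selected by [f], which vanishes unless [f] is
    injective. *)
Lemma wedge_sum_mulmx (P : 'M[A]_m) (a : 'cV[A]_m) (B : 'M[A]_m) :
  wedge_sum (P *m a) (P *m B *m P^T) = \det P * wedge_sum a B.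
Proof.
pose T (f : I -> I) := a (f ord0) 0 * \prod_(i < n) B (f (inord i.*2.+1)) (f (inord i.*2.+2)).
have -> : wedge_sum (P *m a) (P *m B *m P^T) =
   \sum_(f : {ffun I -> I}) (\sum_(s : 'S_m) (-1) ^+ s * \prod_j P (s j) (f j)) * T f.
  rewrite /wedge_sum; under eq_bigr => s _ do rewrite tensor_mulmx mulr_sumr.
  rewrite exchange_big; apply: eq_bigr => f _; rewrite mulr_suml; apply: eq_bigr => s _.
  exact: mulrA.
have alt (f : {ffun I -> I}) : \sum_(s : 'S_m) (-1) ^+ s * \prod_j P (s j) (f j) =
    \det (\matrix_(j, k) P k (f j)).
  by apply: eq_bigr => s _; congr (_ * _); apply: eq_bigr => j _; rewrite mxE.
under eq_bigr => f _ do rewrite alt.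
rewrite (bigID (fun f : {ffun I -> I} => injectiveb f)) /= addrC big1 ?add0r => [|f Uf]; last first.
  have /injectivePn [i1 [i2 ne E]] : ~~ injectiveb f by [].
  by rewrite (determinant_alternate ne) ?mul0r // => k; rewrite !mxE E.
rewrite (reindex (@pval _)) /=; last first.
  pose in_Sn := insubd (1%g : 'S_m).
  by exists in_Sn => /= f Uf; first apply: val_inj; apply: insubdK.
rewrite [RHS]mulr_sumr; apply: eq_big => /= [s | s _]; first by rewrite (valP s).
have -> : (\matrix_(j, k) P k (pval s j)) = row_perm s P^T.
  by apply/matrixP => j k; rewrite !mxE pvalE.
rewrite row_permE det_mulmx det_perm det_tr /T !pvalE.
by rewrite [RHS]mulrCA mulrA; congr (_ * (_ * _)).
Qed.

End WedgeSum.

Section DerivationDeterminant.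
Context {A : comPzRingType}.
Variable e : A -> A.
Hypothesis De : derivation e.

Lemma deriv_prod (I : finType) (F : I -> A) :
  e (\prod_i F i) = \sum_i e (F i) * \prod_(j | j != i) F j.
Proof.
have seqc (r : seq I) : uniq r -> e (\prod_(i <- r) F i) = \sum_(i <- r) e (F i) * \prod_(j <- r | j != i) F j.
  elim: r => [|x r IH] /=; first by rewrite !big_nil (deriv1 De).
  move=> /andP [xr ur]; rewrite !big_cons (derivM De) IH // eqxx /=.
  congr (_ * _ + _).
    rewrite [RHS]big_seq_cond [LHS]big_seq_cond; apply: eq_bigl => j.
    by case jr: (j \in r) => //=; rewrite (contraNneq _ xr) // => <-.
  rewrite mulr_sumr big_seq [RHS]big_seq; apply: eq_bigr => i ir.
  have xi : x != i by apply: contraNneq xr => ->.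
  by rewrite big_cons xi; exact: mulrCA.
by rewrite seqc ?index_enum_uniq.
Qed.

Lemma deriv_sign (b : bool) x : e ((-1) ^+ b * x) = (-1) ^+ b * e x.
Proof. by case: b; rewrite ?expr1 ?expr0 ?mul1r ?mulN1r ?(derivN De). Qed.

(** Jacobi's formula. Differentiating row [i] only and expanding along that row produces the
    cofactors. *)
Lemma deriv_det n (C : 'M[A]_n) : e (\det C) = \tr (map_mx e C *m \adj C).
Proof.
pose Ci i : 'M[A]_n := \matrix_(a, b) (if a == i then e (C a b) else C a b).
have -> : e (\det C) = \sum_i \det (Ci i).
  rewrite /determinant (deriv_sum De) exchange_big /=; apply: eq_bigr => s _.
  rewrite deriv_sign deriv_prod mulr_sumr; apply: eq_bigr => i _; congr (_ * _).
  rewrite [RHS](bigD1 i) //= mxE eqxx; congr (_ * _); apply: eq_bigr => j ji.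
  by rewrite mxE (negbTE ji).
apply: eq_bigr => i _; rewrite (expand_det_row _ i) mxE; apply: eq_bigr => k _.
rewrite [Ci i i k]mxE eqxx [X in _ = X * _]mxE [X in _ = _ * X]mxE; congr (_ * _).
rewrite /cofactor; congr (_ * \det _); apply/matrixP => a b.
by rewrite !mxE eq_sym (negbTE (neq_lift _ _)).
Qed.

Variable n : nat.
Let m := n.*2.+1.
Definition wedge_sum_derivative (a : 'cV[A]_m) (B D : 'M[A]_m) : A :=
  \sum_(s : 'S_m) (-1) ^+ s * (a (s ord0) 0 *
    \sum_(i < n) D (s (inord i.*2.+1)) (s (inord i.*2.+2)) *
      \prod_(j < n | j != i) B (s (inord j.*2.+1)) (s (inord j.*2.+2))).

Lemma deriv_wedge_sum (a : 'cV[A]_m) (B : 'M[A]_m) : (forall i, e (a i 0) = 0) ->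
  e (wedge_sum a B) = wedge_sum_derivative a B (map_mx e B).
Proof.
move=> ea; rewrite /wedge_sum (deriv_sum De); apply: eq_bigr => s _.
rewrite deriv_sign (derivM De) ea mul0r add0r deriv_prod; congr (_ * (_ * _)).
by apply: eq_bigr => i _; rewrite mxE.
Qed.
End DerivationDeterminant.

Section WedgeMorphism.
Context {A R : comPzRingType} {n : nat}.
Variable ev : {rmorphism A -> R}.
Let m := n.*2.+1.
Lemma wedge_sum_morph (a : 'cV[A]_m) (B : 'M[A]_m) :
  ev (wedge_sum a B) = wedge_sum (map_mx ev a) (map_mx ev B).
Proof.
rewrite /wedge_sum rmorph_sum; apply: eq_bigr => s _.
rewrite rmorphM rmorph_sign rmorphM rmorph_prod mxE; congr (_ * (_ * _)).
by apply: eq_bigr => i _; rewrite mxE.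
Qed.
Lemma wedge_sum_derivative_morph (a : 'cV[A]_m) (B D : 'M[A]_m) :
  ev (wedge_sum_derivative a B D) = wedge_sum_derivative (map_mx ev a) (map_mx ev B) (map_mx ev D).
Proof.
rewrite /wedge_sum_derivative rmorph_sum; apply: eq_bigr => s _.
rewrite rmorphM rmorph_sign rmorphM rmorph_sum mxE; congr (_ * (_ * _)).
apply: eq_bigr => i _; rewrite rmorphM rmorph_prod mxE; congr (_ * _).
by apply: eq_bigr => j _; rewrite mxE.
Qed.
End WedgeMorphism.

(* The derivative at t = 0 of wedge_sum along B + t (X B + B X^T) = (1 + t X) B (1 + t X)^T + O(t^2). *)
Lemma wedge_sum_infinitesimal {R : comNzRingType} n (a : 'cV[R]_(n.*2.+1)) (X B : 'M[R]_(n.*2.+1)) :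
  X *m a = 0 -> wedge_sum_derivative a B (X *m B + B *m X^T) = \tr X * wedge_sum a B.
Proof.
move=> Xa; pose cst k l (C : 'M[R]_(k, l)) : 'M[{poly R}]_(k, l) := map_mx polyC C.
have De : derivation (@deriv R) by split=> p q; [exact: poly.derivD|exact: poly.derivM].
pose ev : {rmorphism {poly R} -> R} := horner_eval (0 : R).
have evc k l (C : 'M[R]_(k, l)) : map_mx ev (cst k l C) = C.
  by apply/matrixP => i j; rewrite !mxE /ev /= horner_evalE hornerC.
have dc k l (C : 'M[R]_(k, l)) : map_mx (@deriv R) (cst k l C) = 0.
  by apply/matrixP => i j; rewrite !mxE derivC.
pose P : 'M[{poly R}]_(n.*2.+1) := 1%:M + 'X *: cst _ _ X.
have evX : ev 'X = 0 by rewrite /ev /= horner_evalE hornerX.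
have evP : map_mx ev P = 1%:M by rewrite map_mxD map_mxZ evX scale0r addr0 map_mx1.
have dP : map_mx (@deriv R) P = cst _ _ X.
  apply/matrixP => i j; rewrite !mxE poly.derivD poly.derivM derivC mulr0 addr0 derivX mul1r.
  by rewrite -mulr_natr poly.derivM [(1 : {poly R})^`()]derivC mul0r add0r -[_%:R]polyC_natr derivC mulr0 add0r.
have Pa : P *m cst _ _ a = cst _ _ a.
  by rewrite mulmxDl mul1mx -scalemxAl -map_mxM Xa map_mx0 scaler0 addr0.
have W := wedge_sum_mulmx P (cst _ _ a) (cst _ _ B).
have := congr1 (fun p : {poly R} => ev p^`()) W.
rewrite Pa (deriv_wedge_sum De); last by move=> i; rewrite mxE derivC.
rewrite wedge_sum_derivative_morph !map_mxM evc evc -map_trmx evP trmx1 mul1mx mulmx1.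
have -> : map_mx ev (map_mx (@deriv R) (P *m cst _ _ B *m P^T)) = X *m B + B *m X^T.
  rewrite !(deriv_mulmx De) dc mulmx0 addr0 dP map_mxD !map_mxM -!map_trmx dP !evc evP.
  by rewrite trmx1 mulmx1 mul1mx.
move=> ->; rewrite poly.derivM (deriv_det De) (deriv_wedge_sum De); last by move=> i; rewrite mxE derivC.
have -> : wedge_sum_derivative (cst _ _ a) (cst _ _ B) (map_mx (@deriv R) (cst _ _ B)) = 0.
  rewrite dc /wedge_sum_derivative big1 // => s _; rewrite big1 ?mulr0 // => i _.
  by rewrite mxE mul0r.
rewrite mulr0 addr0 rmorphM wedge_sum_morph !evc; congr (_ * _).
rewrite dP -trace_map_mx map_mxM evc map_mx_adj evP adj1 mulmx1.
by [].
Qed.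

(** * Divergence of the transverse gradient *)

Section Divergence.
Context {R : realType} {n : nat}.
Let d := n.*2.
Variable W : @openset R d.+1.
Local Notation O := (carrier W).
Let oO : open O := @carrierP R d.+1 W.
Local Notation vec := 'rV[R]_d.+1.
Variables (a : vec -> 'cV[R]_d.+1) (X : vec -> vec) (phi : vec -> 'rV[R]_d) (x0 : vec).
Hypotheses (Ox0 : O x0) (sa : smooth_on O a) (sX : smooth_on O X) (sphi : smooth_on O phi).
Hypotheses (aX : forall x, O x -> X x *m a x = 1%:M).
Hypotheses (XOm : forall x, O x -> X x *m extder_loc a x = 0).
Hypotheses (fullphi : forall x, O x -> row_full ('J phi x)).
Hypotheses (Xphi : forall x, O x -> X x *m 'J phi x = 0).
Variables (G : vec -> 'M[R]_d) (u : vec -> 'rV[R]_d).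
Hypotheses (sG : smooth_on O G) (su : smooth_on O u).
Hypotheses (G0 : G x0 = 1%:M) (G1 : forall v i j, 'D_v (fun x => G x i j) x0 = 0).
Local Notation E := (lift a phi).
Local Notation e := (e_ a phi).
Local Notation Om := (Om_ a phi).
Hypothesis OmG : forall x, O x -> Om x *m G x *m (Om x)^T *m G x = 4%:R%:M.

Local Notation ev := (sf_eval Ox0).
Let De k : derivation (eA sa sphi aX fullphi Xphi k). Proof. exact: eA_derivation. Qed.
Local Notation eA k := (eA sa sphi aX fullphi Xphi k).
Let se i : smooth_on O (e i). Proof. exact: (smooth_e sa sphi aX fullphi Xphi). Qed.
Let sE : smooth_on O E. Proof. exact: (smooth_lift sa sphi aX fullphi Xphi). Qed.
Let sOm : smooth_on O Om. Proof. exact: (smooth_Om sa sphi aX fullphi Xphi). Qed.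
Let frame_mx x : 'M[R]_d.+1 := col_mx (X x) (E x).
Let CP x : O x -> coframe a phi x *m frame_mx x = 1%:M.
Proof.
move=> Ox; have -> : frame_mx x = invmx (coframe a phi x).
  exact: esym (inv_coframe aX fullphi Xphi Ox).
exact: (mulmxV (coframe_unit aX fullphi Xphi Ox)).
Qed.
Let PC x : O x -> frame_mx x *m coframe a phi x = 1%:M.
Proof. by move=> Ox; exact: mulmx1C (CP Ox). Qed.
Let sC : smooth_on O (coframe a phi).
Proof. exact: (smooth_coframe sa sphi). Qed.
Let sP : smooth_on O frame_mx.
Proof.
apply: (smooth_eq oO) (smooth_invmx oO (fun x Ox => coframe_unit aX fullphi Xphi Ox) sC) => x Ox.
exact: (inv_coframe aX fullphi Xphi Ox).
Qed.
Let sextder : smooth_on O (extder_loc a). Proof. exact: smooth_extder. Qed.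

Let PA := mkmx sP.
Let CA := mkmx sC.
Let aA := mkmx sa.
Let dA := mkmx sextder.
Let BA := PA *m dA *m PA^T.

Let evDE k p q F (sF : smooth_on O F) : map_mx ev (map_mx (eA k) (@mkmx R d.+1 W p q F sF)) =
  'D_(e k x0) F x0.
Proof.
apply/matrixP => i j; rewrite mxE [X in ev X]mxE.
have D := (is_derive_mx _ _ _ _).1 (smooth_is_derive (e k x0) sF Ox0) i j.
apply: etrans _ (@derive_val _ _ _ _ _ _ _ D).
apply: etrans (sf_derE (se k) _ Ox0) _; apply: near_eq_derive; apply: (open_near oO Ox0) => y Oy.
by rewrite mxE; exact: mksfE.
Qed.

Let blk (B : 'M[R]_d) : 'M[R]_d.+1 := @block_mx R 1 d 1 d 0 0 0 B.

Let blk_ul B i j : blk B (@lshift 1 d i) (@lshift 1 d j) = 0.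
Proof. by apply: etrans (@block_mxEul R 1 d 1 d _ _ _ _ i j) _; rewrite mxE. Qed.
Let blk_ur B i j : blk B (@lshift 1 d i) (@rshift 1 d j) = 0.
Proof. by apply: etrans (@block_mxEur R 1 d 1 d _ _ _ _ i j) _; rewrite mxE. Qed.
Let blk_dl B i j : blk B (@rshift 1 d i) (@lshift 1 d j) = 0.
Proof. by apply: etrans (@block_mxEdl R 1 d 1 d _ _ _ _ i j) _; rewrite mxE. Qed.
Let blk_dr B i j : blk B (@rshift 1 d i) (@rshift 1 d j) = B i j.
Proof. exact: (@block_mxEdr R 1 d 1 d). Qed.

Let BE x (Ox : O x) : map_mx (sf_eval Ox) BA = blk (Om x).
Proof.
rewrite /BA !map_mxM -map_trmx (mkmx_eval sP Ox) (mkmx_eval sextder Ox).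
have asym : (extder_loc a x)^T = - extder_loc a x.
  by apply/matrixP => i j; rewrite mxE [RHS]mxE extder_loc_asym.
have aXT : extder_loc a x *m (X x)^T = 0.
  by rewrite -[extder_loc a x]opprK -asym mulNmx -trmx_mul (XOm Ox) trmx0 oppr0.
rewrite /frame_mx; apply: etrans (congr2 mulmx (@mul_col_mx R 1 d d.+1 d.+1 _ _ _) (@tr_col_mx R 1 d d.+1 _ _)) _.
apply: etrans (@mul_col_row R 1 d d.+1 1 d _ _ _ _) _.
rewrite (XOm Ox) !mul0mx -(mulmxA (E x)) aXT mulmx0.
by [].
Qed.

Let col_e0 i : (@col_mx R 1 d 1 1%:M 0 : 'cV[R]_d.+1) i 0 = (i == ord0)%:R.
Proof.
case: (unliftP ord0 i) => [j ->|->].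
  have -> : fintype.lift ord0 j = @rshift 1 d j by exact: val_inj.
  by apply: etrans (@col_mxEd R 1 d 1 _ _ j 0) _; rewrite mxE.
have -> : ord0 = @lshift 1 d ord0 by exact: val_inj.
by apply: etrans (@col_mxEu R 1 d 1 _ _ ord0 0) _; rewrite mxE !eqxx.
Qed.

Let PaE : forall i, (PA *m aA) i 0 = (i == ord0)%:R.
Proof.
move=> i; apply: smoothf_eq => x Ox; rewrite (sf_natE _ Ox).
have -> : (PA *m aA) i 0 x = (frame_mx x *m a x) i 0.
  have /matrixP/(_ i 0) : map_mx (sf_eval Ox) (PA *m aA) = frame_mx x *m a x.
    by rewrite map_mxM (mkmx_eval sP Ox) (mkmx_eval sa Ox).
  by rewrite mxE.
have -> : frame_mx x *m a x = @col_mx R 1 d 1 1%:M 0.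
  apply: etrans (@mul_col_mx R 1 d d.+1 1 _ _ _) _.
  by rewrite (aX Ox) (lift_form aX fullphi Xphi Ox).
exact: col_e0.
Qed.

Let OmOm : Om x0 *m (Om x0)^T = 4%:R%:M.
Proof. by have := OmG Ox0; rewrite G0 !mulmx1. Qed.

Let asymOm x : (Om x)^T = - Om x.
Proof. by apply/matrixP => i j; rewrite mxE [RHS]mxE Om_asym. Qed.

Let N k : 'M[R]_d := 'D_(e k x0) Om x0.

Let NOm k : N k *m (Om x0)^T + Om x0 *m (N k)^T = 0.
Proof.
pose OA := mkmx sOm; pose GA := mkmx sG.
have E0 : OA *m GA *m OA^T *m GA = 4%:R%:M.
  apply: mxA_eq => x Ox; rewrite !map_mxM -map_trmx (mkmx_eval sOm Ox) (mkmx_eval sG Ox) map_scalar_mx.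
  by rewrite (OmG Ox); congr (_%:M); exact: esym (sf_natE 4 Ox).
have := congr1 (fun M => map_mx ev (map_mx (eA k) M)) E0.
have -> : map_mx (eA k) (4%:R%:M : 'M[smoothf O]_d) = 0.
  apply/matrixP => i j; rewrite !mxE; case: (i == j); rewrite ?mulr1n ?mulr0n ?(deriv_nat (De k)) //.
  exact: (deriv0 (De k)).
have g1 : map_mx ev (map_mx (eA k) GA) = 0.
  rewrite evDE; apply/matrixP => i j; rewrite [RHS]mxE -(G1 (e k x0) i j).
  have D := (is_derive_mx _ _ _ _).1 (smooth_is_derive (e k x0) sG Ox0) i j.
  exact: esym (@derive_val _ _ _ _ _ _ _ D).
rewrite map_mx0 !(deriv_mulmx (De k)) -map_trmx !(map_mxD, map_mxM) g1 -!map_trmx evDE.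
by rewrite !(mkmx_eval _ Ox0) G0 !(mulmx1, mulmx0, mul0mx, addr0).
Qed.

Let trNOm k : \tr (N k *m (Om x0)^T) = 0.
Proof.
have := congr1 mxtrace (NOm k); rewrite mxtraceD mxtrace0.
have -> : \tr (Om x0 *m (N k)^T) = \tr (N k *m (Om x0)^T) by rewrite -mxtrace_tr trmx_mul trmxK.
by move: (\tr _) => t; lra.
Qed.

Let asymN k : (N k)^T = - N k.
Proof.
apply/matrixP => i j; rewrite mxE [RHS]mxE.
have D i1 j1 := (is_derive_mx _ _ _ _).1 (smooth_is_derive (e k x0) sOm Ox0) i1 j1.
have [_ <-] := D i j; have [_ <-] := D j i.
apply: etrans _ (deriveN (@ex_derive _ _ _ _ _ _ _ (D i j))).
by apply: near_eq_derive; apply: (open_near oO Ox0) => y _; exact: Om_asym.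
Qed.

(** This is the volume form evaluated on the frame. [Om] stays compatible with a metric that is
    constant to first order, so its derivative is an infinitesimal change of frame, and one of trace
    0. *)
Let w_critical k : ev (eA k (wedge_sum (PA *m aA) BA)) = 0.
Proof.
rewrite (deriv_wedge_sum (De k)); last by move=> i; rewrite PaE (deriv_nat (De k)).
rewrite wedge_sum_derivative_morph (BE Ox0).
have DB : map_mx ev (map_mx (eA k) BA) = blk (N k).
  have -> : BA = mkmx (smooth_mulmx oO (smooth_mulmx oO sP sextder) (smooth_trmx oO sP)).
    apply: mxA_eq => x Ox; rewrite [RHS](mkmx_eval _ Ox) /BA !map_mxM -map_trmx.
    by rewrite (mkmx_eval sP Ox) (mkmx_eval sextder Ox).
  rewrite evDE.
  have -> : 'D_(e k x0) (fun x => frame_mx x *m extder_loc a x *m (frame_mx x)^T) x0 =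
    'D_(e k x0) (fun x => blk (Om x)) x0.
    apply: near_eq_derive; apply: (open_near oO Ox0) => y Oy; rewrite -(BE Oy) /BA !map_mxM -map_trmx.
    by rewrite (mkmx_eval sP Oy) (mkmx_eval sextder Oy).
  have D : is_derive x0 (e k x0) (fun x => blk (Om x)) (blk (N k)).
    apply/is_derive_mx => i j.
    have c0 : is_derive x0 (e k x0) (fun=> 0 : R) 0 by exact: is_derive_cst.
    have split (l : 'I_d.+1) : l = @lshift 1 d ord0 \/ exists j : 'I_d, l = @rshift 1 d j.
      case: (unliftP ord0 l) => [j' ->|->]; last by left; apply: val_inj.
      by right; exists j'; apply: val_inj.
    have [->|[i' ->]] := split i; have [->|[j' ->]] := split j.
    - by rewrite blk_ul; under eq_fun do rewrite blk_ul.
    - by rewrite blk_ur; under eq_fun do rewrite blk_ur.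
    - by rewrite blk_dl; under eq_fun do rewrite blk_dl.
    rewrite blk_dr; under eq_fun do rewrite blk_dr.
    exact: (is_derive_mx _ _ _ _).1 (smooth_is_derive (e k x0) sOm Ox0) i' j'.
  exact: (@derive_val _ _ _ _ _ _ _ D).
(* The 8 is 4 from the square of [Om] times 2, since each of the two terms of the infinitesimal
   action must give half of [N k]. *)
rewrite DB; pose Xm := 8%:R^-1 *: (N k *m (Om x0)^T); pose a0 := map_mx ev (PA *m aA).
have OmTOm : (Om x0)^T *m Om x0 = 4%:R%:M.
  by rewrite asymOm mulNmx -mulmxN -asymOm OmOm.
have E1 : Xm *m Om x0 = 2^-1 *: N k.
  rewrite /Xm -scalemxAl -mulmxA OmTOm mul_mx_scalar scalerA; congr (_ *: _).
  by field.
have E2 : Om x0 *m Xm^T = 2^-1 *: N k.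
  rewrite /Xm linearZ /= trmx_mul trmxK -scalemxAr mulmxA -{1}[Om x0]opprK -asymOm mulNmx OmTOm.
  rewrite asymN mulmxN mulNmx opprK mul_scalar_mx scalerA; congr (_ *: _).
  by field.
have Xa0 : blk Xm *m a0 = 0.
  have -> : a0 = @col_mx R 1 d 1 1%:M 0.
    by apply/colP => i; rewrite mxE PaE rmorph_nat; exact: esym (col_e0 i).
  apply: etrans (@mul_block_col R 1 d 1 d 1 _ _ _ _ _ _) _.
  by rewrite !mul0mx mulmx0 !addr0; exact: (@col_mx0 R 1 d 1).
have -> : blk (N k) = blk Xm *m blk (Om x0) + blk (Om x0) *m (blk Xm)^T.
  have -> : (blk Xm)^T = blk Xm^T.
    by apply: etrans (@tr_block_mx R 1 d 1 d _ _ _ _) _; rewrite !trmx0.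
  have mb (A B : 'M[R]_d) : blk A *m blk B = blk (A *m B).
    apply: etrans (@mulmx_block R 1 d 1 d 1 d _ _ _ _ _ _ _ _) _.
    by rewrite !(mulmx0, mul0mx, addr0, add0r).
  rewrite !mb E1 E2; apply/esym; apply: etrans (@add_block_mx R 1 d 1 d _ _ _ _ _ _ _ _) _.
  rewrite !addr0 -scalerDl; have -> : 2^-1 + 2^-1 = 1 :> R by field.
  by rewrite scale1r.
rewrite (wedge_sum_infinitesimal _ Xa0).
have -> : \tr (blk Xm) = 0.
  apply: etrans (@mxtrace_block R 1 d _ _ _ _) _.
  by rewrite mxtrace0 add0r mxtraceZ trNOm mulr0.
exact: mul0r.
Qed.

Local Notation rho := (fun x => wedge_top (a x) (extder_loc a x)).
Let rhoA := wedge_sum aA dA.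

Let rhoAE x : O x -> rho x = 2 ^- n * rhoA x.
Proof.
move=> Ox; have -> : rhoA x = wedge_sum (a x) (extder_loc a x).
  by apply: etrans (wedge_sum_morph (sf_eval Ox) aA dA) _; rewrite (mkmx_eval sa Ox) (mkmx_eval sextder Ox).
by [].
Qed.

(** The derivative of a frame field along [e k] is its image under the Jacobian of [e k] plus a
    bracket. The brackets are multiples of [X], and the one with [X] itself vanishes, so they do not
    contribute to the trace. *)
Let divergence_e k : ev (\tr (map_mx (eA k) PA *m CA)) = \tr ('J (e k) x0).
Proof.
rewrite -trace_map_mx map_mxM evDE (mkmx_eval sC Ox0).
pose Q (r : 'I_d.+1) x : vec := row r (frame_mx x).
have Q0 x : Q ord0 x = X x.
  have -> : ord0 = @lshift 1 d ord0 by exact: val_inj.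
  by apply/rowP => j; rewrite [LHS]mxE; exact: (@col_mxEu R 1 d d.+1 (X x) (E x) ord0 j).
have QS i x : Q (fintype.lift ord0 i) x = e i x.
  have -> : fintype.lift ord0 i = @rshift 1 d i by exact: val_inj.
  by apply/rowP => j; rewrite [LHS]mxE [RHS]mxE; exact: (@col_mxEd R 1 d d.+1 (X x) (E x) i j).
have DQ r : row r ('D_(e k x0) frame_mx x0) = 'D_(e k x0) (Q r) x0.
  apply/rowP => j; rewrite mxE.
  have D := (is_derive_mx _ _ _ _).1 (smooth_is_derive (e k x0) sP Ox0) r j.
  have sQ : smooth_on O (Q r).
    by apply/(smooth_mx oO) => i' j'; under eq_fun do rewrite mxE; move/(smooth_mx oO): sP; apply.
  have D2 := (is_derive_mx _ _ _ _).1 (smooth_is_derive (e k x0) sQ Ox0) 0 j.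
  have [_ <-] := D; have [_ <-] := D2.
  by apply: near_eq_derive; apply: (open_near oO Ox0) => y _; rewrite [RHS]mxE.
have JE v : v *m 'J (e k) x0 = 'D_v (e k) x0.
  exact: (mul_jacobian v (smooth_differentiable oO (se k) Ox0)).
have [c [c0 cE]] : exists c : 'I_d.+1 -> R, c ord0 = 0 /\
   forall r, 'D_(e k x0) (Q r) x0 = c r *: X x0 + Q r x0 *m 'J (e k) x0.
  exists (fun r => if unlift ord0 r is Some i then - Om x0 k i else 0).
  rewrite unlift_none; split=> // r; case: (unliftP ord0 r) => [i ->|->].
    rewrite JE QS (_ : Q _ = e i); last by apply/funext => y; exact: QS.
    have := bracket_e sa sphi aX fullphi Xphi k i Ox0; rewrite /lie_bracket.
    by move/eqP; rewrite subr_eq => /eqP ->; rewrite scaleNr.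
  rewrite JE Q0 scale0r add0r (_ : Q _ = X); last by apply/funext => y; exact: Q0.
  have := bracket_X sa sX sphi aX XOm fullphi Xphi k Ox0; rewrite /lie_bracket.
  by move/eqP; rewrite subr_eq0 => /eqP ->.
have -> : 'D_(e k x0) frame_mx x0 = (\col_r c r) *m X x0 + frame_mx x0 *m 'J (e k) x0.
  apply/row_matrixP => r; rewrite DQ cE linearD /= !row_mul.
  have -> : row r (\col_r c r) = (c r)%:M by apply/matrixP => i j; rewrite !mxE !ord1 eqxx mulr1n.
  by rewrite mul_scalar_mx.
have T2 : \tr (frame_mx x0 *m 'J (e k) x0 *m coframe a phi x0) = \tr ('J (e k) x0).
  by rewrite -mulmxA mxtrace_mulC -mulmxA (CP Ox0) mulmx1.
rewrite mulmxDl mxtraceD T2 -mulmxA mxtrace_mulC.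
have XC : X x0 *m coframe a phi x0 = @row_mx R 1 1 d 1%:M 0.
  apply: etrans (@mul_mx_row R 1 d.+1 1 d _ _ _) _.
  by rewrite (aX Ox0) (Xphi Ox0).
have -> : X x0 *m coframe a phi x0 *m (\col_r c r) = 0.
  apply/matrixP => i j; rewrite XC mxE big_ord_recl /= [(\col_r c r) ord0 j]mxE c0 mulr0 add0r big1 ?mxE // => l _.
  have -> : fintype.lift ord0 l = @rshift 1 d l by exact: val_inj.
  have -> : @row_mx R 1 1 d 1%:M 0 i (@rshift 1 d l) = 0.
    by apply: etrans (@row_mxEr R 1 1 d _ _ i l) _; rewrite mxE.
  exact: mul0r.
by rewrite mxtrace0 add0r.
Qed.

(** The frame fields are divergence-free at [x0] for the contact volume: the determinant of the
    frame times the density is critical there by [w_critical], and the logarithmic derivative of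
    that determinant is [divergence_e]. *)
Lemma density_derivative k : 'D_(e k x0) rho x0 = - (rho x0 * \tr ('J (e k) x0)).
Proof.
have W0 : \det PA * rhoA = wedge_sum (PA *m aA) BA by rewrite /BA wedge_sum_mulmx.
have dP : eA k (\det PA) = \det PA * \tr (map_mx (eA k) PA *m CA).
  have CPA : CA *m PA = 1%:M.
    by apply: mxA_eq => x Ox; rewrite map_mxM map_mx1 (mkmx_eval sC Ox) (mkmx_eval sP Ox); exact: CP.
  have adjP : \adj PA = \det PA *: CA.
    by rewrite -[LHS]mul1mx -CPA -mulmxA mul_mx_adj mul_mx_scalar.
  by rewrite (deriv_det (De k)) adjP -scalemxAr mxtraceZ.
have := congr1 (fun f => ev (eA k f)) W0; rewrite w_critical (derivM (De k)) dP rmorphD !rmorphM.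
rewrite divergence_e.
have det0 : ev (\det PA) != 0.
  rewrite -det_map_mx (mkmx_eval sP Ox0); have := congr1 determinant (CP Ox0).
  rewrite det_mulmx det1 => H; apply/eqP => D0; move: H; rewrite D0 mulr0 => /esym/eqP.
  by rewrite oner_eq0.
have -> : 'D_(e k x0) rho x0 = 2 ^- n * ev (eA k rhoA).
  have -> : 'D_(e k x0) rho x0 = 'D_(e k x0) (fun x => 2 ^- n *: rhoA x) x0.
    by apply: near_eq_derive; apply: (open_near oO Ox0) => y Oy; exact: rhoAE.
  have D : is_derive x0 (e k x0) (fun x => 2 ^- n *: rhoA x) (2 ^- n *: 'D_(e k x0) rhoA x0).
    by apply: is_deriveZ; exact: (smooth_is_derive _ (sfunP rhoA) Ox0).
  have [_ ->] := D; congr (_ * _); exact: esym (sf_derE (se k) _ Ox0).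
have -> : rho x0 = 2 ^- n * ev rhoA by exact: rhoAE.
move: (ev (\det PA)) det0 (ev rhoA) (ev (eA k rhoA)) (\tr _) (2 ^- n) => D D0 r r' t c H.
have : D * (r' + t * r) = 0 by rewrite -[RHS]H; ring.
move/eqP; rewrite mulf_eq0 (negbTE D0) addr_eq0 => /eqP ->.
by ring.
Qed.

Definition weighted_gradient x : vec := u x *m G x *m E x.
Local Notation Y := weighted_gradient.

Lemma smooth_weighted_gradient : smooth_on O Y.
Proof. by apply: (smooth_mulmx oO) => //; exact: (smooth_mulmx oO su sG). Qed.

Let y j x := (u x *m G x) 0 j.
Let sy j : smooth_on O (y j).
Proof. by have := smooth_mulmx oO su sG; move/(smooth_mx oO); apply. Qed.

Let Dy j v : 'D_v (y j) x0 = 'D_v (fun x => u x 0 j) x0.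
Proof.
have sui i : smooth_on O (fun x => u x 0 i) by move/(smooth_mx oO): su; apply.
have sGij i : smooth_on O (fun x => G x i j) by move/(smooth_mx oO): sG; apply.
have D i : is_derive x0 v (fun x => u x 0 i * G x i j) ((i == j)%:R * 'D_v (fun x => u x 0 i) x0).
  have [A B] := is_deriveM (smooth_is_derive v (sui i) Ox0) (smooth_is_derive v (sGij i) Ox0).
  apply: DeriveDef; first exact: A.
  apply: etrans B _; rewrite G1 scaler0 add0r G0 mxE.
  by [].
have [_] := @is_derive_sum _ _ _ _ (fun i x => u x 0 i * G x i j) x0 v _ D.
rewrite (_ : \sum_i _ = y j); last by apply/funext => x; rewrite fct_sumE /y mxE.
move=> ->; rewrite (bigD1 j) //= eqxx mul1r big1 ?addr0 // => i ij.
by rewrite (negbTE ij) mul0r.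
Qed.

(** Since [G] is the identity to first order and the fields [e j] are divergence-free at [x0], only
    the derivatives of the components of [u] remain. *)
Theorem divergence_weighted_gradient :
  \sum_i partial i (fun x => wedge_top (a x) (extder_loc a x) * Y x 0 i) x0 =
  wedge_top (a x0) (extder_loc a x0) * \sum_j 'D_(e j x0) (fun x => u x 0 j) x0.
Proof.
have srho : smooth_on O rho.
  apply: (smooth_eq oO) (smooth_mul oO (smooth_cst O (2 ^- n : R)) (sfunP rhoA)) => x Ox.
  exact: esym (rhoAE Ox).
have sYi i : smooth_on O (fun x => Y x 0 i).
  by have := smooth_weighted_gradient; move/(smooth_mx oO); apply.
have sei j i : smooth_on O (fun x => e j x 0 i) by have := se j; move/(smooth_mx oO); apply.
have D1 i : partial i (fun x => rho x * Y x 0 i) x0 =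
    rho x0 * partial i (fun x => Y x 0 i) x0 + Y x0 0 i * partial i rho x0.
  pose v : vec := delta_mx 0 i.
  by have [_] := is_deriveM (smooth_is_derive v srho Ox0) (smooth_is_derive v (sYi i) Ox0).
rewrite (eq_bigr _ (fun i _ => D1 i)) big_split /= -mulr_sumr.
have YE x i : Y x 0 i = \sum_j y j x * e j x 0 i.
  by rewrite /Y mxE; apply: eq_bigr => j _; rewrite [e j x 0 i]mxE.
have D2 i : partial i (fun x => Y x 0 i) x0 =
    \sum_j (y j x0 * partial i (fun x => e j x 0 i) x0 + e j x0 0 i * partial i (y j) x0).
  pose v : vec := delta_mx 0 i.
  have D j := is_deriveM (smooth_is_derive v (sy j) Ox0) (smooth_is_derive v (sei j i) Ox0).
  have [_] := @is_derive_sum _ _ _ _ (fun j x => y j x * e j x 0 i) x0 v _ D.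
  rewrite (_ : \sum_j _ = (fun x => Y x 0 i)); last by apply/funext => x; rewrite fct_sumE YE.
  by [].
have D3 : \sum_i Y x0 0 i * partial i rho x0 = \sum_j y j x0 * 'D_(e j x0) rho x0.
  under eq_bigr => i _ do rewrite YE mulr_suml.
  rewrite exchange_big; apply: eq_bigr => j _.
  rewrite (derive_partial _ (smooth_diff_fun oO srho Ox0)) mulr_sumr.
  by apply: eq_bigr => i _; rewrite mulrA.
rewrite D3 (eq_bigr _ (fun i _ => D2 i)) exchange_big mulr_sumr -big_split mulr_sumr.
apply: eq_bigr => j _; rewrite density_derivative big_split /= -mulr_sumr.
have -> : \tr ('J (e j) x0) = \sum_i partial i (fun x => e j x 0 i) x0.
  by apply: eq_bigr => i _; exact: (jacobianE _ _ (smooth_differentiable oO (se j) Ox0)).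
have -> : \sum_i e j x0 0 i * partial i (y j) x0 = 'D_(e j x0) (fun x => u x 0 j) x0.
  rewrite -Dy; exact: esym (derive_partial _ (smooth_diff_fun oO (sy j) Ox0)).
move: (rho x0) (y j x0) (\sum_i _) ('D_(e j x0) _ _) => r q s t.
by ring.
Qed.

End Divergence.

Lemma near_open (T : topologicalType) (x : T) (P : set T) : (\forall y \near x, P y) ->
  exists2 A : set T, open A /\ A x & A `<=` P.
Proof.
by move=> H; exists P^°; [split; [exact: open_interior|exact: H]|exact: interior_subset].
Qed.

(** * The change formula on an open set *)

Section LocalConformalChange.
Context {R : realType} {n : nat}.
Let d := n.*2.
Variables (O : set 'rV[R]_d.+1) (V V' : set 'rV[R]_d).
Hypotheses (oO : open O) (oV : open V) (oV' : open V').
Local Notation vec := 'rV[R]_d.+1.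
Variables (a : vec -> 'cV[R]_d.+1) (X X' : vec -> vec) (Jc : vec -> 'M[R]_d.+1).
Variables (p p' : vec -> 'rV[R]_d) (h h' : 'rV[R]_d -> 'M[R]_d) (x0 : vec).
Local Notation f := (contact_ham a X').
Hypotheses (Ox0 : O x0) (sa : smooth_on O a) (sX : smooth_on O X) (sX' : smooth_on O X').
Hypotheses (sp : smooth_on O p) (sp' : smooth_on O p').
Hypotheses (aX : forall x, O x -> X x *m a x = 1%:M).
Hypotheses (XOm : forall x, O x -> X x *m extder_loc a x = 0).
Hypotheses (X'Om : forall x j, O x -> (X' x *m extder_loc a x) 0 j = - partial j f x).
Hypotheses (f_gt0 : forall x, O x -> 0 < f x).
Hypotheses (JD : forall x (v : vec), O x -> v *m a x = 0 ->
  v *m Jc x *m a x = 0 /\ v *m Jc x *m Jc x = - v).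
Hypotheses (pV : forall x, O x -> V (p x)) (pV' : forall x, O x -> V' (p' x)).
Hypotheses (fullp : forall x, O x -> row_full ('J p x)).
Hypotheses (fullp' : forall x, O x -> row_full ('J p' x)).
Hypotheses (Xp : forall x, O x -> X x *m 'J p x = 0).
Hypotheses (X'p' : forall x, O x -> X' x *m 'J p' x = 0).
Hypotheses (rh : riemannian_metric_on h V) (rh' : riemannian_metric_on h' V').
Hypotheses (hp : forall x (v w : vec), O x -> v *m a x = 0 -> w *m a x = 0 ->
  v *m ('J p x *m h (p x) *m ('J p x)^T) *m w^T =
  2^-1 *: (v *m extder_loc a x *m (w *m Jc x)^T)).
Hypotheses (hp' : forall x (v w : vec), O x -> v *m a x = 0 -> w *m a x = 0 ->
  v *m ('J p' x *m h' (p' x) *m ('J p' x)^T) *m w^T =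
  (2^-1 * (f x)^-1) *: (v *m extder_loc a x *m (w *m Jc x)^T)).

(** The gradient of log f in a form that mentions neither frame nor quotient (see
    [transverse_gradient]); in this form it is a vector field that makes sense globally. *)
Definition conformal_gradient x : vec :=
  (- 2 * (f x)^-1) *: (X' x *m (1%:M - a x *m X x) *m Jc x).

(** The frame depends on the point, so [E] and [Q] are given existentially with the facts used about
    them: at critical points [E] is a trace of the Hessian over the horizontal basis [e0], for the
    uniqueness; near every point it is a divergence, for the integral. *)
Theorem local_conformal_change : exists (e0 : 'M[R]_(d, d.+1)) (E Q : R),
  [/\ 0 <= Q,
      scalar_curvature h' (p' x0) =
        f x0 * (scalar_curvature h (p x0) + (d%:R + 2) * E - Q),
      (forall v, 'D_v f x0 = 0) ->
        Q = 0 /\ f x0 * E = \sum_i 'D_(row i e0) ('D_(row i e0) f) x0,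
      e0 *m a x0 = 0 /\ (forall v : vec, v *m a x0 = 0 -> exists w, v = w *m e0)
    & exists2 O1 : set vec, open O1 /\ O1 x0 & smooth_on O1 conformal_gradient /\
       \sum_i partial i (fun x => wedge_top (a x) (extder_loc a x) * conformal_gradient x 0 i) x0 =
       wedge_top (a x0) (extder_loc a x0) * E].
Proof.
have [_ symh posh] := rh; have Vx0 := pV Ox0.
have [Q QE] := posdef_orthonormal (symh _ Vx0) (posh _ Vx0).
have [uQ _] := mulmx1_unit (etrans (mulmxA _ _ _) QE).
have uh0 : h (p x0) \in unitmx by apply: posdef_unit; [exact: symh|exact: posh].
pose L := invmx Q; have uL : L \in unitmx by rewrite unitmx_inv.
have hQ : invmx (h (p x0)) = Q^T *m Q.
  apply: (can_inj (mulKmx uh0)); rewrite (mulmxV uh0).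
  apply: (can_inj (mulKmx uQ)); rewrite mulmx1 !mulmxA QE mul1mx.
  by [].
have Lh : L^T *m invmx (h (p x0)) *m L = 1%:M.
  by rewrite hQ mulmxA -trmx_mul (mulmxV uQ) trmx1 mul1mx (mulmxV uQ).
pose psi := normal_chart h (p x0) L.
have spsi U : smooth_on U psi by exact: smooth_normal_chart.
pose g x := \det ('J psi (p x)).
have sg : smooth_on O g.
  apply: (smooth_det oO); apply: (smooth_comp oO oV pV sp).
  exact: (smooth_jacobian oV (spsi _)).
pose W0 := @OpenSet R d V oV; pose W0' := @OpenSet R d V' oV'.
have uhV y : V y -> h y \in unitmx by move=> Vy; apply: posdef_unit; [exact: symh|exact: posh].
have shV : smooth_on V h by case: rh.
have g0 : g x0 != 0.
  by rewrite /g (@jacobian_normal_chart0 R d W0 h (p x0) L Vx0 shV symh uhV) -unitfE -unitmxE.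
have nO : nbhs x0 O by exact: open_nbhs_nbhs.
(* The normal chart has an invertible Jacobian at the base point only by construction; [O1] is where
   this persists. *)
have [ O1 H1 O1s] : exists2 O1 : set vec, open O1 /\ O1 x0 & O1 `<=` [set x | O x /\ g x != 0].
  apply: near_open; near=> x; split; first by near: x.
  by near: x; apply: near_neq0 g0; exact: (smooth_cont sg Ox0).
case: H1 => oO1 O1x0; have sub : O1 `<=` O by move=> x /O1s [].
pose W := @OpenSet R d.+1 O1 oO1.
have uJ x : O1 x -> 'J psi (p x) \in unitmx by move=> /O1s [_]; rewrite unitmxE unitfE.
have S U F (sF : @smooth_on R vec U O F) : smooth_on O1 F := smooth_sub sub sF.
have Sub (P : vec -> Prop) : (forall x, O x -> P x) -> forall x, O1 x -> P x by move=> H x /sub; exact: H.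
have JD1 x v (Hx : O1 x) := JD (v := v) (sub _ Hx).
have hp1 x v w (Hx : O1 x) := hp (v := v) (w := w) (sub _ Hx).
have hp1' x v w (Hx : O1 x) := hp' (v := v) (w := w) (sub _ Hx).
have X'Om1 x j (Hx : O1 x) := X'Om j (sub _ Hx).
pose phi := base_chart p h x0 L.
have C := @conformal_scalar_curvature R d W W0 W0' a X X' Jc p p' h h' x0 L O1x0 (S _ _ sa) (S _ _ sX)
  (S _ _ sX') (S _ _ sp) (S _ _ sp') (Sub _ aX) (Sub _ XOm) X'Om1 (Sub _ f_gt0) JD1 (Sub _ pV) (Sub _ pV')
  (Sub _ fullp) (Sub _ fullp') (Sub _ Xp) (Sub _ X'p') rh rh' hp1 hp1' uL Lh uJ.
pose u := log_gradient a X' p h x0 L.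
pose E := \sum_i 'D_(e_ a phi i x0) (fun x => u x 0 i) x0.
exists (lift a phi x0), E, (d%:R * (d%:R + 2) / 4 * \sum_i (u x0 0 i) ^+ 2).
have sf : smooth_on O1 f.
  by have := smooth_mulmx oO1 (S _ _ sX') (S _ _ sa); move/(smooth_mx oO1); apply.
have fn x : O1 x -> f x != 0 by move=> /sub /f_gt0; rewrite lt0r => /andP [].
have sphi : smooth_on O1 phi by apply: (smooth_comp oO1 oV (Sub _ pV) (S _ _ sp)); exact: spsi.
have Jphi x : O1 x -> 'J phi x = 'J p x *m 'J psi (p x).
  move=> Ox; apply: jacobian_comp; first exact: (smooth_differentiable oO1 (S _ _ sp) Ox).
  exact: (smooth_differentiable oV (spsi _) (pV (sub _ Ox))).
have fullphi x : O1 x -> row_full ('J phi x).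
  move=> Ox; have /row_fullP [B BJ] := fullp (sub _ Ox); apply/row_fullP.
  exists (invmx ('J psi (p x)) *m B); rewrite (Jphi x Ox) mulmxA -(mulmxA (invmx _)) BJ mulmx1.
  exact: mulVmx (uJ _ Ox).
have Xphi x : O1 x -> X x *m 'J phi x = 0.
  by move=> Ox; rewrite (Jphi x Ox) mulmxA (Xp (sub _ Ox)) mul0mx.
have se i : smooth_on O1 (e_ a phi i).
  exact: (@smooth_e R d W a X phi (S _ _ sa) sphi (Sub _ aX) fullphi Xphi).
have sfi : smooth_on O1 (fun x => (f x)^-1) by exact: (smooth_inv oO1 fn sf).
have sdf i : smooth_on O1 (fun x => 'D_(e_ a phi i x) f x) by exact: (smooth_derive_along oO1 sf (se i)).
have ui i : (fun x => u x 0 i) = (fun x => (f x)^-1 * 'D_(e_ a phi i x) f x).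
  by apply/funext => x; rewrite mxE.
have su : smooth_on O1 u.
  apply/(smooth_mx oO1) => i j; have -> : i = 0 by exact: ord1.
  by rewrite ui; exact: (smooth_mul oO1 sfi (sdf j)).
split.
- apply: mulr_ge0; last by apply: sumr_ge0 => i _; exact: sqr_ge0.
  by apply: divr_ge0 => //; apply: mulr_ge0 => //; apply: addr_ge0.
- exact: C.
- move=> df; split.
    rewrite big1 ?mulr0 // => i _; rewrite [u x0 0 i]mxE df mulr0.
    by rewrite expr0n.
  rewrite /E mulr_sumr; apply: eq_bigr => i _; rewrite ui.
  have [_ D] := is_deriveM (smooth_is_derive (e_ a phi i x0) sfi O1x0) (smooth_is_derive (e_ a phi i x0) (sdf i) O1x0).
  have -> : 'D_(e_ a phi i x0) (fun x => (f x)^-1 * 'D_(e_ a phi i x) f x) x0 =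
     (f x0)^-1 * 'D_(e_ a phi i x0) (fun x => 'D_(e_ a phi i x) f x) x0.
    by apply: etrans D _; rewrite df scale0r addr0.
  rewrite mulrA (divff (fn _ O1x0)) mul1r.
  (* [second_derive_pullback] along the identity: at a critical point of [f] the derivative of the
     frame field does not contribute. *)
  have sid : smooth_on O1 (id : vec -> vec) by exact: smooth_id.
  have crit k : partial k f (id x0) = 0 by exact: df.
  have := @second_derive_pullback R d.+1 d.+1 W W id sid (fun x Ox => Ox) f (e_ a phi i) (e_ a phi i x0) x0 sf (se i) O1x0 crit.
  by rewrite jacobian_id !mulmx1.
- split; first exact: (@lift_form R d W a X phi (Sub _ aX) fullphi Xphi).
  move=> v va; exists (v *m 'J phi x0).
  have := @frame_decomposition R d W a X phi (Sub _ aX) fullphi Xphi 1 x0 v O1x0.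
  by rewrite va mul0mx add0r.
pose G := frame_inverse_metric p h x0 L.
have TG x (Ox : O1 x) : u x *m G x *m lift a phi x = conformal_gradient x.
  exact: (@transverse_gradient R d W W0 a X X' Jc p h x0 L (S _ _ sa)
    (S _ _ sX') (S _ _ sp) (Sub _ aX) (Sub _ XOm) X'Om1 (Sub _ f_gt0) JD1 (Sub _ pV)
    (Sub _ fullp) (Sub _ Xp) rh hp1 uJ x Ox).
have sG : smooth_on O1 G.
  exact: (@smooth_frame_inverse_metric R d W W0 p h x0 L (S _ _ sp) (Sub _ pV) rh).
have G0 : G x0 = 1%:M.
  exact: (@frame_inverse_metric0 R d W W0 p h x0 L O1x0 (Sub _ pV) rh Lh).
have G1 v i j : 'D_v (fun x => G x i j) x0 = 0.
  exact: (@frame_inverse_metric1 R d W W0 p h x0 L O1x0 (S _ _ sp) (Sub _ pV) rh v i j).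
have OmG x : O1 x -> Om_ a phi x *m G x *m (Om_ a phi x)^T *m G x = 4%:R%:M.
  move=> Ox.
  rewrite (@frame_compatible R d W W0 a X Jc p h x0 L (S _ _ sp) (Sub _ aX)
     JD1 (Sub _ pV) (Sub _ fullp) (Sub _ Xp) rh hp1 uJ x Ox) -scalemxAl.
  rewrite (mulmx1C (@frame_metricK R d W W0 a X p h x0 L (S _ _ sp) (Sub _ aX)
     (Sub _ pV) (Sub _ fullp) (Sub _ Xp) rh uJ x Ox)).
  by rewrite scalemx1.
exists O1 => //.
have sY := @smooth_weighted_gradient R n W a X phi (S _ _ sa) sphi (Sub _ aX) fullphi Xphi G u sG su.
split; first exact: (smooth_eq oO1 TG sY).
have D := @divergence_weighted_gradient R n W a X phi x0 O1x0 (S _ _ sa) (S _ _ sX) sphi (Sub _ aX)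
  (Sub _ XOm) fullphi Xphi G u sG su G0 G1 OmG.
apply: etrans _ D; apply: eq_bigr => i _; apply: near_eq_derive.
by apply: (open_near oO1 O1x0) => y Oy; rewrite -(TG y Oy).
Unshelve. all: by end_near.
Qed.

End LocalConformalChange.

(** * Charts and torus actions *)

Section ExteriorDerivative.
Context {R : realType} {m : nat}.
Variables (A A' : set 'rV[R]_m) (phi : 'rV[R]_m -> 'rV[R]_m) (al al' : 'rV[R]_m -> 'cV[R]_m).
Hypotheses (oA : open A) (oA' : open A') (sphi : smooth_on A phi) (sal' : smooth_on A' al').
Hypotheses (phiA : forall x, A x -> A' (phi x)).
Hypotheses (alE : forall x, A x -> al x = 'J phi x *m al' (phi x)).

(** Naturality of the exterior derivative: antisymmetrisation removes the second derivatives of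
    [phi], by Schwarz's theorem. *)
Lemma extder_loc_pullback x : A x ->
  extder_loc al x = 'J phi x *m extder_loc al' (phi x) *m ('J phi x)^T.
Proof.
move=> Ax; pose ph k y := phi y 0 k; pose a' k y := al' y k 0.
have sph k : smooth_on A (ph k) by move/(smooth_mx oA): sphi; apply.
have sa' k : smooth_on A' (a' k) by move/(smooth_mx oA'): sal'; apply.
have sa'p k : smooth_on A (fun y => a' k (phi y)).
  exact: (smooth_comp_fun oA oA' phiA sphi (sa' k)).
have JE y i k : A y -> 'J phi y i k = partial i (ph k) y.
  by move=> Ay; rewrite (jacobianE _ _ (smooth_differentiable oA sphi Ay)).
have chain i k : partial i (fun y => a' k (phi y)) x = \sum_l partial i (ph l) x * partial l (a' k) (phi x).
  have [_ E] := is_derive_comp (smooth_derivable (v := delta_mx 0 i) sphi Ax)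
    (smooth_diff_fun oA' (sa' k) (phiA Ax)).
  apply: etrans E _; rewrite (derive_partial _ (smooth_diff_fun oA' (sa' k) (phiA Ax))).
  apply: eq_bigr => l _; congr (_ * _).
  by have [_ <-] := (is_derive_mx _ _ _ _).1 (smooth_is_derive (delta_mx 0 i : 'rV[R]_m) sphi Ax) 0 l.
have P i j : partial i (fun y => al y j 0) x =
    \sum_k (partial j (ph k) x * partial i (fun y => a' k (phi y)) x
            + a' k (phi x) * partial i (partial j (ph k)) x).
  have -> : partial i (fun y => al y j 0) x = partial i (fun y => \sum_k partial j (ph k) y * a' k (phi y)) x.
    apply: near_eq_derive; apply: (open_near oA Ax) => y Ay; rewrite (alE Ay) mxE.
    by apply: eq_bigr => k _; rewrite (JE y j k Ay).
  have spj k : smooth_on A (partial j (ph k)) by exact: smooth_derive.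
  pose v : 'rV[R]_m := delta_mx 0 i.
  have D k := is_deriveM (smooth_is_derive v (spj k) Ax) (smooth_is_derive v (sa'p k) Ax).
  have [_] := @is_derive_sum _ _ _ _ (fun k y => partial j (ph k) y * a' k (phi y)) x v _ D.
  rewrite (_ : \sum_k _ = (fun y => \sum_k partial j (ph k) y * a' k (phi y))); last first.
    by apply/funext => y; rewrite fct_sumE.
  by [].
apply/matrixP => i j; rewrite mxE !P -sumrB.
have E k : partial j (ph k) x * partial i (fun y => a' k (phi y)) x
            + a' k (phi x) * partial i (partial j (ph k)) x
   - (partial i (ph k) x * partial j (fun y => a' k (phi y)) x
            + a' k (phi x) * partial j (partial i (ph k)) x) =
   \sum_l (partial i (ph l) x * partial j (ph k) x * partial l (a' k) (phi x)
     - partial i (ph k) x * partial j (ph l) x * partial l (a' k) (phi x)).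
  have -> : partial i (partial j (ph k)) x = partial j (partial i (ph k)) x.
    exact: (derive_schwarz _ _ oA (sph k 2%N)).
  rewrite !chain !mulr_sumr opprD addrACA subrr addr0 -sumrB; apply: eq_bigr => l _.
  by rewrite mulrA mulrA [partial j (ph k) x * _]mulrC.
under eq_bigr => k _ do rewrite E sumrB.
rewrite sumrB [RHS]mxE.
have -> : \sum_j0 ('J phi x *m extder_loc al' (phi x)) i j0 * ('J phi x)^T j0 j =
  \sum_k \sum_l partial i (ph l) x * partial j (ph k) x * (partial l (a' k) (phi x) - partial k (a' l) (phi x)).
  apply: eq_bigr => k _; rewrite mxE mulr_suml; apply: eq_bigr => l _.
  by rewrite (JE x i l Ax) [('J phi x)^T k j]mxE (JE x j k Ax) [extder_loc _ _ _ _]mxE mulrAC.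
have -> : \sum_k \sum_l partial i (ph l) x * partial j (ph k) x * (partial l (a' k) (phi x) - partial k (a' l) (phi x))
  = \sum_k \sum_l partial i (ph l) x * partial j (ph k) x * partial l (a' k) (phi x)
  - \sum_k \sum_l partial i (ph l) x * partial j (ph k) x * partial k (a' l) (phi x).
  rewrite -sumrB; apply: eq_bigr => k _; rewrite -sumrB; apply: eq_bigr => l _.
  by rewrite mulrBr.
by congr (_ - _); rewrite exchange_big.
Qed.
End ExteriorDerivative.

(** * Tensors in charts *)

Section ChartCalculus.
Context {R : realType} {N : topologicalType} {m : nat}.
Variable M : smooth_structure R N m.
Implicit Types (c : chart R N m) (q : N).

Lemma cinvK c x : atlas M c -> cimg c x -> cdom c (cinv c x) /\ cmap c (cinv c x) = x.
Proof. by move=> /atlas_chart [_ _ K _ _] [q qc <-]; rewrite K. Qed.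

Lemma cmapK c q : atlas M c -> cdom c q -> cinv c (cmap c q) = q.
Proof. by move=> /atlas_chart [_ _ K _ _]; exact: K. Qed.

Lemma cimg_cmap c q : cdom c q -> cimg c (cmap c q).
Proof. by exists q. Qed.

Lemma open_cdom c : atlas M c -> open (cdom c). Proof. by move=> /atlas_chart []. Qed.
Lemma open_cimg c : atlas M c -> open (cimg c). Proof. by move=> /atlas_chart []. Qed.

Lemma chart_image c (U : set N) : atlas M c ->
  cmap c @` (cdom c `&` U) = cimg c `&` cinv c @^-1` U.
Proof.
move=> ac; apply/seteqP; split=> [_ [q [qc Uq] <-]|x [xi Ux]].
  by split; [exact: cimg_cmap|rewrite /preimage /= (cmapK ac qc)].
by have [d E] := cinvK ac xi; exists (cinv c x).
Qed.

Lemma continuous_open_preimage (S T : topologicalType) (A : set S) (f : S -> T) (U : set T) :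
  open A -> (forall x, A x -> {for x, continuous f}) -> open U -> open (A `&` f @^-1` U).
Proof.
move=> oA cf oU; rewrite openE => x [Ax Ux]; apply: filterI; first exact: open_nbhs_nbhs.
exact: (cf x Ax U (open_nbhs_nbhs (conj oU Ux))).
Qed.

Lemma open_chart_image c (U : set N) : atlas M c -> open U -> open (cmap c @` (cdom c `&` U)).
Proof.
move=> ac oU; rewrite chart_image //; apply: continuous_open_preimage => //; first exact: open_cimg.
by move=> x cx; have [_ _ _ _] := atlas_chart ac; exact.
Qed.

Lemma open_chart_preimage c (U : set 'rV[R]_m) : atlas M c -> open U -> open (cdom c `&` cmap c @^-1` U).
Proof.
move=> ac oU; apply: continuous_open_preimage => //; first exact: open_cdom.
by move=> x cx; have [_ _ _ + _] := atlas_chart ac; exact.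
Qed.

Lemma near_cinv c q (P : set N) : atlas M c -> cdom c q -> (\forall y \near q, P y) ->
  \forall x \near cmap c q, P (cinv c x).
Proof.
move=> ac qc H; have [_ _ _ _ /(_ _ (cimg_cmap qc))] := atlas_chart ac.
by apply; rewrite /= (cmapK ac qc).
Qed.

Lemma near_cmap c q (P : set 'rV[R]_m) : atlas M c -> cdom c q -> (\forall x \near cmap c q, P x) ->
  \forall y \near q, P (cmap c y).
Proof. by move=> ac qc H; have [_ _ _ /(_ _ qc) + _] := atlas_chart ac; exact. Qed.

Local Notation tr c c' := (cmap c' \o cinv c).
Local Notation overlap c c' := (cmap c @` (cdom c `&` cdom c')).

Lemma overlapP c q c' : cdom c q -> cdom c' q -> overlap c c' (cmap c q).
Proof. by exists q. Qed.

Lemma smooth_transition c c' : atlas M c -> atlas M c' -> smooth_on (overlap c c') (tr c c').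
Proof. exact: atlas_smooth. Qed.

Lemma differentiable_transition c c' q : atlas M c -> atlas M c' -> cdom c q -> cdom c' q ->
  differentiable (tr c c') (cmap c q).
Proof.
move=> ac ac' qc qc'; apply: (smooth_differentiable (open_chart_image ac (open_cdom ac'))).
  exact: smooth_transition.
exact: overlapP.
Qed.

Lemma near_transition c c' q (E : Type) (F : N -> E) : atlas M c -> atlas M c' -> cdom c q -> cdom c' q ->
  \forall x \near cmap c q, (F \o cinv c) x = ((F \o cinv c') \o tr c c') x.
Proof.
move=> ac ac' qc qc'; apply: (near_cinv ac qc (P := fun y => F y = F (cinv c' (cmap c' y)))).
by apply: (open_near (open_cdom ac') qc') => y yc'; rewrite (cmapK ac' yc').
Qed.

Lemma differentiable_change c c' q d (F : N -> 'rV[R]_d) : atlas M c -> atlas M c' ->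
  cdom c q -> cdom c' q -> differentiable (F \o cinv c') (cmap c' q) ->
  differentiable ((F \o cinv c') \o tr c c') (cmap c q).
Proof.
move=> ac ac' qc qc' dF; apply: differentiable_comp; first exact: differentiable_transition.
by rewrite /= (cmapK ac qc).
Qed.

Lemma jacobian_change c c' q d (F : N -> 'rV[R]_d) : atlas M c -> atlas M c' ->
  cdom c q -> cdom c' q -> differentiable (F \o cinv c) (cmap c q) ->
  differentiable (F \o cinv c') (cmap c' q) ->
  'J (F \o cinv c) (cmap c q) = jac c c' q *m 'J (F \o cinv c') (cmap c' q).
Proof.
move=> ac ac' qc qc' dF dF'.
rewrite (jacobian_near (near_transition F ac ac' qc qc') dF (differentiable_change ac ac' qc qc' dF')).
rewrite jacobian_comp /jac /= ?(cmapK ac qc) //.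
exact: differentiable_transition.
Qed.

Lemma jac_comp c c' c'' q : atlas M c -> atlas M c' -> atlas M c'' ->
  cdom c q -> cdom c' q -> cdom c'' q -> jac c c'' q = jac c c' q *m jac c' c'' q.
Proof.
by move=> ac ac' ac'' qc qc' qc''; apply: jacobian_change => //; exact: differentiable_transition.
Qed.

Lemma jac_id c q : atlas M c -> cdom c q -> jac c c q = 1%:M.
Proof.
move=> ac qc; rewrite -(jacobian_id (cmap c q)); apply: jacobian_near.
- apply: (open_near (open_cimg ac) (cimg_cmap qc)) => x xc.
  by have [_ E] := cinvK ac xc; rewrite /= E.
- exact: differentiable_transition.
- by apply: (smooth_differentiable openT) => //; exact: smooth_id.
Qed.

Lemma jacK c c' q : atlas M c -> atlas M c' -> cdom c q -> cdom c' q ->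
  jac c c' q *m jac c' c q = 1%:M.
Proof. by move=> ac ac' qc qc'; rewrite -jac_comp // jac_id. Qed.

Lemma atlas_at q : atlas M (chart_at M q). Proof. by case: (atlas_chart_at M q). Qed.
Lemma cdom_at q : cdom (chart_at M q) q. Proof. by case: (atlas_chart_at M q). Qed.
Hint Resolve atlas_at cdom_at : core.

Lemma form_locE c (a : N -> 'cV[R]_m) q : atlas M c -> cdom c q ->
  form_loc M c a (cmap c q) = jac c (chart_at M q) q *m a q.
Proof. by move=> ac qc; rewrite /form_loc (cmapK ac qc). Qed.

Lemma vfield_locE c (X : N -> 'rV[R]_m) q : atlas M c -> cdom c q ->
  vfield_loc M c X (cmap c q) = X q *m jac (chart_at M q) c q.
Proof. by move=> ac qc; rewrite /vfield_loc (cmapK ac qc). Qed.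

Lemma form_loc_change c c' (a : N -> 'cV[R]_m) q : atlas M c -> atlas M c' -> cdom c q -> cdom c' q ->
  form_loc M c a (cmap c q) = jac c c' q *m form_loc M c' a (cmap c' q).
Proof. move=> ac ac' qc qc'; apply: etrans (form_locE a ac qc) _.
apply: etrans _ (congr1 (mulmx (jac c c' q)) (esym (form_locE a ac' qc'))).
have E := jac_comp ac ac' (atlas_at q) qc qc' (cdom_at q).
exact: etrans (congr1 (fun B => B *m a q) E) (esym (mulmxA (jac c c' q) (jac c' (chart_at M q) q) (a q))).
Qed.

Lemma vfield_loc_change c c' (X : N -> 'rV[R]_m) q : atlas M c -> atlas M c' -> cdom c q -> cdom c' q ->
  vfield_loc M c' X (cmap c' q) = vfield_loc M c X (cmap c q) *m jac c c' q.
Proof. move=> ac ac' qc qc'; rewrite (vfield_locE X ac qc) (vfield_locE X ac' qc') -mulmxA.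
by rewrite -(jac_comp (atlas_at q) ac ac' (cdom_at q) qc qc'). Qed.

Lemma pairing_loc c (a : N -> 'cV[R]_m) (X : N -> 'rV[R]_m) q : atlas M c -> cdom c q ->
  vfield_loc M c X (cmap c q) *m form_loc M c a (cmap c q) = X q *m a q.
Proof.
move=> ac qc; rewrite vfield_locE // form_locE // mulmxA -(mulmxA (X q)) jacK // mulmx1.
by [].
Qed.

Lemma extder_change c c' (a : N -> 'cV[R]_m) q : atlas M c -> atlas M c' -> cdom c q -> cdom c' q ->
  smooth_on (cimg c') (form_loc M c' a) ->
  extder_loc (form_loc M c a) (cmap c q) =
  jac c c' q *m extder_loc (form_loc M c' a) (cmap c' q) *m (jac c c' q)^T.
Proof.
move=> ac ac' qc qc' sa.
have oA := open_chart_image ac (open_cdom ac').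
have im x : overlap c c' x -> cimg c' (tr c c' x).
  by case=> p [pc pc'] <-; rewrite /= (cmapK ac pc); exact: cimg_cmap.
have := @extder_loc_pullback R m _ _ (tr c c') (form_loc M c a) (form_loc M c' a)
   oA (open_cimg ac') (smooth_transition ac ac') sa im _ (cmap c q) (overlapP qc qc').
rewrite /= (cmapK ac qc) -/(jac c c' q); apply=> _ [p [pc pc'] <-].
by rewrite /= (cmapK ac pc) -/(jac c c' p) -form_loc_change.
Qed.

Lemma extderE c (a : N -> 'cV[R]_m) q : atlas M c -> cdom c q -> smooth_form M a ->
  extder_loc (form_loc M c a) (cmap c q) =
  jac c (chart_at M q) q *m extder M a q *m (jac c (chart_at M q) q)^T.
Proof. by move=> ac qc sa; apply: extder_change => //; exact: sa. Qed.

End ChartCalculus.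

Lemma continuous_pair_at (S T1 T2 : topologicalType) (f : S -> T1) (g : S -> T2) x :
  {for x, continuous f} -> {for x, continuous g} -> {for x, continuous (fun y => (f y, g y))}.
Proof. by move=> cf cg; exact: (cvg_pair cf cg). Qed.

Lemma continuous_cst_at (S T : topologicalType) (t : T) (x : S) : {for x, continuous (fun=> t)}.
Proof. exact: cvg_cst. Qed.

Lemma continuous_id_at (S : topologicalType) (x : S) : {for x, continuous id}.
Proof. by []. Qed.

(** * Slices of a product *)

Section ProductSlices.
Context {R : realType} {V W : normedModType R}.

(** As linear maps the slices make partial functions into compositions with affine maps, to which
    [Ck_on_affine] applies. *)
Definition slice_l (v : V) : V * W := (v, 0).
Definition slice_r (w : W) : V * W := (0, w).
Fact slice_l_linear : linear slice_l.
Proof. by move=> a u v; rewrite /slice_l; congr (_, _); rewrite /= scaler0 addr0. Qed.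
Fact slice_r_linear : linear slice_r.
Proof. by move=> a u v; rewrite /slice_r; congr (_, _); rewrite /= scaler0 addr0. Qed.
HB.instance Definition _ := GRing.isLinear.Build R V (V * W)%type *:%R slice_l slice_l_linear.
HB.instance Definition _ := GRing.isLinear.Build R W (V * W)%type *:%R slice_r slice_r_linear.

Lemma slice_l_continuous : continuous slice_l.
Proof. by move=> v; apply: cvg_pair => //=; exact: cvg_cst. Qed.
Lemma slice_r_continuous : continuous slice_r.
Proof. by move=> v; apply: cvg_pair => //=; exact: cvg_cst. Qed.

Lemma is_derive_slice_l (Z : normedModType R) (F : V * W -> Z) v w u dF :
  is_derive ((v, w) : V * W) ((u, 0) : V * W) F dF <-> is_derive v u (fun v => F (v, w)) dF.
Proof.
have E : (fun t : R => F ((v, w) + t *: ((u, 0) : V * W))) = (fun t => F (v + t *: u, w)).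
  by apply/funext => t; congr (F (_, _)); rewrite /= scaler0 addr0.
by split=> /is_derive_line H; apply/is_derive_line; rewrite E in H *.
Qed.

Lemma is_derive_slice_r (Z : normedModType R) (F : V * W -> Z) v w u dF :
  is_derive ((v, w) : V * W) ((0, u) : V * W) F dF <-> is_derive w u (fun w => F (v, w)) dF.
Proof.
have E : (fun t : R => F ((v, w) + t *: ((0, u) : V * W))) = (fun t => F (v, w + t *: u)).
  by apply/funext => t; congr (F (_, _)); rewrite /= scaler0 addr0.
by split=> /is_derive_line H; apply/is_derive_line; rewrite E in H *.
Qed.

Lemma smooth_slice_l (Z : normedModType R) (U : set (V * W)) (F : V * W -> Z) w :
  smooth_on U F -> smooth_on [set v | U (v, w)] (fun v => F (v, w)).
Proof.
move=> sF k; have := Ck_on_affine (L := slice_l) (slice_r w) slice_l_continuous (sF k).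
have E v : slice_l v + slice_r w = (v, w) by congr (_, _); rewrite /= ?addr0 ?add0r.
have F1 : (fun x => F (slice_l x + slice_r w)) = (fun v => F (v, w)).
  by apply/funext => v; rewrite E.
have U1 : [set x | U (slice_l x + slice_r w)] = [set v | U (v, w)].
  by apply/funext => v /=; rewrite E.
by rewrite F1 U1.
Qed.

Lemma smooth_slice_r (Z : normedModType R) (U : set (V * W)) (F : V * W -> Z) v :
  smooth_on U F -> smooth_on [set w | U (v, w)] (fun w => F (v, w)).
Proof.
move=> sF k; have := Ck_on_affine (L := slice_r) (slice_l v) slice_r_continuous (sF k).
have E w : slice_r w + slice_l v = (v, w) by congr (_, _); rewrite /= ?addr0 ?add0r.
have F1 : (fun x => F (slice_r x + slice_l v)) = (fun w => F (v, w)).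
  by apply/funext => w; rewrite E.
have U1 : [set x | U (slice_r x + slice_l v)] = [set w | U (v, w)].
  by apply/funext => w /=; rewrite E.
by rewrite F1 U1.
Qed.
End ProductSlices.

(** * Smooth actions and their generators *)

Section Action.
Context {R : realType} {N : topologicalType} {m k : nat}.
Variables (M : smooth_structure R N m) (T : 'rV[R]_k -> N -> N).
Hypothesis action : smooth_action M T.
Local Notation PV := ('rV[R]_k * 'rV[R]_m)%type.
Local Notation gen := (generator M T).

Lemma act0 p : T 0 p = p. Proof. by case: action. Qed.
Lemma actD a b p : T (a + b) p = T a (T b p). Proof. by case: action. Qed.
Lemma actC a b p : T a (T b p) = T b (T a p). Proof. by rewrite -!actD addrC. Qed.
Lemma act_continuous : continuous (fun z : 'rV[R]_k * N => T z.1 z.2). Proof. by case: action. Qed.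
Lemma act_continuous_par q : continuous (T ^~ q).
Proof.
move=> a; apply: (@continuous_comp _ _ _ (fun a => (a, q)) (fun z : 'rV[R]_k * N => T z.1 z.2)).
  by apply: continuous_pair_at; [exact: continuous_id_at|exact: continuous_cst_at].
exact: act_continuous.
Qed.

Definition actdom (c c' : chart R N m) : set PV := [set z | cimg c z.2 /\ cdom c' (T z.1 (cinv c z.2))].
Definition act_loc (c c' : chart R N m) (z : PV) : 'rV[R]_m := cmap c' (T z.1 (cinv c z.2)).

Lemma smooth_act_loc c c' : atlas M c -> atlas M c' -> smooth_on (actdom c c') (act_loc c c').
Proof. by case: action => _ _ _; exact. Qed.

Lemma act_loc_continuous c z : atlas M c -> cimg c z.2 ->
  {for z, continuous (fun z : PV => T z.1 (cinv c z.2))}.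
Proof.
move=> ac zi; have ci : {for z.2, continuous (cinv c)} by have [_ _ _ _] := atlas_chart ac; exact.
apply: (@continuous_comp _ _ _ (fun z : PV => (z.1, cinv c z.2)) (fun z : 'rV[R]_k * N => T z.1 z.2)).
  apply: continuous_pair_at; first exact: cvg_fst.
  by apply: (@continuous_comp _ _ _ (fun z : PV => z.2) (cinv c)); [exact: cvg_snd|exact: ci].
exact: act_continuous.
Qed.

Lemma open_actdom c c' : atlas M c -> atlas M c' -> open (actdom c c').
Proof.
move=> ac ac'; have -> : actdom c c' = ([set z : PV | cimg c z.2] `&` (fun z : PV => T z.1 (cinv c z.2)) @^-1` cdom c').
  by [].
apply: continuous_open_preimage; last exact: (open_cdom ac').
- have -> : [set z : PV | cimg c z.2] = snd @^-1` cimg c by [].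
  by apply: open_comp; [move=> z _; exact: cvg_snd|exact: (open_cimg ac)].
- by move=> z zi; exact: act_loc_continuous.
Qed.

Lemma actdom0 c x : atlas M c -> cimg c x -> actdom c c (0, x).
Proof. by move=> ac xi; split=> //=; rewrite act0; have [] := cinvK ac xi. Qed.

Lemma act_loc_pt c c' a q : atlas M c -> cdom c q -> act_loc c c' (a, cmap c q) = cmap c' (T a q).
Proof. by move=> ac qc; rewrite /act_loc /= (cmapK ac qc). Qed.

Lemma actdom_pt c c' a q : atlas M c -> cdom c q -> cdom c' (T a q) -> actdom c c' (a, cmap c q).
Proof. by move=> ac qc H; split; [exact: cimg_cmap|rewrite /= (cmapK ac qc)]. Qed.

Lemma smooth_orbit c q : atlas M c ->
  smooth_on [set a | cdom c (T a q)] (fun a : 'rV[R]_k => cmap c (T a q)).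
Proof.
move=> ac; have ac0 := atlas_at M q; have qc0 := cdom_at M q.
have := @smooth_slice_l _ _ _ _ _ _ (cmap (chart_at M q) q) (smooth_act_loc ac0 ac).
have -> : (fun v => act_loc (chart_at M q) c (v, cmap (chart_at M q) q)) = fun a => cmap c (T a q).
  by apply/funext => a; rewrite act_loc_pt.
by apply: smooth_sub => a aq; exact: actdom_pt.
Qed.

Lemma open_orbit c q : atlas M c -> open [set a | cdom c (T a q)].
Proof.
move=> ac; apply: (@open_comp _ _ (T ^~ q)); last exact: (open_cdom ac).
by move=> a _; exact: act_continuous_par.
Qed.

Lemma near_orbit c q : atlas M c -> cdom c q -> \forall a \near (0 : 'rV[R]_k), cdom c (T a q).
Proof.
move=> ac qc; have : nbhs (0 : 'rV[R]_k) [set a | cdom c (T a q)]; last by [].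
by apply: open_nbhs_nbhs; split; [exact: open_orbit|rewrite /= act0].
Qed.

Lemma differentiable_orbit c q a : atlas M c -> cdom c (T a q) ->
  differentiable (fun a : 'rV[R]_k => cmap c (T a q)) a.
Proof. move=> ac H; have := @smooth_differentiable R k 1 m [set a | cdom c (T a q)] (fun a : 'rV[R]_k => cmap c (T a q)) a.
by apply; [exact: open_orbit|exact: smooth_orbit|]. Qed.

Let generator_at b q : gen b q = 'D_b (fun a : 'rV[R]_k => cmap (chart_at M q) (T a q)) 0.
Proof.
have D := smooth_is_derive (x := 0) b (smooth_orbit q (atlas_at M q)).
have D0 : [set a | cdom (chart_at M q) (T a q)] 0 by rewrite /= act0; exact: cdom_at.
have [_ E] := (is_derive_line _ _ _ _).1 (D D0); rewrite -E /generator derive1E.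
by apply: near_eq_derive; apply: (open_near openT (x := 0 : R)) => // t _; rewrite add0r.
Qed.

Lemma generator_loc c b q : atlas M c -> cdom c q ->
  is_derive (0 : 'rV[R]_k) b (fun a : 'rV[R]_k => cmap c (T a q)) (vfield_loc M c (gen b) (cmap c q)).
Proof.
move=> ac qc; have ac0 := atlas_at M q; have qc0 := cdom_at M q.
have H0 : cdom c (T 0 q) by rewrite act0.
have H1 : cdom (chart_at M q) (T 0 q) by rewrite act0.
have D1 := smooth_is_derive b (smooth_orbit q ac) H0.
have D2 := smooth_is_derive b (smooth_orbit q ac0) H1.
have dt := differentiable_transition ac0 ac qc0 qc.
rewrite (vfield_locE (gen b) ac qc) generator_at.
suff <- : 'D_b (fun a : 'rV[R]_k => cmap c (T a q)) 0 =
   'D_b (fun a : 'rV[R]_k => cmap (chart_at M q) (T a q)) 0 *m jac (chart_at M q) c q by [].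
have dt' : differentiable (cmap c \o cinv (chart_at M q)) (cmap (chart_at M q) (T 0 q)) by rewrite act0.
have [_ E] := @is_derive_comp R _ _ _ _ (fun a : 'rV[R]_k => cmap (chart_at M q) (T a q)) 0 b
  (@ex_derive _ _ _ _ _ _ _ D2) dt'.
rewrite (act0 q) in E; rewrite /jac (mul_jacobian _ dt) -E.
apply: near_eq_derive; apply: filterS (near_orbit ac0 qc0) => a Ha.
by rewrite /= (cmapK ac0 Ha).
Qed.

Lemma generator_curve c b q t : atlas M c -> cdom c (T (t *: b) q) ->
  is_derive (t : R) 1 (fun s : R => cmap c (T (s *: b) q)) (vfield_loc M c (gen b) (cmap c (T (t *: b) q))).
Proof.
move=> ac H; have D := (is_derive_line _ _ _ _).1 (generator_loc b ac H); apply/is_derive_line.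
have -> // : (fun s : R => cmap c (T ((t + s *: 1) *: b) q)) =
   (fun s => cmap c (T (0 + s *: b) (T (t *: b) q))).
by apply/funext => s; rewrite add0r -actD -scalerDl addrC /GRing.scale /= mulr1.
Qed.

(** The generator of [b] at [q] is the differential at 0 of the orbit map of [q], applied to [b]. *)
Lemma generator_linear x b b' q : gen (x *: b + b') q = x *: gen b q + gen b' q.
Proof.
rewrite !generator_at; have H : cdom (chart_at M q) (T 0 q) by rewrite act0; exact: cdom_at.
have d := differentiable_orbit (atlas_at M q) H.
by rewrite -!(mul_jacobian _ d) mulmxDl -scalemxAl.
Qed.

Lemma vfield_loc_act c b x : atlas M c -> cimg c x ->
  is_derive ((0, x) : PV) ((b, 0) : PV) (act_loc c c) (vfield_loc M c (gen b) x).
Proof.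
move=> ac xi; have [qc E] := cinvK ac xi; apply/is_derive_slice_l.
by have := generator_loc b ac qc; rewrite E.
Qed.

Lemma smooth_generator b : smooth_vfield M (gen b).
Proof.
move=> c ac; have s := smooth_derive ((b, 0) : PV) (smooth_act_loc ac ac).
have s2 := @smooth_slice_r _ _ _ _ _ _ (0 : 'rV[R]_k) s.
apply: (smooth_eq (open_cimg ac)) (smooth_sub _ s2) => x xi; last exact: actdom0.
by have [_ ->] := vfield_loc_act b ac xi.
Qed.

(* T a sends the flow of X_b to itself *)
Lemma generator_invariant a b q :
  gen b q *m tangent_map M (T a) q = gen b (T a q).
Proof.
have ac0 := atlas_at M q; have qc0 := cdom_at M q.
have ac1 := atlas_at M (T a q); have qc1 := cdom_at M (T a q).
set c0 := chart_at M q in ac0 qc0 *; set c1 := chart_at M (T a q) in ac1 qc1 *.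
have Ez : (fun x => act_loc c0 c1 (a, x)) = (cmap c1 \o T a \o cinv c0) by [].
have dF : differentiable (cmap c1 \o T a \o cinv c0) (cmap c0 q).
  have oD : open [set x | actdom c0 c1 (a, x)].
    apply: (@open_comp _ _ (fun x : 'rV[R]_m => (a, x) : PV)); last exact: open_actdom.
    by move=> x _; apply: continuous_pair_at; [exact: continuous_cst_at|exact: continuous_id_at].
  have := smooth_slice_r a (smooth_act_loc ac0 ac1); rewrite Ez => s.
  by apply: (smooth_differentiable oD s); exact: actdom_pt.
have D0 := (generator_loc b ac0 qc0).
have D1 := (generator_loc b ac1 qc1).
have g0 : vfield_loc M c0 (gen b) (cmap c0 q) = gen b q.
  by rewrite (vfield_locE (gen b) ac0 qc0) (jac_id ac0 qc0) mulmx1.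
have g1 : vfield_loc M c1 (gen b) (cmap c1 (T a q)) = gen b (T a q).
  by rewrite (vfield_locE (gen b) ac1 qc1) (jac_id ac1 qc1) mulmx1.
rewrite /tangent_map /coord_at -/c0 -/c1 (mul_jacobian _ dF) -g1.
have dF' : differentiable (cmap c1 \o T a \o cinv c0) (cmap c0 (T 0 q)) by rewrite act0.
have [_ E] := is_derive_comp (@ex_derive _ _ _ _ _ _ _ D0) dF'.
have [_ <-] := D1; have [_ E0] := D0; rewrite (act0 q) in E; rewrite -g0 -E0 -E.
apply: near_eq_derive; apply: filterS (near_orbit ac0 qc0) => z Hz.
by rewrite /= (cmapK ac0 Hz) actC.
Qed.

End Action.

Section SmoothMaps.
Context {R : realType} {N : topologicalType} {m : nat}.
Variables (M : smooth_structure R N m) (f : N -> N).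
Hypothesis sf : smooth_map M f.

Lemma differentiable_map_loc c c' q : atlas M c -> atlas M c' -> cdom c q -> cdom c' (f q) ->
  differentiable (cmap c' \o f \o cinv c) (cmap c q).
Proof.
move=> ac ac' qc fqc; case: sf => cf sl.
have oU : open (f @^-1` cdom c').
  by apply: open_comp; [move=> x _; exact: cf|exact: (open_cdom ac')].
apply: (smooth_differentiable (open_chart_image ac oU) (sl c c' ac ac')).
by exists q.
Qed.

Lemma tangent_map_loc c c' q : atlas M c -> atlas M c' -> cdom c q -> cdom c' (f q) ->
  'J (cmap c' \o f \o cinv c) (cmap c q) =
  jac c (chart_at M q) q *m tangent_map M f q *m jac (chart_at M (f q)) c' (f q).
Proof.
move=> ac ac' qc fqc; have ac0 := atlas_at M q; have qc0 := cdom_at M q.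
have ac1 := atlas_at M (f q); have qc1 := cdom_at M (f q).
set c0 := chart_at M q in ac0 qc0 *; set c1 := chart_at M (f q) in ac1 qc1 *.
have d1 := differentiable_map_loc ac ac' qc fqc.
have d2 := differentiable_map_loc ac0 ac' qc0 fqc.
have d3 := differentiable_map_loc ac0 ac1 qc0 qc1.
have d4 := differentiable_transition ac1 ac' qc1 fqc.
apply: etrans (jacobian_change (F := cmap c' \o f) ac ac0 qc qc0 d1 d2) _; rewrite -mulmxA; congr (_ *m _).
have Ef : (cmap c1 \o f \o cinv c0) (cmap c0 q) = cmap c1 (f q).
  by rewrite /comp (cmapK ac0 qc0).
have d4' : differentiable (cmap c' \o cinv c1) ((cmap c1 \o f \o cinv c0) (cmap c0 q)) by rewrite Ef.
have d5 : differentiable ((cmap c' \o cinv c1) \o (cmap c1 \o f \o cinv c0)) (cmap c0 q).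
  exact: differentiable_comp d3 d4'.
have E : \forall x \near cmap c0 q, (cmap c' \o f \o cinv c0) x =
    ((cmap c' \o cinv c1) \o (cmap c1 \o f \o cinv c0)) x.
  have cf : {for q, continuous f} by case: sf => cf _; exact: cf.
  have nb : \forall y \near q, cdom c1 (f y).
    by apply: cf; apply: open_nbhs_nbhs; split => //; exact: (open_cdom ac1).
  apply: filterS (near_cinv ac0 qc0 nb) => x Hx.
  by rewrite /= (cmapK ac1 Hx).
apply: etrans (jacobian_near E d2 d5) _; apply: etrans (jacobian_comp d3 d4') _.
by rewrite Ef.
Qed.
End SmoothMaps.

(** * Bump functions *)

Section FlatFunction.
Context {R : realType}.

(* t^-j exp (-1/t), extended by 0: the derivative is a combination of the next two. *)
Definition flat (j : nat) (t : R) : R := if 0 < t then t^-1 ^+ j * expR (- t^-1) else 0.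

Lemma flat_ge0 j t : 0 <= flat j t.
Proof.
by rewrite /flat; case: ifP => // t0; rewrite mulr_ge0 ?expR_ge0 // exprn_ge0 // invr_ge0 ltW.
Qed.

Lemma flat0_gt0 t : 0 < t -> 0 < flat 0 t.
Proof. by move=> t0; rewrite /flat t0 expr0 mul1r expR_gt0. Qed.

Lemma flat_le0 j t : t <= 0 -> flat j t = 0.
Proof. by rewrite /flat ltNge => ->. Qed.

(** From exp s = (exp (s / n)) ^ n >= (s / n) ^ n with s the inverse of [t] and n = j + 2: the two
    powers beyond [j] leave a square, enough for a zero derivative at the origin. *)
Lemma flat_bound j (t : R) : flat j t <= j.+2%:R ^+ j.+2 * t ^+ 2.
Proof.
rewrite /flat; case: ifP => t0; last by rewrite mulr_ge0 ?sqr_ge0 // exprn_ge0.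
have s0 : 0 < t^-1 by rewrite invr_gt0.
pose n : R := j.+2%:R; have n0 : 0 < n by rewrite ltr0n.
have E : (t^-1 / n) ^+ j.+2 <= expR t^-1.
  have -> : expR t^-1 = expR (t^-1 / n) ^+ j.+2.
    by rewrite -expRM_natl mulrC divfK // gt_eqF.
  apply: lerXn2r; rewrite ?nnegrE ?expR_ge0 ?divr_ge0 ?(ltW s0) ?(ltW n0) //.
  by apply: le_trans (expR_ge1Dx _); rewrite lerDr.
rewrite expRN; have P : 0 < (t^-1 / n) ^+ j.+2 by rewrite exprn_gt0 // divr_gt0.
apply: (@le_trans _ _ (t^-1 ^+ j * ((t^-1 / n) ^+ j.+2)^-1)).
  by rewrite ler_wpM2l ?exprn_ge0 ?(ltW s0) // lef_pV2 // posrE ?expR_gt0.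
have -> : (t^-1 / n) ^+ j.+2 = (t ^+ j.+2 * n ^+ j.+2)^-1 by rewrite exprMn !exprVn -invfM.
rewrite invrK exprVn (_ : t ^+ j.+2 = t ^+ j * t ^+ 2); last by rewrite -exprD addn2.
by rewrite -mulrA mulKf ?expf_neq0 ?gt_eqF // mulrC.
Qed.

Lemma is_derive_flat j (t : R) : is_derive t 1 (flat j) (- j%:R * flat j.+1 t + flat j.+2 t).
Proof.
have [t0|t0|->] := ltgtP t 0.
- rewrite !flat_le0 ?(ltW t0) // mulr0 addr0.
  have C : is_derive t 1 (fun=> 0 : R) 0 by exact: is_derive_cst.
  apply: (near_eq_is_derive _ C).
  have nb : nbhs t [set s : R | s < 0] by apply: open_nbhs_nbhs; split; [exact: open_lt|].
  by apply: filterS nb => s s0; rewrite flat_le0 // ltW.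
- have tn : t != 0 by rewrite gt_eqF.
  have D1 : is_derive t (1 : R) (fun s : R => s^-1) (- t ^- 2).
    have [D E] := is_deriveV tn (is_derive_id t (1 : R)); apply: DeriveDef; first exact: D.
    by rewrite E /GRing.scale /= mulr1.
  have D2 : is_derive t 1 (fun s : R => s^-1 ^+ j) (j%:R * t^-1 ^+ j.-1 * - t ^- 2).
    have [D E] := is_deriveX j D1.
    have F : (GRing.inv : R -> R) ^+ j = (fun s : R => s^-1 ^+ j) by rewrite exprfctE.
    by rewrite -F; apply: DeriveDef.
  have D3 : is_derive t 1 (fun s : R => expR (- s^-1)) (expR (- t^-1) * t ^- 2).
    have D4 : is_derive t 1 (fun s : R => - s^-1) (t ^- 2).
      have [D E] := is_deriveN D1; apply: DeriveDef; first exact: D.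
      by rewrite E opprK.
    have := @is_derive1_comp _ expR (fun s : R => - s^-1) t _ _ (is_derive_expR _) D4.
    by apply.
  have [D E] := is_deriveM D2 D3.
  have F : is_derive t 1 (fun s : R => s^-1 ^+ j * expR (- s^-1)) (- j%:R * flat j.+1 t + flat j.+2 t).
    apply: DeriveDef; first exact: D.
    apply: etrans E _; rewrite /flat t0 /GRing.scale /=; case: (j) => [|i].
      by rewrite !mul0r expr0 mul1r oppr0 mulr0 mul0r addr0 add0r exprVn mulrC.
    by rewrite -(exprVn t 2) /= !exprS expr0; move: (t^-1) (t^-1 ^+ i) (expR _) => s p E; ring.
  apply: (near_eq_is_derive _ F).
  have nb : nbhs t [set s : R | 0 < s] by apply: open_nbhs_nbhs; split; [exact: open_gt|].
  by apply: filterS nb => s /= s0; rewrite /flat s0.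
rewrite !flat_le0 // mulr0 addr0.
pose C : R := j.+2%:R ^+ j.+2; have C0 : 0 < C by rewrite exprn_gt0.
have L : (fun h : R => h^-1 *: (flat j (h *: 1 + 0) - flat j 0)) @ 0^' --> (0 : R).
  apply/cvgrPdist_le => e e0.
  have nb : \forall h \near (0 : R)^', `|h| <= e / C.
    apply: nbhs_dnbhs; have : \forall h \near (0 : R), `|h| < e / C by exact: (@near0_norm_lt R R _ (divr_gt0 e0 C0)).
    by apply: filterS => h; exact: ltW.
  near=> h; have hn : h != 0 by near: h; exact: nbhs_dnbhs_neq.
  have he : `|h| <= e / C by near: h.
  rewrite sub0r normrN [flat j 0]flat_le0 // subr0 addr0 /GRing.scale /= mulr1 normrM.
  rewrite [`|flat _ _|]ger0_norm ?flat_ge0 //.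
  apply: (@le_trans _ _ (`|h^-1| * (C * h ^+ 2))); first by rewrite ler_wpM2l // flat_bound.
  have -> : `|h^-1| * (C * h ^+ 2) = C * `|h|.
    rewrite mulrCA -(real_normK (num_real h)) expr2; congr (C * _).
    by rewrite mulrA normrV ?unitfE // mulVf ?normr_eq0 // mul1r.
  by rewrite mulrC -ler_pdivlMr.
apply: DeriveDef; first by apply/cvg_ex; exists 0.
exact: cvg_lim L.
Unshelve. all: by end_near.
Qed.

Lemma smooth_flat j : smooth_on setT (flat j).
Proof.
move=> k; elim: k j => [|k IH] j.
  split=> // x _; apply: differentiable_continuous; apply/derivable1_diffP.
  exact: (@ex_derive _ _ _ _ _ _ _ (is_derive_flat j x)).
apply: (@Ck_onSI R R R k setT (flat j) (fun v x => v * (- j%:R * flat j.+1 x + flat j.+2 x)) openT).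
- move=> x _; apply: differentiable_continuous; apply/derivable1_diffP.
  exact: (@ex_derive _ _ _ _ _ _ _ (is_derive_flat j x)).
- move=> v x _; have := is_derive_scale v (is_derive_flat j x).
  by rewrite [v *: (1 : R)]mulr1.
move=> v; apply: (Ck_on_mul openT); first exact: Ck_on_cst.
apply: (Ck_on_add openT); last exact: IH.
by apply: (Ck_on_mul openT); [exact: Ck_on_cst|exact: IH].
Qed.

Definition entry00 (y : 'rV[R]_1) : R := y 0 0.
Fact entry00_linear : linear entry00.
Proof. by move=> a u v; rewrite /entry00 !mxE. Qed.
HB.instance Definition _ := GRing.isLinear.Build R 'rV[R]_1 R *:%R entry00 entry00_linear.

Lemma smooth_comp_real m (U : set 'rV[R]_m) (g : R -> R) (f : 'rV[R]_m -> R) : open U ->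
  smooth_on setT g -> smooth_on U f -> smooth_on U (fun x => g (f x)).
Proof.
move=> oU sg sf.
have sg' : smooth_on [set: 'rV[R]_1] (fun y => g (entry00 y)).
  move=> k; have := Ck_on_affine (L := entry00) 0 (@coord_continuousE R 1 1 0 0) (sg k).
  have F : (fun y => g (entry00 y + 0)) = (fun y => g (entry00 y)).
    by apply/funext => y; rewrite addr0.
  by rewrite F.
have sF : smooth_on U (fun x => \row_(_ < 1) f x).
  by apply/(smooth_mx oU) => i j; under eq_fun do rewrite mxE.
have := smooth_comp_fun oU openT (fun _ _ => I) sF sg'.
have -> // : (fun y => g (entry00 y)) \o (fun x => \row_(_ < 1) f x) = fun x => g (f x).
by apply/funext => x; rewrite /comp /entry00 mxE.
Qed.

Definition bump m (x0 : 'rV[R]_m) (r : R) (x : 'rV[R]_m) : R :=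
  \prod_i flat 0 (r ^+ 2 - (x 0 i - x0 0 i) ^+ 2).

Lemma smooth_bump m (x0 : 'rV[R]_m) r : smooth_on setT (bump x0 r).
Proof.
apply: (smooth_prod openT) => i _; apply: (smooth_comp_real openT); first exact: smooth_flat.
apply: (smooth_subf openT); first exact: smooth_cst.
have s : smooth_on setT (fun x : 'rV[R]_m => x 0 i - x0 0 i).
  by apply: (smooth_subf openT); [exact: smooth_coord|exact: smooth_cst].
by under eq_fun do rewrite expr2; exact: (smooth_mul openT).
Qed.

Lemma bump_ge0 m (x0 : 'rV[R]_m) r x : 0 <= bump x0 r x.
Proof. by apply: prodr_ge0 => i _; exact: flat_ge0. Qed.

Lemma bump_center m (x0 : 'rV[R]_m) r : r != 0 -> 0 < bump x0 r x0.
Proof.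
move=> r0; apply: prodr_gt0 => i _; apply: flat0_gt0.
by rewrite subrr expr0n subr0 exprn_even_gt0.
Qed.

Lemma bump_support m (x0 : 'rV[R]_m) r x : 0 < r -> bump x0 r x != 0 -> `|x - x0| < r.
Proof.
move=> r0 H; apply: row_norm_lt => // i; rewrite ltNge; apply: contra H => H; apply/eqP/eqP.
rewrite /bump (bigD1 i) //= flat_le0 ?mul0r //.
rewrite !mxE in H; rewrite subr_le0 -[leRHS](real_normK (num_real _)).
by rewrite lerXn2r // ?nnegrE ?(ltW r0).
Qed.

End FlatFunction.

(** * Extension of local fields and functions to N *)

Section Extension.
Context {R : realType} {N : topologicalType} {m : nat}.
Variable M : smooth_structure R N m.
Hypothesis hausN : hausdorff_space N.
Variables (c : chart R N m) (p : N) (O : set 'rV[R]_m).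
Hypotheses (ac : atlas M c) (pc : cdom c p) (oO : open O) (Op : O (cmap c p)) (Oc : O `<=` cimg c).
Let x0 := cmap c p.

Lemma closed_box_in : exists2 r : R, 0 < r & [set x | `|x - x0| <= r] `<=` O.
Proof.
have : nbhs x0 O by exact: open_nbhs_nbhs.
move=> /nbhs_ballP [e e0 H]; exists (e / 2); first by rewrite divr_gt0.
move=> x /= xr; apply: H; rewrite -ball_normE /= distrC; apply: le_lt_trans xr _.
by rewrite ltr_pdivrMr // ltr_pMr // ltr1n.
Qed.

Lemma compact_chart_box (B : set 'rV[R]_m) : compact B -> B `<=` cimg c -> compact (cinv c @` B).
Proof.
move=> cB Bc; apply: continuous_compact => //; apply: continuous_in_subspaceT => x /set_mem xB.
by have [_ _ _ _] := atlas_chart ac; apply; exact: Bc.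
Qed.

(* Off the support K of the bump function the extension by 0 vanishes on a neighbourhood, K being closed. *)
Lemma chart_bump : exists (chi : 'rV[R]_m -> R) (r : R),
  [/\ smooth_on setT chi, (forall x, 0 <= chi x), 0 < chi x0, 0 < r &
   [/\ [set x | `|x - x0| <= r] `<=` O, (forall x, chi x != 0 -> `|x - x0| < r) &
     closed (cinv c @` [set x | `|x - x0| <= r])]].
Proof.
have [r r0 H] := closed_box_in; exists (bump x0 r), r; split => //.
- exact: smooth_bump.
- by move=> x; exact: bump_ge0.
- by apply: bump_center; rewrite gt_eqF.
split=> //; first by move=> x; exact: bump_support.
apply: compact_closed => //; apply: compact_chart_box; first exact: closed_ball_compact.
by move=> x /H /Oc.
Qed.

(** Smoothness is checked near each point. A point of the closed set lies in the domain of the chart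
    [c], where the local expression is given; any other point has a neighbourhood on which [F]
    vanishes. *)
Let smooth_glue (A : choiceType) d1 d2 (F : chart R N m -> N -> 'M[R]_(d1, d2)) (r : R) c' :
  atlas M c' -> [set x | `|x - x0| <= r] `<=` O ->
  closed (cinv c @` [set x | `|x - x0| <= r]) ->
  (forall q, ~ (cinv c @` [set x | `|x - x0| <= r]) q -> F c' q = 0) ->
  smooth_on (cimg c' `&` cinv c' @^-1` (cdom c `&` cmap c @^-1` O)) (F c' \o cinv c') ->
  smooth_on (cimg c') (F c' \o cinv c').
Proof.
move=> ac' rO clK F0 sF; set K := cinv c @` _ in clK F0.
apply: smooth_pt => y yi; have [qc' E] := cinvK ac' yi; set q := cinv c' y in qc' E.
have [[x xr xq]|nK] := pselect (K q).
  exists (cimg c' `&` cinv c' @^-1` (cdom c `&` cmap c @^-1` O)) => //.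
  split=> //=; rewrite -/q -xq; have xO := rO x xr; have [H1 H2] := cinvK ac (Oc xO).
  by split=> //=; rewrite H2.
exists (cimg c' `&` cinv c' @^-1` (~` K)); first by split.
apply: (smooth_eq (f := fun=> 0)); last exact: smooth_cst.
  rewrite -(chart_image _ ac'); apply: (open_chart_image ac'); exact: closed_openC.
by move=> z [zi zK]; rewrite /= F0.
Qed.

Let oA c' : atlas M c' -> open (cimg c' `&` cinv c' @^-1` (cdom c `&` cmap c @^-1` O)).
Proof.
move=> ac'; rewrite -(chart_image _ ac'); apply: (open_chart_image ac').
exact: (open_chart_preimage ac oO).
Qed.

Let smooth_tr c' : atlas M c' ->
  smooth_on (cimg c' `&` cinv c' @^-1` (cdom c `&` cmap c @^-1` O)) (cmap c \o cinv c').
Proof.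
move=> ac'; apply: smooth_sub (smooth_transition ac' ac) => y [yi [yc _]].
by rewrite (chart_image _ ac').
Qed.

Definition extend_field (chi : 'rV[R]_m -> R) (V : 'rV[R]_m -> 'rV[R]_m) q : 'rV[R]_m :=
  if pselect (cdom c q) then chi (cmap c q) *: (V (cmap c q) *m jac c (chart_at M q) q) else 0.

Lemma extend_field_loc chi V c' q : atlas M c' -> cdom c' q -> cdom c q ->
  vfield_loc M c' (extend_field chi V) (cmap c' q) = chi (cmap c q) *: (V (cmap c q) *m jac c c' q).
Proof.
move=> ac' qc' qc; rewrite (vfield_locE (extend_field chi V) ac' qc') /extend_field.
case: pselect => //= qc0; rewrite -scalemxAl -mulmxA; congr (_ *: (_ *m _)).
exact: esym (jac_comp ac (atlas_at M q) ac' qc (cdom_at M q) qc').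
Qed.

Lemma exists_extended_field (V : 'rV[R]_m -> 'rV[R]_m) : smooth_on O V ->
  exists (chi : 'rV[R]_m -> R) (X : N -> 'rV[R]_m),
   [/\ smooth_on setT chi, 0 < chi x0, smooth_vfield M X,
     (forall q, cdom c q -> vfield_loc M c X (cmap c q) = chi (cmap c q) *: V (cmap c q)) &
     (forall q, ~ cdom c q -> X q = 0)].
Proof.
move=> sV; have [chi [r [schi _ chi0 r0 [rO supp clK]]]] := chart_bump.
pose X := extend_field chi V; exists chi, X; split=> //.
- move=> c' ac'.
  apply: (@smooth_glue nat _ _ (fun c' q => X q *m jac (chart_at M q) c' q) r c' ac' rO clK).
    move=> q nK; rewrite /X /extend_field; case: pselect => /= [qc|nqc]; last exact: mul0mx.
    have [->|/supp H] := eqVneq (chi (cmap c q)) 0; first by rewrite scale0r mul0mx.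
    by exfalso; apply: nK; exists (cmap c q); [exact: ltW|exact: (cmapK ac qc)].
  have st := smooth_tr ac'; have oA' := oA ac'.
  apply: (smooth_eq (f := fun y => chi (cmap c (cinv c' y)) *: (V (cmap c (cinv c' y)) *m
     'J (cmap c' \o cinv c) (cmap c (cinv c' y))))) => //.
    move=> y [yi [yc yO]]; have [qc' E] := cinvK ac' yi.
    by have := extend_field_loc chi V ac' qc' yc; rewrite {1}E => <-.
  apply: (smooth_scale oA'); first exact: (smooth_comp_fun oA' openT (fun _ _ => I) st schi).
  apply: (smooth_mulmx oA').
    by apply: (smooth_comp oA' oO _ st sV) => y [_ []].
  have sJ := smooth_jacobian (open_chart_image ac (open_cdom ac')) (smooth_transition ac ac').
  apply: (smooth_comp oA' (open_chart_image ac (open_cdom ac')) _ st sJ) => y [yi [yc yO]].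
  by exists (cinv c' y) => //; split=> //; have [] := cinvK ac' yi.
- move=> q qc; have := extend_field_loc chi V ac qc qc.
  by rewrite (jac_id ac qc) mulmx1.
by move=> q nqc; rewrite /X /extend_field; case: pselect.
Qed.

Definition smooth_scalar (g : N -> R) := forall c', atlas M c' -> smooth_on (cimg c') (g \o cinv c').

Lemma smooth_scalar_continuous g : smooth_scalar g -> continuous g.
Proof.
move=> sg q; have [aq cq] := atlas_chart_at M q.
apply: (@near_continuous_at _ _ ((g \o cinv (chart_at M q)) \o cmap (chart_at M q))).
  by apply: (open_near (open_cdom aq) cq) => q' qc'; rewrite /= (cmapK aq qc').
have [_ _ _ cc _] := atlas_chart aq; apply: continuous_comp; first exact: cc.
exact: (smooth_cont (sg _ aq) (cimg_cmap cq)).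
Qed.

Lemma exists_smooth_bump : exists (g : N -> R) (r : R),
  [/\ smooth_scalar g, (forall q, 0 <= g q), 0 < g p, 0 < r &
    [set x | `|x - x0| <= r] `<=` O /\
    (forall q, g q != 0 -> cdom c q /\ `|cmap c q - x0| < r)].
Proof.
have [chi [r [schi chige chi0 r0 [rO supp clK]]]] := chart_bump.
pose g q := if pselect (cdom c q) then chi (cmap c q) else 0.
have gsupp q : g q != 0 -> cdom c q /\ `|cmap c q - x0| < r.
  by rewrite /g; case: pselect => /= [qc H|nqc]; [split=> //; exact: supp|rewrite eqxx].
exists g, r; split=> //; last first.
- by rewrite /g; case: pselect.
- by move=> q; rewrite /g; case: pselect => //= qc; exact: chige.
move=> c' ac'; have oc' := open_cimg ac'.
have S : smooth_on (cimg c') (fun y => (g (cinv c' y))%:M : 'rV[R]_1).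
  apply: (@smooth_glue nat _ _ (fun c' q => (g q)%:M) r c' ac' rO clK).
    move=> q nK; suff -> : g q = 0 by rewrite raddf0.
    apply/eqP; apply: contraT => /gsupp [qc H].
    by exfalso; apply: nK; exists (cmap c q); [exact: ltW|exact: (cmapK ac qc)].
  have st := smooth_tr ac'; have oA' := oA ac'.
  apply: (smooth_eq (f := fun y => (chi (cmap c (cinv c' y)))%:M)) => //.
    by move=> y [yi [yc yO]]; rewrite /= /g; case: pselect.
  apply/(smooth_mx oA') => i j.
  have -> : (fun y => ((chi (cmap c (cinv c' y)))%:M : 'rV[R]_1) i j) = (fun y => chi (cmap c (cinv c' y))).
    by apply/funext => y; rewrite !ord1 mxE eqxx mulr1n.
  exact: (smooth_comp_fun oA' openT (fun _ _ => I) st schi).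
move/(smooth_mx oc'): S => /(_ 0 0); apply: smooth_eq => // y _.
by rewrite mxE eqxx mulr1n.
Qed.

End Extension.

(** The product rule adds the wedge of the differential of [g] with [a], which vanishes on vectors
    in the kernel of [a]. *)
Lemma extder_loc_scale {R : realType} m (U : set 'rV[R]_m) (g : 'rV[R]_m -> R) (a a' : 'rV[R]_m -> 'cV[R]_m) x
  (v w : 'rV[R]_m) : open U -> smooth_on U g -> smooth_on U a -> (forall y, U y -> a' y = g y *: a y) ->
  U x -> v *m a x = 0 -> w *m a x = 0 ->
  v *m extder_loc a' x *m w^T = g x *: (v *m extder_loc a x *m w^T).
Proof.
move=> oU sg sa aE Ux va wa.
have sai i : smooth_on U (fun y => a y i 0) by move/(smooth_mx oU): sa; apply.
pose dg : 'cV[R]_m := \col_i partial i g x.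
have E : extder_loc a' x = g x *: extder_loc a x + dg *m (a x)^T - a x *m dg^T.
  have P i j : partial i (fun y => a' y j 0) x = g x * partial i (fun y => a y j 0) x + a x j 0 * partial i g x.
    have -> : partial i (fun y => a' y j 0) x = partial i (fun y => g y * a y j 0) x.
      by apply: near_eq_derive; apply: (open_near oU Ux) => y Uy; rewrite aE // mxE.
    pose e : 'rV[R]_m := delta_mx 0 i.
    by have [_] := is_deriveM (smooth_is_derive e sg Ux) (smooth_is_derive e (sai j) Ux).
  apply/matrixP => i j; rewrite [LHS]mxE !P !mxE !big_ord1 !mxE.
  move: (partial _ _ _) (partial _ _ _) (partial _ _ _) (partial _ _ _) (g x) (a x i 0) (a x j 0).
  by move=> p1 p2 p3 p4 t s r; ring.
rewrite E mulmxBr mulmxDr mulmxBl mulmxDl !mulmxA va !mul0mx subr0.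
have -> : v *m dg *m (a x)^T *m w^T = 0.
  by rewrite -mulmxA -trmx_mul wa trmx0 mulmx0.
by rewrite addr0 -scalemxAr -scalemxAl.
Qed.

(** * Flow boxes *)

Section FlowBox.
Context {R : realType} {N : ptopologicalType} {n k : nat}.
Let d := n.*2.
Let m := d.+1.
Variables (M : smooth_structure R N m) (T : 'rV[R]_k -> N -> N).
Hypothesis action : smooth_action M T.
Local Notation gen := (generator M T).
Variables (b : 'rV[R]_k) (c : chart R N m) (p0 : N).
Hypotheses (ac : atlas M c) (pc : cdom c p0).
Let x0 := cmap c p0.
Let X0 := vfield_loc M c (gen b) x0.
Hypothesis X0n : X0 != 0.
Local Notation PV := ('rV[R]_k * 'rV[R]_m)%type.

Section PairMulmx.
Variables (B1 : 'M[R]_(m, k)) (B2 : 'M[R]_m).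
Definition pair_mulmx (z : 'rV[R]_m) : PV := (z *m B1, z *m B2).
Fact pair_mulmx_linear : linear pair_mulmx.
Proof. by move=> s u v; rewrite /pair_mulmx !mulmxDl -!scalemxAl. Qed.
HB.instance Definition _ := GRing.isLinear.Build R 'rV[R]_m PV *:%R pair_mulmx pair_mulmx_linear.
Lemma mulmxr_continuous p q (B : 'M[R]_(p, q)) : continuous (fun z : 'rV[R]_p => z *m B).
Proof.
move=> z; have := smooth_cont (smooth_affine setT B 0) (I : setT z).
by rewrite (_ : (fun z => z *m B + 0) = fun z => z *m B) //; apply/funext => y; rewrite addr0.
Qed.
Lemma pair_mulmx_continuous : continuous pair_mulmx.
Proof.
move=> z; have H : {for z, continuous (fun y : 'rV[R]_m => (y *m B1, y *m B2))}.
  by apply: continuous_pair_at; exact: mulmxr_continuous.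
exact: H.
Qed.
End PairMulmx.

Let e0 : 'rV[R]_m := delta_mx 0 ord0.
Let Pr : 'M[R]_(m, d) := \matrix_(l, i) (l == fintype.lift ord0 i)%:R.
Let Lr : 'M[R]_(d, m) := Pr^T.
Let LP : Lr *m Pr = 1%:M.
Proof.
apply/matrixP => i j; rewrite !mxE (bigD1 (fintype.lift ord0 i)) //= !mxE eqxx mul1r big1 ?addr0.
  by rewrite (inj_eq lift_inj).
by move=> l ln; rewrite !mxE (negbTE ln) mul0r.
Qed.
Let eP : e0 *m Pr = 0.
Proof.
apply/rowP => i; rewrite -rowE !mxE.
by case: eqP => // /esym/eqP; rewrite -[_ == _]negbK neq_lift.
Qed.
Let decomp (z : 'rV[R]_m) : z = z 0 ord0 *: e0 + z *m Pr *m Lr.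
Proof.
apply/rowP => l; rewrite !mxE; case: (unliftP ord0 l) => [i ->|->].
  rewrite (bigD1 i) //= big1 ?addr0; last first.
    by move=> i' ni; rewrite !mxE (inj_eq lift_inj) eq_sym (negbTE ni) mulr0.
  rewrite !mxE !eqxx mulr1 (bigD1 (fintype.lift ord0 i)) //= !mxE eqxx mulr1 big1 ?addr0.
    by rewrite mulr0 add0r.
  by move=> l' ln; rewrite !mxE (negbTE ln) mulr0.
rewrite eqxx mulr1 big1 ?addr0 // => i _; rewrite !mxE.
by rewrite (negbTE (neq_lift _ _)) mulr0.
Qed.

Let B1 : 'M[R]_(m, k) := delta_mx ord0 0 *m b.

(** [Psi] flows for time [z 0 ord0] from a point of a slice transverse to the generator. The columns
    of its differential at 0 are the generator and a basis of the slice, so the inverse function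
    theorem gives the coordinates [g]. *)
Lemma exists_flow_box : exists (B2 : 'M[R]_m) (r : R) (g : 'rV[R]_m -> 'rV[R]_m),
  let Psi (z : 'rV[R]_m) := T (z 0 ord0 *: b) (cinv c (z *m B2 + x0)) in
  let Phi (z : 'rV[R]_m) := cmap c (Psi z) in
  [/\ 0 < r /\ e0 *m B2 = 0, open (Phi @` [set z | `|z| < r]),
     (forall z, `|z| < r -> [/\ g (Phi z) = z, cimg c (z *m B2 + x0) & cdom c (Psi z)]),
     smooth_on (Phi @` [set z | `|z| < r]) g &
     forall x, (Phi @` [set z | `|z| < r]) x -> 'J g x \in unitmx].
Proof.
have [j Xj] : exists j, X0 0 j != 0.
  apply/existsP; apply: contraR X0n => /existsPn H; apply/eqP/rowP => j; rewrite [RHS]mxE.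
  by have := H j; rewrite negbK => /eqP.
(* The coordinate hyperplane omitting the direction [j], transverse to [X0] because its component
   [j] is nonzero. *)
pose S0 : 'M[R]_(d, m) := \matrix_(i, l) (l == fintype.lift j i)%:R.
pose B2 := Pr *m S0.
have e1 : e0 *m B1 = b.
  by rewrite /B1 mulmxA mul_delta_mx; apply/rowP => l; rewrite !mxE big_ord1 !mxE eqxx mul1r.
have e2 : e0 *m B2 = 0 by rewrite /B2 mulmxA eP mul0mx.
have zB1 (z : 'rV[R]_m) : z *m B1 = z 0 ord0 *: b.
  rewrite /B1 mulmxA; apply/rowP => l; rewrite !mxE big_ord1 !mxE (bigD1 ord0) //= !mxE eqxx mulr1.
  by rewrite big1 ?addr0 // => i ni; rewrite !mxE (negbTE ni) mulr0.
have cL : continuous (pair_mulmx B1 B2) by exact: pair_mulmx_continuous.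
pose Psi (z : 'rV[R]_m) := T (z 0 ord0 *: b) (cinv c (z *m B2 + x0)).
pose Phi (z : 'rV[R]_m) := cmap c (Psi z).
have PhiE (z : 'rV[R]_m) : Phi z = act_loc T c c (pair_mulmx B1 B2 z + slice_r x0).
  by rewrite /Phi /Psi /act_loc /= addr0 zB1.
pose U0 := [set z : 'rV[R]_m | actdom T c c (pair_mulmx B1 B2 z + slice_r x0)].
have oU0 : open U0.
  rewrite (_ : U0 = (fun z => pair_mulmx B1 B2 z + slice_r x0) @^-1` actdom T c c) //.
  apply: open_comp; last exact: (open_actdom action ac ac).
  by move=> z _; apply: continuousD; [exact: cL|exact: cst_continuous].
have sPhi : smooth_on U0 Phi.
  move=> l; have := Ck_on_affine (L := pair_mulmx B1 B2) (slice_r x0) cL (smooth_act_loc action ac ac l).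
  by rewrite (_ : Phi = fun z => act_loc T c c (pair_mulmx B1 B2 z + slice_r x0)) //; apply/funext.
have x0i : cimg c x0 by exact: cimg_cmap.
have z0E : pair_mulmx B1 B2 0 + slice_r x0 = (0, x0) :> PV.
  by congr (_, _); rewrite /= !mul0mx add0r.
have U00 : U0 0.
  have H := actdom0 action ac x0i.
  by have : actdom T c c (pair_mulmx B1 B2 0 + slice_r x0) by rewrite z0E; exact: H.
have D0 : is_derive 0 e0 Phi X0.
  have := (is_derive_slice_l _ _ _ _ _).1 (vfield_loc_act action b ac x0i) => /is_derive_line H.
  apply/is_derive_line; rewrite (_ : (fun t => Phi _) = fun t : R => act_loc T c c (0 + t *: b, x0)) //.
  apply/funext => t; rewrite PhiE; congr act_loc; congr (_, _); rewrite /=.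
    by rewrite !add0r addr0 -scalemxAl e1.
  by rewrite add0r -scalemxAl e2 scaler0 add0r.
have Di i : is_derive 0 (delta_mx 0 (fintype.lift ord0 i) : 'rV[R]_m) Phi (delta_mx 0 (fintype.lift j i)).
  set ei : 'rV[R]_m := delta_mx 0 (fintype.lift ord0 i); set si : 'rV[R]_m := delta_mx 0 (fintype.lift j i).
  have E1 : ei *m B1 = 0.
    by rewrite zB1 mxE eqxx [ord0 == _](negbTE (neq_lift _ _)) scale0r.
  have E2 : ei *m B2 = si.
    rewrite /B2 mulmxA (_ : ei *m Pr = delta_mx 0 i); last first.
      by apply/rowP => l; rewrite -rowE !mxE eqxx (inj_eq lift_inj) eq_sym.
    by apply/rowP => l; rewrite -rowE !mxE eqxx.
  apply/is_derive_line.
  have A : is_derive (0 : R) 1 (fun t : R => t *: si + x0) si.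
    have := is_derive_affine si x0.
    have := @is_derive_affine R m m 1%:M x0 (0 : 'rV[R]_m) si => H _.
    have := (is_derive_line _ _ _ _).1 H; rewrite mulmx1.
    by rewrite (_ : (fun t : R => (0 + t *: si) *m 1%:M + x0) = fun t => t *: si + x0) //;
      apply/funext => t; rewrite add0r mulmx1.
  apply: (near_eq_is_derive _ A).
  have nb : nbhs (0 : R) [set t : R | cimg c (t *: si + x0)].
    have cf : {for (0 : R), continuous (fun t : R => t *: si + x0)}.
      by apply: continuousD; [exact: scalel_continuous|exact: cst_continuous].
    apply: cf; apply: open_nbhs_nbhs; split; first exact: (open_cimg ac).
    by rewrite scale0r add0r.
  apply: filterS nb => t ti; rewrite PhiE /act_loc /= add0r -!scalemxAl E1 E2 scaler0 addr0.
  by rewrite (act0 action); have [_ ->] := cinvK ac ti.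
have dPhi : differentiable Phi 0 by exact: (smooth_differentiable oU0 sPhi U00).
have uJ : 'J Phi 0 \in unitmx.
  rewrite -row_free_unit; apply: inj_row_free => v vJ.
  have JE : v *m 'J Phi 0 = v 0 ord0 *: X0 + \sum_i v 0 (fintype.lift ord0 i) *: delta_mx 0 (fintype.lift j i).
    rewrite {1}[v]row_sum_delta mulmx_suml big_ord_recl /=; congr (_ + _).
      by rewrite -scalemxAl (mul_jacobian _ dPhi); have [_ ->] := D0.
    by apply: eq_bigr => i _; rewrite -scalemxAl (mul_jacobian _ dPhi); have [_ ->] := Di i.
  have co l : v 0 ord0 * X0 0 l + \sum_i v 0 (fintype.lift ord0 i) * (l == fintype.lift j i)%:R = 0.
    have H := congr1 (fun w : 'rV[R]_m => w 0 l) JE; rewrite vJ in H.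
    transitivity ((0 : 'rV[R]_m) 0 l); last by rewrite mxE.
    rewrite H.
    rewrite [RHS]mxE [(_ *: X0) 0 l]mxE summxE.
    by congr (_ + _); apply: eq_bigr => i _; rewrite !mxE eqxx.
  have v0 : v 0 ord0 = 0.
    have := co j; rewrite big1 ?addr0 => [/eqP|i _].
      by rewrite mulf_eq0 (negbTE Xj) orbF => /eqP.
    by rewrite (negbTE (neq_lift _ _)) mulr0.
  apply/rowP => l; rewrite mxE; case: (unliftP ord0 l) => [i ->|-> //].
  have := co (fintype.lift j i); rewrite v0 mul0r add0r (bigD1 i) //= eqxx mulr1 big1 ?addr0 // => i' ni.
  by rewrite (inj_eq lift_inj) eq_sym (negbTE ni) mulr0.
have [V [g [[oV V0] VU oPV [gP sg uPhi]]]] := inverse_function oU0 sPhi U00 uJ filterT.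
have [r r0 rV] : exists2 r : R, 0 < r & [set z : 'rV[R]_m | `|z| < r] `<=` V.
  have /nbhs_ballP [r r0 H] : nbhs (0 : 'rV[R]_m) V by exact: open_nbhs_nbhs.
  by exists r => // z zr; apply: H; rewrite -ball_normE /= sub0r normrN.
exists B2, r, g; rewrite -/Psi -/Phi /=; split; first by split.
- have -> : Phi @` [set z | `|z| < r] = (Phi @` V) `&` g @^-1` [set z | `|z| < r].
    apply/seteqP; split=> [_ [z zr <-]|_ [[z zV <-] gz]].
      by split; [exists z => //; exact: rV|rewrite /preimage /= gP //; exact: rV].
    by exists z => //; move: gz; rewrite /preimage /= gP.
  apply: continuous_open_preimage => //; first by move=> x Px; exact: (smooth_cont sg Px).
  have -> : [set z : 'rV[R]_m | `|z| < r] = ball 0 r.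
    by apply/seteqP; split=> z; rewrite -ball_normE /= sub0r normrN.
  exact: ball_open.
- move=> z zr; have zV := rV z zr; have [zU _] := VU z zV.
  have [H1 H2] : actdom T c c (pair_mulmx B1 B2 z + slice_r x0) := zU.
  by split; [exact: gP|exact: H1|move: H2; rewrite /= addr0 zB1].
- by apply: smooth_sub sg => _ [z zr <-]; exists z => //; exact: rV.
move=> _ [z zr <-]; have zV := rV z zr; have [zU _] := VU z zV.
have d1 : differentiable Phi z by exact: (smooth_differentiable oU0 sPhi zU).
have d2 : differentiable g (Phi z) by apply: (smooth_differentiable oPV sg); exists z.
have E : 'J (g \o Phi) z = 1%:M.
  rewrite -(jacobian_id z); apply: jacobian_near.
  - by apply: (open_near oV zV) => y; exact: gP.
  - exact: differentiable_comp.
  - by apply: (smooth_differentiable openT) => //; exact: smooth_id.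
by move: E; rewrite (jacobian_comp d1 d2) => /mulmx1_unit [].
Qed.

End FlowBox.

Lemma near_comp (S T : topologicalType) (f : S -> T) x (P : T -> Prop) :
  {for x, continuous f} -> (\forall y \near f x, P y) -> \forall y \near x, P (f y).
Proof. by move=> cf H; exact: (cf P H). Qed.

(** * Fixed points at which a generator has trivial first jet *)

Section AveragedFixedPoint.
Context {R : realType} {N : ptopologicalType} {m k : nat}.
Variables (M : smooth_structure R N m) (T : 'rV[R]_k -> N -> N).
Hypotheses (hausN : hausdorff_space N) (action : smooth_action M T).
Hypothesis periodic : forall (a : 'rV[R]_k) p, (forall i, a 0 i \is a Num.int) -> T a p = p.
Variables (c : chart R N m) (q : N) (a : 'rV[R]_k).
Hypotheses (ac : atlas M c) (qc : cdom c q).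
Local Notation PV := ('rV[R]_k * 'rV[R]_m)%type.
Let x0 := cmap c q.
Let Y := vfield_loc M c (generator M T a).
Hypotheses (Y0 : Y x0 = 0) (DY0 : forall v i, 'D_v (fun x => Y x 0 i) x0 = 0).
Let Phi := act_loc T c c.

Let gen0 : generator M T a q = 0.
Proof.
have [aq cq] := atlas_chart_at M q.
by rewrite -[LHS]mulmx1 -(jacK aq ac cq qc) mulmxA -(vfield_locE _ ac qc) -/Y -/x0 Y0 mul0mx.
Qed.

Let flow0 t : cdom c (T (t *: a) q) -> Y (cmap c (T (t *: a) q)) = 0.
Proof. by move=> tc; rewrite /Y (vfield_locE _ ac tc) -(generator_invariant action) gen0 !mul0mx. Qed.

Let fixed_multiple s n : T (s *: a) q = q -> T ((n%:R * s) *: a) q = q.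
Proof.
move=> sq; elim: n => [|n IH]; first by rewrite mul0r scale0r (act0 action).
by rewrite -natr1 mulrDl mul1r scalerDl (actD action) sq IH.
Qed.

(** The generator is carried along by its flow, so it vanishes on the whole orbit of [q]. While the
    orbit stays in the chart the mean value inequality makes it constant; other times are multiples
    of short ones. *)
Lemma fixed_orbit t : T (t *: a) q = q.
Proof.
have cs : {for 0, continuous (fun s : R => s *: a)} by exact: scalel_continuous.
have nc : \forall s \near (0 : R), cdom c (T (s *: a) q).
  by apply: (near_comp (P := fun s => cdom c (T s q)) cs); rewrite scale0r; exact: (near_orbit action ac qc).
have [d d0 dc] : exists2 d : R, 0 < d & forall s, `|s| < d -> cdom c (T (s *: a) q).
  by move/nbhs_ballP: nc => [d d0 H]; exists d => // s sd; apply: H; rewrite /ball /= sub0r normrN.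
have fix_small s : `|s| < d -> T (s *: a) q = q.
  move=> sd; have sc := dc s sd; rewrite -(cmapK ac sc) -[RHS](cmapK ac qc); congr cinv.
  apply/rowP => i; apply/eqP; rewrite -subr_eq0 -normr_le0.
  have := @line_mvt R _ (fun u : R => cmap c (T (u *: a) q) 0 i) 0 s 0 0.
  rewrite add0r scale0r (act0 action) subr0; apply=> u /andP[u0 u1].
  have uc : cdom c (T ((0 + u *: s) *: a) q).
    by apply: dc; rewrite add0r; apply: le_lt_trans sd; rewrite normrM (ger0_norm u0) ler_piMl.
  have D := (is_derive_mx _ _ _ _).1 (generator_curve action ac uc) 0 i.
  have := is_derive_scale s D; rewrite [s *: 1]mulr1 -/Y flow0 // mxE scaler0 => D'.
  by case: D' => D1 D2; split=> //; rewrite D2 subr0 normr0.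
have b0 := archi_boundP (normr_ge0 (t / d)).
set n := Num.bound _ in b0.
have n0 : 0 < n%:R :> R by apply: le_lt_trans b0.
rewrite -[t](mulVKf (x := n%:R)) ?gt_eqF //.
apply: fixed_multiple; apply: fix_small.
by rewrite normrM normfV (gtr0_norm n0) ltr_pdivrMl // -ltr_pdivrMr // -(gtr0_norm d0) -normf_div.
Qed.

Let sPhi i : smooth_on (actdom T c c) (fun z => Phi z 0 i).
Proof. by have := smooth_act_loc action ac ac; move/(smooth_mx (open_actdom action ac ac)); apply. Qed.

Let flowY z i : actdom T c c z -> is_derive z ((a, 0) : PV) (fun z => Phi z 0 i) (Y (Phi z) 0 i).
Proof.
case: z => s x [/= xc sc]; apply: (is_derive_mx Phi _ _ (Y (Phi _))).1; apply/is_derive_slice_l.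
have := generator_loc action a ac sc; rewrite -/Y => /is_derive_line H; apply/is_derive_line.
move: H; congr (is_derive _ _ _ _); apply/funext => u /=.
by rewrite /Phi /act_loc /= add0r addrC (actD action).
Qed.

Let dom t : actdom T c c (t *: a, x0).
Proof. by have tc := qc; rewrite -(fixed_orbit t) in tc; exact: (actdom_pt ac qc tc). Qed.

Let Phi0 t : Phi (t *: a, x0) = x0.
Proof. by rewrite /Phi /act_loc /= (cmapK ac qc) fixed_orbit. Qed.

(** The linearised flow equation: by Schwarz's theorem the time derivative of the spatial
    differential is the differential of [Y] at the fixed point, which is 0, and at time 0 the
    differential is the identity. *)
Let derivative_fixed t v i : 'D_((0, v) : PV) (fun z => Phi z 0 i) (t *: a, x0) = v 0 i.
Proof.
have oD := open_actdom action ac ac.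
pose g (s : R) := 'D_((0, v) : PV) (fun z => Phi z 0 i) (((0, x0) : PV) + s *: ((a, 0) : PV)).
have pE s : ((0, x0) : PV) + s *: ((a, 0) : PV) = (s *: a, x0).
  by congr (_, _); rewrite /= ?add0r // scaler0 addr0.
have Yi : smooth_on (cimg c) (fun x => Y x 0 i).
  by have := smooth_generator action a ac; move/(smooth_mx (open_cimg ac)); apply.
have D s : is_derive (s : R) 1 g 0.
  apply: (@is_derive_shift_line R PV R (fun z => 'D_((0, v) : PV) (fun z => Phi z 0 i) z) (0, x0) (a, 0)); rewrite pE.
  have Ds := smooth_is_derive ((a, 0) : PV) (smooth_derive ((0, v) : PV) (sPhi i)) (dom s).
  move: Ds; rewrite (derive_schwarz (k := 0) ((0, v) : PV) ((a, 0) : PV) oD (sPhi i 2) (dom s)).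
  have E : \forall z \near ((s *: a, x0) : PV), 'D_((a, 0) : PV) (fun z => Phi z 0 i) z = Y (Phi z) 0 i.
    by apply: (open_near oD (dom s)) => z /(flowY i) [].
  rewrite (near_eq_derive _ E).
  have dP : derivable Phi (s *: a, x0) ((0, v) : PV).
    by have [D1 _] := smooth_is_derive ((0, v) : PV) (smooth_act_loc action ac ac) (dom s).
  have dY : differentiable (fun x => Y x 0 i) (Phi (s *: a, x0)).
    by rewrite Phi0; apply: (smooth_diff_fun (open_cimg ac) Yi); exact: cimg_cmap.
  have [_ ->] := is_derive_comp dP dY.
  by rewrite Phi0 DY0.
have gt : g t = g 0 by apply: is_derive_0_is_cst.
move: gt; rewrite /g !pE scale0r => ->.
have D0 : actdom T c c (0, x0) by have := dom 0; rewrite scale0r.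
have /is_derive_slice_r [_ E] := smooth_is_derive ((0, v) : PV) (sPhi i) D0; rewrite -E.
have near_id : \forall x \near x0, Phi (0, x) 0 i = x 0 i.
  apply: (open_near (open_cimg ac) (cimg_cmap qc)) => x xc.
  by rewrite /Phi /act_loc /= (act0 action); have [_ ->] := cinvK ac xc.
rewrite (near_eq_derive _ near_id).
by have [_ ->] := (is_derive_mx _ _ _ _).1 (is_derive_id x0 v) 0 i.
Qed.

(** Reduction modulo the period lattice puts the one-parameter group into a bounded set of
    parameters. Its closure [K] is compact, and by continuity its elements still fix [q] with
    identity differential. *)
Let rep (t : R) : 'rV[R]_k := \row_i (t * a 0 i - (Num.floor (t * a 0 i))%:~R).

Let repE t p : T (rep t) p = T (t *: a) p.
Proof.
have -> : t *: a = rep t + \row_i (Num.floor (t * a 0 i))%:~R.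
  by apply/rowP => i; rewrite !mxE subrK.
rewrite (actD action); congr (T _ _); apply/esym/periodic => i; by rewrite mxE intr_int.
Qed.

Let K := closure (range rep).

Let compactK : compact K.
Proof.
have cB : compact [set y : 'rV[R]_k | `|y - 0| <= 1] by exact: closed_ball_compact.
apply: (subclosed_compact _ cB); first exact: closed_closure.
have cl : closed [set y : 'rV[R]_k | `|y - 0| <= 1].
  by apply: compact_closed; [exact: norm_hausdorff|exact: cB].
rewrite [X in _ `<=` X]((closure_id _).1 cl); apply: closureS => _ [t _ <-] /=; rewrite subr0.
apply: row_norm_le => // i; rewrite mxE.
have /andP[f1 f2] := floor_itv (t * a 0 i); move: f2; rewrite intrD => f2.
by rewrite ger0_norm ?subr_ge0 // lerBlDl ltW // addrC.
Qed.

Let fixedK th : K th -> T th q = q.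
Proof.
have cl : closed [set th | T th q = q].
  have -> : [set th | T th q = q] = (T ^~ q) @^-1` [set q] by [].
  apply: closed_comp; first by move=> z _; exact: (act_continuous_par action).
  exact: accessible_closed_set1 (hausdorff_accessible hausN) q.
have : K `<=` [set th | T th q = q]; last exact.
by rewrite [X in _ `<=` X]((closure_id _).1 cl); apply: closureS => _ [t _ <-]; rewrite /= repE fixed_orbit.
Qed.

Let domK th : K th -> actdom T c c (th, x0).
Proof. by move=> Kth; have tc := qc; rewrite -(fixedK Kth) in tc; exact: (actdom_pt ac qc tc). Qed.

Let derivativeK th v i : K th -> 'D_((0, v) : PV) (fun z => Phi z 0 i) (th, x0) = v 0 i.
Proof.
move=> Kth; apply/eqP; rewrite -subr_eq0; apply/negP => /negP ne.
have cD0 : {for th, continuous (fun th => 'D_((0, v) : PV) (fun z => Phi z 0 i) (th, x0))}.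
  apply: (@continuous_comp _ _ _ (fun th => (th, x0)) (fun z => 'D_((0, v) : PV) (fun z => Phi z 0 i) z)).
    by apply: continuous_pair_at; [exact: continuous_id_at|exact: continuous_cst_at].
  exact: smooth_cont (smooth_derive _ (sPhi i)) (domK Kth).
have cD := continuousB cD0 (@cst_continuous _ _ (v 0 i) th).
have [_ [[t _ <-]]] := Kth _ (near_neq0 cD ne).
move=> /eqP; apply; apply: (@etrans _ _ ('D_((0, v) : PV) (fun z => Phi z 0 i) (rep t, x0) - v 0 i)); first by [].
apply/eqP; rewrite subr_eq0; apply/eqP.
rewrite -(derivative_fixed t v i).
have drep : actdom T c c (rep t, x0).
  by have tc := qc; rewrite -(fixed_orbit t) -repE in tc; exact: (actdom_pt ac qc tc).
have /is_derive_slice_r [_ E1] := smooth_is_derive ((0, v) : PV) (sPhi i) drep.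
have /is_derive_slice_r [_ E2] := smooth_is_derive ((0, v) : PV) (sPhi i) (dom t).
rewrite -E1 -E2; congr ('D_v _ x0); apply/funext => x.
by rewrite /Phi /act_loc /= repE.
Qed.

(** Compactness of [K] makes the radius independent of the torus element. The bound is chosen so
    that summing over the [m] coordinates gives less than 1/2. *)
Let uniform : exists2 r : R, 0 < r & forall x, ball x0 r x -> forall th, K th ->
  actdom T c c (th, x) /\
  forall i j : 'I_m, `|'D_((0, delta_mx 0 j) : PV) (fun z => Phi z 0 i) (th, x) - (j == i)%:R| <= (2 * m.+1%:R)^-1.
Proof.
have e0 : 0 < (2 * m.+1%:R)^-1 :> R by rewrite invr_gt0 mulr_gt0.
have /compact_near_coveringP C := compactK.
have : \forall x \near x0, K `<=` (fun th => actdom T c c (th, x) /\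
  forall i j : 'I_m, `|'D_((0, delta_mx 0 j) : PV) (fun z => Phi z 0 i) (th, x) - (j == i)%:R| <= (2 * m.+1%:R)^-1).
  apply: (C _ (nbhs x0) (fun x th => actdom T c c (th, x) /\
    forall i j : 'I_m, `|'D_((0, delta_mx 0 j) : PV) (fun z => Phi z 0 i) (th, x) - (j == i)%:R| <= (2 * m.+1%:R)^-1)).
  move=> th Kth; have D := domK Kth.
  have : \forall z \near (th, x0), actdom T c c z /\
      forall i j : 'I_m, `|'D_((0, delta_mx 0 j) : PV) (fun z => Phi z 0 i) z - (j == i)%:R| <= (2 * m.+1%:R)^-1.
    apply: filterI; first exact: (open_near (open_actdom action ac ac) D).
    suff : \forall z \near (th, x0), forall ij : 'I_m * 'I_m,
        `|'D_((0, delta_mx 0 ij.2) : PV) (fun z => Phi z 0 ij.1) z - (ij.2 == ij.1)%:R| <= (2 * m.+1%:R)^-1.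
      by apply: filterS => z H i j; exact: (H (i, j)).
    apply: near_forall => -[i j] /=.
    have cD := smooth_cont (smooth_derive ((0, delta_mx 0 j) : PV) (sPhi i)) D.
    have := near_dist_le cD e0; apply: filterS => z; rewrite derivativeK // mxE eqxx /=.
    by rewrite eq_sym.
  by apply: filterS => -[th' x].
by move=> /nbhs_ballP[r r0 H]; exists r => // x xr th Kth; exact: (H x xr th Kth).
Qed.

(** Near [q] every map of the group differs from the identity by a map of Lipschitz constant 1/2. If
    [P t] moved [x], each iterate would move it on by at least half as far in nearly the same
    direction, yet all iterates stay in a fixed ball. *)
Lemma fixed_near : \forall p \near q, forall t, T (t *: a) p = p.
Proof.
have [r r0 rP] := uniform.
have rball x : `|x - x0| < r -> ball x0 r x by rewrite -ball_normE /= distrC.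
have lip th x y : K th -> `|x - x0| < r -> `|y - x0| < r ->
    `|Phi (th, y) - Phi (th, x) - (y - x)| <= 2^-1 * `|y - x|.
  move=> Kth xr yr; apply: row_norm_le => [|i]; first by rewrite mulr_ge0 ?invr_ge0.
  have := @line_mvt R _ (fun z => Phi (th, z) 0 i) x (y - x) ((y - x) 0 i) (2^-1 * `|y - x|) _.
  rewrite (addrC x) subrK => H.
  have -> : (Phi (th, y) - Phi (th, x) - (y - x)) 0 i = Phi (th, y) 0 i - Phi (th, x) 0 i - (y - x) 0 i by rewrite !mxE.
  apply: H => t /andP[t0 t1].
  set z := x + t *: (y - x).
  have zr : `|z - x0| < r.
    rewrite (_ : z - x0 = (1 - t) *: (x - x0) + t *: (y - x0)); last first.
      by apply/rowP => j; rewrite !mxE; ring.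
    apply: le_lt_trans (ler_normD _ _) _; rewrite !normrZ (ger0_norm t0) ger0_norm ?subr_ge0 //.
    have [->|tn] := eqVneq t 0; first by rewrite subr0 mul1r mul0r addr0.
    have tp : 0 < t by rewrite lt_neqAle eq_sym tn.
    have A : (1 - t) * `|x - x0| <= (1 - t) * r by rewrite ler_wpM2l ?subr_ge0 // ltW.
    have B : t * `|y - x0| < t * r by rewrite ltr_pM2l.
    by lra.
  have [dz Dz] := rP z (rball z zr) th Kth.
  have sf : smooth_on [set z | actdom T c c (th, z)] (fun z => Phi (th, z) 0 i).
    exact: (smooth_slice_r th (sPhi i)).
  have oS : open [set z | actdom T c c (th, z)].
    have -> : [set z | actdom T c c (th, z)] = (fun z => (th, z)) @^-1` actdom T c c by [].
    apply: open_comp; last exact: (open_actdom action ac ac).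
    by move=> u _; apply: continuous_pair_at; [exact: continuous_cst_at|exact: continuous_id_at].
  have [D1 _] := smooth_is_derive (y - x) sf dz; split; first exact: D1.
  rewrite (derive_partial _ (smooth_diff_fun oS sf dz)) -(sum_deltaC (fun j => (y - x) 0 j) i).
  rewrite -sumrB; apply: le_trans (ler_norm_sum _ _ _) _.
  apply: (@le_trans _ _ (\sum_(j < m) `|y - x| * (2 * m.+1%:R)^-1)); last first.
    rewrite sumr_const card_ord -[X in X <= _]mulr_natr -mulrA [X in X <= _]mulrC; apply: ler_wpM2r => //.
    by rewrite invfM -mulrA ler_piMr // ler_pdivrMl // mulr1 ler_nat leqnSn.
  apply: ler_sum => j _; rewrite -mulrBr normrM; apply: ler_pM => //; first exact: coord_le_norm.
  have /is_derive_slice_r [_ E] := smooth_is_derive ((0, delta_mx 0 j) : PV) (sPhi i) dz.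
  by rewrite /partial E eq_sym; exact: Dz.
pose P s x := cmap c (T (s *: a) (cinv c x)).
have Krep s : K (rep s) by apply: subset_closure; exists s.
have PE s x : P s x = Phi (rep s, x) by rewrite /Phi /act_loc /= repE.
have P0 s : P s x0 = x0 by rewrite PE -PE /P (cmapK ac qc) fixed_orbit.
have xr0 : `|x0 - x0| < r by rewrite subrr normr0.
have move2 s x : `|x - x0| < r / 2 -> `|P s x - x0| < r.
  move=> xr; have xr' : `|x - x0| < r by apply: lt_le_trans xr _; lra.
  have := lip _ _ _ (Krep s) xr0 xr'; rewrite -!PE P0 => H.
  have := ler_normD (P s x - x0 - (x - x0)) (x - x0); rewrite subrK => H'.
  by move: (normr_ge0 (x - x0)) => ?; lra.
have dom2 s x : `|x - x0| < r -> cimg c x /\ cdom c (T (s *: a) (cinv c x)).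
  by move=> xr; have [[h1 h2] _] := rP x (rball x xr) _ (Krep s); split=> //; rewrite -repE.
have compP s t x : `|x - x0| < r / 2 -> P s (P t x) = P (s + t) x.
  move=> xr; have xr' : `|x - x0| < r by apply: lt_le_trans xr _; lra.
  have [_ tc] := dom2 t x xr'.
  by rewrite {1}/P /P (cmapK ac tc) scalerDl (actD action).
have fixP t x : `|x - x0| < r / 2 -> P t x = x.
  move=> xr; have xr' : `|x - x0| < r by apply: lt_le_trans xr _; lra.
  set y := P t x; have yr : `|y - x0| < r by exact: move2.
  (* The displacements of the first [J] iterates telescope to [P (J%:R * t) x - x], which is
     bounded, while each is within half of [y - x] from [y - x]. *)
  have bound J : J%:R * `|y - x| <= 4 * r.
    have tele : \sum_(j < J) (P (j%:R * t) y - P (j%:R * t) x) = P (J%:R * t) x - x.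
      elim: J => [|J IH].
        rewrite big_ord0 mul0r /P scale0r (act0 action); have [_ ->] := cinvK ac (dom2 0 x xr').1.
        by rewrite subrr.
      by rewrite big_ord_recr IH /= compP // -natr1 mulrDl mul1r addrC addrA subrK.
    have L : `|\sum_(j < J) (P (j%:R * t) y - P (j%:R * t) x - (y - x))| <= J%:R * (2^-1 * `|y - x|).
      apply: le_trans (ler_norm_sum _ _ _) _.
      apply: (@le_trans _ _ (\sum_(j < J) 2^-1 * `|y - x|)).
        by apply: ler_sum => j _; rewrite !PE; exact: lip.
      by rewrite sumr_const card_ord -[X in X <= _]mulr_natl.
    rewrite sumrB tele sumr_const card_ord in L.
    have E : (y - x) *+ J = (P (J%:R * t) x - x0) - (x - x0) - (P (J%:R * t) x - x - (y - x) *+ J).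
      by rewrite opprB opprD opprK addrA; apply/rowP => l; rewrite !mxE; ring.
    have nE : `|(y - x) *+ J| = J%:R * `|y - x| by rewrite -scaler_nat normrZ normr_nat.
    have n1 := ler_normB (P (J%:R * t) x - x0 - (x - x0)) (P (J%:R * t) x - x - (y - x) *+ J).
    have n2 := ler_normB (P (J%:R * t) x - x0) (x - x0).
    rewrite -E nE in n1; have n3 := move2 (J%:R * t) x xr.
    by move: n1 n2 n3 L xr'; rewrite !mulrA; lra.
  apply/eqP; rewrite -subr_eq0 -normr_le0 leNgt; apply/negP => d0.
  have := bound (Num.bound `|4 * r / `|y - x| |); rewrite leNgt => /negP; apply.
  rewrite -ltr_pdivrMr //; exact: le_lt_trans (ler_norm _) (archi_boundP (normr_ge0 _)).
have H : \forall x \near x0, `|x - x0| < r / 2.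
  by apply/nbhs_ballP; exists (r / 2) => [|x]; [rewrite /= divr_gt0|rewrite -ball_normE /= distrC].
have H2 := near_cmap ac qc H.
have H3 := open_near (open_cdom ac) qc (fun p pc => pc).
near=> p => t.
have pc : cdom c p by near: p.
have pr : `|cmap c p - x0| < r / 2 by near: p.
have pr' : `|cmap c p - x0| < r by apply: lt_le_trans pr _; lra.
have [_ tc] := dom2 t _ pr'; rewrite (cmapK ac pc) in tc.
have := fixP t _ pr; rewrite /P (cmapK ac pc) => E.
by rewrite -(cmapK ac tc) E (cmapK ac pc).
Unshelve. all: by end_near. Qed.

End AveragedFixedPoint.

(** * Second-order conditions at a maximum *)

Section LocalMaximum.
Context {R : realType} {V : normedModType R}.
Variables (U : set V) (F : V -> R) (x0 : V).
Hypotheses (oU : open U) (sF : smooth_on U F) (Ux0 : U x0) (Fmax : forall x, U x -> F x <= F x0).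

Let near_line v : \forall t \near (0 : R), U (x0 + t *: v).
Proof.
have cl : {for 0, continuous (fun t : R => x0 + t *: v)}.
  by apply: cvgD; [exact: cvg_cst|exact: scalel_continuous].
by apply: (near_comp cl); rewrite scale0r addr0; exact: (open_near oU Ux0).
Qed.

Lemma derive_at_max v : 'D_v F x0 = 0.
Proof.
have /nbhs_ballP[d /= d0 H] := near_line v.
have {}H t : t \in `]-d, d[ -> U (x0 + t *: v).
  by rewrite in_itv /= -ltr_norml => td; apply: H; rewrite /ball /= sub0r normrN.
have [||||_ E] := @derive1_at_max R (fun t => F (x0 + t *: v)) (- d) d 0.
- by lra.
- by move=> t /H xt; have [] := is_derive_shift_line (smooth_is_derive v sF xt).
- by rewrite in_itv /= oppr_lt0 d0.
- by move=> t /H xt; rewrite scale0r addr0; exact: Fmax.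
have [_ E'] := (is_derive_line F x0 v _).1 (smooth_is_derive v sF Ux0).
by rewrite -E'.
Qed.

(** For [w] opposite to [v] the second difference is twice the maximal value minus two values of
    [F], hence nonnegative. *)
Lemma derive2_at_max v : 'D_v ('D_v F) x0 <= 0.
Proof.
apply/ler_addgt0Pl => e e0; rewrite addr0.
have A := second_difference v (-1 *: v) oU (sF 2) Ux0 e0.
have [t [tn At [U1 U2]]] := near0_ex2 A (filterI (near_line v) (near_line (-1 *: v))).
have E : 'D_(-1 *: v) ('D_v F) x0 = - 'D_v ('D_v F) x0.
  have [_ ->] := is_derive_scale (-1) (smooth_is_derive v (smooth_derive v sF) Ux0).
  by rewrite scaleN1r.
have x0E : x0 + t *: v + t *: (-1 *: v) = x0 by rewrite scaleN1r scalerN addrK.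
have t0 : 0 < t ^+ 2 by rewrite exprn_even_gt0.
move: At; rewrite x0E E => /ler_normlP[_ At].
have M1 := Fmax U1; have M2 := Fmax U2.
rewrite -(ler_pM2l t0); lra.
Qed.

End LocalMaximum.

Section Hessian.
Context {R : realType} {m : nat}.
Variables (U : set 'rV[R]_m) (F : 'rV[R]_m -> R) (x0 : 'rV[R]_m).
Hypotheses (oU : open U) (sF : smooth_on U F) (Ux0 : U x0).

Definition hessian : 'M[R]_m := \matrix_(i, j) partial i (partial j F) x0.

Lemma hessianE v w : 'D_v ('D_w F) x0 = (v *m hessian *m w^T) 0 0.
Proof.
have E : \forall x \near x0, 'D_w F x = \sum_j w 0 j * partial j F x.
  apply: (open_near oU Ux0) => x Ux.
  exact: (derive_partial _ (smooth_diff_fun oU sF Ux)).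
rewrite (near_eq_derive _ E).
have sP j : smooth_on U (partial j F) by exact: smooth_derive.
have D j : is_derive x0 v (fun x => w 0 j * partial j F x) (w 0 j * 'D_v (partial j F) x0).
  exact: (is_deriveZ (w 0 j) (smooth_is_derive v (sP j) Ux0)).
have [_] := @is_derive_sum _ _ _ _ (fun j x => w 0 j * partial j F x) x0 v _ D.
rewrite (_ : \sum_j _ = (fun x => \sum_j w 0 j * partial j F x)); last by apply/funext => x; rewrite fct_sumE.
move=> ->; rewrite mxE; apply: eq_bigr => j _; rewrite mulrC [w^T _ _]mxE; congr (_ * _).
rewrite (derive_partial _ (smooth_diff_fun oU (sP j) Ux0)) mxE.
by apply: eq_bigr => i _; rewrite [hessian _ _]mxE.
Qed.

Lemma hessian_sym : hessian^T = hessian.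
Proof. by apply/matrixP => i j; rewrite !mxE; exact: (derive_schwarz (k := 0) _ _ oU (sF 2) Ux0). Qed.

Hypothesis Fmax : forall x, U x -> F x <= F x0.

(** An isotropic vector of a semidefinite form lies in its kernel: with [w] its image, the form on
    [w + t *: v] is affine in [t] with slope twice the squared norm of [w], so boundedness above
    forces [w] to be 0. *)
Lemma hessian_null v : 'D_v ('D_v F) x0 = 0 -> v *m hessian = 0.
Proof.
rewrite hessianE => vv; set w := v *m hessian.
have nsd (u : 'rV[R]_m) : (u *m hessian *m u^T) 0 0 <= 0 by rewrite -hessianE; exact: (derive2_at_max oU sF Ux0 Fmax).
have vw : (v *m hessian *m w^T) 0 0 = \sum_i w 0 i ^+ 2.
  by rewrite mxE; apply: eq_bigr => i _; rewrite [w^T _ _]mxE expr2.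
have wv : (w *m hessian *m v^T) 0 0 = \sum_i w 0 i ^+ 2.
  have tr (A : 'M[R]_1) : A 0 0 = A^T 0 0 by rewrite [RHS]mxE.
  by rewrite -vw tr !trmx_mul trmxK hessian_sym mulmxA.
set b := \sum_i _ in vw wv; set a := (w *m hessian *m w^T) 0 0.
have b0 : 0 <= b by apply: sumr_ge0 => i _; rewrite sqr_ge0.
have H t : a + 2 * t * b <= 0.
  have := nsd (w + t *: v); rewrite linearD linearZ /= !mulmxDl !mulmxDr -!scalemxAl -!scalemxAr.
  rewrite [X in X <= 0](_ : _ = a + 2 * t * b) //.
  have addE (A B : 'M[R]_1) : (A + B) 0 0 = A 0 0 + B 0 0 by rewrite mxE.
  have scaleE s (A : 'M[R]_1) : (s *: A) 0 0 = s * A 0 0 by rewrite mxE.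
  by rewrite !(addE, scaleE) wv vw vv -/a; ring.
have b00 : b = 0.
  apply/eqP; rewrite eq_le b0 andbT leNgt; apply/negP => bp.
  have := H ((1 - a) / (2 * b)); have -> : a + 2 * ((1 - a) / (2 * b)) * b = 1 by field; rewrite gt_eqF.
  by rewrite ler10.
apply/rowP => i; rewrite [RHS]mxE; apply/eqP; rewrite -sqrf_eq0.
by move/eqP: b00; rewrite psumr_eq0 => [/allP/(_ i)|j _]; [rewrite mem_index_enum => /(_ isT)|exact: sqr_ge0].
Qed.

End Hessian.

(** Where [A] vanishes the derivative of the coefficient [C] drops out, so the first jet of [A] can
    be read off its contractions. *)
Lemma derive_mulmx_zero {R : realType} m (U : set 'rV[R]_m) (A : 'rV[R]_m -> 'rV[R]_m)
  (B : 'rV[R]_m -> R) (C : 'rV[R]_m -> 'cV[R]_m) x0 v : open U -> smooth_on U A -> smooth_on U C -> U x0 ->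
  A x0 = 0 -> (forall x, U x -> A x *m C x = (B x)%:M) ->
  (\row_i 'D_v (fun x => A x 0 i) x0) *m C x0 = ('D_v B x0)%:M.
Proof.
move=> oU sA sC Ux0 A0 AC.
have sAi i : smooth_on U (fun x => A x 0 i) by move/(smooth_mx oU): sA; apply.
have sCi i : smooth_on U (fun x => C x i 0) by move/(smooth_mx oU): sC; apply.
have E : \forall x \near x0, B x = \sum_i A x 0 i * C x i 0.
  by apply: (open_near oU Ux0) => x Ux; have /(congr1 (fun M : 'M[R]_1 => M 0 0)) := AC x Ux; rewrite !mxE eqxx => ->.
rewrite (near_eq_derive _ E).
have D i := is_deriveM (smooth_is_derive v (sAi i) Ux0) (smooth_is_derive v (sCi i) Ux0).
have [_] := @is_derive_sum _ _ _ _ (fun i x => A x 0 i * C x i 0) x0 v _ D.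
rewrite (_ : \sum_i _ = (fun x => \sum_i A x 0 i * C x i 0)); last by apply/funext => x; rewrite fct_sumE.
move=> ->; apply/matrixP => i j; rewrite !ord1 mxE [RHS]mxE eqxx; apply: eq_bigr => l _.
by rewrite A0 [(0 : 'rV[R]_m) _ _]mxE scale0r add0r mxE mulrC.
Qed.

Lemma continuous_at_comp (S T U : topologicalType) (f : S -> T) (g : T -> U) x :
  {for x, continuous f} -> {for f x, continuous g} -> {for x, continuous (fun y => g (f y))}.
Proof. exact: continuous_comp. Qed.

Lemma continuous_lincomb (R : realType) (T : topologicalType) (u v : R) (F G : T -> R) :
  continuous F -> continuous G -> continuous (fun x => u * F x + v * G x).
Proof.
move=> cF cG x.
exact: continuousD (continuousM (@cst_continuous _ _ u x) (cF x)) (continuousM (@cst_continuous _ _ v x) (cG x)).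
Qed.

(** * Integration in a chart *)

Section BoxIntegral.
Context {R : realType}.
Local Notation leb := (@lebesgue_measure R).

(** The centre is a sequence indexed by nat, so that the tail used in the induction on [m] is again
    a centre. *)
Definition in_box m (a : nat -> R) (r : R) : set 'rV[R]_m := [set x | forall i : 'I_m, `|x 0 i - a i| <= r].

Definition cons_row m (t : R) (y : 'rV[R]_m) : 'rV[R]_m.+1 := row_mx (t%:M : 'rV[R]_1) y.

Lemma cons_row0 m t (y : 'rV[R]_m) : cons_row t y 0 ord0 = t.
Proof.
rewrite (_ : ord0 = @lshift 1 m ord0); last exact: val_inj.
by apply: (etrans (row_mxEl (t%:M : 'rV[R]_1) y 0 ord0)); rewrite mxE.
Qed.

Lemma cons_rowS m t (y : 'rV[R]_m) i : cons_row t y 0 (fintype.lift ord0 i) = y 0 i.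
Proof.
rewrite (_ : fintype.lift ord0 i = @rshift 1 m i); last exact: val_inj.
exact: row_mxEr.
Qed.

Lemma in_box_cons m a r t (y : 'rV[R]_m) :
  in_box a r (cons_row t y) <-> `|t - a 0%N| <= r /\ in_box (fun i => a i.+1) r y.
Proof.
split=> [H|[H0 H] i].
  split=> [|i]; first by have := H ord0; rewrite cons_row0.
  by have := H (fintype.lift ord0 i); rewrite cons_rowS.
by case: (unliftP ord0 i) => [j ->|->]; rewrite ?cons_row0 ?cons_rowS //; exact: H.
Qed.

Lemma cons_row_continuous m : continuous (fun z : R * 'rV[R]_m => cons_row z.1 z.2).
Proof.
move=> z; apply: mx_continuous_at => i j; rewrite (ord1 i).
case: (unliftP ord0 j) => [l ->|->].
  rewrite (_ : (fun _ => _) = (fun z : R * 'rV[R]_m => z.2 0 l)); last first.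
    by apply/funext => w; rewrite cons_rowS.
  by apply: (continuous_at_comp (f := snd) (g := fun y : 'rV[R]_m => y 0 l)); [exact: cvg_snd|exact: coord_continuous].
rewrite (_ : (fun _ => _) = (fun z : R * 'rV[R]_m => z.1)); first exact: cvg_fst.
by apply/funext => w; rewrite cons_row0.
Qed.

Lemma cons_continuous_l m (F : 'rV[R]_m.+1 -> R) t : continuous F -> continuous (fun y => F (cons_row t y)).
Proof.
move=> cF y; apply: (continuous_at_comp (f := cons_row t) (g := F)); last exact: cF.
apply: (continuous_at_comp (f := fun y : 'rV[R]_m => (t, y)) (g := fun z => cons_row z.1 z.2)); last exact: cons_row_continuous.
by apply: continuous_pair_at => //; exact: continuous_cst_at.
Qed.

(** A real-valued companion of [iter_integral] for continuous integrands of either sign, for which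
    linearity and the fundamental theorem of calculus are available. *)
Fixpoint box_integral m (a : nat -> R) (r : R) : ('rV[R]_m -> R) -> R :=
  match m with
  | 0 => fun F => F 0
  | m'.+1 => fun F => Rintegral leb `[a 0%N - r, a 0%N + r]
      (fun t => box_integral (fun i => a i.+1) r (fun y : 'rV[R]_m' => F (cons_row t y)))
  end.

Variable r : R.
Hypothesis r0 : 0 < r.
Local Notation JB a := (box_integral a r).

Let itvP t (c : R) : t \in ([set` `[c - r, c + r]] : set R) = (`|t - c| <= r).
Proof. by rewrite ler_distl; apply/idP/idP; rewrite inE /= in_itv. Qed.

Lemma box_integral_ext m a (F G : 'rV[R]_m -> R) : (forall x, in_box a r x -> F x = G x) -> JB a F = JB a G.
Proof.
elim: m a F G => [|m IH] a F G FG /=; first by apply: FG => -[].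
apply: eq_Rintegral => t; rewrite itvP => tr; apply: IH => y yB.
by apply: FG; apply/in_box_cons.
Qed.

Lemma box_compact m a : compact (in_box a r : set 'rV[R]_m).
Proof.
rewrite (_ : in_box a r = [set y : 'rV[R]_m | `|y - \row_i a i| <= r]); first exact: closed_ball_compact.
apply/seteqP; split=> y H /=.
  by apply: row_norm_le (ltW r0) _ => i; rewrite !mxE; exact: H.
by move=> i; have := le_trans (coord_le_norm (y - \row_i a i) i) H; rewrite !mxE.
Qed.

(** Compactness of the box makes continuity in the first coordinate uniform in the others. *)
Lemma box_tube m a (F : 'rV[R]_m.+1 -> R) t e : continuous F -> 0 < e ->
  \forall s \near t, forall y, in_box a r y -> `|F (cons_row s y) - F (cons_row t y)| < e.
Proof.
move=> cF e0.
have /compact_near_coveringP C := @box_compact m a.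
apply: (C R (nbhs t) (fun s y => `|F (cons_row s y) - F (cons_row t y)| < e)) => y _.
have cG : {for (y, t), continuous (fun z : 'rV[R]_m * R => F (cons_row z.2 z.1) - F (cons_row t z.1))}.
  apply: cvgB.
    apply: (continuous_at_comp (f := fun z : 'rV[R]_m * R => cons_row z.2 z.1) (g := F)); last exact: cF.
    apply: (continuous_at_comp (f := fun z : 'rV[R]_m * R => (z.2, z.1)) (g := fun z => cons_row z.1 z.2)); last exact: cons_row_continuous.
    by apply: continuous_pair_at; [exact: cvg_snd|exact: cvg_fst].
  by apply: (continuous_at_comp (f := fst) (g := fun y => F (cons_row t y))); [exact: cvg_fst|exact: cons_continuous_l].
have := cG; move/cvgrPdist_lt => /(_ _ e0) /=.
by apply: filterS => -[y' s] /=; rewrite subrr sub0r normrN.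
Qed.

(** Linearity and the bound go through the induction together: one dimension up, both need the inner
    integral to be continuous in its parameter ([param]), which follows from both in the lower
    dimension. *)
Let good m := (forall a c (F G : 'rV[R]_m -> R), continuous F -> continuous G ->
    JB a (fun x => c * F x + G x) = c * JB a F + JB a G) /\
  (forall a e (F : 'rV[R]_m -> R), continuous F -> (forall x, in_box a r x -> `|F x| <= e) ->
    `|JB a F| <= (2 * r) ^+ m * e).

Let r2 m : 0 < (2 * r) ^+ m. Proof. by rewrite exprn_gt0 // mulr_gt0. Qed.

Let param m a (F : 'rV[R]_m.+1 -> R) : good m -> continuous F ->
  continuous (fun t => JB a (fun y => F (cons_row t y))).
Proof.
move=> [lin bnd] cF t; apply/cvgrPdist_le => /= e e0.
have e'0 : 0 < e / (2 * r) ^+ m by rewrite divr_gt0.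
near=> s.
have cG u : continuous (fun y => F (cons_row u y)) by exact: cons_continuous_l.
have -> : JB a (fun y => F (cons_row t y)) - JB a (fun y => F (cons_row s y)) =
    JB a (fun y => -1 * F (cons_row s y) + F (cons_row t y)) by rewrite lin // mulN1r addrC.
rewrite (_ : e = (2 * r) ^+ m * (e / (2 * r) ^+ m)); last by rewrite mulrC divfK // gt_eqF.
apply: bnd => [y|y yB].
  exact: continuousD (continuousM (@cst_continuous _ _ (-1 : R) y) (cG s y)) (cG t y).
rewrite mulN1r addrC distrC; apply: ltW; move: y yB; near: s; exact: box_tube.
Unshelve. all: by end_near. Qed.

Let itv_integrable (g : R -> R) c : continuous g -> leb.-integrable `[c - r, c + r] (EFin \o g).
Proof.
by move=> cg; apply: continuous_compact_integrable; [exact: segment_compact|exact: continuous_subspaceT].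
Qed.

Let all_good m : good m.
Proof.
elim: m => [|m IH].
  by split=> [a c F G _ _ //|a e F _ H] /=; rewrite mul1r; apply: H => -[].
have P a (F : 'rV[R]_m.+1 -> R) (cF : continuous F) := param (a := a) IH cF.
split=> [a c F G cF cG|a e F cF H] /=.
  have E t : _ = _ := IH.1 (fun i => a i.+1) c _ _ (@cons_continuous_l _ _ t cF) (@cons_continuous_l _ _ t cG).
  under eq_Rintegral => t _ do rewrite E.
  rewrite RintegralD //; [rewrite RintegralZl //; exact/itv_integrable/P| |exact/itv_integrable/P].
  by apply: itv_integrable => t; apply: cvgM; [exact: cvg_cst|exact: P].
have D0 : lebesgue_measure ([set` `[a 0%N - r, a 0%N + r]] : set R) = (2 * r)%:E.
  rewrite lebesgue_measure_itv /= lte_fin ifT; first by rewrite -EFinD; congr EFin; ring.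
  by rewrite ltrD2l gtrN.
pose g t := JB (fun i => a i.+1) (fun y => F (cons_row t y)).
have cg : continuous g by exact: P.
have cn : continuous (fun t => `|g t|) by move=> t; exact: (continuous_comp (cg t) (@norm_continuous _ R^o _)).
have gb t : t \in ([set` `[a 0%N - r, a 0%N + r]] : set R) -> `|g t| <= (2 * r) ^+ m * e.
  rewrite itvP => tr; apply: IH.2 => [|y yB]; first exact: cons_continuous_l.
  by apply: H; apply/in_box_cons.
have B : `|Rintegral leb `[a 0%N - r, a 0%N + r] g| <= Rintegral leb `[a 0%N - r, a 0%N + r] (fun t => `|g t|).
    by apply: le_normr_Rintegral => //; exact: itv_integrable.
  apply: (le_trans B).
apply: (@le_trans _ _ (Rintegral leb `[a 0%N - r, a 0%N + r] (fun=> (2 * r) ^+ m * e))).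
  apply: le_Rintegral => //; [exact: itv_integrable|by apply: itv_integrable => t; exact: cvg_cst|].
  by move=> t tD; apply: gb; rewrite inE.
have -> : Rintegral leb `[a 0%N - r, a 0%N + r] (fun=> (2 * r) ^+ m * e) =
    (2 * r) ^+ m * e * fine (leb [set` `[a 0%N - r, a 0%N + r]]) by apply: Rintegral_cst.
by rewrite D0 /= exprS; lra.
Qed.

Lemma box_integral_linear m a c (F G : 'rV[R]_m -> R) : continuous F -> continuous G ->
  JB a (fun x => c * F x + G x) = c * JB a F + JB a G.
Proof. exact: (all_good m).1. Qed.

Lemma box_integral_lincomb m a u v (F G : 'rV[R]_m -> R) : continuous F -> continuous G ->
  JB a (fun x => u * F x + v * G x) = u * JB a F + v * JB a G.
Proof.
move=> cF cG; have c0 := continuous_lincomb (u := 0) (v := 0) cF cF.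
have z : JB a (fun x => 0 * F x + 0 * F x) = 0.
  have := box_integral_linear a 1 c0 c0; rewrite mul1r => /esym.
  rewrite (_ : (fun x => 1 * _ + _) = (fun x => 0 * F x + 0 * F x)); last by apply/funext => x; lra.
  by rewrite -[X in _ = X -> _]addr0 => /addrI.
have e1 : JB a (fun x => v * G x) = v * JB a G.
  rewrite -[RHS]addr0 -z -(box_integral_linear a v cG c0).
  by congr (box_integral _ _ _); apply/funext => x; lra.
rewrite -e1 -(box_integral_linear a u cF) // => x.
exact: continuousM (@cst_continuous _ _ v x) (cG x).
Qed.

Lemma box_integral_bound m a e (F : 'rV[R]_m -> R) : continuous F ->
  (forall x, in_box a r x -> `|F x| <= e) -> `|JB a F| <= (2 * r) ^+ m * e.
Proof. exact: (all_good m).2. Qed.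

Lemma box_integral_param m a (F : 'rV[R]_m.+1 -> R) : continuous F ->
  continuous (fun t => JB a (fun y => F (cons_row t y))).
Proof. exact: param (all_good m). Qed.

Lemma iter_integral0 m : iter_integral (fun _ : 'rV[R]_m => 0%E) = 0%E.
Proof. by elim: m => //= m IH; rewrite IH; apply: integral0. Qed.

Lemma iter_integral_box m a (F : 'rV[R]_m -> R) : continuous F ->
  iter_integral (fun x => (\1_(in_box a r) x * F x)%:E) = (JB a F)%:E.
Proof.
elim: m a F => [|m IH] a F cF /=; first by rewrite indicE mem_set ?mul1r // => -[].
pose g t := JB (fun i => a i.+1) (fun y => F (cons_row t y)).
have -> : (fun t : R => iter_integral (fun y : 'rV[R]_m =>
    (\1_(in_box a r) (row_mx (t%:M : 'rV[R]_1) y) * F (row_mx (t%:M : 'rV[R]_1) y))%:E)) =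
    ((EFin \o g) \_ `[(a 0%N - r)%R, (a 0%N + r)%R])%E.
  apply/funext => t; rewrite patchE itvP; case: ifPn => tr.
    rewrite /= -IH; last exact: cons_continuous_l.
    congr iter_integral; apply/funext => y; congr (_%:E); congr (_ * _); rewrite !indicE.
    congr (_%:R); congr nat_of_bool; apply/idP/idP; rewrite !inE; first by case/in_box_cons.
    by move=> yB; apply/in_box_cons.
  rewrite -[RHS](iter_integral0 m); congr iter_integral; apply/funext => y; rewrite indicE memNset ?mul0r //.
  by case/in_box_cons => tr'; rewrite tr' in tr.
rewrite -integral_mkcond /Rintegral fineK //; apply: integrable_fin_num => //.
by apply: itv_integrable; exact: box_integral_param.
Qed.

Lemma box_integral_derive m a (F F' : 'rV[R]_m.+1 -> R) t : continuous F -> continuous F' ->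
  (forall x, is_derive x (delta_mx 0 ord0 : 'rV[R]_m.+1) F (F' x)) ->
  is_derive (t : R) 1 (fun t => JB a (fun y => F (cons_row t y))) (JB a (fun y => F' (cons_row t y))).
Proof.
move=> cF cF' dF; pose g t := JB a (fun y => F (cons_row t y)); pose l := JB a (fun y => F' (cons_row t y)).
suff H : h^-1 *: (g (h *: 1 + t) - g t) @[h --> (0 : R)^'] --> l.
  by apply: DeriveDef; [apply/cvg_ex; exists l|exact: cvg_lim H].
apply/cvgrPdist_le => /= e e0; pose e' := e / (2 * r) ^+ m.
have e'0 : 0 < e' by rewrite divr_gt0.
have /(nbhs0P (fun s => forall y, in_box a r y -> `|F' (cons_row s y) - F' (cons_row t y)| < e')) :=
  box_tube a t cF' e'0.
move=> /nbhs_ballP[d /= d0 dP].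
near=> h.
have h0 : h != 0 by near: h; exact: nbhs_dnbhs_neq.
have hd : `|h| < d by near: h; apply: dnbhs0_lt.
have cl (G : 'rV[R]_m.+1 -> R) s : continuous G -> continuous (fun y => G (cons_row s y)) by exact: cons_continuous_l.
have e1 : g (h + t) - g t = JB a (fun y => -1 * F (cons_row t y) + F (cons_row (h + t) y)).
  by rewrite box_integral_linear; [rewrite mulN1r addrC|exact: cl|exact: cl].
rewrite [h *: 1]mulr1 /g e1.
have cm (u v : R) (G K : 'rV[R]_m -> R) : continuous G -> continuous K -> continuous (fun y => u * G y + K y).
  by move=> cG cK y; exact: continuousD (continuousM (@cst_continuous _ _ u y) (cG y)) (cK y).
have e2 : l - h^-1 *: JB a (fun y => -1 * F (cons_row t y) + F (cons_row (h + t) y)) =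
    JB a (fun y => - h^-1 * (-1 * F (cons_row t y) + F (cons_row (h + t) y)) + F' (cons_row t y)).
  rewrite [RHS]box_integral_linear; first by rewrite mulNr addrC.
    by apply: (cm (-1) 0) => //; exact: cl.
  exact: cl.
rewrite e2 (_ : e = (2 * r) ^+ m * e'); last by rewrite mulrC divfK // gt_eqF.
apply: box_integral_bound => [|y yB].
  by apply: (cm _ 0); [apply: (cm _ 0); exact: cl|exact: cl].
pose e_0 : 'rV[R]_m.+1 := delta_mx 0 ord0.
have line s : cons_row t y + s *: e_0 = cons_row (s + t) y.
  apply/rowP => j; rewrite mxE [X in _ + X]mxE [e_0 _ _]mxE /=.
  case: (unliftP ord0 j) => [i ->|->]; rewrite ?cons_rowS ?cons_row0 /=; first by rewrite mulr0 addr0.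
  by rewrite mulr1 addrC.
have := @line_mvt R _ F (cons_row t y) (h *: e_0) (h * F' (cons_row t y)) (`|h| * e') _.
rewrite (line h) => H.
have {}H : `|F (cons_row (h + t) y) - F (cons_row t y) - h * F' (cons_row t y)| <= `|h| * e'.
  apply: H => s /andP[s0 s1].
  have [D1 D2] := is_derive_scale h (dF (cons_row t y + s *: (h *: e_0))).
  split=> //; rewrite D2 scalerA line -[h *: _]/(h * _) -mulrBr normrM ler_wpM2l //.
  apply/ltW; move: y yB {e2 line D1 D2}.
  have := dP (s * h); rewrite /ball /= sub0r normrN normrM (ger0_norm s0) addrC => Q y yB.
  by apply: Q => //; apply: le_lt_trans hd; rewrite ler_piMl.
rewrite -(ler_pM2l (_ : 0 < `|h|)) ?normr_gt0 // -normrM; apply: le_trans H.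
rewrite -normrN le_eqVlt; apply/orP; left; apply/eqP; congr (`|_|); field; exact: h0.
Unshelve. all: by end_near. Qed.

(** In the first coordinate this is the fundamental theorem of calculus for the inner integral,
    which vanishes at both ends; the other coordinates are reached by induction on slices. *)
Lemma box_integral_partial m (a : nat -> R) (F : 'rV[R]_m -> R) i : smooth_on setT F ->
  (forall x : 'rV[R]_m, (exists j : 'I_m, r <= `|x 0 j - a j|) -> F x = 0) -> JB a (partial i F) = 0.
Proof.
elim: m a F i => [|m IH] a F i sF F0; first by case: i.
have cF (G : 'rV[R]_m.+1 -> R) : smooth_on setT G -> continuous G by move=> sG x; exact: (smooth_cont sG I).
have sP : smooth_on setT (partial i F) by exact: smooth_derive.
have zero : Rintegral leb `[a 0%N - r, a 0%N + r] (fun=> 0) = 0.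
  by rewrite /Rintegral integral0.
case: (unliftP ord0 i) => [j|] iE; last first.
  pose g t := JB (fun i => a i.+1) (fun y => F (cons_row t y)).
  pose g' t := JB (fun i => a i.+1) (fun y => partial i F (cons_row t y)).
  have D t : is_derive (t : R) 1 g (g' t).
    apply: box_integral_derive; [exact: cF|exact: cF|move=> x].
    by rewrite -iE; exact: (smooth_is_derive _ sF).
  have c' : continuous g' by apply: box_integral_param; exact: cF.
  have cg t : {for t, continuous g} by apply: differentiable_continuous; apply/derivable1_diffP; case: (D t).
  have g0 t : r <= `|t - a 0%N| -> g t = 0.
    move=> tr; rewrite /g (@box_integral_ext _ _ _ (fun=> -1 * 0 + 0)); last first.
      by move=> y _; rewrite mulr0 addr0; apply: F0; exists ord0; rewrite cons_row0.
    by rewrite box_integral_linear; [lra|exact: cst_continuous|exact: cst_continuous].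
  have z1 : g (a 0%N + r) = 0 by apply: g0; rewrite addrAC subrr add0r ler_norm.
  have z2 : g (a 0%N - r) = 0 by apply: g0; rewrite addrAC subrr add0r normrN ler_norm.
  rewrite /= -/(g' _) /Rintegral (@continuous_FTC2 _ g' g) //=.
  - by rewrite z1 z2 /= subrr.
  - by rewrite ltrD2l gtrN.
  - exact: continuous_subspaceT.
  - split=> [t _||]; [by case: (D t)|exact: cvg_at_right_filter (cg _)|exact: cvg_at_left_filter (cg _)].
  - by move=> t _; rewrite derive1E; case: (D t).
rewrite /= (@eq_Rintegral _ _ _ _ _ (fun=> 0)) // => t _.
pose A : 'M[R]_(m, m.+1) := \matrix_(k, l) (fintype.lift ord0 k == l)%:R.
have cE y : cons_row t y = y *m A + cons_row t 0.
  apply/rowP => l; rewrite [in RHS]mxE [X in X + _]mxE.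
  under eq_bigr => k _ do rewrite [A _ _]mxE.
  case: (unliftP ord0 l) => [k ->|->]; rewrite ?cons_rowS ?cons_row0.
    rewrite mxE addr0 -[LHS]sum_delta; apply: eq_bigr => k' _.
    by rewrite (inj_eq (@lift_inj _ ord0)).
  by rewrite big1 ?add0r // => k _; rewrite mulr0.
have sG : smooth_on setT (fun y => F (cons_row t y)).
  apply: (@smooth_eq _ _ _ _ (fun y => F (y *m A + cons_row t 0))) => //; first exact: openT.
    by move=> y _; rewrite -cE.
  by apply: (smooth_comp_fun openT openT _ (smooth_affine _ _ _) sF).
rewrite -(IH (fun i => a i.+1) (fun y => F (cons_row t y)) j sG).
  apply: box_integral_ext => y _.
  have /is_derive_line D := smooth_is_derive (delta_mx 0 i) sF (I : setT (cons_row t y)).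
  have E : (fun s : R => F (cons_row t y + s *: delta_mx 0 i)) = (fun s => F (cons_row t (y + s *: delta_mx 0 j))).
    apply/funext => s; congr F; apply/rowP => l; rewrite iE [in LHS]mxE [X in _ + X]mxE [delta_mx _ _ _ _]mxE.
    case: (unliftP ord0 l) => [k ->|->]; rewrite ?cons_rowS ?cons_row0.
      by rewrite !mxE (inj_eq lift_inj).
    by rewrite /= mulr0 addr0.
  rewrite E in D; have [_ D'] := (is_derive_line (fun y => F (cons_row t y)) y (delta_mx 0 j) _).2 D.
  exact: esym D'.
by move=> y [l lr]; apply: F0; exists (fintype.lift ord0 l); rewrite cons_rowS.
Qed.

End BoxIntegral.

(** * Integrals of functions without measurability *)

Section NonmeasurableIntegral.
Local Open Scope ereal_scope.
Context d (T : measurableType d) (R : realType) (mu : {measure set T -> \bar R}).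
Import HBNNSimple.

(* Integrals are suprema over simple functions, so monotonicity and superadditivity need no measurability. *)
Lemma le_integralT (f g : T -> \bar R) : (forall x, f x <= g x) -> \int[mu]_x f x <= \int[mu]_x g x.
Proof.
move=> fg; rewrite /integral !patch_setT; apply: leeB; apply: ereal_sup_le => _ /= [h hf <-];
  exists h => // x; apply: le_trans (hf x) _.
  by apply: (@funepos_le _ _ setT) (in_setT x) => y _.
by apply: (@funeneg_le _ _ setT) (in_setT x) => y _.
Qed.

Lemma integral_superadditive (f g : T -> \bar R) : (forall x, 0 <= f x) -> (forall x, 0 <= g x) ->
  \int[mu]_x f x + \int[mu]_x g x <= \int[mu]_x (f x + g x).
Proof.
move=> f0 g0; have fg0 x : 0 <= f x + g x by rewrite adde_ge0.
have [->|fin] := eqVneq (\int[mu]_x (f x + g x)) +oo; first exact: leey.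
have {}fin : \int[mu]_x (f x + g x) \is a fin_num by rewrite ge0_fin_numE ?lt_neqAle ?fin ?leey // integral_ge0.
have H (h1 h2 : {nnsfun T >-> R}) : (forall x, (h1 x)%:E <= f x) -> (forall x, (h2 x)%:E <= g x) ->
    sintegral mu h1 + sintegral mu h2 <= \int[mu]_x (f x + g x).
  move=> h1f h2g; rewrite -sintegralD (ge0_integralTE _ fg0); apply: ereal_sup_ubound.
  by exists (add_nnsfun h1 h2) => // x; rewrite /= EFinD leeD.
have fin1 (h1 : {nnsfun T >-> R}) : (forall x, (h1 x)%:E <= f x) -> sintegral mu h1 \is a fin_num.
  move=> h1f; rewrite ge0_fin_numE ?sintegral_ge0 //.
  apply: le_lt_trans (_ : \int[mu]_x (f x + g x) < +oo); last by rewrite ltey_eq fin.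
  apply: le_trans (H h1 nnsfun0 h1f _); first by rewrite sintegral0 adde0.
  by move=> x.
rewrite (ge0_integralTE _ f0) -leeBrDr; last first.
  rewrite ge0_fin_numE ?integral_ge0 //.
  apply: le_lt_trans (_ : \int[mu]_x (f x + g x) < +oo); last by rewrite ltey_eq fin.
  by apply: le_integralT => x; rewrite leeDr.
apply: ge_ereal_sup => _ /= [h1 h1f <-]; rewrite leeBrDr; last first.
  rewrite ge0_fin_numE ?integral_ge0 //.
  apply: le_lt_trans (_ : \int[mu]_x (f x + g x) < +oo); last by rewrite ltey_eq fin.
  by apply: le_integralT => x; rewrite leeDr.
rewrite addeC -leeBrDr ?fin1 // (ge0_integralTE _ g0).
apply: ge_ereal_sup => _ /= [h2 h2g <-]; rewrite leeBrDr ?fin1 // addeC; exact: H.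
Qed.

End NonmeasurableIntegral.

Section IterIntegral.
Context {R : realType}.

Lemma iter_integral_ge0 m (f : 'rV[R]_m -> \bar R) : (forall x, 0 <= f x)%E -> (0 <= iter_integral f)%E.
Proof. by elim: m f => //= m IH f f0; apply: integral_ge0 => t _; apply: IH. Qed.

Lemma le_iter_integral m (f g : 'rV[R]_m -> \bar R) : (forall x, f x <= g x)%E ->
  (iter_integral f <= iter_integral g)%E.
Proof. by elim: m f g => //= m IH f g fg; apply: le_integralT => t; apply: IH. Qed.

Lemma iter_integral_superadditive m (f g : 'rV[R]_m -> \bar R) : (forall x, 0 <= f x)%E ->
  (forall x, 0 <= g x)%E -> (iter_integral f + iter_integral g <= iter_integral (fun x => f x + g x))%E.
Proof.
elim: m f g => [//|m IH] f g f0 g0 /=.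
apply: le_trans (integral_superadditive _ _ _) _; try by move=> t; exact: iter_integral_ge0.
by apply: le_integralT => t; apply: IH.
Qed.

Lemma iter_integral_sum m L (f : nat -> 'rV[R]_m -> R) : (forall j x, 0 <= f j x) ->
  (\sum_(j < L) iter_integral (fun x => (f j x)%:E) <= iter_integral (fun x => (\sum_(j < L) f j x)%:E))%E.
Proof.
move=> f0; elim: L => [|L IH].
  by rewrite big_ord0; apply: iter_integral_ge0 => x; rewrite big_ord0.
rewrite big_ord_recr /=; apply: le_trans (leeD IH (lexx _)) _.
apply: le_trans (iter_integral_superadditive _ _) _.
- by move=> x; rewrite lee_fin sumr_ge0.
- by move=> x; rewrite lee_fin.
by apply: le_iter_integral => x; rewrite big_ord_recr /= EFinD.
Qed.

(** The discrete layer-cake formula, with an error of at most 1. The error is later removed by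
    scaling the function. *)
Lemma level_sum (s : R) L : 0 <= s <= L%:R -> s <= \sum_(j < L) (j%:R < s)%R%:R <= s + 1.
Proof.
move=> /andP[s0]; elim: L => [|L IH] sL.
  by rewrite big_ord0 sL (le_trans s0) // lerDl.
rewrite big_ord_recr /=; have [sL'|Ls] := leP s L%:R; first by rewrite addr0 IH.
rewrite (eq_bigr (fun=> 1)); last first.
  by move=> j _; rewrite (lt_trans _ Ls) // ltr_nat ltn_ord.
by rewrite sumr_const card_ord -[1%:R]/1 -natr1 in sL *; rewrite sL lerD2r ltW.
Qed.
End IterIntegral.

(** * The volume measure against box integrals *)

Section MeasureLink.
Context {R : realType} {N : ptopologicalType} {m : nat}.
Local Notation NS := (g_sigma_algebraType (@open N)).
Variables (c : chart R N m) (mu : {measure set NS -> \bar R}) (rho rhot : 'rV[R]_m -> R).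
Variables (a : nat -> R) (r : R).
Local Notation B := (in_box a r).
Local Notation JB := (box_integral a r).
Hypothesis muc : forall A : set NS, measurable A -> A `<=` cdom c ->
  mu A = iter_integral (fun x => (\1_(cmap c @` (A : set N)) x * rho x)%:E).
Hypotheses (r0 : 0 < r) (rho0 : forall x, 0 <= rho x) (Bc : B `<=` cimg c).
Hypothesis cinvP : forall x, cimg c x -> cdom c (cinv c x) /\ cmap c (cinv c x) = x.
Hypothesis cmapP : forall q, cdom c q -> cinv c (cmap c q) = q.
Let K : set NS := cinv c @` B.
Hypothesis mK : measurable K.
Hypotheses (crhot : continuous rhot) (rhotE : forall x, B x -> rhot x = rho x).

Let Kc : K `<=` cdom c. Proof. by move=> _ [x xB <-]; case: (cinvP (Bc xB)). Qed.

Let KB q : cdom c q -> K q <-> B (cmap c q).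
Proof.
move=> qc; split=> [[x xB xq]|H]; last by exists (cmap c q) => //; exact: cmapP.
by rewrite -xq; have [_ ->] := cinvP (Bc xB).
Qed.

(** The chart formula measures sets only, so [psi] is bounded by the sum of the indicators of its
    integer superlevel sets; these sum to at most [psi] plus 1 on the box, and the 1 costs the
    volume of the box. *)
Let upper1 (psi : NS -> R) L G : measurable_fun setT psi -> (forall q, 0 <= psi q <= L%:R) ->
  (forall q, ~ K q -> psi q = 0) -> continuous G -> (forall x, B x -> G x = psi (cinv c x) * rho x) ->
  (\int[mu]_q (psi q)%:E <= (JB G + JB rhot)%:E)%E.
Proof.
move=> mpsi pL pK cG GE; pose A j : set NS := [set q | j%:R < psi q].
have mA j : measurable (A j).
  rewrite -[A j]setTI (_ : A j = psi @^-1` `]j%:R, +oo[); first exact: mpsi.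
  by apply/seteqP; split=> q; rewrite /A /= in_itv /= andbT.
have AK j : A j `<=` K.
  by move=> q; rewrite /A /=; apply: contraPP => /pK ->; rewrite ltNge ler0n.
apply: (@le_trans _ _ (\int[mu]_q \sum_(j < L) (\1_(A j) q)%:E)%E).
  apply: le_integralT => q; rewrite sumEFin lee_fin.
  rewrite (eq_bigr (fun j : 'I_L => (j%:R < psi q)%R%:R)); first by case/andP: (level_sum (pL q)).
  by move=> j _; rewrite indicE; congr (_%:R); congr nat_of_bool; apply/idP/idP; rewrite inE.
rewrite ge0_integral_sum //; last by move=> j; apply/measurable_EFinP; exact: (measurable_indic (mA j)).
under eq_bigr => j _ do rewrite integral_indic // setIT (muc (mA j) (subset_trans (AK j) Kc)).
pose f j x := \1_(cmap c @` (A j : set N)) x * rho x.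
apply: le_trans (@iter_integral_sum R m L f _) _; first by move=> j x; rewrite mulr_ge0.
have -> : JB G + JB rhot = JB (fun x => 1 * G x + 1 * rhot x) by rewrite box_integral_lincomb // !mul1r.
rewrite -iter_integral_box //; last exact: continuous_lincomb.
apply: le_iter_integral => x; rewrite lee_fin /f -mulr_suml !mul1r.
have inA j : (cmap c @` (A j : set N)) x -> B x /\ j%:R < psi (cinv c x).
  move=> [q qA qx]; have qc := Kc (AK j q qA).
  by rewrite -qx cmapP //; split=> //; apply/(KB qc)/(AK j q qA).
have [xB|xB] := pselect (B x); last first.
  rewrite big1 ?mul0r ?indicE ?memNset ?mul0r // => j _.
  by rewrite indicE memNset // => /inA[].
rewrite indicE mem_set // mul1r GE // rhotE // -[X in _ + X]mul1r -mulrDl; apply: ler_wpM2r => //.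
apply: le_trans (_ : \sum_(j < L) (j%:R < psi (cinv c x))%R%:R <= _); last by case/andP: (level_sum (pL (cinv c x))).
apply: ler_sum => j _; rewrite indicE; case: (boolP (x \in _)) => [|_]; last exact: ler0n.
by rewrite inE => /inA[_ ->].
Qed.

(** The estimate [upper1] for [k] times [psi], divided by [k]: the volume term disappears for large
    [k]. *)
Let upper (psi : NS -> R) L G : measurable_fun setT psi -> (forall q, 0 <= psi q <= L%:R) ->
  (forall q, ~ K q -> psi q = 0) -> continuous G -> (forall x, B x -> G x = psi (cinv c x) * rho x) ->
  (\int[mu]_q (psi q)%:E <= (JB G)%:E)%E.
Proof.
move=> mpsi pL pK cG GE; have I0 : (0 <= \int[mu]_q (psi q)%:E)%E.
  by apply: integral_ge0 => q _; rewrite lee_fin; case/andP: (pL q).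
have fin : (\int[mu]_q (psi q)%:E)%E \is a fin_num.
  by rewrite ge0_fin_numE //; apply: le_lt_trans (upper1 mpsi pL pK cG GE) _; exact: ltry.
have H k : k%:R * fine (\int[mu]_q (psi q)%:E)%E <= k%:R * JB G + JB rhot.
  rewrite -lee_fin EFinM fineK // -ge0_integralZl_EFin //; last 2 first.
  - by move=> q _; rewrite lee_fin; case/andP: (pL q).
  - exact/measurable_EFinP.
  have -> : k%:R * JB G = JB (fun x => k%:R * G x + 0 * G x).
    by rewrite box_integral_lincomb // mul0r addr0.
  apply: (upper1 (psi := fun q => k%:R * psi q) (L := (k * L)%N)).
  - by apply: measurable_funM => //; exact: measurable_cst.
  - by move=> q; case/andP: (pL q) => h1 h2; rewrite natrM mulr_ge0 //= ler_wpM2l.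
  - by move=> q /pK ->; rewrite mulr0.
  - exact: continuous_lincomb.
  - by move=> x xB; rewrite mul0r addr0 GE // mulrA.
rewrite -[X in (X <= _)%E]fineK // lee_fin leNgt; apply/negP => lt.
have d0 : 0 < fine (\int[mu]_q (psi q)%:E)%E - JB G by rewrite subr_gt0.
pose k := Num.bound `|JB rhot / (fine (\int[mu]_q (psi q)%:E)%E - JB G)|.
have := H k; rewrite -lerBlDl -mulrBr leNgt => /negP; apply.
by rewrite -ltr_pdivrMr //; exact: le_lt_trans (ler_norm _) (archi_boundP (normr_ge0 _)).
Qed.

Let muK : mu K = (JB rhot)%:E.
Proof.
rewrite (muc mK Kc) -iter_integral_box //; congr iter_integral; apply/funext => x; congr (_%:E).
rewrite !indicE; case: (pselect (B x)) => xB; last first.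
  rewrite !memNset ?mul0r // => -[q Kq qx]; apply: xB; rewrite -qx.
  exact/(KB (Kc Kq)).
rewrite !mem_set ?rhotE //; exists (cinv c x); first by exists x.
by have [] := cinvP (Bc xB).
Qed.

Let integrable (w : NS -> R) L : measurable_fun setT w -> (forall q, `|w q| <= L) ->
  (forall q, ~ K q -> w q = 0) -> mu.-integrable setT (EFin \o w).
Proof.
move=> mw wL wK; have -> : EFin \o w = (EFin \o w) \_ K.
  by apply/funext => q; rewrite patchE; case: ifPn => //; rewrite notin_setE => /wK /= ->.
apply: (integrable_mkcond _ mK).1; apply: measurable_bounded_integrable => //.
- by rewrite muK ltry.
- exact: measurable_funS mw.
- by exists L; split; [exact: num_real|move=> y Ly q _; apply: le_trans (wL q) (ltW Ly)].
Qed.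

Lemma chart_integral (w : NS -> R) L G : measurable_fun setT w -> (forall q, `|w q| <= L%:R) ->
  (forall q, ~ K q -> w q = 0) -> continuous G -> (forall x, B x -> G x = w (cinv c x) * rho x) ->
  mu.-integrable setT (EFin \o w) /\ (\int[mu]_q (w q)%:E = (JB G)%:E)%E.
Proof.
move=> mw wL wK cG GE; have iw := integrable mw wL wK; split=> //.
pose k (q : NS) : R := \1_K q.
have mk : measurable_fun setT k by exact: (measurable_indic mK).
have k1 q : `|k q| <= 1 by rewrite /k indicE; case: (q \in K); rewrite ?normr1 ?normr0.
have kK q : ~ K q -> k q = 0 by move=> nK; rewrite /k indicE memNset.
have kK1 q : K q -> k q = 1 by move=> qK; rewrite /k indicE mem_set.
have ik := integrable mk k1 kK.
have fw : (\int[mu]_q (w q)%:E)%E \is a fin_num by exact: integrable_fin_num.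
have ek : (\int[mu]_q (k q)%:E = (JB rhot)%:E)%E by rewrite integral_indic // setIT muK.
have main s : s ^+ 2 = 1 -> s * fine (\int[mu]_q (w q)%:E)%E <= s * JB G.
  move=> s2; have sn : `|s| = 1 by apply/eqP; rewrite -sqr_norm_eq1 s2.
  pose psi q := s * w q + L%:R * k q.
  have mpsi : measurable_fun setT psi.
    by apply: measurable_funD; apply: measurable_funM => //; exact: measurable_cst.
  have pL q : 0 <= psi q <= (2 * L)%N%:R.
    rewrite /psi natrM; have [qK|qK] := pselect (K q); last by rewrite wK // kK // !mulr0 addr0 lexx mulr_ge0.
    rewrite kK1 //; have : `|s * w q| <= L%:R by rewrite normrM sn mul1r.
    by rewrite ler_norml => /andP[]; lra.
  have := @upper psi _ (fun x => s * G x + L%:R * rhot x) mpsi pL _ _ _.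
  have -> : (\int[mu]_q (psi q)%:E)%E = (s * fine (\int[mu]_q (w q)%:E)%E + L%:R * JB rhot)%:E.
    under eq_integral => q _ do rewrite /psi EFinD !EFinM.
    rewrite integralD //; [|exact: integrableZl|exact: integrableZl].
    by rewrite !integralZl // ek EFinD !EFinM fineK.
  have -> : JB (fun x => s * G x + L%:R * rhot x) = s * JB G + L%:R * JB rhot by exact: box_integral_lincomb.
  rewrite lee_fin lerD2r; apply.
  - by move=> q nK; rewrite /psi wK // kK // !mulr0 addr0.
  - exact: continuous_lincomb.
  - by move=> x xB; rewrite GE // rhotE // /psi kK1; [ring|exists x].
rewrite -[LHS]fineK //; congr (_%:E); apply/eqP; rewrite eq_le.
by have := main 1 (expr1n _ _); have := main (-1) (sqrr_sign _ 1); lra.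
Qed.

End MeasureLink.

Section WedgeScale.
Context {R : realType} {n : nat}.
Let m := n.*2.+1.

Lemma wedge_top_mulmx (P : 'M[R]_m) (a : 'cV[R]_m) (B : 'M[R]_m) :
  wedge_top (P *m a) (P *m B *m P^T) = \det P * wedge_top a B.
Proof. by rewrite -[LHS]/(_ * wedge_sum _ _) wedge_sum_mulmx mulrCA. Qed.

(* In a basis in which a is a multiple of the first covector, only the entries of B on ker a contribute. *)
Lemma wedge_top_scale (l : R) (a : 'cV[R]_m) (B B' : 'M[R]_m) :
  (forall v w : 'rV[R]_m, v *m a = 0 -> w *m a = 0 -> v *m B' *m w^T = l *: (v *m B *m w^T)) ->
  wedge_top (l *: a) B' = l ^+ n.+1 * wedge_top a B.
Proof.
move=> BB'; pose P := invmx (col_ebase a).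
have uP : P \in unitmx by rewrite unitmx_inv col_ebase_unit.
have Pa i : i != ord0 -> (P *m a) i 0 = 0.
  move=> i0; rewrite -{1}(mulmx_ebase a) !mulmxA mulVmx ?col_ebase_unit // mul1mx mxE big1 // => j _.
  rewrite [pid_mx _ _ _]mxE (ord1 j) /= (_ : (nat_of_ord i == 0%N) = false) ?mul0r //.
  by apply: contraNF i0 => /eqP h; apply/eqP/val_inj.
have dP : \det P != 0 by rewrite -unitfE -unitmxE.
apply: (mulfI dP).
rewrite [RHS]mulrCA -[X in X = _](wedge_top_mulmx P (l *: a) B') -[X in _ * X](wedge_top_mulmx P a B) /wedge_top.
rewrite [RHS]mulrCA; congr (_ * _); rewrite mulr_sumr; apply: eq_bigr => s _.
rewrite [RHS]mulrCA; congr (_ * _).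
have PlE : (P *m (l *: a)) (s ord0) 0 = l * (P *m a) (s ord0) 0 by rewrite -scalemxAr mxE.
have [s0|s0] := eqVneq (s ord0) ord0; last first.
  by rewrite PlE Pa // mulr0 !mul0r mulr0.
rewrite PlE exprS -!mulrA; congr (_ * _); rewrite mulrCA; congr (_ * _).
rewrite -[n in l ^+ n]card_ord -prodr_const -big_split /=; apply: eq_bigr => i _.
have nz j : (0 < j < m)%N -> s (inord j) != ord0.
  move=> /andP[j0 jm]; rewrite -s0 (inj_eq perm_inj) -val_eqE /= inordK // -lt0n.
  by [].
have im : (i.*2.+2 < m)%N by rewrite /m ltnS -doubleS leq_double.
have rowP0 j : j != ord0 -> row j P *m a = 0.
  by move=> j0; apply/matrixP => x y; rewrite -row_mul mxE (ord1 y) Pa // mxE.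
have E (C : 'M[R]_m) x y : (P *m C *m P^T) x y = (row x P *m C *m (row y P)^T) 0 0.
  rewrite -row_mul mxE [RHS]mxE; apply: eq_bigr => z _.
  by rewrite [row x _ _ _]mxE [P^T _ _]mxE [(row y P)^T _ _]mxE [row y P _ _]mxE.
rewrite !E BB'; [by rewrite mxE| |]; apply: rowP0; apply: nz; first exact: ltnW.
by rewrite im.
Qed.

End WedgeScale.

Section SumOfBoxIntegrals.
Context {R : realType} {m : nat}.
Variables (a : nat -> R) (r l : R).
Hypothesis r0 : 0 < r.

Lemma box_integral_sum0 (I : Type) (s : seq I) (f : I -> 'rV[R]_m -> R) :
  (forall i, continuous (f i)) -> (forall i, box_integral a r (f i) = 0) ->
  continuous (fun x => \sum_(i <- s) l * f i x) /\ box_integral a r (fun x => \sum_(i <- s) l * f i x) = 0.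
Proof.
move=> cf f0; elim: s => [|i s [cs s0]].
  have -> : (fun x => \sum_(i <- [::]) l * f i x) = cst 0 by apply/funext => x; rewrite big_nil.
  split; first exact: cst_continuous.
  have := @box_integral_lincomb R r r0 m a 0 0 (fun=> 0) (fun=> 0) (@cst_continuous _ _ _) (@cst_continuous _ _ _).
  by rewrite !mul0r !addr0.
have -> : (fun x => \sum_(j <- i :: s) l * f j x) = (fun x => l * f i x + 1 * \sum_(j <- s) l * f j x).
  by apply/funext => x; rewrite big_cons mul1r.
split; first exact: continuous_lincomb.
by rewrite box_integral_lincomb // f0 s0 !mulr0 addr0.
Qed.
End SumOfBoxIntegrals.

Section Clamp.
Context {R : realType} {m : nat}.
Variables (x0 : 'rV[R]_m) (r : R).
Hypothesis r0 : 0 <= r.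

(** Each coordinate offset is truncated to the interval from [- r] to [r]. Composition with this
    retraction extends a density that is continuous on the box to a continuous function on the whole
    space. *)
Definition clamp (x : 'rV[R]_m) : 'rV[R]_m :=
  \row_i (x0 0 i + (`|x 0 i - x0 0 i + r| - `|x 0 i - x0 0 i - r|) / 2).

Lemma clamp_continuous : continuous clamp.
Proof.
move=> x; apply: mx_continuous_at => i j.
have -> : (fun y => clamp y i j) = (fun y => x0 0 j + (`|y 0 j - x0 0 j + r| - `|y 0 j - x0 0 j - r|) / 2).
  by apply/funext => y; rewrite mxE.
have cj (s : R) : {for x, continuous (fun y : 'rV[R]_m => `|y 0 j - x0 0 j + s|)}.
  apply: norm_continuous_at.
  exact: continuousD (continuousB (@coord_continuous _ 1 m 0 j x) (@cst_continuous _ _ _ x)) (@cst_continuous _ _ _ x).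
apply: continuousD; first exact: cst_continuous.
by apply: continuousM; [exact: continuousB (cj r) (cj (- r))|exact: cst_continuous].
Qed.

Lemma clamp_box x : `|clamp x - x0| <= r.
Proof.
apply: row_norm_le => // i; rewrite !mxE addrAC subrr add0r normrM [X in _ * X]ger0_norm ?invr_ge0 //.
rewrite ler_pdivrMr //; apply: le_trans (ler_dist_dist _ _) _.
have -> : x 0 i - x0 0 i + r - (x 0 i - x0 0 i - r) = r * 2 by ring.
by rewrite ger0_norm // mulr_ge0.
Qed.

Lemma clampE x : `|x - x0| <= r -> clamp x = x.
Proof.
move=> xr; apply/rowP => i; rewrite mxE; have := le_trans (coord_le_norm (x - x0) i) xr; rewrite !mxE.
rewrite ler_norml => /andP[h1 h2]; rewrite ger0_norm; last lra.
by rewrite ler0_norm; lra.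
Qed.
End Clamp.

Lemma continuous_borel {R : realType} {N : ptopologicalType} (f : N -> R) : continuous f ->
  measurable_fun [set: g_sigma_algebraType (@open N)] (f : g_sigma_algebraType (@open N) -> R).
Proof.
move=> cf; apply: (measurability _ (RGenOInfty.measurableE R)) => _ [_ [x ->] <-].
rewrite setTI; apply: sub_sigma_algebra.
by apply: open_comp; [move=> q _; exact: cf|exact: rray_open].
Qed.

(** * The Sasaki cone *)

Section SasakiCone.
Context {R : realType} {N : ptopologicalType} {n k : nat}.
Let d := n.*2.
Let m := d.+1.
Variables (M : smooth_structure R N m) (S : cr_data R N m) (T : 'rV[R]_k -> N -> N).
Variables eta eta0 : N -> 'cV[R]_m.
Hypotheses (hausN : hausdorff_space N) (compactN : compact [set: N]) (connectedN : connected [set: N]).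
Hypotheses (action : smooth_action M T) (crT : forall a, cr_diffeo M S (T a)).
Hypotheses (contact : contact_form M S eta) (crS : cr_structure M S).
Hypothesis contact0 : contact_form M S eta0.
Hypothesis pos0 : forall p v, cr_D S p v -> v != 0 -> 0 < bilin (extder M eta0 p) v (v *m cr_J S p).
Local Notation gen := (generator M T).

Section ReebField.
Variable b : 'rV[R]_k.
Hypothesis cb : sasaki_cone M eta T b.
Local Notation etab := (eta_of M eta T b).
Local Notation aloc c := (form_loc M c etab).
Local Notation Xloc c := (vfield_loc M c (gen b)).

Lemma pairing_pos q : 0 < pairing (eta q) (gen b q). Proof. exact: cb. Qed.

Lemma eta_of_generator q : gen b q *m etab q = 1%:M.
Proof.
rewrite /eta_of -scalemxAr [gen b q *m eta q]mx11_scalar -/(pairing _ _) -scalemx1 scalerA.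
by rewrite mulVf ?scale1r // gt_eqF // pairing_pos.
Qed.

Lemma eta_of_kernel q v : cr_D S q v <-> v *m etab q = 0.
Proof.
have p0 : (pairing (eta q) (gen b q))^-1 != 0 by rewrite invr_eq0 gt_eqF // pairing_pos.
case: contact => _ _ H _; rewrite H /eta_of -scalemxAr; split=> [E|/eqP].
  by rewrite [v *m eta q]mx11_scalar -/(pairing _ _) E raddf0 scaler0.
by rewrite scaler_eq0 (negbTE p0) /pairing => /eqP ->; rewrite mxE.
Qed.

Lemma contact_smooth : smooth_form M eta. Proof. by case: contact. Qed.

Lemma smooth_eta_of : smooth_form M etab.
Proof.
move=> c ac; have oc := open_cimg ac.
have sX := smooth_generator action b ac; have sa := contact_smooth ac.
pose g x := (vfield_loc M c (gen b) x *m form_loc M c eta x) 0 0.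
have gE x : cimg c x -> g x = pairing (eta (cinv c x)) (gen b (cinv c x)).
  move=> xi; have [qc E] := cinvK ac xi; rewrite /g -{1 2}E.
  by rewrite (pairing_loc eta (gen b) ac qc).
have sg : smooth_on (cimg c) g by have := smooth_mulmx oc sX sa; move/(smooth_mx oc); apply.
have g0 x : cimg c x -> g x != 0 by move=> xi; rewrite (gE x xi) gt_eqF // pairing_pos.
apply: (smooth_eq oc) (smooth_scale oc (smooth_inv oc g0 sg) sa) => x xi.
by rewrite (gE x xi) /form_loc /eta_of -scalemxAr.
Qed.

(* Both sides have the kernel D and the value 1 on the T-invariant field X_b. *)
Lemma eta_of_invariant a q : tangent_map M (T a) q *m etab (T a q) = etab q.
Proof.
set al := _ *m _; have H1 : gen b q *m al = 1%:M.
  by rewrite /al mulmxA (generator_invariant action) eta_of_generator.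
have H0 (v : 'rV[R]_m) : v *m etab q = 0 -> v *m al = 0.
  move=> /eta_of_kernel Dv; have [_ _ H _] := crT a; have [Dv' _] := H q v Dv.
  by rewrite /al mulmxA; apply/eta_of_kernel.
apply/row_matrixP => i; rewrite !rowE.
pose v : 'rV[R]_m := delta_mx 0 i - (delta_mx 0 i *m etab q) *m gen b q.
have /H0 : v *m etab q = 0 by rewrite mulmxBl -(mulmxA (delta_mx 0 i *m etab q)) eta_of_generator mulmx1 subrr.
rewrite mulmxBl -(mulmxA (delta_mx 0 i *m etab q)) H1 mulmx1 => /eqP; rewrite subr_eq0 => /eqP.
by [].
Qed.

Lemma eta_of_invariant_loc c c' a q : atlas M c -> atlas M c' -> cdom c q -> cdom c' (T a q) ->
  'J (cmap c' \o T a \o cinv c) (cmap c q) *m form_loc M c' etab (cmap c' (T a q)) =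
  form_loc M c etab (cmap c q).
Proof.
move=> ac ac' qc qc'; have [sT _ _ _] := crT a.
rewrite (tangent_map_loc sT ac ac' qc qc').
apply: etrans (congr1 (mulmx _) (form_locE etab ac' qc')) _.
apply: etrans _ (esym (form_locE etab ac qc)); rewrite -!mulmxA; congr (_ *m _).
apply: etrans (congr1 (mulmx _) (mulmxA _ _ _)) _.
rewrite (jacK (atlas_at M (T a q)) ac' (cdom_at M (T a q)) qc') mul1mx.
exact: eta_of_invariant.
Qed.

Local Notation PV := ('rV[R]_k * 'rV[R]_m)%type.

Section Chart.
Variables (c : chart R N m) (b' : 'rV[R]_k).
Hypothesis ac : atlas M c.
Let a := form_loc M c etab.
Let X' := vfield_loc M c (gen b').
Let oc := open_cimg ac.
Let sa : smooth_on (cimg c) a. Proof. exact: smooth_eta_of. Qed.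
Let sX' : smooth_on (cimg c) X'. Proof. exact: smooth_generator. Qed.
Let sai j : smooth_on (cimg c) (fun y => a y j 0). Proof. by move/(smooth_mx oc): sa; apply. Qed.
Let sXi j : smooth_on (cimg c) (fun y => X' y 0 j). Proof. by move/(smooth_mx oc): sX'; apply. Qed.

(** The Lie derivative of the rescaled form along any generator is 0. The pullback by a torus
    element is constant in that element; differentiating at 0 and exchanging the mixed derivatives
    gives the coordinate formula. *)
Lemma lie_derivative_eta_of x i : cimg c x ->
  \sum_j partial i (fun y => X' y 0 j) x * a x j 0 + 'D_(X' x) (fun y => a y i 0) x = 0.
Proof.
move=> xi; have [qc qE] := cinvK ac xi; set q := cinv c x in qc qE.
pose F (z : PV) := act_loc T c c z; pose D := actdom T c c.
have oD : open D := open_actdom action ac ac.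
have D0 : D (0, x) := actdom0 action ac xi.
have sF : smooth_on D F := smooth_act_loc action ac ac.
pose Fj j (z : PV) := F z 0 j.
have sFj j : smooth_on D (Fj j) by move/(smooth_mx oD): sF; apply.
have FD z : D z -> cimg c (F z) by case=> _ H; exact: cimg_cmap.
pose ei : PV := (0, delta_mx 0 i); pose bb : PV := (b', 0).
have sG j : smooth_on D ('D_ei (Fj j)) by exact: smooth_derive.
have saF j : smooth_on D (fun z => a (F z) j 0) by exact: (smooth_comp_fun oD oc FD sF (sai j)).
have Fx y : cimg c y -> F (0, y) = y.
  by move=> yi; have [yc E] := cinvK ac yi; rewrite /F /act_loc /= (act0 action).
pose Psi z := \sum_j 'D_ei (Fj j) z * a (F z) j 0.
have PsiE z : D z -> z.2 = x -> Psi z = a x i 0.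
  case: z => [al y] /= Dz yx; move: Dz; rewrite yx => Dz.
  have Hq : cdom c (T al q) by case: Dz.
  have [sT _ _ _] := crT al.
  have dT := differentiable_map_loc sT ac ac qc Hq.
  have := eta_of_invariant_loc ac ac qc Hq; rewrite qE => /matrixP/(_ i 0); rewrite -/a mxE => <-.
  rewrite /Psi; apply: eq_bigr => j _.
  have -> : a (F (al, x)) j 0 = form_loc M c etab (cmap c (T al q)) j 0 by [].
  congr (_ * _); rewrite qE in dT; rewrite (jacobianE _ _ dT).
  have DD := smooth_is_derive ei (sFj j) Dz.
  by have [_ <-] := (is_derive_slice_r _ _ _ _ _).1 DD.
have Psi0 : 'D_bb Psi (0, x) = 0.
  have H : is_derive ((0, x) : PV) bb Psi 0.
    apply/is_derive_slice_l.
    have C : is_derive (0 : 'rV[R]_k) b' (fun=> a x i 0) 0 by exact: is_derive_cst.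
    apply: (near_eq_is_derive _ C).
    have nb : nbhs (0 : 'rV[R]_k) [set al | D (al, x)].
      apply: open_nbhs_nbhs; split=> //; apply: (@open_comp _ _ (fun al : 'rV[R]_k => (al, x) : PV)) => //.
      by move=> al _; apply: continuous_pair_at; [exact: continuous_id_at|exact: continuous_cst_at].
    by apply: filterS nb => al Dal; rewrite PsiE.
  by have [] := H.
have DP j := is_deriveM (smooth_is_derive bb (sG j) D0) (smooth_is_derive bb (saF j) D0).
have [_] := @is_derive_sum _ _ _ _ (fun j z => 'D_ei (Fj j) z * a (F z) j 0) (0, x) bb _ DP.
rewrite (_ : \sum_j _ = Psi); last by apply/funext => z; rewrite fct_sumE.
rewrite Psi0 => /esym; rewrite big_split /= => E.
have E1 j : 'D_ei (Fj j) (0, x) = (i == j)%:R.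
  have DD := smooth_is_derive ei (sFj j) D0.
  have [_ <-] := (is_derive_slice_r _ _ _ _ _).1 DD.
  have -> : 'D_(delta_mx 0 i) (fun w : 'rV[R]_m => Fj j (0, w)) x =
      'D_(delta_mx 0 i) (fun w : 'rV[R]_m => w 0 j) x.
    by apply: near_eq_derive; apply: (open_near oc xi) => y yi; rewrite /Fj Fx.
  have I := is_derive_id x (delta_mx 0 i : 'rV[R]_m).
  by have [_ ->] := (is_derive_mx _ _ _ _).1 I 0 j; rewrite mxE eqxx /= eq_sym.
have E2 j : 'D_bb (fun z => a (F z) j 0) (0, x) = 'D_(X' x) (fun y => a y j 0) x.
  have DX := vfield_loc_act action b' ac xi.
  have df : differentiable (fun y => a y j 0) (F (0, x)).
    by rewrite (Fx x xi); exact: (smooth_diff_fun oc (sai j) xi).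
  have [_ H] := is_derive_comp (@ex_derive _ _ _ _ _ _ _ DX) df.
  apply: etrans H _; have [_ ->] := DX.
  by have -> : act_loc T c c (0, x) = x := Fx x xi.
have E3 j : 'D_bb ('D_ei (Fj j)) (0, x) = partial i (fun y => X' y 0 j) x.
  have -> : 'D_bb ('D_ei (Fj j)) (0, x) = 'D_ei ('D_bb (Fj j)) (0, x).
    exact: (derive_schwarz _ _ oD (sFj j 2%N)).
  have s2 : smooth_on D ('D_bb (Fj j)) by exact: smooth_derive.
  have [_ <-] := (is_derive_slice_r _ _ _ _ _).1 (smooth_is_derive ei s2 D0).
  apply: near_eq_derive; apply: (open_near oc xi) => y yi.
  have DX := vfield_loc_act action b' ac yi.
  by have [_ ->] := (is_derive_mx _ _ _ _).1 DX 0 j.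
rewrite -[RHS]E addrC; congr (_ + _).
  by apply: eq_bigr => j _; rewrite E3 (Fx x xi) mulrC.
apply/esym; rewrite (bigD1 i) //= E1 eqxx E2 scale1r big1 ?addr0 // => j ji.
by rewrite E1 eq_sym (negbTE ji) scale0r.
Qed.

(** Cartan's magic formula with vanishing Lie derivative: contracting the generator into the
    differential gives minus the differential of its Hamiltonian. *)
Lemma contact_hamiltonian x j : cimg c x ->
  (X' x *m extder_loc a x) 0 j = - partial j (contact_ham a X') x.
Proof.
move=> xi; pose v : 'rV[R]_m := delta_mx 0 j.
have -> : partial j (contact_ham a X') x =
    \sum_l (X' x 0 l * partial j (fun y => a y l 0) x + a x l 0 * partial j (fun y => X' y 0 l) x).
  have D l := is_deriveM (smooth_is_derive v (sXi l) xi) (smooth_is_derive v (sai l) xi).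
  have [_] := @is_derive_sum _ _ _ _ (fun l y => X' y 0 l * a y l 0) x v _ D.
  rewrite (_ : \sum_l _ = contact_ham a X'); last by apply/funext => y; rewrite fct_sumE /contact_ham mxE.
  by [].
have := lie_derivative_eta_of j xi.
rewrite (derive_partial _ (smooth_diff_fun oc (sai j) xi)) => H.
have -> : (X' x *m extder_loc a x) 0 j = \sum_l X' x 0 l * partial l (fun y => a y j 0) x
    - \sum_l X' x 0 l * partial j (fun y => a y l 0) x.
  rewrite mxE -sumrB; apply: eq_bigr => l _; rewrite [extder_loc a x l j]mxE.
  exact: mulrBr.
rewrite big_split /=; have -> : \sum_l X' x 0 l * partial l (fun y => a y j 0) x =
    - \sum_l partial j (fun y => X' y 0 l) x * a x l 0.
  by apply/eqP; rewrite -addr_eq0; apply/eqP; rewrite -[RHS]H; exact: addrC.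
rewrite [in RHS]addrC opprD; congr (- _ - _).
by apply: eq_bigr => l _; exact: mulrC.
Qed.
End Chart.

Lemma reeb_chart c x : atlas M c -> cimg c x ->
  vfield_loc M c (gen b) x *m form_loc M c etab x = 1%:M.
Proof.
move=> ac xi; have [qc E] := cinvK ac xi; rewrite -E (pairing_loc etab (gen b) ac qc).
exact: eta_of_generator.
Qed.

Lemma reeb_kernel c x : atlas M c -> cimg c x ->
  vfield_loc M c (gen b) x *m extder_loc (form_loc M c etab) x = 0.
Proof.
move=> ac xi; apply/rowP => j; rewrite (contact_hamiltonian b ac j xi) [RHS]mxE.
apply/eqP; rewrite oppr_eq0; apply/eqP; rewrite -[RHS](derive_cst (1 : R) x (delta_mx 0 j)).
apply: near_eq_derive; apply: (open_near (open_cimg ac) xi) => y yi.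
by rewrite /contact_ham (reeb_chart ac yi) mxE eqxx.
Qed.

Let kerP q v : cr_D S q v <-> v *m etab q = 0 := eta_of_kernel q v.
Let etabX q : gen b q *m etab q = 1%:M := eta_of_generator q.

Lemma J_D q v : cr_D S q v -> cr_D S q (v *m cr_J S q) /\ v *m cr_J S q *m cr_J S q = - v.
Proof. by case: crS => _ H _ _; exact: H. Qed.

Lemma proportional_form (al : 'cV[R]_m) q : (forall v, cr_D S q v -> v *m al = 0) ->
  al = (gen b q *m al) 0 0 *: etab q.
Proof.
move=> H; apply/row_matrixP => i; rewrite !rowE -scalemxAr.
pose v : 'rV[R]_m := delta_mx 0 i - (delta_mx 0 i *m etab q) *m gen b q.
have /kerP/H : v *m etab q = 0.
  by rewrite mulmxBl -(mulmxA (delta_mx 0 i *m etab q)) etabX mulmx1 subrr.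
rewrite mulmxBl -(mulmxA (delta_mx 0 i *m etab q)) => /eqP; rewrite subr_eq0 => /eqP ->.
by rewrite {1}[gen b q *m al]mx11_scalar mul_mx_scalar.
Qed.

Definition J_loc c x : 'M[R]_m :=
  let q := cinv c x in jac c (chart_at M q) q *m cr_J S q *m jac (chart_at M q) c q.

Lemma J_locE c q : atlas M c -> cdom c q ->
  J_loc c (cmap c q) = jac c (chart_at M q) q *m cr_J S q *m jac (chart_at M q) c q.
Proof. by move=> ac qc; rewrite /J_loc (cmapK ac qc). Qed.

Lemma aloc_kernel c q v : atlas M c -> cdom c q ->
  cr_D S q v <-> v *m jac (chart_at M q) c q *m aloc c (cmap c q) = 0.
Proof.
move=> ac qc; rewrite (form_locE etab ac qc) mulmxA -(mulmxA v).
by rewrite (jacK (atlas_at M q) ac (cdom_at M q) qc) mulmx1; exact: kerP.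
Qed.

Lemma aloc_kernelV c q v : atlas M c -> cdom c q ->
  cr_D S q (v *m jac c (chart_at M q) q) <-> v *m aloc c (cmap c q) = 0.
Proof.
move=> ac qc; rewrite (aloc_kernel _ ac qc) -(mulmxA v).
by rewrite (jacK ac (atlas_at M q) qc (cdom_at M q)) mulmx1.
Qed.

Lemma J_locP c x (v : 'rV[R]_m) : atlas M c -> cimg c x -> v *m aloc c x = 0 ->
  v *m J_loc c x *m aloc c x = 0 /\ v *m J_loc c x *m J_loc c x = - v.
Proof.
move=> ac xi; have [qc E] := cinvK ac xi; set q := cinv c x in qc E *; rewrite -E.
rewrite (J_locE ac qc) => /(aloc_kernelV v ac qc) /J_D [H1 H2].
have K : jac (chart_at M q) c q *m jac c (chart_at M q) q = 1%:M.
  exact: (jacK (atlas_at M q) ac (cdom_at M q) qc).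
have K' : jac c (chart_at M q) q *m jac (chart_at M q) c q = 1%:M.
  exact: (jacK ac (atlas_at M q) qc (cdom_at M q)).
have H3 := (aloc_kernel _ ac qc).1 H1.
split; first by rewrite (mulmxA v) (mulmxA v).
move: (jac (chart_at M q) c q) (jac c (chart_at M q) q) (cr_J S q) K K' H2 => B A J BA AB H2.
have -> : v *m (A *m J *m B) *m (A *m J *m B) = v *m A *m J *m (B *m A) *m J *m B by rewrite !mulmxA.
by rewrite BA mulmx1 H2 mulNmx -mulmxA AB mulmx1.
Qed.

(** The matrix of the complex structure is meaningful on the contact hyperplane only; preceded by
    this projection it becomes a tensor that can be smooth. *)
Definition D_projection c x : 'M[R]_m := 1%:M - aloc c x *m Xloc c x.

Lemma D_projection_kernel c x : atlas M c -> cimg c x -> D_projection c x *m aloc c x = 0.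
Proof.
move=> ac xi; rewrite mulmxBl mul1mx -mulmxA.
by rewrite (reeb_chart ac xi) mulmx1 subrr.
Qed.

Lemma smooth_D_projection c : atlas M c -> smooth_on (cimg c) (D_projection c).
Proof.
move=> ac; have oc := open_cimg ac; apply: (smooth_subf oc); first exact: smooth_cst.
apply: (smooth_mulmx oc); first exact: (smooth_eta_of ac).
exact: (smooth_generator action b ac).
Qed.

Lemma exists_D_section c p (v : 'rV[R]_m) : atlas M c -> cdom c p ->
  exists (chi : 'rV[R]_m -> R) (X : N -> 'rV[R]_m),
   [/\ smooth_on setT chi, 0 < chi (cmap c p), D_section M S X &
     forall q, cdom c q -> vfield_loc M c X (cmap c q) = chi (cmap c q) *: (v *m D_projection c (cmap c q))].
Proof.
move=> ac pc; have oc := open_cimg ac.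
have sV : smooth_on (cimg c) (fun x => v *m D_projection c x).
  by apply: (smooth_mulmx oc); [exact: smooth_cst|exact: smooth_D_projection].
have [chi [X [schi chi0 sX XE X0]]] :=
  exists_extended_field hausN ac oc (cimg_cmap pc) (fun _ H => H) sV.
exists chi, X; split=> //; split=> // q; apply/kerP.
have [qc|nqc] := pselect (cdom c q); last by rewrite X0 ?mul0mx.
rewrite -(pairing_loc etab X ac qc) (XE q qc) -scalemxAl -mulmxA.
by rewrite (D_projection_kernel ac (cimg_cmap qc)) mulmx0 scaler0.
Qed.

Lemma applyJ_loc c (X : N -> 'rV[R]_m) q : atlas M c -> cdom c q ->
  vfield_loc M c (applyJ S X) (cmap c q) = vfield_loc M c X (cmap c q) *m J_loc c (cmap c q).
Proof.
move=> ac qc; rewrite (J_locE ac qc).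
apply: etrans (vfield_locE (applyJ S X) ac qc) _.
apply: etrans _ (congr1 (fun B => B *m _) (esym (vfield_locE X ac qc))).
have K := jacK (atlas_at M q) ac (cdom_at M q) qc.
rewrite /applyJ; move: (jac (chart_at M q) c q) (jac c (chart_at M q) q) (cr_J S q) (X q) K.
move=> B A J v BA; rewrite !mulmxA -(mulmxA v) BA mulmx1.
by [].
Qed.

(** The hypothesis concerns global sections of the contact bundle. A local section is multiplied by
    a bump function, extended and transformed, and the bump function is divided out where it is
    nonzero. *)
Lemma smooth_J_loc c : atlas M c -> smooth_on (cimg c) (fun x => D_projection c x *m J_loc c x).
Proof.
move=> ac; have oc := open_cimg ac; apply/(smooth_mx oc) => i j; apply: smooth_pt => y yi.
have [pc E] := cinvK ac yi; set p := cinv c y in pc E.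
have [chi [X [schi chi0 DX XE]]] := exists_D_section (delta_mx 0 i) ac pc.
have sJX : smooth_vfield M (applyJ S X) by case: crS => _ _ H _; exact: H.
pose A := cimg c `&` [set x | chi x != 0].
have oA : open A.
  apply: openI => //; have -> : [set x | chi x != 0] = ~` (chi @^-1` [set 0]).
    by apply/seteqP; split=> x /= /eqP.
  apply: closed_openC; apply: preimage_closed; first by move=> x _; exact: (smooth_cont schi).
  exact: closed_eq.
exists A; first by split=> //=; rewrite -E gt_eqF.
apply: (smooth_eq (f := fun x => (chi x)^-1 * vfield_loc M c (applyJ S X) x 0 j)) => //.
  move=> x [xi /= xn]; have [qc Eq] := cinvK ac xi; rewrite -Eq.
  have F := applyJ_loc X ac qc; rewrite (XE _ qc) -scalemxAl -mulmxA -rowE in F.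
  apply: etrans (congr1 (fun B : 'rV[R]_m => _ * B 0 j) F) _.
  rewrite [X in _ * X]mxE mulrA mulVf ?mul1r; last by rewrite Eq.
  by rewrite [LHS]mxE.
apply: (smooth_mul oA).
  apply: (smooth_inv oA); first by move=> x [].
  exact: smooth_sub schi.
have : smooth_on (cimg c) (fun x => vfield_loc M c (applyJ S X) x 0 j).
  by have := sJX c ac; move/(smooth_mx oc); apply.
by apply: smooth_sub => x [].
Qed.

Lemma vfield_at q (X : N -> 'rV[R]_m) : vfield_loc M (chart_at M q) X (coord_at M q) = X q.
Proof.
rewrite /coord_at (vfield_locE X (atlas_at M q) (cdom_at M q)).
by rewrite (jac_id (atlas_at M q) (cdom_at M q)) mulmx1.
Qed.

Lemma form_at q (al : N -> 'cV[R]_m) : form_loc M (chart_at M q) al (coord_at M q) = al q.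
Proof.
rewrite /coord_at (form_locE al (atlas_at M q) (cdom_at M q)).
by rewrite (jac_id (atlas_at M q) (cdom_at M q)) mul1mx.
Qed.

Lemma bracket_form q X Y : D_section M S X -> D_section M S Y ->
  (bracket M X Y q *m etab q) 0 0 = - bilin (extder M etab q) (X q) (Y q).
Proof.
move=> [sX DX] [sY DY]; have ac := atlas_at M q; have qc := cdom_at M q.
set c := chart_at M q in ac qc; have oc := open_cimg ac.
have xi : cimg c (coord_at M q) by exact: cimg_cmap.
pose W := @OpenSet R m (cimg c) oc.
have sa : smooth_on (cimg c) (aloc c) := smooth_eta_of ac.
have := @form_lie_bracket R n.*2 W (aloc c) sa _ _ _ (sX c ac) (sY c ac) xi.
have Z (V : N -> 'rV[R]_m) (w : 'rV[R]_m) : (forall q, cr_D S q (V q)) ->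
    'D_w (fun y => (vfield_loc M c V y *m aloc c y) 0 0) (coord_at M q) = 0.
  move=> DV; rewrite -[RHS](derive_cst (0 : R) (coord_at M q) w); apply: near_eq_derive.
  apply: (open_near oc xi) => y yi; have [yc Ey] := cinvK ac yi.
  by rewrite -Ey (pairing_loc etab V ac yc) (kerP _ _).1 ?mxE.
rewrite !Z // subrr sub0r => H.
have B : lie_bracket (vfield_loc M c X) (vfield_loc M c Y) (coord_at M q) = bracket M X Y q.
  by rewrite /lie_bracket /bracket -/c !vfield_at.
rewrite -B -(form_at q etab) -/c; apply: etrans H _; congr (- _).
by rewrite /bilin /extder -/c !vfield_at.
Qed.

Lemma D_section_at q v : cr_D S q v ->
  exists (t : R) X, [/\ 0 < t, D_section M S X & X q = t *: v].
Proof.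
move=> Dv; have [chi [X [_ chi0 DX XE]]] := exists_D_section v (atlas_at M q) (cdom_at M q).
exists (chi (coord_at M q)), X; split=> //; rewrite -[LHS]vfield_at (XE q (cdom_at M q)).
congr (_ *: _); rewrite /D_projection mulmxBr mulmx1 mulmxA -/(coord_at M q) form_at.
by rewrite (kerP _ _).1 // mul0mx subr0.
Qed.

Lemma bilinZ (B : 'M[R]_m) s t v w : bilin B (s *: v) (t *: w) = s * t * bilin B v w.
Proof. by rewrite /bilin linearZ /= -!scalemxAl -scalemxAr scalerA mxE. Qed.

Lemma extder_asym (al : N -> 'cV[R]_m) q v w : bilin (extder M al q) v w = - bilin (extder M al q) w v.
Proof.
have E : (extder M al q)^T = - extder M al q.
  by apply/matrixP => i j; rewrite !mxE opprB.
rewrite /bilin; have -> : v *m extder M al q *m w^T = (w *m (extder M al q)^T *m v^T)^T.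
  by rewrite !trmx_mul !trmxK mulmxA.
by rewrite E mulmxN mulNmx mxE mxE.
Qed.

(* Involutivity in the direction of eta: [X, Y] - [JX, JY] is a section of D. *)
Lemma J_invariant q v w : cr_D S q v -> cr_D S q w ->
  bilin (extder M etab q) (v *m cr_J S q) (w *m cr_J S q) = bilin (extder M etab q) v w.
Proof.
move=> Dv Dw; have [s [X [s0 DX XE]]] := D_section_at Dv; have [t [Y [t0 DY YE]]] := D_section_at Dw.
have DJ Z : D_section M S Z -> D_section M S (applyJ S Z).
  by move=> DZ; split; [case: crS => _ _ H _; exact: H|move=> p; apply: (J_D _).1; case: DZ].
have [_ _ _ int] := crS; have [H _] := int X Y DX DY q.
have H1 : (bracket M X Y q *m etab q) 0 0 = (bracket M (applyJ S X) (applyJ S Y) q *m etab q) 0 0.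
  by move/kerP: H; rewrite mulmxBl => /eqP; rewrite subr_eq0 => /eqP ->.
have := oppr_inj (etrans (esym (bracket_form q DX DY)) (etrans H1 (bracket_form q (DJ _ DX) (DJ _ DY)))).
have E (V : N -> 'rV[R]_m) r u : V q = r *: u -> applyJ S V q = r *: (u *m cr_J S q).
  by rewrite /applyJ => ->; rewrite -scalemxAl.
rewrite (E _ _ _ XE) (E _ _ _ YE) XE YE (bilinZ _ s t v w) (bilinZ _ s t (v *m _)).
by move=> /esym; apply: mulfI; rewrite mulf_neq0 ?gt_eqF.
Qed.

(** Invariance of the differential under the complex structure, together with its antisymmetry,
    makes the Levi form symmetric. *)
Lemma levi_symmetric q v w : cr_D S q v -> cr_D S q w ->
  bilin (extder M etab q) v (w *m cr_J S q) = bilin (extder M etab q) w (v *m cr_J S q).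
Proof.
move=> Dv Dw; have [DJw JJw] := J_D Dw; rewrite -(J_invariant Dv DJw) JJw.
rewrite -[- w]scaleN1r -[v *m cr_J S q]scale1r bilinZ mul1r mulN1r extder_asym opprK scale1r.
by [].
Qed.

Lemma extder_proportional (al : N -> 'cV[R]_m) q v w : smooth_form M al ->
  (forall p v, cr_D S p v -> v *m al p = 0) -> (forall p, 0 < (gen b p *m al p) 0 0) ->
  cr_D S q v -> cr_D S q w ->
  bilin (extder M al q) v w = (gen b q *m al q) 0 0 * bilin (extder M etab q) v w.
Proof.
move=> sal kal _ Dv Dw; have ac := atlas_at M q; have qc := cdom_at M q.
set c := chart_at M q in ac qc; have oc := open_cimg ac.
have xi : cimg c (coord_at M q) by exact: cimg_cmap.
pose g x := (Xloc c x *m form_loc M c al x) 0 0.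
have sg : smooth_on (cimg c) g.
  have := smooth_mulmx oc (smooth_generator action b ac) (sal c ac).
  by move/(smooth_mx oc); apply.
have aE y : cimg c y -> form_loc M c al y = g y *: aloc c y.
  move=> yi; have [yc Ey] := cinvK ac yi; rewrite -Ey /g (pairing_loc al (gen b) ac yc).
  apply: etrans (form_locE al ac yc) _; apply: etrans _ (congr1 (GRing.scale _) (esym (form_locE etab ac yc))).
  by rewrite {1}(proportional_form (kal _)) -scalemxAr.
have va : v *m aloc c (coord_at M q) = 0 by rewrite form_at; apply/kerP.
have wa : w *m aloc c (coord_at M q) = 0 by rewrite form_at; apply/kerP.
have sa : smooth_on (cimg c) (aloc c) := smooth_eta_of ac.
have := extder_loc_scale oc sg sa aE xi va wa.
rewrite /bilin /extder -/c => ->; rewrite mxE; congr (_ * _).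
by rewrite /g vfield_at form_at.
Qed.

(** Positivity is given for [eta0], while the cone is built from [eta]. Both define the same
    co-oriented hyperplanes, so they differ by a positive factor, which passes to their
    differentials on these hyperplanes. *)
Lemma levi_positive q v : cr_D S q v -> v != 0 -> 0 < bilin (extder M etab q) v (v *m cr_J S q).
Proof.
move=> Dv vn; have [s0 _ k0 p0] := contact0.
have kal p w : cr_D S p w -> w *m eta0 p = 0.
  by move=> /k0; rewrite /pairing => H; apply/matrixP => i j; rewrite !ord1 H mxE.
have pal p : 0 < (gen b p *m eta0 p) 0 0.
  by apply/p0; have [_ _ _ pe] := contact; apply/pe; exact: cb.
have := pos0 Dv vn; rewrite (extder_proportional s0 kal pal Dv (J_D Dv).1).
by rewrite pmulr_rgt0.
Qed.

Lemma sasaki_metric_D q v w : cr_D S q v -> cr_D S q w ->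
  bilin (sasaki_metric M S eta T b q) v w = 2^-1 * bilin (extder M etab q) v (w *m cr_J S q).
Proof.
move=> /kerP va /kerP wa; rewrite /bilin /sasaki_metric mulmxDr mulmxDl.
have -> : v *m (etab q *m (etab q)^T) *m w^T = 0 by rewrite mulmxA va !mul0mx.
have -> : w *m cr_J S q = w *m Phi_of M S eta T b q.
  by rewrite /Phi_of mulmxA mulmxBr mulmx1 mulmxA wa mul0mx subr0.
rewrite addr0 -scalemxAr -scalemxAl mxE; move: (Phi_of M S eta T b q) => Ph.
by rewrite trmx_mul !mulmxA.
Qed.

Lemma bilin_extder_loc c q v w : atlas M c -> cdom c q ->
  v *m extder_loc (aloc c) (cmap c q) *m w^T =
  (bilin (extder M etab q) (v *m jac c (chart_at M q) q) (w *m jac c (chart_at M q) q))%:M.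
Proof.
move=> ac qc; rewrite [LHS]mx11_scalar /bilin; congr (_%:M).
rewrite (extderE ac qc (smooth_eta_of)) trmx_mul.
by rewrite !mulmxA.
Qed.

Lemma act_curve_continuous q t : {for t, continuous (fun t : R => T (t *: b) q)}.
Proof.
apply: (@continuous_comp _ _ _ (fun t : R => t *: b) (T ^~ q)); first exact: scalel_continuous.
by have := @act_continuous_par _ _ _ _ M T action q (t *: b).
Qed.

Lemma reeb_jacobian (pi : N -> 'rV[R]_d) c q : atlas M c -> cdom c q ->
  differentiable (pi \o cinv c) (cmap c q) -> (\forall t \near (0 : R), pi (T (t *: b) q) = pi q) ->
  Xloc c (cmap c q) *m 'J (pi \o cinv c) (cmap c q) = 0.
Proof.
move=> ac qc dp inv; rewrite (mul_jacobian _ dp).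
have H0 : cdom c (T (0 *: b) q) by rewrite scale0r (act0 action).
have D := generator_curve action ac H0.
have E0 : T (0 *: b) q = q by rewrite scale0r (act0 action).
have dp' : differentiable (pi \o cinv c) (cmap c (T (0 *: b) q)) by rewrite E0.
have [_ E] := is_derive_comp (@ex_derive _ _ _ _ _ _ _ D) dp'.
have [_ DX] := D; rewrite DX E0 in E; rewrite -E -[RHS](derive_cst (pi q) (0 : R) (1 : R)).
apply: near_eq_derive; near=> t; rewrite /comp (cmapK ac); first by near: t.
near: t; have cT : {for (0 : R), continuous (fun t : R => T (t *: b) q)} by exact: act_curve_continuous.
by apply: cT; apply: open_nbhs_nbhs; split; [exact: (open_cdom ac)|rewrite scale0r (act0 action)].
Unshelve. all: by end_near.
Qed.

Lemma levi_loc c q v w : atlas M c -> cdom c q ->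
  v *m extder_loc (aloc c) (cmap c q) *m (w *m J_loc c (cmap c q))^T =
  (bilin (extder M etab q) (v *m jac c (chart_at M q) q) (w *m jac c (chart_at M q) q *m cr_J S q))%:M.
Proof.
move=> ac qc; rewrite (bilin_extder_loc _ _ ac qc); congr ((bilin _ _ _)%:M).
have K := jacK (atlas_at M q) ac (cdom_at M q) qc.
rewrite (J_locE ac qc); move: (jac (chart_at M q) c q) (jac c (chart_at M q) q) (cr_J S q) K => B A J BA.
have -> : w *m (A *m J *m B) *m A = w *m A *m J *m (B *m A) by rewrite !mulmxA.
by rewrite BA mulmx1.
Qed.

(** * Local quotients in charts *)

Section Isometry.
Variables (pi : N -> 'rV[R]_d) (H : 'M[R]_d) (c : chart R N m) (q : N).
Hypotheses (ac : atlas M c) (qc : cdom c q).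
Hypothesis dpi : forall c', atlas M c' -> cdom c' q -> differentiable (pi \o cinv c') (cmap c' q).
Let Jpi := 'J (pi \o cinv c) (cmap c q).

Lemma tangent_fun_loc : tangent_fun M pi q = jac (chart_at M q) c q *m Jpi.
Proof. exact: (jacobian_change (atlas_at M q) ac (cdom_at M q) qc (dpi (atlas_at M q) (cdom_at M q)) (dpi ac qc)). Qed.

(** Read forwards it translates the isometry condition of a given quotient into the chart; read
    backwards it verifies that condition for the quotient built from a flow box. *)
Lemma isometry_loc :
  (forall v w, cr_D S q v -> cr_D S q w ->
    bilin (sasaki_metric M S eta T b q) v w = bilin H (v *m tangent_fun M pi q) (w *m tangent_fun M pi q)) <->
  (forall v w : 'rV[R]_m, v *m aloc c (cmap c q) = 0 -> w *m aloc c (cmap c q) = 0 ->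
    v *m (Jpi *m H *m Jpi^T) *m w^T =
    2^-1 *: (v *m extder_loc (aloc c) (cmap c q) *m (w *m J_loc c (cmap c q))^T)).
Proof.
have K := jacK (atlas_at M q) ac (cdom_at M q) qc.
have K' := jacK ac (atlas_at M q) qc (cdom_at M q).
have bl (B : 'M[R]_d) v w : v *m (Jpi *m B *m Jpi^T) *m w^T = (bilin B (v *m Jpi) (w *m Jpi))%:M.
  rewrite [LHS]mx11_scalar /bilin; congr (_%:M); rewrite trmx_mul.
  by rewrite !mulmxA.
have JL v : v *m J_loc c (cmap c q) *m jac c (chart_at M q) q = v *m jac c (chart_at M q) q *m cr_J S q.
  rewrite (J_locE ac qc); move: (jac (chart_at M q) c q) (jac c (chart_at M q) q) (cr_J S q) K K' => B A J BA AB.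
  have -> : v *m (A *m J *m B) *m A = v *m A *m J *m (B *m A) by rewrite !mulmxA.
  by rewrite BA mulmx1.
have inj (r s : R) : r%:M = s%:M :> 'M[R]_1 -> r = s.
  by move/matrixP/(_ 0 0); rewrite !mxE eqxx !mulr1n.
have cancelK (A B : 'M[R]_m) (u : 'rV[R]_m) (P : 'M[R]_(m, d)) : A *m B = 1%:M ->
    u *m A *m (B *m P) = u *m P.
  by move=> AB; rewrite mulmxA -(mulmxA u) AB mulmx1.
have KV (u : 'rV[R]_m) : u *m jac (chart_at M q) c q *m jac c (chart_at M q) q = u.
  by rewrite -mulmxA K mulmx1.
split=> I v w.
  move=> /(aloc_kernelV v ac qc) Dv /(aloc_kernelV w ac qc) Dw.
  rewrite bl (bilin_extder_loc _ _ ac qc) JL scale_scalar_mx; congr (_%:M).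
  rewrite -(sasaki_metric_D Dv Dw) (I _ _ Dv Dw) tangent_fun_loc.
  by rewrite (cancelK _ _ v _ K') (cancelK _ _ w _ K').
move=> Dv Dw.
have va := (aloc_kernel v ac qc).1 Dv; have wa := (aloc_kernel w ac qc).1 Dw.
have := I _ _ va wa; rewrite bl (bilin_extder_loc _ _ ac qc) JL scale_scalar_mx => /inj.
rewrite (sasaki_metric_D Dv Dw) tangent_fun_loc (mulmxA v) (mulmxA w) => ->.
apply: (congr2 (fun u u' : 'rV[R]_m => 2^-1 * bilin (extder M etab q) u (u' *m cr_J S q))).
  exact: esym (KV v).
exact: esym (KV w).
Qed.
End Isometry.

Section Quotient.
Variables (U : set N) (pi : N -> 'rV[R]_d) (h : 'rV[R]_d -> 'M[R]_d).
Hypothesis quot : local_quotient M S eta T b U pi h.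

Lemma quotient_open : open U. Proof. by case: quot. Qed.

Lemma quotient_smooth c : atlas M c -> smooth_on (cmap c @` (cdom c `&` U)) (pi \o cinv c).
Proof. by case: quot => _ [H _] _ _ _; exact: H. Qed.

Lemma quotient_differentiable c q : atlas M c -> cdom c q -> U q -> differentiable (pi \o cinv c) (cmap c q).
Proof.
move=> ac qc Uq; apply: (smooth_differentiable (open_chart_image ac quotient_open) (quotient_smooth ac)).
by exists q.
Qed.

Lemma quotient_full c x : atlas M c -> (cmap c @` (cdom c `&` U)) x -> row_full ('J (pi \o cinv c) x).
Proof.
move=> ac [q [qc Uq] <-]; have [_ [_ F] _ _ _] := quot.
have E := tangent_fun_loc ac qc (fun c' ac' qc' => quotient_differentiable ac' qc' Uq).
have := F q Uq; rewrite E => /row_fullP [B BJ]; apply/row_fullP; exists (B *m jac (chart_at M q) c q).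
by rewrite -mulmxA.
Qed.

(** For short times the whole orbit segment stays in [U], as the orbit relation of a local quotient
    demands. *)
Lemma quotient_orbit q : U q -> \forall t \near (0 : R), pi (T (t *: b) q) = pi q.
Proof.
move=> Uq; have cT : {for (0 : R), continuous (fun t : R => T (t *: b) q)}.
  exact: act_curve_continuous.
have nb : \forall t \near (0 : R), U (T (t *: b) q).
  by apply: cT; apply: open_nbhs_nbhs; split; [exact: quotient_open|rewrite scale0r (act0 action)].
move/nbhs_ballP: nb => [e /= e0 H].
have e0' : 0 < e by exact: e0.
apply: filterS (@near0_norm_lt R R _ e0') => t te; apply/esym.
have [_ _ Q _ _] := quot; apply/Q => //; first by apply: H; rewrite -ball_normE /= sub0r normrN.
exists t => // r /andP [r0 r1]; apply: H; rewrite -ball_normE /= sub0r normrN normrM.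
by rewrite (ger0_norm r0); apply: le_lt_trans te; rewrite ler_piMl.
Qed.

Lemma quotient_reeb c x : atlas M c -> (cmap c @` (cdom c `&` U)) x -> Xloc c x *m 'J (pi \o cinv c) x = 0.
Proof.
move=> ac [q [qc Uq] <-]; apply: reeb_jacobian => //; last exact: quotient_orbit.
exact: quotient_differentiable.
Qed.

(** The curvature differentiates the metric on the image of the quotient map, so the image must
    contain a neighbourhood of each of its points; local sections provide it. *)
Lemma quotient_image_open : open (pi @` U).
Proof.
rewrite openE => y [q Uq <-]; have ac := atlas_at M q; have qc := cdom_at M q.
set c := chart_at M q in ac qc; pose O := cmap c @` (cdom c `&` U).
have oO : open O := open_chart_image ac quotient_open.
have Oq : O (cmap c q) by exists q.
have [W [s [oW W0 _ _ H]]] := submersion_section oO (quotient_smooth ac) Oq (quotient_full ac Oq).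
have W0' : W (pi q) by move: W0; rewrite /= (cmapK ac qc).
apply: filterS (open_nbhs_nbhs (conj oW W0')) => z /H [[q' [qc' Uq'] Eq'] Ez].
by exists q' => //; move: Ez; rewrite -Eq' /= (cmapK ac qc').
Qed.

Lemma quotient_metric : riemannian_metric_on h (pi @` U). Proof. by case: quot. Qed.

Lemma quotient_isometry c x (v w : 'rV[R]_m) : atlas M c -> (cmap c @` (cdom c `&` U)) x ->
  v *m aloc c x = 0 -> w *m aloc c x = 0 ->
  v *m ('J (pi \o cinv c) x *m h (pi (cinv c x)) *m ('J (pi \o cinv c) x)^T) *m w^T =
    2^-1 *: (v *m extder_loc (aloc c) x *m (w *m J_loc c x)^T).
Proof.
move=> ac [q [qc Uq] <-]; have [_ _ _ _ I] := quot.
have := (isometry_loc (h (pi q)) ac qc (fun c' ac' qc' => quotient_differentiable ac' qc' Uq)).1.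
by rewrite (cmapK ac qc); apply=> v' w' Dv Dw; exact: I.
Qed.

End Quotient.

Section Invariance.
Variables (c : chart R N m) (a : 'rV[R]_k) (q : N).
Hypotheses (ac : atlas M c) (qc : cdom c q) (qc' : cdom c (T a q)).
Local Notation F := (cmap c \o T a \o cinv c).
Let A := 'J F (cmap c q).

Lemma form_transport : A *m aloc c (cmap c (T a q)) = aloc c (cmap c q).
Proof. exact: (eta_of_invariant_loc ac ac qc qc'). Qed.

Lemma extder_transport :
  extder_loc (aloc c) (cmap c q) = A *m extder_loc (aloc c) (cmap c (T a q)) *m A^T.
Proof.
have [[cT sT] _ _ _] := crT a.
have oU : open (T a @^-1` cdom c).
  by apply: open_comp; [move=> x _; exact: cT|exact: (open_cdom ac)].
have im x : (cmap c @` (cdom c `&` T a @^-1` cdom c)) x -> cimg c (F x).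
  by case=> p [pc pc'] <-; rewrite /= (cmapK ac pc); exact: cimg_cmap.
have H := @extder_loc_pullback R m _ _ F (aloc c) (aloc c) (open_chart_image ac oU) (open_cimg ac)
   (sT c c ac ac) (smooth_eta_of ac) im.
have E : F (cmap c q) = cmap c (T a q) by rewrite /= (cmapK ac qc).
have := H _ (cmap c q); rewrite E; apply; last by exists q.
move=> _ [p [pc pc'] <-]; have -> : F (cmap c p) = cmap c (T a p) by rewrite /= (cmapK ac pc).
exact: esym (eta_of_invariant_loc ac ac pc pc').
Qed.

Lemma J_transport (v : 'rV[R]_m) : v *m aloc c (cmap c q) = 0 ->
  v *m J_loc c (cmap c q) *m A = v *m A *m J_loc c (cmap c (T a q)).
Proof.
move=> /(aloc_kernelV v ac qc) Dv; have [sT _ H _] := crT a.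
have [_ E] := H _ _ Dv.
rewrite /A (tangent_map_loc sT ac ac qc qc') (J_locE ac qc) (J_locE ac qc').
have K := jacK (atlas_at M q) ac (cdom_at M q) qc.
have K' := jacK (atlas_at M (T a q)) ac (cdom_at M (T a q)) qc'.
move: (jac (chart_at M q) c q) (jac c (chart_at M q) q) (cr_J S q) K E => B1 A1 J1 BA1 E.
move: (jac (chart_at M (T a q)) c (T a q)) (jac c (chart_at M (T a q)) (T a q)) (cr_J S (T a q))
  (tangent_map M (T a) q) K' E => B2 A2 J2 D BA2 E.
have -> : v *m (A1 *m J1 *m B1) *m (A1 *m D *m B2) = v *m A1 *m J1 *m (B1 *m A1) *m D *m B2 by rewrite !mulmxA.
have -> : v *m (A1 *m D *m B2) *m (A2 *m J2 *m B2) = v *m A1 *m D *m (B2 *m A2) *m J2 *m B2 by rewrite !mulmxA.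
by rewrite BA1 BA2 !mulmx1 E.
Qed.
End Invariance.

(** * Existence of local quotients *)

Section QuotientExistence.
Local Notation Jloc c := (J_loc c).

Lemma reeb_chart_neq0 c x : atlas M c -> cimg c x -> Xloc c x != 0.
Proof.
move=> ac xi; apply/eqP => H; have := reeb_chart ac xi; rewrite H mul0mx.
by move=> /matrixP /(_ 0 0); rewrite !mxE => /esym/eqP; rewrite oner_eq0.
Qed.

Section Levi.
Variables (c : chart R N m) (x : 'rV[R]_m).
Hypotheses (ac : atlas M c) (xi : cimg c x).
Definition levi_form (v w : 'rV[R]_m) : R := (v *m extder_loc (aloc c) x *m (w *m Jloc c x)^T) 0 0.

Lemma levi_formE v w : v *m extder_loc (aloc c) x *m (w *m Jloc c x)^T = (levi_form v w)%:M.
Proof. exact: mx11_scalar. Qed.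

Let q := cinv c x.
Let qc : cdom c q. Proof. by have [] := cinvK ac xi. Qed.
Let xE : x = cmap c q. Proof. by have [_ ->] := cinvK ac xi. Qed.
Let G := jac c (chart_at M q) q.
Let ker v : v *m aloc c x = 0 -> cr_D S q (v *m G).
Proof. by rewrite xE => H; apply/(aloc_kernelV v ac qc). Qed.
Let leviE v w : levi_form v w = bilin (extder M etab q) (v *m G) (w *m G *m cr_J S q).
Proof.
rewrite /levi_form xE (levi_loc v w ac qc).
by rewrite mxE eqxx mulr1n.
Qed.

Lemma levi_form_sym v w : v *m aloc c x = 0 -> w *m aloc c x = 0 -> levi_form v w = levi_form w v.
Proof.
move=> /ker vD /ker wD; rewrite !leviE.
exact: (levi_symmetric).
Qed.

Lemma levi_form_gt0 v : v *m aloc c x = 0 -> v != 0 -> 0 < levi_form v v.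
Proof.
move=> /ker vD vn; rewrite leviE.
apply: (levi_positive vD).
apply: contra_neq vn => H; rewrite -[v]mulmx1 -(jacK ac (atlas_at M q) qc (cdom_at M q)).
by rewrite mulmxA H mul0mx.
Qed.

End Levi.

Variables (c : chart R N m) (p0 : N).
Hypotheses (ac : atlas M c) (pc : cdom c p0).
Let x0 := cmap c p0.
Variables (B2 : 'M[R]_m) (r : R) (g : 'rV[R]_m -> 'rV[R]_m).
Let e0 : 'rV[R]_m := delta_mx 0 ord0.
Let Psi (z : 'rV[R]_m) := T (z 0 ord0 *: b) (cinv c (z *m B2 + x0)).
Let Phi z := cmap c (Psi z).
Let Bx : set 'rV[R]_m := [set z | `|z| < r].
Let O := Phi @` Bx.
Hypotheses (r0 : 0 < r) (e0B : e0 *m B2 = 0) (oO : open O).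
Hypothesis gP : forall z, `|z| < r -> [/\ g (Phi z) = z, cimg c (z *m B2 + x0) & cdom c (Psi z)].
Hypotheses (sg : smooth_on O g) (ug : forall x, O x -> 'J g x \in unitmx).

Let Pr : 'M[R]_(m, d) := \matrix_(l, i) (l == fintype.lift ord0 i)%:R.
Let Lr : 'M[R]_(d, m) := Pr^T.
Let LP : Lr *m Pr = 1%:M.
Proof.
apply/matrixP => i j; rewrite !mxE (bigD1 (fintype.lift ord0 i)) //= !mxE eqxx mul1r big1 ?addr0.
  by rewrite (inj_eq lift_inj).
by move=> l ln; rewrite !mxE (negbTE ln) mul0r.
Qed.
Let eP : e0 *m Pr = 0.
Proof.
apply/rowP => i; rewrite -rowE !mxE.
by case: eqP => // /esym/eqP; rewrite -[_ == _]negbK neq_lift.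
Qed.
Let PrE (z : 'rV[R]_m) i : (z *m Pr) 0 i = z 0 (fintype.lift ord0 i).
Proof.
rewrite mxE (bigD1 (fintype.lift ord0 i)) //= !mxE eqxx mulr1 big1 ?addr0 // => l ln.
by rewrite !mxE (negbTE ln) mulr0.
Qed.
Let LrE (y : 'rV[R]_d) i : (y *m Lr) 0 (fintype.lift ord0 i) = y 0 i.
Proof. by rewrite -PrE -(mulmxA y) LP mulmx1. Qed.
Let Lr0 (y : 'rV[R]_d) : (y *m Lr) 0 ord0 = 0.
Proof. by rewrite mxE big1 // => i _; rewrite !mxE (negbTE (neq_lift _ _)) mulr0. Qed.
Let eqP0 (z w : 'rV[R]_m) : z 0 ord0 = w 0 ord0 -> z *m Pr = w *m Pr -> z = w.
Proof.
move=> E0 E; apply/rowP => l; case: (unliftP ord0 l) => [i ->|-> //].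
by rewrite -!PrE E.
Qed.
Let decomp (z : 'rV[R]_m) : z = z 0 ord0 *: e0 + z *m Pr *m Lr.
Proof.
have e00 : e0 0 ord0 = 1 by rewrite mxE !eqxx.
have H (s : R) : (s *: e0 + z *m Pr *m Lr) 0 ord0 = s.
  by rewrite mxE [(s *: e0) 0 ord0]mxE e00 Lr0 mulr1 addr0.
apply: eqP0; first by rewrite H.
rewrite mulmxDl -scalemxAl eP scaler0 add0r -(mulmxA (z *m Pr)) LP mulmx1 //.
Qed.
Let LrB (z : 'rV[R]_m) : z *m Pr *m Lr *m B2 = z *m B2.
Proof.
by rewrite [in RHS](decomp z) mulmxDl -scalemxAl e0B scaler0 add0r.
Qed.
Let normLr (z : 'rV[R]_m) : `|z *m Pr *m Lr| <= `|z|.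
Proof.
rewrite {1}/Num.norm /= mx_normrE; apply/bigmax_leP; split=> [|[i l] _ /=]; first exact: normr_ge0.
rewrite (ord1 i); case: (unliftP ord0 l) => [j ->|->].
  by rewrite LrE PrE; exact: coord_le_norm.
by rewrite Lr0 normr0 normr_ge0.
Qed.

(** The flow box as a quotient: [pi] forgets the time coordinate, and [xy] sends a point of the
    quotient back to the slice at time 0. *)
Let U : set N := Psi @` Bx.
Let phi x := g x *m Pr.
Let pi q := phi (cmap c q).
Let xy (y : 'rV[R]_d) := y *m Lr *m B2 + x0.

Let UP q : U q <-> cdom c q /\ O (cmap c q).
Proof.
split=> [[z zr <-]|[qc [z zr E]]]; first by have [_ _ H] := gP zr; split=> //; exists z.
have [_ _ H] := gP zr; exists z => //.
by rewrite -(cmapK ac qc) -(cmapK ac H) -/(Phi z) E.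
Qed.

Let cimgO x : O x -> cimg c x.
Proof. by move=> [z zr <-]; have [_ _ H] := gP zr; exact: cimg_cmap. Qed.

Let oU : open U.
Proof.
have -> : U = cdom c `&` cmap c @^-1` O by apply/seteqP; split=> q; rewrite UP.
exact: (open_chart_preimage ac).
Qed.

Let piPsi z : `|z| < r -> pi (Psi z) = z *m Pr.
Proof. by move=> zr; have [E _ _] := gP zr; rewrite /pi /phi -/(Phi z) E. Qed.

Let PsiT (z : 'rV[R]_m) s : T (s *: b) (Psi z) = Psi (z + s *: e0).
Proof.
rewrite /Psi -(actD action) -scalerDl mulmxDl -scalemxAl e0B scaler0 addr0.
by congr (T (_ *: b) _); rewrite !mxE !eqxx mulr1 addrC.
Qed.

Let sphi : smooth_on O phi.
Proof.
apply: (smooth_mulmx oO sg); exact: smooth_cst.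
Qed.

Let smooth_pi : smooth_fun_on M U pi.
Proof.
move=> c' ac'; have E : pi \o cinv c' = phi \o (cmap c \o cinv c') by [].
rewrite E; apply: (smooth_comp (open_chart_image ac' oU) oO) => //.
  by move=> _ [q [qc /UP [_ Oq]] <-] /=; rewrite (cmapK ac' qc).
apply: smooth_sub (smooth_transition ac' ac) => _ [q [qc' Uq] <-].
by exists q => //; split=> //; have [] := (UP q).1 Uq.
Qed.

Let dpi c' q : atlas M c' -> cdom c' q -> U q -> differentiable (pi \o cinv c') (cmap c' q).
Proof.
move=> ac' qc' Uq; apply: (smooth_differentiable (open_chart_image ac' oU) (smooth_pi ac')).
by exists q.
Qed.

Let piO x : O x -> (pi \o cinv c) x = phi x.
Proof. by move=> /cimgO xi; rewrite /pi /=; have [_ ->] := cinvK ac xi. Qed.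

Let Jpi x : O x -> 'J (pi \o cinv c) x = 'J phi x.
Proof.
move=> Ox; have [qc E] := cinvK ac (cimgO Ox); apply: jacobian_near.
- by apply: (open_near oO Ox) => y; exact: piO.
- by rewrite -E; apply: dpi => //; apply/UP; rewrite E.
- exact: (smooth_differentiable oO sphi).
Qed.

Let fullphi x : O x -> row_full ('J phi x).
Proof.
move=> Ox; have dg : differentiable g x by exact: (smooth_differentiable oO sg).
have E : phi = (fun z : 'rV[R]_m => z *m Pr + 0) \o g by apply/funext => y; rewrite /= addr0.
have -> : 'J phi x = 'J g x *m Pr.
  rewrite E jacobian_comp ?jacobian_affine //.
  by apply: (smooth_differentiable openT) => //; exact: smooth_affine.
apply/row_fullP; exists (Lr *m invmx ('J g x)).
by rewrite -mulmxA (mulmxA (invmx _)) mulVmx ?mul1mx ?LP // ug.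
Qed.

Let full_pi q : U q -> row_full (tangent_fun M pi q).
Proof.
move=> Uq; have [qc Oq] := (UP q).1 Uq.
rewrite (@tangent_fun_loc pi c q ac qc); last by move=> c' ac' qc'; exact: dpi.
rewrite (Jpi Oq); have /row_fullP [L LE] := fullphi Oq.
apply/row_fullP; exists (L *m jac c (chart_at M q) q).
by rewrite -mulmxA (mulmxA (jac _ _ _)) (jacK ac (atlas_at M q) qc (cdom_at M q)) mul1mx.
Qed.

Let pi_flow q : U q -> \forall t \near (0 : R), pi (T (t *: b) q) = pi q.
Proof.
move=> [z zr <-].
have nb : \forall t \near (0 : R), Bx (z + t *: e0).
  have cf : {for (0 : R), continuous (fun t : R => z + t *: e0)}.
    by apply: continuousD; [exact: cst_continuous|exact: scalel_continuous].
  apply: (near_comp cf); apply: open_nbhs_nbhs; split; last by rewrite scale0r addr0.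
  have -> : Bx = ball 0 r.
    by apply/seteqP; split=> w; rewrite -ball_normE /= sub0r normrN.
  exact: ball_open.
apply: filterS nb => t tr; rewrite PsiT (piPsi tr) (piPsi zr).
by rewrite mulmxDl -scalemxAl eP scaler0 addr0.
Qed.

Let pi_path q t : (forall s : R, 0 <= s <= 1 -> U (T ((s * t) *: b) q)) -> pi q = pi (T (t *: b) q).
Proof.
move=> H; apply/rowP => j; pose f (s : R) := pi (T ((s * t) *: b) q) 0 j.
have D (s : R) : 0 <= s <= 1 -> is_derive (s : R) 1 f 0.
  move=> s01; have /= := pi_flow (H s s01) => Hn.
  have cf : {for s, continuous (fun u : R => (u - s) * t)}.
    apply: continuousM; last exact: cst_continuous.
    by apply: continuousB; [exact: continuous_id_at|exact: cst_continuous].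
  have nb : \forall u \near s, pi (T (((u - s) * t) *: b) (T ((s * t) *: b) q)) = pi (T ((s * t) *: b) q).
    have Hn' : \forall h \near (fun u : R => (u - s) * t) s, pi (T (h *: b) (T ((s * t) *: b) q)) = pi (T ((s * t) *: b) q).
      by rewrite /= subrr mul0r.
    exact: (near_comp cf Hn').
  apply: (near_eq_is_derive _ (is_derive_cst (f s) s 1)).
  apply: filterS nb => u; rewrite -(actD action) -scalerDl -mulrDl subrK => E.
  by rewrite /f E.
have := @line_mvt R R f 0 1 0 0.
have -> : (0 + 1 : R) = 1 by rewrite add0r.
move=> L; have : `|f 1 - f 0 - 0| <= 0.
  apply: L => t0 t01; rewrite add0r; have D0 := D _ t01.
  have E1 : t0 *: (1 : R) = t0 by rewrite /GRing.scale /= mulr1.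
  rewrite E1; have [D1 D2] := D0; split=> //; by rewrite D2 subrr normr0.
rewrite subr0 normr_le0 subr_eq0 => /eqP; rewrite /f mul1r mul0r scale0r (act0 action) => ->; done.
Qed.

Let orbits p q : U p -> U q ->
  (pi p = pi q <-> exists2 t : R, q = T (t *: b) p & forall s : R, 0 <= s <= 1 -> U (T ((s * t) *: b) p)).
Proof.
move=> Up Uq; split; last by move=> [t -> H]; exact: pi_path.
case: Up Uq => z zr <- [w wr <-]; rewrite (piPsi zr) (piPsi wr) => E.
have Ew : w = z + (w 0 ord0 - z 0 ord0) *: e0.
  apply: eqP0; first by rewrite !mxE !eqxx mulr1 addrC subrK.
  by rewrite mulmxDl -scalemxAl eP scaler0 addr0 E.
exists (w 0 ord0 - z 0 ord0); first by rewrite PsiT -Ew.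
move=> s /andP [s0 s1]; rewrite PsiT; eexists; last by [].
have -> : z + (s * (w 0 ord0 - z 0 ord0)) *: e0 = (1 - s) *: z + s *: w.
  by rewrite {2}Ew scalerDr scalerA addrA -scalerDl subrK scale1r.
rewrite /Bx /=; apply: le_lt_trans (ler_normD _ _) _; rewrite !normrZ.
rewrite (ger0_norm s0) ger0_norm ?subr_ge0 //.
have [->|sn] := eqVneq s 0; first by rewrite subr0 mul1r mul0r addr0.
have sp : 0 < s by rewrite lt_neqAle eq_sym sn.
have -> : r = (1 - s) * r + s * r by rewrite -mulrDl subrK mul1r.
by apply: ler_ltD; [rewrite ler_wpM2l ?subr_ge0 // ltW|rewrite ltr_pM2l].
Qed.

Let W : @openset R m := OpenSet oO.
Let sa : smooth_on (carrier W) (aloc c).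
Proof. by apply: (smooth_sub cimgO); exact: (smooth_eta_of ac). Qed.
Let sX : smooth_on (carrier W) (Xloc c).
Proof. by apply: (smooth_sub cimgO); exact: (smooth_generator action b ac). Qed.
Let aX x : carrier W x -> Xloc c x *m aloc c x = 1%:M.
Proof. by move=> Ox; exact: (reeb_chart ac (cimgO Ox)). Qed.
Let XOm x : carrier W x -> Xloc c x *m extder_loc (aloc c) x = 0.
Proof. by move=> Ox; exact: (reeb_kernel ac (cimgO Ox)). Qed.
Let Xphi x : carrier W x -> Xloc c x *m 'J phi x = 0.
Proof.
move=> Ox; have [qc E] := cinvK ac (cimgO Ox); have Uq : U (cinv c x) by apply/UP; rewrite E.
have := reeb_jacobian ac qc (dpi ac qc Uq) (pi_flow Uq).
by rewrite E (Jpi Ox).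
Qed.
Let Ef := lift (aloc c) phi.
Let Efa x : O x -> Ef x *m aloc c x = 0.
Proof. by move=> Ox; exact: (@lift_form R d W _ _ _ aX fullphi Xphi). Qed.
Let EfJ x : O x -> Ef x *m 'J phi x = 1%:M.
Proof. by move=> Ox; exact: (@lift_jacobian R d W _ _ _ aX fullphi Xphi). Qed.

(** One half of the Levi form on the lifts. On these the projection acts as the identity; it is
    inserted so that [smooth_J_loc] gives smoothness. *)
Let H x : 'M[R]_d :=
  2^-1 *: (Ef x *m extder_loc (aloc c) x *m (Ef x *m (D_projection c x *m Jloc c x))^T).
Let h y := H (xy y).

Let HE x (v w : 'rV[R]_d) : O x ->
  v *m H x *m w^T = (2^-1 * levi_form c x (v *m Ef x) (w *m Ef x))%:M.
Proof.
move=> Ox; rewrite scalar_mxM mul_scalar_mx -levi_formE /H.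
have -> : Ef x *m (D_projection c x *m Jloc c x) = Ef x *m Jloc c x.
  rewrite mulmxA /D_projection mulmxBr mulmx1 (mulmxA (Ef x)) (Efa Ox) mul0mx subr0 //.
rewrite -scalemxAr -scalemxAl; congr (_ *: _).
rewrite [(w *m Ef x *m Jloc c x)^T]trmx_mul (trmx_mul w) (trmx_mul (Ef x)).
by rewrite !mulmxA.
Qed.

Let Oxy y : (pi @` U) y -> O (xy y) /\ phi (xy y) = y.
Proof.
move=> [_ [z zr <-] <-]; rewrite (piPsi zr).
have zr' : `|z *m Pr *m Lr| < r by exact: le_lt_trans (normLr z) zr.
have E : Phi (z *m Pr *m Lr) = xy (z *m Pr).
  rewrite /Phi /Psi Lr0 scale0r (act0 action) /xy.
  by have [_ xi _] := gP zr'; have [_ ->] := cinvK ac xi.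
split; first by rewrite -E; exists (z *m Pr *m Lr).
by rewrite -E /phi; have [-> _ _] := gP zr'; rewrite -(mulmxA (z *m Pr)) LP mulmx1.
Qed.

Let vEa (v : 'rV[R]_d) x : O x -> v *m Ef x *m aloc c x = 0.
Proof. by move=> Ox; rewrite -(mulmxA v) (Efa Ox) mulmx0. Qed.

Let image_open : open (pi @` U).
Proof.
have -> : pi @` U = [set y : 'rV[R]_d | `|y *m Lr| < r].
  apply/seteqP; split=> [_ [_ [z zr <-] <-]|y yr].
    by rewrite (piPsi zr) /=; exact: le_lt_trans (normLr z) zr.
  exists (Psi (y *m Lr)); first by exists (y *m Lr).
  by rewrite (piPsi yr) -(mulmxA y) LP mulmx1.
have -> : [set y : 'rV[R]_d | `|y *m Lr| < r] = (fun y : 'rV[R]_d => y *m Lr + 0) @^-1` ball 0 r.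
  by apply/seteqP; split=> y; rewrite /preimage -ball_normE /= addr0 sub0r normrN.
apply: open_comp; last exact: ball_open.
by move=> y _; apply: (smooth_cont (smooth_affine setT Lr 0)).
Qed.

Let metric_h : riemannian_metric_on h (pi @` U).
Proof.
split.
- apply: (smooth_comp image_open oO) => [y Vy||].
  + by have [] := Oxy Vy.
  + rewrite (_ : xy = fun y : 'rV[R]_d => y *m (Lr *m B2) + x0).
      exact: smooth_affine.
    by apply/funext => y; rewrite /xy -(mulmxA y).
  + apply: (smooth_scale oO); first exact: smooth_cst.
    have sE : smooth_on O Ef by exact: (@smooth_lift R d W _ _ _ sa sphi aX fullphi Xphi).
    have sOm : smooth_on O (extder_loc (aloc c)) by exact: (@smooth_extder R d W _ sa).
    apply: (smooth_mulmx oO); first exact: (smooth_mulmx oO).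
    apply: (smooth_trmx oO); apply: (smooth_mulmx oO) => //.
    by apply: (smooth_sub cimgO); exact: (smooth_J_loc ac).
- move=> y /Oxy [Ox _]; apply/matrixP => i j; rewrite mxE.
  have E i' j' : h y i' j' = 2^-1 * levi_form c (xy y) (delta_mx 0 i' *m Ef (xy y)) (delta_mx 0 j' *m Ef (xy y)).
    have := HE (delta_mx 0 i') (delta_mx 0 j') Ox => /matrixP /(_ 0 0).
    rewrite trmx_delta -rowE -colE mxE mxE => ->.
    by rewrite mxE eqxx mulr1n.
  by rewrite !E (levi_form_sym ac (cimgO Ox) (vEa _ Ox) (vEa _ Ox)).
move=> y /Oxy [Ox _] v vn; rewrite (HE v v Ox) mxE eqxx mulr1n mulr_gt0 ?invr_gt0 ?ltr0n //.
apply: (levi_form_gt0 ac (cimgO Ox) (vEa v Ox)); apply: contra_neq vn => vE.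
by rewrite -[v]mulmx1 -(EfJ Ox) mulmxA vE mul0mx.
Qed.

(** The metric [h] is read off on the slice. A point at time [s] is moved to the slice by
    [T (- s *: b)], which preserves the form, its differential and the complex structure, and
    commutes with the quotient map. *)
Let isometry q v w : U q -> cr_D S q v -> cr_D S q w ->
  bilin (sasaki_metric M S eta T b q) v w =
  bilin (h (pi q)) (v *m tangent_fun M pi q) (w *m tangent_fun M pi q).
Proof.
move=> Uq; have [qc Oq] := (UP q).1 Uq; move: v w.
apply/(@isometry_loc pi (h (pi q)) c q ac qc (fun c' ac' qc' => dpi ac' qc' Uq)).
rewrite (Jpi Oq); case: Uq => z zr qE; have [gz xi Pc] := gP zr.
set s := z 0 ord0; set q1 := cinv c (z *m B2 + x0).
have [q1c q1x] := cinvK ac xi.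
have q1E : q1 = T (- s *: b) q.
  by rewrite -qE /Psi -/s -(actD action) -scalerDl addNr scale0r (act0 action).
have xyE : xy (pi q) = cmap c q1 by rewrite -qE (piPsi zr) /xy LrB q1x.
have zr' : `|z *m Pr *m Lr| < r by exact: le_lt_trans (normLr z) zr.
have O1 : O (cmap c q1) by rewrite -xyE; have [] := Oxy (ex_intro2 _ _ q (ex_intro2 _ _ z zr qE) erefl).
have q1c' : cdom c (T (- s *: b) q) by rewrite -q1E.
pose F := cmap c \o T (- s *: b) \o cinv c.
have Fx : F (cmap c q) = cmap c q1 by rewrite /F /= (cmapK ac qc) q1E.
have dF : differentiable F (cmap c q).
  have [sT _ _ _] := crT (- s *: b); exact: (differentiable_map_loc sT ac ac qc q1c').
have JE : 'J phi (cmap c q) = 'J F (cmap c q) *m 'J phi (cmap c q1).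
  have d1 : differentiable phi (F (cmap c q)) by rewrite Fx; exact: (smooth_differentiable oO sphi).
  rewrite -Fx -(jacobian_comp dF d1); apply: jacobian_near.
  - have nb : nbhs (cmap c q) (O `&` g @^-1` [set y | `|y - s *: e0| < r]).
      apply: open_nbhs_nbhs; split; last first.
        split=> //; rewrite /preimage /= -qE -/(Phi z) gz.
        by rewrite {1}(decomp z) -/s addrC addKr.
      apply: continuous_open_preimage => //; first by move=> x Ox; exact: (smooth_cont sg Ox).
      have -> : [set y : 'rV[R]_m | `|y - s *: e0| < r] = ball (s *: e0) r.
        by apply/seteqP; split=> y; rewrite -ball_normE /= distrC.
      exact: ball_open.
    apply: filterS nb => _ [[z' zr1 <-] H']; have [gz' _ Pc'] := gP zr1.
    rewrite /F /= {2}/Phi (cmapK ac Pc') PsiT -/(Phi _).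
    move: H'; rewrite /preimage /= gz' => H'.
    have H2 : `|z' + - s *: e0| < r by rewrite scaleNr.
    have [g2 _ _] := gP H2.
    by rewrite /phi gz' g2 mulmxDl -scalemxAl eP scaler0 addr0.
  - exact: (smooth_differentiable oO sphi).
  - exact: differentiable_comp.
move=> v w va wa.
have ft := form_transport ac qc q1c'.
have et := extder_transport ac qc q1c'.
have jt := J_transport ac qc q1c'.
rewrite -/F -q1E in ft et jt.
set A := 'J F (cmap c q) in JE ft et jt.
have key (u : 'rV[R]_m) : u *m aloc c (cmap c q) = 0 -> u *m A = u *m 'J phi (cmap c q) *m Ef (cmap c q1).
  move=> ua; have := @frame_decomposition R d W _ _ _ aX fullphi Xphi 1 (cmap c q1) (u *m A) O1.
  have E1 := etrans (esym (mulmxA u A _)) (etrans (congr1 (mulmx u) ft) ua).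
  have E2 := etrans (esym (mulmxA u A _)) (congr1 (mulmx u) (esym JE)).
  by rewrite E1 mul0mx add0r E2.
have hE : h (pi q) = H (cmap c q1) by rewrite /h xyE.
rewrite hE.
have -> : v *m ('J phi (cmap c q) *m H (cmap c q1) *m ('J phi (cmap c q))^T) *m w^T =
  (v *m 'J phi (cmap c q)) *m H (cmap c q1) *m (w *m 'J phi (cmap c q))^T.
  by rewrite trmx_mul !mulmxA.
rewrite (HE _ _ O1) et scalar_mxM mul_scalar_mx -levi_formE -(key v va) -(key w wa).
have alg (B e : 'M[R]_m) (u : 'rV[R]_m) : v *m B *m e *m (u *m B)^T = v *m (B *m e *m B^T) *m u^T.
  by rewrite (trmx_mul u) !mulmxA.
exact: (congr1 ( *:%R 2^-1) (etrans (congr1 (fun u => v *m A *m _ *m u^T) (esym (jt w wa))) (alg A _ _))).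
Qed.

Lemma flow_box_quotient : local_quotient M S eta T b U pi h /\ U p0.
Proof.
split.
  by split; [exact: oU|split; [exact: smooth_pi|exact: full_pi]|exact: orbits|exact: metric_h|exact: isometry].
exists 0; first by rewrite /Bx /= normr0.
by rewrite /Psi mxE scale0r (act0 action) mul0mx add0r (cmapK ac pc).
Qed.

End QuotientExistence.

End ReebField.

Local Notation cone := (sasaki_cone M eta T).
Local Notation etab b := (eta_of M eta T b).
Local Notation aloc b c := (form_loc M c (etab b)).
Local Notation Xloc b c := (vfield_loc M c (gen b)).

(** Without it [transverse_scal] could take the default value 0 of [xget]. *)
Lemma exists_local_quotient b p0 : cone b ->
  exists U pi h, local_quotient M S eta T b U pi h /\ U p0.
Proof.
move=> cb; pose c := chart_at M p0.
have ac : atlas M c := atlas_at M p0; have pc : cdom c p0 := cdom_at M p0.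
have [B2 [r [g [[r0 e0B] oO gP sg ug]]]] :=
  exists_flow_box action ac pc (reeb_chart_neq0 cb ac (cimg_cmap pc)).
do 3 eexists; exact: (flow_box_quotient cb ac pc r0 e0B oO gP sg ug).
Qed.

Lemma transverse_scalP b p : cone b -> exists U pi h,
  [/\ local_quotient M S eta T b U pi h, U p & transverse_scal M S eta T b p = scalar_curvature h (pi p)].
Proof.
move=> cb; rewrite /transverse_scal; case: xgetP => [s _ [U [pi [h [q Up ->]]]]|none].
  by exists U, pi, h.
have [U [pi [h [q Up]]]] := exists_local_quotient p cb.
by case: (none (scalar_curvature h (pi p))); exists U, pi, h.
Qed.

Local Notation cham b b' c := (contact_ham (aloc b c) (Xloc b' c)).

Definition hamiltonian b b' q : R := pairing (etab b q) (gen b' q).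

Lemma hamiltonianE b b' q : hamiltonian b b' q = pairing (eta q) (gen b' q) / pairing (eta q) (gen b q).
Proof. by rewrite /hamiltonian /pairing /eta_of -scalemxAr mxE mulrC. Qed.

Lemma hamiltonian_loc b b' c q : atlas M c -> cdom c q ->
  cham b b' c (cmap c q) = hamiltonian b b' q.
Proof. by move=> ac qc; rewrite /contact_ham pairing_loc. Qed.

Lemma hamiltonian_gt0 b b' q : cone b -> cone b' -> 0 < hamiltonian b b' q.
Proof. by move=> cb cb'; rewrite hamiltonianE; exact: divr_gt0 (cb' q) (cb q). Qed.

Lemma smooth_ham b b' c : cone b -> atlas M c -> smooth_on (cimg c) (cham b b' c).
Proof.
move=> cb ac; have oc := open_cimg ac.
have sm : smooth_on (cimg c) (fun x => Xloc b' c x *m aloc b c x).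
  by apply: (smooth_mulmx oc); [exact: smooth_generator|exact: (smooth_eta_of cb)].
by move/(smooth_mx oc): sm; apply.
Qed.

Definition chart_gradient b b' c x : 'rV[R]_m :=
  conformal_gradient (aloc b c) (Xloc b c) (Xloc b' c) (J_loc c) x.

Definition density b c x : R := wedge_top (aloc b c x) (extder_loc (aloc b c) x).

Theorem transverse_change b b' c q : cone b -> cone b' -> atlas M c -> cdom c q ->
  exists (e0 : 'M[R]_(d, m)) (E Q : R),
  [/\ 0 <= Q,
      transverse_scal M S eta T b' q =
        hamiltonian b b' q * (transverse_scal M S eta T b q + (d%:R + 2) * E - Q),
      (forall v : 'rV[R]_m, 'D_v (cham b b' c) (cmap c q) = 0) ->
        Q = 0 /\ hamiltonian b b' q * E =
          \sum_i 'D_(row i e0) ('D_(row i e0) (cham b b' c)) (cmap c q),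
      e0 *m aloc b c (cmap c q) = 0 /\
        (forall v : 'rV[R]_m, v *m aloc b c (cmap c q) = 0 -> exists w, v = w *m e0)
    & exists2 O1 : set 'rV[R]_m, open O1 /\ O1 (cmap c q) & smooth_on O1 (chart_gradient b b' c) /\
       \sum_i partial i (fun x => density b c x * chart_gradient b b' c x 0 i) (cmap c q) =
       density b c (cmap c q) * E].
Proof.
move=> cb cb' ac qc.
(* The values come with some local quotients, and the local change formula holds for any two of them
   over a common open set of N. *)
have [U [pi [h [Q1 Uq ->]]]] := transverse_scalP q cb.
have [U' [pi' [h' [Q2 Uq' ->]]]] := transverse_scalP q cb'.
have oU := quotient_open Q1; have oU' := quotient_open Q2.
pose O := cmap c @` (cdom c `&` (U `&` U')).
have oO : open O by exact: (open_chart_image ac (openI oU oU')).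
have Oc x : O x -> [/\ cimg c x, (cmap c @` (cdom c `&` U)) x & (cmap c @` (cdom c `&` U')) x].
  by case=> p [pc [Up Up']] <-; split; exists p.
have Oq : O (cmap c q) by exists q.
have ham x : cimg c x -> cham b b' c x = hamiltonian b b' (cinv c x).
  by move=> xc; have [pc xE] := cinvK ac xc; rewrite -{1}xE hamiltonian_loc.
have sub (A : set 'rV[R]_m) : (forall x, O x -> A x) -> forall p1 p2 (F : 'rV[R]_m -> 'M[R]_(p1, p2)), smooth_on A F -> smooth_on O F.
  by move=> OA p1 p2 F; apply: smooth_sub.
have Oci x : O x -> cimg c x by case/Oc.
have etaE x : cimg c x -> aloc b' c x = (cham b b' c x)^-1 *: aloc b c x.
  move=> xc; have [pc xE] := cinvK ac xc; rewrite -xE hamiltonian_loc // !form_locE //.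
  rewrite hamiltonianE invf_div /eta_of -!scalemxAr scalerA; congr (_ *: _).
  by rewrite mulrAC divff ?mul1r // gt_eqF //; exact: cb.
have sa := smooth_eta_of cb.
have sham := smooth_ham b' cb ac.
have hamn x : cimg c x -> cham b b' c x != 0.
  by move=> xc; rewrite ham // gt_eqF // hamiltonian_gt0.
have := @local_conformal_change R n O (pi @` U) (pi' @` U') oO (quotient_image_open Q1)
  (quotient_image_open Q2) (aloc b c) (Xloc b c) (Xloc b' c) (J_loc c)
  (pi \o cinv c) (pi' \o cinv c) h h' (cmap c q) Oq.
rewrite /= (cmapK ac qc) (hamiltonian_loc _ _ ac qc); apply.
- exact: (sub _ Oci) (sa c ac).
- exact: (sub _ Oci) (smooth_generator action _ ac).
- exact: (sub _ Oci) (smooth_generator action _ ac).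
- by apply: (sub (cmap c @` (cdom c `&` U))); [move=> x /Oc[]|exact: (quotient_smooth Q1 ac)].
- by apply: (sub (cmap c @` (cdom c `&` U'))); [move=> x /Oc[]|exact: (quotient_smooth Q2 ac)].
- by move=> x /Oci xc; exact: reeb_chart.
- by move=> x /Oci xc; exact: reeb_kernel.
- by move=> x j /Oci xc; exact: contact_hamiltonian.
- by move=> x /Oci xc; rewrite ham // hamiltonian_gt0.
- by move=> x v /Oci xc; exact: (J_locP cb ac xc).
- by move=> x [p [pc [Up _]] <-]; exists p => //=; rewrite (cmapK ac pc).
- by move=> x [p [pc [_ Up]] <-]; exists p => //=; rewrite (cmapK ac pc).
- by move=> x /Oc[_ xU _]; exact: (quotient_full Q1 ac xU).
- by move=> x /Oc[_ _ xU]; exact: (quotient_full Q2 ac xU).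
- by move=> x /Oc[_ xU _]; exact: (quotient_reeb Q1 ac xU).
- by move=> x /Oc[_ _ xU]; exact: (quotient_reeb Q2 ac xU).
- exact: quotient_metric Q1.
- exact: quotient_metric Q2.
- by move=> x v w /Oc[_ xU _] va wa; exact: (quotient_isometry cb Q1 ac xU va wa).
move=> x v w /Oc[xc _ xU] va wa.
have ka (u : 'rV[R]_m) : u *m aloc b c x = 0 -> u *m aloc b' c x = 0.
  by move=> u0; rewrite etaE // -scalemxAr u0 scaler0.
rewrite (quotient_isometry cb' Q2 ac xU (ka _ va) (ka _ wa)) -scalerA.
have [wJ _] := J_locP cb ac xc wa.
congr (_ *: _); apply: (extder_loc_scale (open_cimg ac) (smooth_inv (open_cimg ac) hamn sham) (sa c ac)) => //.
Qed.

(** * Uniqueness of the scalar-flat ray *)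

Section Uniqueness.
Local Notation ham := hamiltonian.
Variables b b' : 'rV[R]_k.
Hypotheses (cb : cone b) (cb' : cone b').

(** Positivity of the Levi form makes the contact form and its differential together injective on
    tangent vectors. *)
Lemma reeb_coframe_injective c x (v : 'rV[R]_m) : atlas M c -> cimg c x ->
  v *m aloc b c x = 0 -> v *m extder_loc (aloc b c) x = 0 -> v = 0.
Proof.
move=> ac xc va vO; apply/eqP; apply: contraT => vn.
have := levi_form_gt0 cb ac xc va vn.
by rewrite /levi_form vO mul0mx mxE ltxx.
Qed.

Let F c := cham b b' c.

(** The Hamiltonian is constant along the Reeb flow: its differential is a contraction of the
    differential of the form, which the Reeb field annihilates. *)
Lemma ham_reeb c x : atlas M c -> cimg c x -> \sum_j Xloc b c x 0 j * partial j (F c) x = 0.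
Proof.
move=> ac xc; have H j := contact_hamiltonian cb b' ac j xc.
have OX : extder_loc (aloc b c) x *m (Xloc b c x)^T = 0.
  apply: trmx_inj; rewrite trmx_mul trmxK trmx0.
  rewrite (_ : (extder_loc _ _)^T = - extder_loc (aloc b c) x); last first.
    by apply/matrixP => i j; rewrite mxE [RHS]mxE; exact: extder_loc_asym.
  by rewrite mulmxN (reeb_kernel cb ac xc) oppr0.
have : (Xloc b' c x *m extder_loc (aloc b c) x *m (Xloc b c x)^T) 0 0 = 0 by rewrite -mulmxA OX mulmx0 mxE.
rewrite mxE => Z; apply/eqP; rewrite -oppr_eq0 -sumrN; apply/eqP; apply: etrans Z.
by apply: eq_bigr => j _; rewrite H [(Xloc b c x)^T _ _]mxE mulNr mulrC.
Qed.

Hypothesis sb : forall p, transverse_scal M S eta T b p = 0.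
Hypothesis sb' : forall p, transverse_scal M S eta T b' p = 0.
Variable q : N.
Hypothesis qmax : forall p, ham b b' p <= ham b b' q.
Let c := chart_at M q.
Let ac : atlas M c. Proof. exact: atlas_at. Qed.
Let qc : cdom c q. Proof. exact: cdom_at. Qed.
Let oc := open_cimg ac.
Let x0 := cmap c q.
Let x0c : cimg c x0. Proof. exact: cimg_cmap. Qed.

Let FE x : cimg c x -> F c x = ham b b' (cinv c x).
Proof. by move=> xc; have [pc xE] := cinvK ac xc; rewrite -{1}xE /F hamiltonian_loc. Qed.

Let Fmax x : cimg c x -> F c x <= F c x0.
Proof. by move=> xc; rewrite !FE // (cmapK ac qc). Qed.

(** The horizontal second derivatives are nonpositive with sum 0, so each is 0 and [hessian_null]
    puts the vectors of [e0] into the kernel of the Hessian. The Reeb direction is added by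
    differentiating [ham_reeb]. *)
Let hess0 : hessian (F c) x0 = 0.
Proof.
have sF := smooth_ham b' cb ac; have dF v := derive_at_max oc sF x0c Fmax v.
have [e0 [E [Q [_ sE]]]] := transverse_change cb cb' ac qc.
move=> /(_ dF)[Q0 fE] [e0a e0D] _.
have f0 : 0 < ham b b' q by exact: hamiltonian_gt0.
have E0 : E = 0.
  move: sE; rewrite sb sb' Q0 subr0 add0r => /esym/eqP.
  by rewrite !mulf_eq0 (gt_eqF f0) gt_eqF ?ltr_wpDl //= => /eqP.
have null i : row i e0 *m hessian (F c) x0 = 0.
  apply: (hessian_null oc sF x0c Fmax); apply/eqP; rewrite -oppr_eq0; apply/eqP.
  move: fE; rewrite E0 mulr0 => /esym/eqP; rewrite -oppr_eq0 -sumrN psumr_eq0 => [/allP/(_ i)|j _].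
    by rewrite mem_index_enum => /(_ isT)/eqP.
  by rewrite oppr_ge0; exact: (derive2_at_max oc sF x0c Fmax).
have e0H : e0 *m hessian (F c) x0 = 0 by apply/row_matrixP => i; rewrite row_mul null row0.
have sX := smooth_generator action b ac.
have XH : Xloc b c x0 *m hessian (F c) x0 = 0.
  apply/rowP => i; rewrite [RHS]mxE -(hessian_sym oc sF x0c) mxE.
  have sXj j : smooth_on (cimg c) (fun x => Xloc b c x 0 j) by move/(smooth_mx oc): sX; apply.
  have sPj j : smooth_on (cimg c) (partial j (F c)) by exact: smooth_derive.
  pose v : 'rV[R]_m := delta_mx 0 i.
  have D j := is_deriveM (smooth_is_derive v (sXj j) x0c) (smooth_is_derive v (sPj j) x0c).
  have [_] := @is_derive_sum _ _ _ _ (fun j x => Xloc b c x 0 j * partial j (F c) x) x0 v _ D.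
  have Z : \forall x \near x0, (\sum_j (fun x => Xloc b c x 0 j * partial j (F c) x)) x = 0.
    by apply: (open_near oc x0c) => x xc; rewrite fct_sumE ham_reeb.
  rewrite (near_eq_derive _ Z) derive_cst => E1; apply: (etrans _ (esym E1)); apply: eq_bigr => j _.
  by rewrite [partial j _ x0]dF scale0r addr0 [_^T _ _]mxE [hessian _ _ _ _]mxE.
suff : (1%:M : 'M[R]_m) *m hessian (F c) x0 = 0 by rewrite mul1mx.
apply/row_matrixP => i; rewrite row_mul row0; set v := row i 1%:M.
have vz : (v - (v *m aloc b c x0) *m Xloc b c x0) *m aloc b c x0 = 0.
  by rewrite mulmxBl -(mulmxA (v *m aloc b c x0) (Xloc b c x0)) (reeb_chart cb ac x0c) mulmx1 subrr.
have [w wE] := e0D _ vz.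
by rewrite -[v](subrK ((v *m aloc b c x0) *m Xloc b c x0)) wE mulmxDl -(mulmxA w) e0H -(mulmxA (v *m aloc b c x0) (Xloc b c x0)) XH !mulmx0 addr0.
Qed.

Let a := - ham b b' q *: b + b'.
Let Y := Xloc a c.

Let YE x : cimg c x -> Y x = - ham b b' q *: Xloc b c x + Xloc b' c x.
Proof. by move=> xc; rewrite /Y /vfield_loc /a generator_linear // mulmxDl scalemxAl. Qed.

Let Ya x : cimg c x -> Y x *m aloc b c x = (F c x - F c x0)%:M.
Proof.
move=> xc; rewrite YE // mulmxDl -scalemxAl (reeb_chart cb ac xc) [F c x0]FE // (cmapK ac qc).
by rewrite [X in _ + X]mx11_scalar scalemx1 -raddfD addrC.
Qed.

Let YO x j : cimg c x -> Y x *m col j (extder_loc (aloc b c) x) = (- partial j (F c) x)%:M.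
Proof.
move=> xc; rewrite colE mulmxA -colE YE // mulmxDl -scalemxAl (reeb_kernel cb ac xc) scaler0 add0r.
by apply/matrixP => i l; rewrite !ord1 mxE [RHS]mxE eqxx; exact: (contact_hamiltonian cb b' ac j xc).
Qed.

Let kernel (v : 'rV[R]_m) : v *m aloc b c x0 = 0 -> (forall j, v *m col j (extder_loc (aloc b c) x0) = 0) -> v = 0.
Proof.
move=> va vO; apply: (reeb_coframe_injective ac x0c va); apply/rowP => j.
by have /(congr1 (fun M : 'M[R]_1 => M 0 0)) := vO j; rewrite colE mulmxA -colE mxE => ->; rewrite !mxE.
Qed.

Let dF v : 'D_v (F c) x0 = 0. Proof. exact: (derive_at_max oc (smooth_ham b' cb ac) x0c Fmax). Qed.

Let Y0 : Y x0 = 0.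
Proof.
apply: kernel => [|j]; first by rewrite Ya // subrr raddf0.
by rewrite YO // [partial _ _ _]dF oppr0 raddf0.
Qed.

(** The contractions of [Y] with the form and with its differential are [F] minus its maximum and
    the derivatives of [F], all with vanishing first jet. As [Y] is 0 at the point, its derivative
    has zero contractions too, and [kernel] applies. *)
Let DY0 v i : 'D_v (fun x => Y x 0 i) x0 = 0.
Proof.
have sY := smooth_generator action a ac; have sa := smooth_eta_of cb ac.
have sF := smooth_ham b' cb ac.
suff : (\row_i 'D_v (fun x => Y x 0 i) x0) = 0 by move/rowP/(_ i); rewrite !mxE.
apply: kernel => [|j].
  rewrite (derive_mulmx_zero v oc sY sa x0c Y0 Ya).
  have [_ ->] := is_deriveB (smooth_is_derive v sF x0c) (is_derive_cst (F c x0) x0 v).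
  by rewrite dF subr0 raddf0.
have sO : smooth_on (cimg c) (fun x => col j (extder_loc (aloc b c) x)).
  apply/(smooth_mx oc) => l l'; rewrite ord1.
  have /(smooth_mx oc)/(_ l j) H := smooth_extder (W := OpenSet oc) sa.
  by apply: (smooth_eq oc _ H) => x _; rewrite [col _ _ _ _]mxE.
rewrite (derive_mulmx_zero v oc sY sO x0c Y0 (fun x xc => YO j xc)).
have [_ ->] := is_deriveN (smooth_is_derive v (smooth_derive (delta_mx 0 j) sF) x0c).
by rewrite (hessianE oc sF x0c) hess0 mulmx0 mul0mx mxE oppr0 raddf0.
Qed.

Hypothesis periodic : forall (a : 'rV[R]_k) p, (forall i, a 0 i \is a Num.int) -> T a p = p.

Lemma trivial_near_max : \forall p \near q, forall t, T (t *: (- ham b b' q *: b + b')) p = p.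
Proof. exact: (fixed_near hausN action periodic ac qc Y0 DY0). Qed.

End Uniqueness.

Section PartOne.
Local Notation ham := hamiltonian.

Lemma hamiltonian_continuous b b' : cone b -> continuous (ham b b').
Proof.
move=> cb; apply: (smooth_scalar_continuous (M := M)) => c ac.
apply: (smooth_eq (open_cimg ac) _ (smooth_ham b' cb ac)) => x xc.
by have [qc xE] := cinvK ac xc; rewrite -{1}xE hamiltonian_loc.
Qed.

Lemma generator_trivial a p : (forall t, T (t *: a) p = p) -> generator M T a p = 0.
Proof.
move=> H; rewrite /generator (_ : (fun t : R => _) = cst (cmap (chart_at M p) p)) ?derive1_cst //.
by apply/funext => t; rewrite H.
Qed.

Hypothesis torus : forall a, (forall p, T a p = p) <-> (forall i, a 0 i \is a Num.int).

Theorem unique_scalar_flat_ray b b' : cone b -> cone b' ->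
  (forall p, transverse_scal M S eta T b p = 0) -> (forall p, transverse_scal M S eta T b' p = 0) ->
  exists2 l : R, 0 < l & b' = l *: b.
Proof.
move=> cb cb' sb sb'; have cf := hamiltonian_continuous (b' := b') cb.
have [||q _ qmax] := @compact_EVT_max N R (ham b b') setT _ compactN; first by exists point.
  exact: continuous_subspaceT.
have {}qmax p : ham b b' p <= ham b b' q by apply: qmax; rewrite inE.
pose a := - ham b b' q *: b + b'.
have near_fix p : ham b b' p = ham b b' q -> \forall p' \near p, forall t, T (t *: a) p' = p'.
  move=> pq; rewrite /a -pq; apply: (trivial_near_max cb cb' sb sb').
    by move=> p'; rewrite pq.
  by move=> c p' ci; apply: (torus c).2.
have ham_fix p : (forall t, T (t *: a) p = p) -> ham b b' p = ham b b' q.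
  move=> /generator_trivial; rewrite generator_linear // => /(congr1 (pairing (eta_of M eta T b p))).
  rewrite {2}/pairing mul0mx mxE /pairing mulmxDl -scalemxAl eta_of_generator // => /eqP.
  by rewrite mxE [X in X + _]mxE [1%:M _ _]mxE mulr1 addrC subr_eq0 => /eqP.
have Z : [set p | ham b b' p = ham b b' q] = setT.
  apply: connectedN; first by exists q.
    exists [set p | ham b b' p = ham b b' q]; last by rewrite setTI.
    rewrite openE => p /= /near_fix; apply: filterS => p'; exact: ham_fix.
  exists [set p | ham b b' p = ham b b' q]; last by rewrite setTI.
  have -> : [set p | ham b b' p = ham b b' q] = ham b b' @^-1` [set ham b b' q] by [].
  apply: closed_comp; first by move=> p _; exact: cf.
  exact: closed_eq.
have fixed t : forall p, T (t *: a) p = p.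
  by move=> p; have : [set p | ham b b' p = ham b b' q] p by [rewrite Z]; move=> /near_fix /nbhs_singleton.
have a0 : a = 0.
  apply/rowP => i; rewrite [RHS]mxE; apply/eqP; apply: contraT => ai.
  (* At this time the coordinate [i] of the parameter is 1/2, so the torus element cannot be
     trivial. *)
  have /(_ i) := (torus _).1 (fixed (2 * a 0 i)^-1); rewrite mxE invfM -mulrA mulVf // mulr1 => h.
  have := norm_intr_ge1 h; rewrite invr_eq0 pnatr_eq0 => /(_ isT).
  by rewrite ger0_norm ?invr_ge0 // invf_ge1 // lern1.
exists (ham b b' q); first exact: hamiltonian_gt0.
by apply/eqP; rewrite -subr_eq0 addrC -scaleNr; apply/eqP.
Qed.

End PartOne.

(** * Sign of the total transverse scalar curvature *)

Section ConePair.
Variables b bo : 'rV[R]_k.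
Hypotheses (cb : cone b) (cbo : cone bo).
Local Notation rho := (density b).
Local Notation Y := (chart_gradient b bo).
Local Notation NS := (g_sigma_algebraType (@open N)).

Lemma smooth_density c : atlas M c -> smooth_on (cimg c) (rho c).
Proof.
move=> ac; have oc := open_cimg ac; have sa := smooth_eta_of cb ac.
have sO := smooth_extder (W := OpenSet oc) sa.
apply: (smooth_mul oc); first exact: smooth_cst.
apply: (smooth_sum oc) => s _; apply: (smooth_mul oc); first exact: smooth_cst.
apply: (smooth_mul oc); first by move/(smooth_mx oc): sa; apply.
by apply: (smooth_prod oc) => i _; move/(smooth_mx oc): sO; apply.
Qed.

(** Nondegeneracy of [eta] carries over to the rescaled form, since top forms scale by a power of
    the factor ([wedge_top_scale]). *)
Lemma density_neq0 c x : atlas M c -> cimg c x -> rho c x != 0.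
Proof.
move=> ac xc; have oc := open_cimg ac; have [pc xE] := cinvK ac xc; set p := cinv c x in pc xE.
have [seta ne _ _] := contact.
have H : wedge_top (form_loc M c eta x) (extder_loc (form_loc M c eta) x) != 0.
  have [uj _] := mulmx1_unit (jacK ac (atlas_at M p) pc (cdom_at M p)).
  rewrite -xE (form_locE _ ac pc) (extderE ac pc seta) wedge_top_mulmx.
  by apply: mulf_neq0; [rewrite -unitfE -unitmxE|exact: ne].
pose l y : R := (pairing (eta (cinv c y)) (gen b (cinv c y)))^-1.
have lE y : cimg c y -> aloc b c y = l y *: form_loc M c eta y.
  by move=> yc; have [qc yE] := cinvK ac yc; rewrite -yE !form_locE // yE /eta_of scalemxAr.
have l0 y : l y != 0 by rewrite invr_eq0 gt_eqF //; exact: cb.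
have sl : smooth_on (cimg c) l.
  have sp : smooth_on (cimg c) (fun y => Xloc b c y *m form_loc M c eta y).
    by apply: (smooth_mulmx oc); [exact: smooth_generator|exact: seta].
  move/(smooth_mx oc): sp => /(_ 0 0) sp; apply: (smooth_inv oc) => [y yc|].
    by rewrite -invr_eq0; exact: l0.
  apply: (smooth_eq oc _ sp) => y yc; have [qc yE] := cinvK ac yc.
  by rewrite -{1 2}yE pairing_loc.
rewrite /density lE // (wedge_top_scale (B := extder_loc (form_loc M c eta) x)).
  by rewrite mulf_neq0 // expf_neq0.
move=> v w va wa; exact: (extder_loc_scale oc sl (seta c ac) lE xc va wa).
Qed.

Lemma smooth_chart_gradient c : atlas M c -> smooth_on (cimg c) (Y c).
Proof.
move=> ac; apply: smooth_pt => x xc; have [qc xE] := cinvK ac xc.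
have [e0 [E [Q [_ _ _ _ [W1 [_ W1x] [sY _]]]]]] :=
  transverse_change cb cbo ac qc.
by exists W1 => //; rewrite -xE.
Qed.

Definition weighted_divergence c x : R := (rho c x)^-1 * \sum_i partial i (fun y => rho c y * Y c y 0 i) x.
Local Notation wd := weighted_divergence.

(** The divergence clause identifies the existential [E] with the smooth function
    [weighted_divergence]; nonnegativity of the new curvature and of [Q] then leaves a lower bound
    for the old one. *)
Lemma transverse_scal_ge c q : atlas M c -> cdom c q -> 0 <= transverse_scal M S eta T bo q ->
  - (d%:R + 2) * wd c (cmap c q) <= transverse_scal M S eta T b q.
Proof.
have ar (u e s q' : R) : 0 <= q' -> 0 <= s + u * e - q' -> - u * e <= s by move=> ? ?; lra.
move=> ac qc so; have [e0 [E [Q [Q0 sE _ _ [W1 _ [_ div]]]]]] :=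
  transverse_change cb cbo ac qc.
have rn := density_neq0 ac (cimg_cmap qc).
have dE : wd c (cmap c q) = E.
  exact: etrans (congr1 (fun z => (rho c (cmap c q))^-1 * z) div) (mulKf rn E).
have f0 : 0 < hamiltonian b bo q by exact: hamiltonian_gt0.
have := eq_ind _ (fun z => 0 <= z) so _ sE.
by rewrite dE (pmulr_rge0 _ f0); exact: ar.
Qed.

(** The gradient is a genuine vector field. This lets the derivatives of the partition of unity,
    computed in different charts, be added at a point. *)
Lemma chart_gradient_change c c' q : atlas M c -> atlas M c' -> cdom c q -> cdom c' q ->
  Y c' (cmap c' q) = Y c (cmap c q) *m jac c c' q.
Proof.
move=> ac ac' qc qc'; have a0 := atlas_at M q; have q0 := cdom_at M q.
rewrite /chart_gradient /conformal_gradient !hamiltonian_loc // -scalemxAl; congr (_ *: _).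
have JE c1 : atlas M c1 -> cdom c1 q ->
    J_loc c1 (cmap c1 q) = jac c1 (chart_at M q) q *m cr_J S q *m jac (chart_at M q) c1 q.
  by move=> a1 q1; exact: J_locE.
rewrite (JE c' ac' qc') (JE c ac qc) (jac_comp ac' ac a0 qc' qc q0) (jac_comp a0 ac ac' q0 qc qc').
have PP : jac c c' q *m jac c' c q = 1%:M := jacK ac ac' qc qc'.
move: PP (vfield_loc_change (gen bo) ac ac' qc qc') (vfield_loc_change (gen b) ac ac' qc qc')
  (form_loc_change (etab b) ac ac' qc qc').
move: (jac c c' q) (jac c' c q) (jac c (chart_at M q) q) (jac (chart_at M q) c q) (cr_J S q) => P P' C C' J.
move: (Xloc bo c' _) (Xloc bo c _) (Xloc b c' _) (Xloc b c _) (form_loc M c' _ _) (form_loc M c _ _).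
move=> X2 X Z2 Z a' a PP -> -> ->.
have -> : X *m P *m (1%:M - a' *m (Z *m P)) = X *m (1%:M - P *m a' *m Z) *m P.
  by rewrite !mulmxBr !mulmx1 mulmxBl !mulmxA.
by rewrite !mulmxA -(mulmxA _ P P') PP mulmx1.
Qed.

Section LocalIntegral.

(** The divergence of [chi] times the gradient field, by the product rule, extended by 0 outside the
    chart; for [chi] supported in the chart it is continuous on N. *)
Definition divergence_term (c : chart R N m) (chi : N -> R) (q : N) : R :=
  if pselect (cdom c q) then chi q * wd c (cmap c q) + 'D_(Y c (cmap c q)) (chi \o cinv c) (cmap c q) else 0.

Lemma divergence_termE c chi q : cdom c q ->
  divergence_term c chi q = chi q * wd c (cmap c q) + 'D_(Y c (cmap c q)) (chi \o cinv c) (cmap c q).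
Proof. by rewrite /divergence_term; case: pselect. Qed.

Lemma divergence_term0 c chi q : ~ cdom c q -> divergence_term c chi q = 0.
Proof. by rewrite /divergence_term; case: pselect. Qed.

Variables (c : chart R N m) (p : N) (chi : N -> R) (r : R).
Hypotheses (ac : atlas M c) (pc : cdom c p) (r0 : 0 < r).
Let x0 := cmap c p.
Let oc := open_cimg ac.
Hypothesis box_in : forall x, `|x - x0| <= r -> cimg c x /\ 0 < rho c x * rho c x0.
Hypotheses (schi : smooth_scalar M chi) (supp : forall q, chi q != 0 -> cdom c q /\ `|cmap c q - x0| < r).
Let box : set 'rV[R]_m := [set x | `|x - x0| <= r].
Let K : set N := cinv c @` box.
Let w := divergence_term c chi.
Let chil := chi \o cinv c.

Let closedK : closed K.
Proof.
apply: compact_closed => //; apply: (compact_chart_box ac); first exact: closed_ball_compact.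
by move=> x /box_in[].
Qed.

Let chi0 q : ~ K q -> chi q = 0.
Proof.
move=> nK; apply/eqP; apply: contraT => /supp[qc qr]; exfalso; apply: nK.
by exists (cmap c q); [exact: ltW|exact: (cmapK ac qc)].
Qed.

Let sY : smooth_on (cimg c) (Y c).
Proof. exact: (smooth_chart_gradient ac). Qed.
Let srho : smooth_on (cimg c) (rho c). Proof. exact: (smooth_density ac). Qed.
Let schil : smooth_on (cimg c) chil. Proof. exact: schi. Qed.
Let sYi i : smooth_on (cimg c) (fun x => Y c x 0 i). Proof. by move/(smooth_mx oc): sY; apply. Qed.
Let srY i : smooth_on (cimg c) (fun x => rho c x * Y c x 0 i). Proof. exact: (smooth_mul oc srho (sYi i)). Qed.
Let rn x : cimg c x -> rho c x != 0. Proof. exact: (density_neq0 ac). Qed.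

Let near0 q : ~ K q -> \forall q' \near q, chi q' = 0.
Proof. by move=> nK; apply: (open_near (closed_openC closedK) nK) => q' nK'; exact: chi0. Qed.

Let notK q : ~ cdom c q -> ~ K q.
Proof. by move=> nqc [x /box_in[xc _] xq]; apply: nqc; rewrite -xq; have [] := cinvK ac xc. Qed.

Lemma near_support q : ~ cdom c q -> \forall q' \near q, chi q' = 0.
Proof. by move/notK; exact: near0. Qed.

Lemma divergence_term_out q : ~ K q -> w q = 0.
Proof.
move=> nK; have [qc|/divergence_term0] := pselect (cdom c q); last exact.
rewrite /w (divergence_termE _ qc) chi0 // mul0r add0r.
have nz : \forall x \near cmap c q, (chi \o cinv c) x = 0.
  exact: (near_cinv (P := fun q => chi q = 0) ac qc (near0 nK)).
by rewrite (near_eq_derive _ nz) derive_cst.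
Qed.

Let W x := chil x * wd c x + 'D_(Y c x) chil x.

Let sW : smooth_on (cimg c) W.
Proof.
apply: (smooth_add oc); last exact: smooth_derive_along.
apply: (smooth_mul oc) => //; apply: (smooth_mul oc); first exact: (smooth_inv oc rn srho).
by apply: (smooth_sum oc) => i _; exact: smooth_derive.
Qed.

Let wE q : cdom c q -> w q = W (cmap c q).
Proof. by move=> qc; rewrite /w (divergence_termE _ qc) /W /chil /= (cmapK ac qc). Qed.

Lemma divergence_term_continuous : continuous w.
Proof.
move=> q; have [qc|nqc] := pselect (cdom c q).
  apply: (@near_continuous_at _ _ (W \o cmap c)).
    by apply: (open_near (open_cdom ac) qc) => q' /wE ->.
  have [_ _ _ cc _] := atlas_chart ac.
  by apply: continuous_comp; [exact: cc|exact: (smooth_cont sW (cimg_cmap qc))].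
have nK := notK nqc.
apply: (@near_continuous_at _ _ (cst 0)); last exact: cst_continuous.
by apply: (open_near (closed_openC closedK) nK) => q' nK'; rewrite divergence_term_out.
Qed.

Variable mu : {measure set NS -> \bar R}.
Hypothesis vol : volume_measure M eta T b mu.
Let a i : R := x0 0 (inord i).

Let boxE x : in_box a r x <-> box x.
Proof.
split=> [H|H i].
  by apply: row_norm_le (ltW r0) _ => i; have := H i; rewrite /a inord_val !mxE.
by have := le_trans (coord_le_norm (x - x0) i) H; rewrite /a inord_val !mxE.
Qed.

(** The components of the density times [chi] times the gradient, extended by 0 outside the box.
    They vanish at its boundary because the support of [chi] lies strictly inside. *)
Let F j x : R := if pselect (box x) then chil x * (rho c x * Y c x 0 j) else 0.

Let FE j x : cimg c x -> F j x = chil x * (rho c x * Y c x 0 j).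
Proof.
move=> xc; rewrite /F; case: pselect => //= nb; have [qc qx] := cinvK ac xc.
rewrite /chil /= chi0 ?mul0r // => -[y yb yx]; apply: nb.
by rewrite -qx -yx; have [_ ->] := cinvK ac (box_in yb).1.
Qed.

Let sF j : smooth_on setT (F j).
Proof.
apply: smooth_pt => x _; have [xc|nxc] := pselect (cimg c x).
  by exists (cimg c) => //; apply: (smooth_eq oc _ (smooth_mul oc schil (srY j))) => y yc; rewrite FE.
have cl : closed box by apply: compact_closed; [exact: norm_hausdorff|exact: closed_ball_compact].
exists (~` box); first by move=> /box_in[].
apply: (smooth_eq (closed_openC cl) _ (smooth_cst _ 0)) => y ny.
by rewrite /F; case: pselect.
Qed.

Let F0 j (x : 'rV[R]_m) : (exists i : 'I_m, r <= `|x 0 i - a i|) -> F j x = 0.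
Proof.
move=> [i ri]; rewrite /F; case: pselect => //= xb; have [xc _] := box_in xb.
have [->|/supp[_]] := eqVneq (chil x) 0; first by rewrite mul0r.
have [_ ->] := cinvK ac xc; move=> xr; exfalso; move: ri; rewrite leNgt => /negP; apply.
by apply: le_lt_trans xr; have := coord_le_norm (x - x0) i; rewrite /a inord_val !mxE.
Qed.

(** The volume uses the absolute value of the density. On the box the density keeps the sign it has
    at the centre, so the absolute value is multiplication by this constant. *)
Let s : R := Num.sg (rho c x0) / (n`!)%:R.

Let volE x : box x -> volume_density M eta T b c x = s * rho c x.
Proof.
move=> /box_in[_]; rewrite /volume_density -/(rho c x) /s; move: (rho c x) (rho c x0) => u v uv.
rewrite mulrAC; congr (_ / _); rewrite normrEsg; congr (_ * _); move: uv.
case: (ltgtP 0 v) => [h|h|<-]; last by rewrite mulr0 ltxx.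
  by rewrite pmulr_lgt0 // => h'; rewrite !gtr0_sg.
by rewrite nmulr_lgt0 // => h'; rewrite !ltr0_sg.
Qed.

Lemma divergence_term_integral : mu.-integrable setT (EFin \o (w : NS -> R)) /\
  (\int[mu]_q ((w : NS -> R) q)%:E = 0)%E.
Proof.
have cP j : continuous (partial j (F j)) by move=> x; exact: (smooth_cont (smooth_derive _ (sF j)) I).
have zP j : box_integral a r (partial j (F j)) = 0 by apply: box_integral_partial (F0 j) => //; exact: sF.
have [cG G0] := box_integral_sum0 s r0 (index_enum 'I_m) cP zP.
have clw : continuous (fun q => `|w q|) by move=> q; apply: norm_continuous_at; exact: divergence_term_continuous.
have [||q1 _ wmax] := @compact_EVT_max N R (fun q => `|w q|) setT _ compactN; first by exists point.
  exact: continuous_subspaceT.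
pose L := Num.bound `|w q1|.
have wL q : `|w q| <= L%:R.
  by apply: le_trans (wmax q (in_setT q)) _; apply: ltW; exact: archi_boundP (normr_ge0 _).
have inB x : in_box a r x -> cimg c x by move=> /boxE/box_in[].
have imK : cinv c @` in_box a r = K by rewrite (_ : in_box a r = box) //; apply/seteqP; split=> x /boxE.
have mK : measurable (K : set NS).
  rewrite -[K]setCK; apply: measurableC; apply: sub_sigma_algebra; exact: closed_openC.
have mKB : measurable (cinv c @` in_box a r : set NS) by rewrite imK.
have cvol : continuous (volume_density M eta T b c \o clamp x0 r).
  move=> x; have xb := clamp_box x0 (ltW r0) x.
  apply: (@continuous_comp _ _ _ (clamp x0 r) (volume_density M eta T b c)); first exact: clamp_continuous.
  apply: continuousM; last exact: cst_continuous.
  by apply: norm_continuous_at; exact: (smooth_cont srho (box_in xb).1).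
have volB x : in_box a r x -> (volume_density M eta T b c \o clamp x0 r) x = volume_density M eta T b c x.
  by move=> /boxE xb; rewrite /= clampE.
have wout q : ~ (cinv c @` in_box a r) q -> w q = 0 by rewrite imK; exact: divergence_term_out.
have vol0 x : 0 <= volume_density M eta T b c x by rewrite divr_ge0.
have GE x : in_box a r x -> \sum_j s * partial j (F j) x = w (cinv c x) * volume_density M eta T b c x; last first.
  have [iw ->] := chart_integral (vol ac) r0 vol0 inB (fun x => cinvK ac) (fun q => cmapK ac) mKB cvol volB
    (continuous_borel divergence_term_continuous) wL wout cG GE.
  by split=> //; rewrite G0.
move=> /boxE xb; have [xc _] := box_in xb; have [qc qx] := cinvK ac xc.
rewrite wE // qx volE // mulrCA -mulr_sumr; congr (_ * _).
have D j : partial j (F j) x = chil x * partial j (fun y => rho c y * Y c y 0 j) x + rho c x * (Y c x 0 j * partial j chil x).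
  have nE : \forall y \near x, F j y = chil y * (rho c y * Y c y 0 j) by apply: (open_near oc xc) => y; exact: FE.
  rewrite /partial (near_eq_derive _ nE).
  have [_ ->] := is_deriveM (smooth_is_derive (delta_mx 0 j) schil xc) (smooth_is_derive (delta_mx 0 j) (srY j) xc).
  by rewrite mulrA.
rewrite (eq_bigr _ (fun j _ => D j)) big_split /= -!mulr_sumr /W mulrDl.
rewrite -(derive_partial _ (smooth_diff_fun oc schil xc)); congr (_ + _); last exact: mulrC.
rewrite /weighted_divergence -mulrA; congr (_ * _).
by move: (\sum_i _) (rho c x) (rn xc) => z u u0; rewrite mulrC mulVKf.
Qed.

End LocalIntegral.

Lemma derive_chart_gradient (chi : N -> R) c c' q : smooth_scalar M chi ->
  atlas M c -> atlas M c' -> cdom c q -> cdom c' q ->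
  'D_(Y c (cmap c q)) (chi \o cinv c) (cmap c q) = 'D_(Y c' (cmap c' q)) (chi \o cinv c') (cmap c' q).
Proof.
move=> schi ac ac' qc qc'; have dt := differentiable_transition ac ac' qc qc'.
have dc : differentiable (chi \o cinv c') ((cmap c' \o cinv c) (cmap c q)).
  rewrite /= (cmapK ac qc); exact: (smooth_diff_fun (open_cimg ac') (schi c' ac') (cimg_cmap qc')).
rewrite (near_eq_derive _ (near_transition chi ac ac' qc qc')).
have [_ ->] := is_derive_comp (@diff_derivable _ _ _ _ _ (Y c (cmap c q)) dt) dc.
rewrite -(mul_jacobian _ dt) /= (cmapK ac qc) (chart_gradient_change ac ac' qc qc'); reflexivity.
Qed.

Hypothesis so : forall p, 0 <= transverse_scal M S eta T bo p.
Variable mu : {measure set NS -> \bar R}.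
Hypothesis vol : volume_measure M eta T b mu.

(** Each point has a bump function supported in a box on which the density keeps its sign. By
    compactness finitely many are positive somewhere at every point, and they are divided by their
    positive sum [G]. *)
Lemma exists_partition : exists (L : nat) (p : 'I_L -> N) (chi : 'I_L -> N -> R) (r : 'I_L -> R),
  (forall q, \sum_i chi i q = 1) /\
  forall i, [/\ smooth_scalar M (chi i), (forall q, 0 <= chi i q), 0 < r i,
    forall x, `|x - cmap (chart_at M (p i)) (p i)| <= r i -> cimg (chart_at M (p i)) x /\
      0 < rho (chart_at M (p i)) x * rho (chart_at M (p i)) (cmap (chart_at M (p i)) (p i)) &
    forall q, chi i q != 0 -> cdom (chart_at M (p i)) q /\ `|cmap (chart_at M (p i)) q - cmap (chart_at M (p i)) (p i)| < r i].
Proof.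
pose c p := chart_at M p; pose x0 p := cmap (c p) p.
have bump p : exists gr : (N -> R) * R, [/\ smooth_scalar M gr.1, (forall q, 0 <= gr.1 q), 0 < gr.1 p & 0 < gr.2] /\
   (forall x, `|x - x0 p| <= gr.2 -> cimg (c p) x /\ 0 < rho (c p) x * rho (c p) (x0 p)) /\
   (forall q, gr.1 q != 0 -> cdom (c p) q /\ `|cmap (c p) q - x0 p| < gr.2).
  have ac : atlas M (c p) := atlas_at M p; have pc : cdom (c p) p := cdom_at M p.
  have crho x : cimg (c p) x -> {for x, continuous (rho (c p))}.
    exact: (smooth_cont (smooth_density ac)).
  have oO : open (cimg (c p) `&` (fun x => rho (c p) x * rho (c p) (x0 p)) @^-1` [set u | 0 < u]).
    apply: (continuous_open_preimage (open_cimg ac) _ (@open_gt R 0)).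
    by move=> x xc; exact: continuousM (crho x xc) (@cst_continuous _ _ _ x).
  have rn := density_neq0 ac (cimg_cmap pc).
  have Op : (cimg (c p) `&` (fun x => rho (c p) x * rho (c p) (x0 p)) @^-1` [set u | 0 < u]) (x0 p).
    split; first exact: cimg_cmap.
    by rewrite /= -expr2 lt_neqAle sqr_ge0 eq_sym sqrf_eq0 rn.
  have Oc : cimg (c p) `&` (fun x => rho (c p) x * rho (c p) (x0 p)) @^-1` [set u | 0 < u] `<=` cimg (c p) by move=> x [].
  have [g [r [sg g0 gp r0 [rO supp]]]] := exists_smooth_bump hausN ac pc oO Op Oc.
  by exists (g, r); do 2!split => //=.
have [gr grP] := choice bump.
have cg p : continuous (gr p).1 by apply: (smooth_scalar_continuous (M := M)); have [[]] := grP p.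
move: (compactN); rewrite compact_cover => /(_ N setT (fun p => [set q | 0 < (gr p).1 q])) [p _||D' _ cov].
- by apply: open_comp (@open_gt R 0) => q _; exact: cg.
- by move=> p _; exists p => //=; have [[]] := grP p.
pose s := finmap.enum_fset D'; pose p (i : 'I_(size s)) := nth point s i.
pose G q := \sum_i (gr (p i)).1 q.
have g0 i q : 0 <= (gr (p i)).1 q by have [[_ + _ _] _] := grP (p i); exact.
have G0 q : 0 < G q.
  have [p' /= Dp' gp'] := cov q I; have ip : (index p' s < size s)%N by rewrite index_mem.
  rewrite /G (bigD1 (Ordinal ip)) //= /p /= nth_index // ltr_pwDl //; apply: sumr_ge0 => i _; exact: g0.
exists _, p, (fun i q => (gr (p i)).1 q * (G q)^-1), (fun i => (gr (p i)).2); split.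
  by move=> q; rewrite -mulr_suml mulfV ?gt_eqF //; exact: G0.
move=> i; have [[sg _ _ r0] [bx supp]] := grP (p i); split=> //.
- move=> c' ac'; have oc' := open_cimg ac'.
  apply: (smooth_mul oc' (sg c' ac')); apply: (smooth_inv oc') => [x _|]; first by rewrite gt_eqF //; exact: G0.
  by apply: (smooth_sum oc') => j _; have [[sgj _ _ _] _] := grP (p j); exact: sgj.
- by move=> q; rewrite mulr_ge0 // invr_ge0 ltW //; exact: G0.
by move=> q h; apply: supp; apply: contraNneq h => ->; rewrite mul0r.
Qed.

Theorem total_transverse_scal_ge0 : 0 <= total_transverse_scal M S eta T b mu.
Proof.
have [L [p [chi [r [chi1 chiP]]]]] := exists_partition.
pose c i := chart_at M (p i); pose w i := divergence_term (c i) (chi i).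
have wI i : mu.-integrable setT (EFin \o (w i : NS -> R)) /\ (\int[mu]_q ((w i : NS -> R) q)%:E = 0)%E.
  have [schi _ r0 bx supp] := chiP i.
  exact: (divergence_term_integral
    (atlas_at M (p i)) r0 bx schi supp vol).
(* In each chart separately, [- (d%:R + 2)] times its divergence bounds the curvature from below,
   and weighting with [chi i] preserves the bound. Outside chart [i] both [chi i] and its derivative
   vanish, and 0 serves as [t]. *)
have wE i q : exists t : R, (- (d%:R + 2) * t) * chi i q <= chi i q * transverse_scal M S eta T b q /\
   w i q = chi i q * t + 'D_(Y (chart_at M q) (coord_at M q)) (chi i \o cinv (chart_at M q)) (coord_at M q).
  have [schi chi0 r0 bx supp] := chiP i; have ac := atlas_at M (p i).
  have [qc|nqc] := pselect (cdom (c i) q).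
    exists (wd (c i) (cmap (c i) q)); split.
      rewrite [leRHS]mulrC ler_wpM2r //.
      exact: (transverse_scal_ge ac qc (so q)).
    have E := divergence_termE (chi i) qc.
    have D := derive_chart_gradient schi ac (atlas_at M q) qc (cdom_at M q).
    transitivity (divergence_term (c i) (chi i) q); first by [].
    rewrite E D; reflexivity.
  have chi0q : chi i q = 0 by apply/eqP; apply: contraT => /supp[].
  exists 0; split; first by rewrite chi0q !(mulr0, mul0r).
  rewrite chi0q mul0r add0r /w divergence_term0 //; apply/esym.
  have nz : \forall x \near coord_at M q, (chi i \o cinv (chart_at M q)) x = 0.
    apply: (near_cinv (P := fun q => chi i q = 0) (atlas_at M q) (cdom_at M q)).
    exact: (near_support (atlas_at M (p i)) bx supp nqc).
  by rewrite (near_eq_derive _ nz) derive_cst.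
have key q : - (d%:R + 2) * \sum_i w i q <= transverse_scal M S eta T b q.
  have [t tP] := choice (fun i => wE i q).
  have schi i : smooth_scalar M (chi i) by have [] := chiP i.
  (* The gradient terms add up to the derivative of the constant 1. *)
  have D0 : \sum_i 'D_(Y (chart_at M q) (coord_at M q)) (chi i \o cinv (chart_at M q)) (coord_at M q) = 0.
    have [_] := @is_derive_sum _ _ _ _ (fun i => chi i \o cinv (chart_at M q)) (coord_at M q)
      (Y (chart_at M q) (coord_at M q)) _ (fun i => smooth_is_derive _ (schi i _ (atlas_at M q)) (cimg_cmap (cdom_at M q))).
    move=> <-; rewrite (_ : \sum_i _ = cst 1) ?derive_cst //.
    by apply/funext => y; rewrite fct_sumE chi1.
  have -> : \sum_i w i q = \sum_i chi i q * t i.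
    by rewrite (eq_bigr _ (fun i _ => (tP i).2)) big_split /= D0 addr0.
  rewrite mulr_sumr [leRHS](_ : _ = \sum_i chi i q * transverse_scal M S eta T b q); last by rewrite -mulr_suml chi1 mul1r.
  apply: ler_sum => i _.
  rewrite mulrA mulrAC; exact: (tP i).1.
pose W i : NS -> \bar R := EFin \o w i; have iW i : mu.-integrable setT (W i) := (wI i).1.
have iw := integrable_sum measurableT (index_enum 'I_L) (P := xpredT) (fun i _ => iW i).
have w0 : (\int[mu]_q \sum_i W i q = 0)%E.
  by apply: etrans (integral_sum measurableT iW _ _) _; rewrite big1 // => i _; exact: (wI i).2.
(* It suffices that the extended integral is nonnegative, since [fine] keeps the sign even at +oo.
   It dominates the integral of a combination of divergences, which is 0. *)
rewrite /total_transverse_scal /Rintegral; apply: fine_ge0.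
have -> : (0 = \int[mu]_q ((- (d%:R + 2))%:E * \sum_i W i q))%E by rewrite integralZl // w0 mule0.
by apply: le_integralT => q; rewrite sumEFin -EFinM lee_fin; exact: key.
Qed.

End ConePair.

End SasakiCone.
Theorem corollary1p8 (R : realType) (n : nat) (n_ge1 : (1 <= n)%N)
  (N : ptopologicalType) (M : smooth_structure R N n.*2.+1)
  (N_hausdorff : hausdorff_space N) (N_compact : compact [set: N])
  (N_connected : connected [set: N])
  (S : cr_data R N n.*2.+1) (S_sasaki : sasaki_type M S)
  (k : nat) (T : 'rV[R]_k -> N -> N) (T_maximal : maximal_cr_torus M S T)
  (eta : N -> 'cV[R]_(n.*2.+1)) (eta_contact : contact_form M S eta) :
  (forall b b' : 'rV[R]_k,
     sasaki_cone M eta T b -> sasaki_cone M eta T b' ->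
     (forall p, transverse_scal M S eta T b p = 0) ->
     (forall p, transverse_scal M S eta T b' p = 0) ->
     exists2 l : R, 0 < l & b' = l *: b) /\
  ((exists2 bo : 'rV[R]_k, sasaki_cone M eta T bo &
      forall p, 0 <= transverse_scal M S eta T bo p) ->
   forall b : 'rV[R]_k, sasaki_cone M eta T b ->
   forall mu : {measure set (g_sigma_algebraType (@open N)) -> \bar R},
     volume_measure M eta T b mu ->
     0 <= total_transverse_scal M S eta T b mu).
Proof.
have [crS [eta0 [xi [contact0 pos0 _ _ _]]]] := S_sasaki; have [[action crT] torus] := T_maximal.1; split.
  by move=> b b' cb cb'; exact: (unique_scalar_flat_ray N_hausdorff N_compact N_connected action crT eta_contact crS contact0 pos0 torus cb cb').
move=> [bo cbo so] b cb mu vol.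
exact: (total_transverse_scal_ge0 N_hausdorff N_compact action crT eta_contact crS contact0 pos0 cb cbo so vol).
Qed.
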